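(* A simply-connected $\mathrm G_2/\mathrm{SO}(4)$-nondegenerate, $\mathrm G_2/\mathrm{SO}(4)$-abelian surface $\phi:\mathbb R^2\to\mathbb R^7$ is equivalent to a family of flat connections $\theta_\lambda$ on $\mathbb R^2$ of the form $$\theta_\lambda=\sum_{i=1}^2(\lambda b_i+[b_i,v])\,dx_i,$$ where $(x_1,x_2)$ are the standard coordinates on $\mathbb R^2$ and $v:\mathbb R^2\to\hat{\mathfrak p}$.
   Context: Octonions: $\mathbb O$ has orthonormal basis $1,e_1,\dots,e_7$ with $e_i^2=-1$, distinct $e_i,e_j$ anticommuting, and $e_ae_b=e_c$ for $(a,b,c)$ any cyclic permutation of $(1,5,2),(1,6,3),(1,7,4),(2,7,3),(2,4,6),(3,5,4),(5,6,7)$. $\mathbb R^7=\mathrm{Im}(\mathbb O)$ and $\mathrm G_2=\mathrm{Aut}(\mathbb O)\subset\mathrm{SO}(7)$. A $3$-plane in $\mathbb R^7$ is associative if it generates an associative subalgebra of $\mathbb O$; every $2$-plane $E\subset\mathbb R^7$ lies in a unique associative $3$-plane $E_+$. The Grassmannian of associative $3$-planes is $\mathrm G_2/\mathrm{SO}(4)$. Lie algebra: $X\in\mathfrak{so}(7)$ lies in $\mathfrak g_2$ iff $X_{67}=X_{12}+X_{34}$, $X_{75}=X_{13}+X_{42}$, $X_{56}=X_{14}+X_{23}$, $X_{51}+X_{64}-X_{73}=0$, $X_{52}+X_{63}+X_{74}=0$, $X_{53}-X_{62}+X_{71}=0$, $X_{54}-X_{61}-X_{72}=0$. Thus elements of $\mathfrak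 g_2$ are $\begin{pmatrix}A&-{}^tB\\ B&\nu(A)\end{pmatrix}$ with $A\in\mathfrak{so}(4)$, $\nu(A)\in\mathfrak{so}(3)$ determined by the first three relations, and $B\in\mathfrak p$, the space of $3\times4$ matrices satisfying the last four relations (rows indexed $5,6,7$, columns $1,\dots,4$). The Lie algebra $\mathfrak g_2\ltimes\mathbb R^7$ is the set of block matrices (block sizes $4,3,1$) $\begin{pmatrix}C&-{}^tB&X\\ B&\nu(C)&Y\\ 0&0&0\end{pmatrix}$ with $C\in\mathfrak{so}(4)$, $B\in\mathfrak p$, $X\in\mathbb R^4$, $Y\in\mathbb R^3$. Put $$\hat{\mathfrak p}=\left\{\begin{pmatrix}0&-{}^tB&X\\ B&0&0\\ 0&0&0\end{pmatrix}: B\in\mathfrak p,\ X\in\mathbb R^4\right\},\qquad b_i=\begin{pmatrix}0&-{}^ta_i&0\\ a_i&0&0\\ 0&0&0\end{pmatrix},$$ with $$a_1=\begin{pmatrix}1&0&0&0\\ 0&0&0&0\\ 0&0&1&0\end{pmatrix},\qquad a_2=\begin{pmatrix}0&0&0&0\\ 0&0&0&1\\ 0&0&1&0\end{pmatrix}.$$ The family $\theta_\lambda$ is a $1$-parameter family with parameter $\lambda\in\mathbb C$; flat means $d\theta_\lambda+\theta_\lambda\wedge\theta_\lambda=0$ for every $\lambda$. Surfaces: for a smooth immersion $\phi:M^2\to\mathbb R^7$ of a surface, the extended Gauss map is $\Gamma:M\to\mathrm G_2/\mathrm{SO}(4)$, $\Gamma(m)=(\phi_*T_mM)_+$. Over $\mathrm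 G_2/\mathrm{SO}(4)$ let $\mathcal V$ be the tautological rank-$3$ bundle (fibre over an associative $3$-plane $A$ is $A$) and $\mathcal W$ the tautological rank-$4$ bundle with fibre $A^\perp$, with their natural metrics and compatible connections. The immersion $\phi$ is $\mathrm G_2/\mathrm{SO}(4)$-abelian if $\Gamma^*\mathcal W$ is flat (and consequently so is $\Gamma^*\mathcal V$), and $\mathrm G_2/\mathrm{SO}(4)$-nondegenerate if $\Gamma$ is an immersion. The equivalence is understood via moving frames: a $\mathrm G_2$-adapted frame of a surface is a frame $(e_1,\dots,e_7)\in\mathrm G_2$ such that $e_5,e_6,e_7$ span the unique extension of the tangent bundle to a bundle of associative $3$-planes, and a simply-connected surface in $\mathbb R^7$ with a $\mathrm G_2$-adapted frame is equivalent to a surface with a flat $\mathfrak g_2\ltimes\mathbb R^7$-valued one-form (the pullback of the Maurer–Cartan form).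
   Formalization: x_1, x_2 are coordinates near each point of R^2, standard only after reparametrizing by a smooth section of x (globally false for a surface restricted to a disc); conversely, the integrated phi is abelian and nondegenerate when it is an immersion (v=0 gives a constant). *)

(* Defs.v *)
From HB Require Import structures.
From mathcomp Require Import all_boot all_order all_algebra.
From mathcomp Require Import all_classical all_reals all_analysis.
From mathcomp.real_closed Require Import complex.

Set Implicit Arguments.
Unset Strict Implicit.
Unset Printing Implicit Defensive.

Import Order.TTheory GRing.Theory Num.Theory.
Import numFieldNormedType.Exports.
Local Open Scope classical_set_scope.
Local Open Scope ring_scope.

Definition plane (R : realType) := 'rV[R]_2.

Definition partial (R : realType) (V : normedModType R) (j : 'I_2)
    (f : plane R -> V) : plane R -> V :=
  fun m => 'D_(delta_mx ord0 j : 'rV[R]_2) f m.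

Fixpoint class_C (R : realType) (V : normedModType R) (k : nat)
    (f : plane R -> V) : Prop :=
  match k with
  | 0%N => continuous f
  | k'.+1 => (forall m, differentiable f m) /\
             (forall j, class_C k' (partial j f))
  end.

Definition smooth (R : realType) (V : normedModType R) (f : plane R -> V) :=
  forall k, class_C k f.

Definition tangent (R : realType) (p q : nat)
    (f : plane R -> 'M[R]_(p.+1, q.+1)) (m : plane R) :
    {vspace 'M[R]_(p.+1, q.+1)} :=
  <<[:: partial ord0 f m; partial ord_max f m]>>%VS.

Definition immersion (R : realType) (p q : nat)
    (f : plane R -> 'M[R]_(p.+1, q.+1)) : Prop :=
  smooth f /\ forall m, \dim (tangent f m) = 2.

(* Between manifolds of the same dimension, the immersions are the local
   diffeomorphisms; the components x_1, x_2 of such a map are coordinates near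
   every point. *)
Definition local_diffeo (R : realType) (x : plane R -> plane R) : Prop :=
  @immersion R 0 1 x.

Definition oct (R : realType) := 'cV[R]_(1 + 7).

Definition oct_triples : seq (nat * nat * nat) :=
  [:: (1, 5, 2); (1, 6, 3); (1, 7, 4); (2, 7, 3); (2, 4, 6); (3, 5, 4);
      (5, 6, 7)]%N.

Definition oct_cyclic (i j k : nat) : bool :=
  [|| (i, j, k) \in oct_triples, (j, k, i) \in oct_triples
    | (k, i, j) \in oct_triples].

(* The coefficient of e_k in e_i e_j, where e_0 = 1. *)
Definition oct_coef (R : realType) (i j k : nat) : R :=
  if i == 0%N then (j == k)%:R
  else if j == 0%N then (i == k)%:R
  else if i == j then - (k == 0%N)%:R
  else (oct_cyclic i j k)%:R - (oct_cyclic j i k)%:R.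

Definition oct_mul (R : realType) (x y : oct R) : oct R :=
  \col_(k < 1 + 7) \sum_(i < 1 + 7) \sum_(j < 1 + 7)
    oct_coef R i j k * x i ord0 * y j ord0.

Definition oct_one (R : realType) : oct R := col_mx 1%:M 0.

Definition oct_im (R : realType) (u : 'cV[R]_7) : oct R := col_mx 0 u.

(* 'cV_7 is the space of imaginary octonions, with basis e_1, ..., e_7.
   Every automorphism of the octonions fixes 1 and preserves their imaginary
   part, on which it acts through a matrix g. *)
Definition G2 (R : realType) (g : 'M[R]_7) : Prop :=
  let G : 'M[R]_(1 + 7) := block_mx 1%:M 0 0 g in
  g \in unitmx /\
  forall x y : oct R, G *m oct_mul x y = oct_mul (G *m x) (G *m y).

Definition oct_subalgebra (R : realType) (S : {vspace oct R}) : Prop :=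
  oct_one R \in S /\
  forall x y, x \in S -> y \in S -> oct_mul x y \in S.

Definition oct_generated (R : realType) (A : {vspace 'cV[R]_7}) : set (oct R) :=
  [set z | forall S : {vspace oct R}, oct_subalgebra S ->
     (forall u, u \in A -> oct_im u \in S) -> z \in S].

Definition associative_plane (R : realType) (A : {vspace 'cV[R]_7}) : Prop :=
  \dim A = 3 /\
  forall x y z, oct_generated A x -> oct_generated A y -> oct_generated A z ->
    oct_mul x (oct_mul y z) = oct_mul (oct_mul x y) z.

(* E_+, the associative 3-plane containing E (unique when \dim E = 2). *)
Definition assoc_ext (R : realType) (E : {vspace 'cV[R]_7}) :
    {vspace 'cV[R]_7} :=
  xget 0%VS [set A | associative_plane A /\ (E <= A)%VS].

Definition surface (R : realType) (phi : plane R -> 'cV[R]_7) : Prop :=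
  @immersion R 6 0 phi.

Definition gauss (R : realType) (phi : plane R -> 'cV[R]_7) (m : plane R) :
    {vspace 'cV[R]_7} :=
  assoc_ext (@tangent R 6 0 phi m).

(* Orthogonal projection of R^7 onto A: M (M^T M)^-1 M^T, where the columns of
   M form a basis of A. *)
Definition orth_proj (R : realType) (A : {vspace 'cV[R]_7}) : 'M[R]_7 :=
  let M := \matrix_(i < 7, j < \dim A) (vbasis A)`_j i ord0 in
  M *m invmx (M^T *m M) *m M^T.

(* The Grassmannian of 3-planes of R^7, hence also G_2/SO(4), is regarded as a
   submanifold of the space of 7 x 7 matrices through A |-> orth_proj A. *)
Definition nondegenerate_surface (R : realType) (phi : plane R -> 'cV[R]_7) : Prop :=
  @immersion R 6 6 (fun m => orth_proj (gauss phi m)).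

(* Gamma^*W is the bundle with fibre (gauss phi m)^\perp at m; its connection is
   the orthogonal projection of the ordinary derivative of R^7-valued maps. *)
Definition W_section (R : realType) (phi s : plane R -> 'cV[R]_7) : Prop :=
  smooth s /\ forall m, orth_proj (gauss phi m) *m s m = 0.

Definition W_nabla (R : realType) (phi : plane R -> 'cV[R]_7) (j : 'I_2)
    (s : plane R -> 'cV[R]_7) : plane R -> 'cV[R]_7 :=
  fun m => (1%:M - orth_proj (gauss phi m)) *m partial j s m.

(* The curvature of Gamma^*W vanishes; the coordinate vector fields commute. *)
Definition abelian_surface (R : realType) (phi : plane R -> 'cV[R]_7) : Prop :=
  forall s, W_section phi s -> forall m,
    W_nabla phi ord0 (W_nabla phi ord_max s) m =
    W_nabla phi ord_max (W_nabla phi ord0 s) m.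

(* The frame (e_1, ..., e_7) at m is the sequence of columns of F m, numbered
   from 0, so that e_5, e_6, e_7 are columns 4, 5, 6. *)
Definition adapted_frame (R : realType) (phi : plane R -> 'cV[R]_7)
    (F : plane R -> 'M[R]_7) : Prop :=
  [/\ smooth F, forall m, G2 (F m) &
      forall m, gauss phi m =
        <<[:: col (inord 4) (F m); col (inord 5) (F m);
              col (inord 6) (F m)]>>%VS].

Definition motion (R : realType) (g : 'M[R]_7) (c : 'cV[R]_7) :
    'M[R]_(4 + 3 + 1) :=
  block_mx g c 0 1%:M.

(* The j-th component of the pullback of the Maurer-Cartan form of
   G_2 |x R^7 by (F, phi). *)
Definition maurer_cartan (R : realType) (F : plane R -> 'M[R]_7)
    (phi : plane R -> 'cV[R]_7) (j : 'I_2) (m : plane R) :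
    'M[R]_(4 + 3 + 1) :=
  invmx (motion (F m) (phi m)) *m
  partial j (fun z => motion (F z) (phi z) : 'M[R]_8) m.

(* Rows of B are numbered 5, 6, 7 and columns 1, 2, 3, 4 in the relations
   defining g_2. *)
Definition in_p (R : realType) (B : 'M[R]_(3, 4)) : Prop :=
  let X (i j : nat) := B (inord (i - 5)) (inord (j - 1)) in
  [/\ X 5%N 1%N + X 6%N 4%N - X 7%N 3%N = 0,
      X 5%N 2%N + X 6%N 3%N + X 7%N 4%N = 0,
      X 5%N 3%N - X 6%N 2%N + X 7%N 1%N = 0 &
      X 5%N 4%N - X 6%N 1%N - X 7%N 2%N = 0].

Definition phat_mx (R : realType) (B : 'M[R]_(3, 4)) (X : 'cV[R]_4) :
    'M[R]_(4 + 3 + 1) :=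
  block_mx (block_mx 0 (- B^T) B 0) (col_mx X 0) 0 0.

Definition in_phat (R : realType) (v : 'M[R]_(4 + 3 + 1)) : Prop :=
  exists B X, in_p B /\ v = phat_mx B X.

Definition a_mx (R : realType) (i : 'I_2) : 'M[R]_(3, 4) :=
  if i == ord0 then delta_mx (inord 0) (inord 0) + delta_mx (inord 2) (inord 2)
  else delta_mx (inord 1) (inord 3) + delta_mx (inord 2) (inord 2).

Definition b_mx (R : realType) (i : 'I_2) : 'M[R]_(4 + 3 + 1) :=
  phat_mx (a_mx R i) 0.

Definition commutator (K : pzRingType) (n : nat) (A B : 'M[K]_n) : 'M[K]_n :=
  A *m B - B *m A.

Definition complexify (R : realType) (n : nat) (A : 'M[R]_n) : 'M[R[i]]_n :=
  map_mx (fun a => Complex a 0) A.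

(* \sum_i (lambda b_i + [b_i, v]) dx_i, evaluated on the j-th standard
   coordinate vector field of the plane; x_1, x_2 are the components of x, and
   x = id gives the standard coordinates. *)
Definition theta (R : realType) (x : plane R -> plane R)
    (v : plane R -> 'M[R]_(4 + 3 + 1)) (lambda : R[i]) (j : 'I_2)
    (m : plane R) : 'M[R[i]]_(4 + 3 + 1) :=
  \sum_(i < 2) Complex (partial j x m ord0 i) 0 *:
    (lambda *: complexify (b_mx R i) + complexify (commutator (b_mx R i) (v m))).

Definition cpartial (R : realType) (n : nat) (j : 'I_2)
    (f : plane R -> 'M[R[i]]_n.+1) (m : plane R) : 'M[R[i]]_n.+1 :=
  complexify (partial j (fun z => map_mx (@complex.Re R) (f z)) m) +
  Complex 0 1 *: complexify (partial j (fun z => map_mx (@complex.Im R) (f z)) m).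

(* d omega + omega /\ omega = 0, for omega = omega_1 du_1 + omega_2 du_2. *)
Definition flat_form (R : realType) (n : nat)
    (omega : 'I_2 -> plane R -> 'M[R[i]]_n.+1) : Prop :=
  forall m, cpartial ord0 (omega ord_max) m - cpartial ord_max (omega ord0) m
            + commutator (omega ord0 m) (omega ord_max m) = 0.

Definition flat_family (R : realType) (x : plane R -> plane R)
    (v : plane R -> 'M[R]_(4 + 3 + 1)) : Prop :=
  [/\ smooth (v : plane R -> 'M[R]_8), forall m, in_phat (v m) &
      forall lambda : R[i], @flat_form R 7 (theta x v lambda)].

(* The flat connection attached to the framed surface (F, phi) is the member
   theta_1 of the family. *)
Definition integrates (R : realType) (x : plane R -> plane R)
    (v : plane R -> 'M[R]_(4 + 3 + 1)) (F : plane R -> 'M[R]_7)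
    (phi : plane R -> 'cV[R]_7) : Prop :=
  [/\ smooth F, smooth phi, forall m, G2 (F m) &
      forall j m, complexify (maurer_cartan F phi j m) = theta x v 1 j m].

(* Main.v *)
Require Import Defs.
From mathcomp Require Import all_boot all_order all_algebra.
From mathcomp Require Import all_classical all_reals all_analysis.
From mathcomp.real_closed Require Import complex.
From mathcomp Require Import ring lra.

Set Implicit Arguments.
Unset Strict Implicit.
Unset Printing Implicit Defensive.

Import Order.TTheory GRing.Theory Num.Theory.
Import numFieldNormedType.Exports.
Local Open Scope classical_set_scope.
Local Open Scope ring_scope.

(** A framed surface (F, phi) is the same thing as a solution of
    dF = F A, d phi = F c for the flat form (A, c) with values in the Lie
    algebra of G_2 |x R^7.  Write A = B + K along the splitting of g_2 into p,
    the part exchanging R^4 and R^3, and k, the stabiliser of both; the frame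
    is adapted when c takes its values in R^3.

    From the family to the surface.  The terms of the curvature of theta_lambda
    of degree two and one in lambda vanish identically, because b_1 and b_2
    commute, because the dx_i are closed, and by the Jacobi identity
    ([flat_pencil], [flat_family_real]).  So the family is flat as soon as its
    member theta_1 is, and theta_1 integrates to a framed surface by the
    Frobenius theorem ([frobenius], [poincare]), uniquely up to a motion.  If P
    is the projection onto the Gauss plane, then P_j = F [B_j, P0] F^T, whence
    [P_1, P_2] = - F [B_1, B_2] F^T = 0.  The curvature of the bundle of
    orthogonal complements is the restriction of [P_1, P_2] ([curvature]), so
    the surface is abelian; it is nondegenerate because b_1 and b_2 are
    independent and x is a local diffeomorphism.

    From the surface to the family.  Put alpha_j = [P_j, P], which is a
    derivation of the octonions since 2 P - 1 is a curve in G_2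
    ([alpha_der]).  For an abelian surface alpha_1 and alpha_2 commute
    ([alpha_commute]); this makes alpha itself a flat form, and a parallel frame
    E turns it into a closed form beta with values in p, whose two components
    commute and are independent ([parallel_frame]).  At every point a commuting
    pair in p is conjugate under the stabiliser of R^3 into the plane a spanned
    by b_1 and b_2 ([normal_form]).  The conjugation can be made smooth
    ([gauge]): to first order it has to move along the unique w_j in k for which
    d_j beta - [w_j, beta] stays tangent to the maximal flat spanned by beta,
    and w is flat because an element of k is determined by its brackets with a
    regular pair.  After this gauge transformation the p-part of the frame is
    sum eta_jl b_l dx_j.  Comparing entries in the structure equation, on which
    brackets of k with a have no influence, shows that eta is closed, so it is
    dx_l for a local diffeomorphism x; the rest of the structure equation says
    that the k-part is [b_l, V] dx_l for some V in p ([potentialP]) and that the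
    translation part is b_l u dx_l for some u in R^4 ([trans_potentialP]).  The
    pair (V, u) is v ([adapted_family]). *)

(** * Smooth maps on the plane *)

Section Entries.
Variables (R : realType) (V : normedModType R) (p q : nat).
Implicit Type f : V -> 'M[R]_(p, q).

Lemma differentiable_mxP f m :
  differentiable f m <-> forall i j, differentiable (fun z => f z i j) m.
Proof.
split=> [df i j|df].
  exact: (differentiable_comp df (differentiable_coord _ _ _)).
have -> : f = (\sum_(k < p) fun z => (\sum_(l < q) fun z => f z k l *: delta_mx k l) z).
  apply/funext => z; rewrite fct_sumE [LHS]matrix_sum_delta.
  by apply: eq_bigr => i _; rewrite fct_sumE.
apply: differentiable_sum => k; apply: differentiable_sum => l.
exact: differentiableZl.
Qed.

Lemma continuous_mxP f :
  continuous f <-> forall i j, continuous (fun z => f z i j).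
Proof.
split=> [cf i j z|cf z].
  by apply: (@continuous_comp _ _ _ f (fun M => M i j)); [exact: cf|exact: coord_continuous].
have -> : f = (fun z => \sum_(k < p) \sum_(l < q) f z k l *: delta_mx k l).
  by apply/funext => w; exact: matrix_sum_delta.
have cadd : continuous (fun x : 'M[R]_(p, q) * 'M[R]_(p, q) => x.1 + x.2).
  by move=> x; exact: add_continuous.
apply: (@continuous_big 'M[R]_(p, q) _ +%R 0 xpredT cadd V) => k _.
apply: (@continuous_big 'M[R]_(p, q) _ +%R 0 xpredT cadd V) => l _ w.
by apply: cvgZr_tmp; exact: cf.
Qed.

End Entries.

Section Calculus.
Variable R : realType.
Local Notation plane := (plane R).

Lemma partial_mxE p q (f : plane -> 'M[R]_(p, q)) j m i k :
  differentiable f m -> partial j f m i k = partial j (fun z => f z i k) m.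
Proof.
by move=> df; rewrite /partial derive_mx ?mxE//; exact: diff_derivable.
Qed.

Lemma class_CW (V : normedModType R) k (f : plane -> V) : class_C k.+1 f -> class_C k f.
Proof.
elim: k f => [f [df _] m|k IH f [df Cf]]; first exact: differentiable_continuous.
by split=> // j; apply: IH; apply: Cf.
Qed.

Lemma smooth_diff (V : normedModType R) (f : plane -> V) m : smooth f -> differentiable f m.
Proof. by move=> /(_ 1%N)[]. Qed.

Lemma smooth_partial (V : normedModType R) (f : plane -> V) j : smooth f -> smooth (partial j f).
Proof. by move=> sf k; have [_ /(_ j)] := sf k.+1. Qed.

Lemma smooth_continuous (V : normedModType R) (f : plane -> V) : smooth f -> continuous f.
Proof. by move=> /(_ 0%N). Qed.

Lemma class_C_mxP p q k (f : plane -> 'M[R]_(p, q)) :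
  class_C k f <-> forall i j, class_C k (fun z => f z i j).
Proof.
elim: k f => [|k IH] f /=; first exact: continuous_mxP.
split=> [[df Cf] i j|Cf].
  split=> [m|l]; first by move/differentiable_mxP: (df m).
  have -> : partial l (fun z => f z i j) = fun z => partial l f z i j.
    by apply/funext => z; rewrite partial_mxE.
  by move: (Cf l) => /IH.
have df m : differentiable f m.
  by apply/differentiable_mxP => i j; have [/(_ m)] := Cf i j.
split=> // l; apply/IH => i j.
have -> : (fun z => partial l f z i j) = partial l (fun z => f z i j).
  by apply/funext => z; rewrite partial_mxE.
by have [_ /(_ l)] := Cf i j.
Qed.

Lemma smooth_mxP p q (f : plane -> 'M[R]_(p, q)) :
  smooth f <-> forall i j, smooth (fun z => f z i j).
Proof.
by split=> [sf i j k|sf k]; [move/class_C_mxP : (sf k)|apply/class_C_mxP => i j; apply: sf].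
Qed.

Lemma partial_cst (V : normedModType R) j (c : V) : partial j (fun=> c) = fun=> 0.
Proof. by apply/funext => z; rewrite /partial derive_cst. Qed.

Lemma class_C_cst (V : normedModType R) k (c : V) : class_C k (fun _ : plane => c).
Proof.
elim: k c => [|k IH] c /=; first by move=> m; exact: cst_continuous.
split=> [m|j]; first exact: differentiable_cst.
by rewrite partial_cst.
Qed.

Lemma smooth_cst (V : normedModType R) (c : V) : smooth (fun _ : plane => c).
Proof. by move=> k; exact: class_C_cst. Qed.

Lemma class_CD (V : normedModType R) k (f g : plane -> V) :
  class_C k f -> class_C k g -> class_C k (fun z => f z + g z).
Proof.
elim: k f g => [|k IH] f g /=; first by move=> cf cg m; exact: (continuousD (cf m) (cg m)).
move=> [df Cf] [dg Cg]; split=> [m|j]; first exact: differentiableD.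
have -> : partial j (fun z => f z + g z) = fun z => partial j f z + partial j g z.
  by apply/funext => z; rewrite /partial deriveD//; exact: diff_derivable.
exact: IH.
Qed.

Lemma partialN (V : normedModType R) j (f : plane -> V) m : differentiable f m ->
  partial j (fun z => - f z) m = - partial j f m.
Proof. by move=> df; rewrite /partial deriveN//; exact: diff_derivable. Qed.

Lemma partialD (V : normedModType R) j (f g : plane -> V) m :
  differentiable f m -> differentiable g m ->
  partial j (fun z => f z + g z) m = partial j f m + partial j g m.
Proof. by move=> df dg; rewrite /partial deriveD//; exact: diff_derivable. Qed.

Lemma partialB (V : normedModType R) j (f g : plane -> V) m :
  differentiable f m -> differentiable g m ->
  partial j (fun z => f z - g z) m = partial j f m - partial j g m.
Proof. by move=> df dg; rewrite /partial deriveB//; exact: diff_derivable. Qed.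

Lemma class_CN (V : normedModType R) k (f : plane -> V) :
  class_C k f -> class_C k (fun z => - f z).
Proof.
elim: k f => [|k IH] f /=; first by move=> cf m; exact: (continuousN (cf m)).
move=> [df Cf]; split=> [m|j]; first exact: differentiableN.
have -> : partial j (fun z => - f z) = fun z => - partial j f z.
  by apply/funext => z; rewrite partialN.
exact: IH.
Qed.

Lemma partialM j (f g : plane -> R) m :
  differentiable f m -> differentiable g m ->
  partial j (fun z => f z * g z) m = partial j f m * g m + f m * partial j g m.
Proof.
move=> df dg; rewrite /partial deriveM//=; try exact: diff_derivable.
by rewrite addrC mulrC; congr (_ + _); rewrite mulrC.
Qed.

Lemma class_CM k (f g : plane -> R) :
  class_C k f -> class_C k g -> class_C k (fun z => f z * g z).
Proof.
elim: k f g => [|k IH] f g /=; first by move=> cf cg m; exact: (continuousM (cf m) (cg m)).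
move=> /[dup] Cf' [df Cf] /[dup] Cg' [dg Cg]; split=> [m|j]; first exact: differentiableM.
have -> : partial j (fun z => f z * g z) = fun z => partial j f z * g z + f z * partial j g z.
  by apply/funext => z; rewrite partialM.
by apply: class_CD; apply: IH => //; apply: class_CW; split.
Qed.

Lemma class_CV k (f : plane -> R) : (forall z, f z != 0) ->
  class_C k f -> class_C k (fun z => (f z)^-1).
Proof.
move=> f0; elim: k => [|k IH] /=.
  by move=> cf m; exact: (continuousV (f0 m) (cf m)).
move=> /[dup] Cf' [df Cf]; split=> [m|j]; first exact: differentiableV.
have -> : partial j (fun z => (f z)^-1) = fun z => - ((f z)^-1 * (f z)^-1) * partial j f z.
  apply/funext => z; rewrite /partial deriveV//=; last exact: diff_derivable.
  by rewrite expr2 invfM.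
have IH' := IH (class_CW Cf').
by apply: class_CM => //; apply: class_CN; exact: class_CM.
Qed.

Lemma smoothD (V : normedModType R) (f g : plane -> V) :
  smooth f -> smooth g -> smooth (fun z => f z + g z).
Proof. by move=> sf sg k; exact: class_CD. Qed.

Lemma smoothN (V : normedModType R) (f : plane -> V) :
  smooth f -> smooth (fun z => - f z).
Proof. by move=> sf k; exact: class_CN. Qed.

Lemma smoothB (V : normedModType R) (f g : plane -> V) :
  smooth f -> smooth g -> smooth (fun z => f z - g z).
Proof. by move=> sf sg; apply: smoothD => //; exact: smoothN. Qed.

Lemma smoothM (f g : plane -> R) :
  smooth f -> smooth g -> smooth (fun z => f z * g z).
Proof. by move=> sf sg k; exact: class_CM. Qed.

Lemma smoothV (f : plane -> R) : (forall z, f z != 0) ->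
  smooth f -> smooth (fun z => (f z)^-1).
Proof. by move=> f0 sf k; exact: class_CV. Qed.

Lemma class_C_sum (V : normedModType R) k I (r : seq I) (P : pred I) (f : I -> plane -> V) :
  (forall i, P i -> class_C k (f i)) -> class_C k (fun z => \sum_(i <- r | P i) f i z).
Proof.
move=> sf; elim: r => [|a r IH].
  by rewrite (_ : (fun _ => _) = fun=> 0); [exact: class_C_cst|apply/funext => z; rewrite big_nil].
case Pa : (P a); last first.
  rewrite (_ : (fun _ => _) = fun z => \sum_(i <- r | P i) f i z)//.
  by apply/funext => z; rewrite big_cons Pa.
rewrite (_ : (fun _ => _) = fun z => f a z + \sum_(i <- r | P i) f i z); last first.
  by apply/funext => z; rewrite big_cons Pa.
by apply: class_CD => //; exact: sf.
Qed.

Lemma smooth_sum (V : normedModType R) I (r : seq I) (P : pred I) (f : I -> plane -> V) :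
  (forall i, P i -> smooth (f i)) -> smooth (fun z => \sum_(i <- r | P i) f i z).
Proof. by move=> sf k; apply: class_C_sum => i Pi; exact: sf. Qed.

Lemma smooth_prod I (r : seq I) (P : pred I) (f : I -> plane -> R) :
  (forall i, P i -> smooth (f i)) -> smooth (fun z => \prod_(i <- r | P i) f i z).
Proof.
move=> sf; elim: r => [|a r IH].
  by rewrite (_ : (fun _ => _) = fun=> 1); [exact: smooth_cst|apply/funext => z; rewrite big_nil].
case Pa : (P a); last first.
  rewrite (_ : (fun _ => _) = fun z => \prod_(i <- r | P i) f i z)//.
  by apply/funext => z; rewrite big_cons Pa.
rewrite (_ : (fun _ => _) = fun z => f a z * \prod_(i <- r | P i) f i z); last first.
  by apply/funext => z; rewrite big_cons Pa.
by apply: smoothM => //; exact: sf.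
Qed.

Lemma class_C_mulmx k p q r (f : plane -> 'M[R]_(p, q)) (g : plane -> 'M[R]_(q, r)) :
  class_C k f -> class_C k g -> class_C k (fun z => f z *m g z).
Proof.
move=> /class_C_mxP sf /class_C_mxP sg; apply/class_C_mxP => i j.
under eq_fun do rewrite mxE.
by apply: class_C_sum => l _; exact: class_CM.
Qed.

Lemma smooth_mulmx p q r (f : plane -> 'M[R]_(p, q)) (g : plane -> 'M[R]_(q, r)) :
  smooth f -> smooth g -> smooth (fun z => f z *m g z).
Proof. by move=> sf sg k; exact: class_C_mulmx. Qed.

Lemma smooth_scale p q (a : plane -> R) (f : plane -> 'M[R]_(p, q)) :
  smooth a -> smooth f -> smooth (fun z => a z *: f z).
Proof.
move=> sa /smooth_mxP sf; apply/smooth_mxP => i j.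
under eq_fun do rewrite mxE.
exact: smoothM.
Qed.

Lemma smooth_trmx p q (f : plane -> 'M[R]_(p, q)) :
  smooth f -> smooth (fun z => (f z)^T).
Proof.
move=> /smooth_mxP sf; apply/smooth_mxP => i j.
under eq_fun do rewrite mxE; exact: sf.
Qed.

Lemma smooth_det n (f : plane -> 'M[R]_n) : smooth f -> smooth (fun z => \det (f z)).
Proof.
move=> /smooth_mxP sf; rewrite /determinant; apply: smooth_sum => s _.
apply: smoothM; first exact: smooth_cst.
by apply: smooth_prod => i _.
Qed.

Lemma smooth_invmx n (f : plane -> 'M[R]_n) : (forall z, f z \in unitmx) ->
  smooth f -> smooth (fun z => invmx (f z)).
Proof.
move=> fu sf.
have -> : (fun z => invmx (f z)) = fun z => (\det (f z))^-1 *: \adj (f z).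
  by apply/funext => z; rewrite /invmx fu.
apply: smooth_scale.
  apply: smoothV; last exact: smooth_det.
  by move=> z; have := fu z; rewrite unitmxE unitfE.
apply/smooth_mxP => i j; under eq_fun do rewrite mxE /cofactor.
apply: smoothM; first exact: smooth_cst.
apply: smooth_det; apply/smooth_mxP => k l; under eq_fun do rewrite !mxE.
by move/smooth_mxP : sf => sf; exact: sf.
Qed.

Lemma partial_mulmx p q r j (f : plane -> 'M[R]_(p, q)) (g : plane -> 'M[R]_(q, r)) m :
  differentiable f m -> differentiable g m ->
  partial j (fun z => f z *m g z) m = partial j f m *m g m + f m *m partial j g m.
Proof.
move=> df dg.
have df' := (differentiable_mxP f m).1 df.
have dg' := (differentiable_mxP g m).1 dg.
have dM i k l : differentiable (fun z => f z i l * g z l k) m by exact: differentiableM.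
apply/matrixP => i k; rewrite partial_mxE; last first.
  apply/differentiable_mxP => i' k'.
  have -> : (fun z => (f z *m g z) i' k') = \sum_(l < q) (fun z => f z i' l * g z l k').
    by apply/funext => z; rewrite mxE fct_sumE.
  exact: differentiable_sum.
have -> : (fun z => (f z *m g z) i k) = \sum_(l < q) (fun z => f z i l * g z l k).
  by apply/funext => z; rewrite mxE fct_sumE.
rewrite /partial derive_sum; last by move=> l; exact: diff_derivable.
rewrite !mxE -big_split /=; apply: eq_bigr => l _.
by rewrite -!/(partial j _ m) partialM// !partial_mxE.
Qed.

Lemma differentiable_mulmx p q r (f : plane -> 'M[R]_(p, q)) (g : plane -> 'M[R]_(q, r)) m :
  differentiable f m -> differentiable g m -> differentiable (fun z => f z *m g z) m.
Proof.
move=> /differentiable_mxP df /differentiable_mxP dg; apply/differentiable_mxP => i k.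
have -> : (fun z => (f z *m g z) i k) = \sum_(l < q) (fun z => f z i l * g z l k).
  by apply/funext => z; rewrite mxE fct_sumE.
by apply: differentiable_sum => l; exact: differentiableM.
Qed.

Lemma differentiable_trmx p q (f : plane -> 'M[R]_(p, q)) m :
  differentiable f m -> differentiable (fun z => (f z)^T) m.
Proof.
move=> /differentiable_mxP df; apply/differentiable_mxP => i k.
under eq_fun do rewrite mxE; exact: df.
Qed.

Lemma partial_trmx p q j (f : plane -> 'M[R]_(p, q)) m :
  differentiable f m -> partial j (fun z => (f z)^T) m = (partial j f m)^T.
Proof.
move=> df; apply/matrixP => i k; rewrite partial_mxE ?mxE; last exact: differentiable_trmx.
by under eq_fun do rewrite mxE; rewrite partial_mxE.
Qed.

Lemma partial_scale p q j (a : plane -> R) (f : plane -> 'M[R]_(p, q)) m :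
  differentiable a m -> differentiable f m ->
  partial j (fun z => a z *: f z) m = partial j a m *: f m + a m *: partial j f m.
Proof.
move=> da /[dup] df /differentiable_mxP df'; apply/matrixP => i k.
rewrite partial_mxE; last first.
  apply/differentiable_mxP => i' k'; under eq_fun do rewrite mxE.
  exact: differentiableM.
under eq_fun do rewrite mxE.
by rewrite partialM// !mxE partial_mxE.
Qed.

Lemma partial_sum (V : normedModType R) n j (f : 'I_n -> plane -> V) m :
  (forall i, differentiable (f i) m) ->
  partial j (fun z => \sum_(i < n) f i z) m = \sum_(i < n) partial j (f i) m.
Proof.
move=> df; have -> : (fun z => \sum_(i < n) f i z) = \sum_(i < n) f i.
  by apply/funext => z; rewrite fct_sumE.
by rewrite /partial derive_sum// => i; exact: diff_derivable.
Qed.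

End Calculus.

(** * Mean values, symmetry of second derivatives, chain rule *)

Section Lines.
Variable R : realType.
Local Notation plane := (plane R).
Local Notation e j := (delta_mx ord0 j : 'rV[R]_2).

Lemma plane_sum (v : plane) : v = v ord0 ord0 *: e ord0 + v ord0 ord_max *: e ord_max.
Proof.
by rewrite [LHS]row_sum_delta big_ord_recl big_ord_recl big_ord0 addr0; congr (_ + v _ _ *: delta_mx _ _);
  apply: val_inj.
Qed.

Lemma derive_partial (V : normedModType R) (f : plane -> V) m (v : plane) : differentiable f m ->
  'D_v f m = v ord0 ord0 *: partial ord0 f m + v ord0 ord_max *: partial ord_max f m.
Proof.
by move=> df; rewrite /partial !deriveE// {1}(plane_sum v) linearD !linearZ.
Qed.

Lemma is_derive_line (V : normedModType R) (f : plane -> V) (a v : plane) (t : R) :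
  differentiable f (a + t *: v) ->
  is_derive t 1 (fun s => f (a + s *: v)) ('D_v f (a + t *: v)).
Proof.
move=> /(@diff_derivable _ _ _ _ _ v) df.
have E : (fun h : R => h^-1 *: (f (a + (h *: 1 + t) *: v) - f (a + t *: v))) =
         (fun h : R => h^-1 *: (f (h *: v + (a + t *: v)) - f (a + t *: v))).
  apply/funext => h; congr (_ *: (f _ - _)).
  by rewrite scalerDl [h *: 1]mulr1 addrCA.
split; first by rewrite /derivable /= E.
by rewrite /derive /= E.
Qed.

Lemma is_derive_line_partial (V : normedModType R) (f : plane -> V) (a : plane) j (t : R) :
  differentiable f (a + t *: e j) ->
  is_derive t 1 (fun s => f (a + s *: e j)) (partial j f (a + t *: e j)).
Proof. exact: is_derive_line. Qed.

Lemma MVT0 (f df : R -> R) (b : R) : 0 <= b ->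
  (forall t : R, is_derive t 1 f (df t)) ->
  exists2 c, 0 <= c <= b & f b - f 0 = df c * b.
Proof.
move=> b0 fd.
have fc : {within `[0, b], continuous f}.
  apply: continuous_subspaceT => x.
  by apply: differentiable_continuous; apply/derivable1_diffP; have [] := fd x.
have [c + ->] := @MVT_segment R f df 0 b b0 (fun x _ => fd x) fc.
by rewrite in_itv/= => cb; exists c => //; rewrite subr0.
Qed.

Lemma partial0_cst (f : plane -> R) : (forall m, differentiable f m) ->
  (forall j m, partial j f m = 0) -> forall m, f m = f 0.
Proof.
move=> df f0 m.
have [//||c _] := @MVT0 (fun s => f (0 + s *: m)) (fun t => 'D_m f (0 + t *: m)) 1.
  by move=> t; exact: is_derive_line.
rewrite derive_partial// !f0 !scaler0 addr0 mul0r scale1r scale0r !add0r.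
by move/eqP; rewrite subr_eq0 => /eqP.
Qed.

Lemma partial0_cst_mx p q (f : plane -> 'M[R]_(p, q)) : (forall m, differentiable f m) ->
  (forall j m, partial j f m = 0) -> forall m, f m = f 0.
Proof.
move=> df f0 m; apply/matrixP => i k; apply: (@partial0_cst (fun z => f z i k)).
  by move=> z; have /differentiable_mxP := df z.
by move=> j z; rewrite -partial_mxE// f0 mxE.
Qed.

(** Two applications of the mean value theorem; exchanging i and j leaves
    the left-hand side unchanged, which is how the symmetry of second
    derivatives arises. *)
Lemma second_difference (f : plane -> R) (i j : 'I_2) m (h : R) : 0 <= h ->
  class_C 2 f ->
  exists s t, [/\ 0 <= s <= h, 0 <= t <= h &
    f (m + h *: e i + h *: e j) - f (m + h *: e i) - (f (m + h *: e j) - f m) =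
    partial j (partial i f) (m + s *: e i + t *: e j) * h * h].
Proof.
move=> h0 [df C2f].
have dif z : differentiable (partial i f) z by have [] := C2f i.
have [//||s sh] := @MVT0 (fun s => f (m + h *: e j + s *: e i) - f (m + s *: e i))
   (fun s => partial i f (m + h *: e j + s *: e i) - partial i f (m + s *: e i)) h.
  by move=> t; apply: is_deriveB; exact: is_derive_line_partial.
have [//||t th] := @MVT0 (fun t => partial i f (m + s *: e i + t *: e j))
   (fun t => partial j (partial i f) (m + s *: e i + t *: e j)) h.
  by move=> t; exact: is_derive_line_partial.
rewrite !scale0r !addr0 => E1 E2; exists s, t; split=> //.
by rewrite -E1 [m + s *: _ + _]addrAC -E2 [m + h *: e j + _]addrAC.
Qed.

Lemma close_point (g : plane -> R) (i j : 'I_2) m (d : R) : 0 < d ->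
  continuous g -> exists2 h0, 0 < h0 & forall s t, 0 <= s <= h0 -> 0 <= t <= h0 ->
    `|g m - g (m + s *: e i + t *: e j)| < d.
Proof.
move=> d0 cg; have /nbhs_ballP[r /= r0 Hr] : nbhs m (fun x => `|g m - g x| < d).
  exact: ((cvgrPdist_lt g (g m)).1 (cg m)).
exists (r / 3); first by rewrite divr_gt0.
move=> s t /andP[s0 sr] /andP[t0 tr]; apply: Hr.
have ne k : `|e k| <= 1.
  rewrite [`|_|]mx_normrE; apply/bigmax_leP; split=> // -[a b] _ /=.
  by rewrite mxE; case: (_ && _); rewrite ?normr1 ?normr0.
rewrite -ball_normE /ball_ /= -addrA opprD addrA subrr add0r normrN.
rewrite (le_lt_trans (ler_normD _ _))// !normrZ !ger0_norm//.
have : s * `|e i| <= s by rewrite ler_piMr.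
have : t * `|e j| <= t by rewrite ler_piMr.
lra.
Qed.

Lemma dist_half (A B C d : R) : `|A - C| < d / 2 -> `|B - C| < d / 2 -> `|A - B| <= d.
Proof.
by rewrite !ltr_norml ler_norml => /andP[? ?] /andP[? ?]; apply/andP; split; lra.
Qed.

Lemma schwarz (f : plane -> R) i j m : class_C 2 f ->
  partial i (partial j f) m = partial j (partial i f) m.
Proof.
move=> C2f; have [_ C1f] := C2f.
have cij k l : continuous (partial k (partial l f)).
  by have [_ /(_ k)] := C1f l.
apply/eqP; rewrite -subr_eq0 -normr_le0; apply/ler_addgt0Pl => d d0; rewrite addr0.
have d20 : 0 < d / 2 by rewrite divr_gt0.
have [h1 h10 H1] := close_point j i m d20 (cij i j).
have [h2 h20 H2] := close_point i j m d20 (cij j i).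
pose h := Num.min h1 h2.
have h0 : 0 < h by rewrite lt_min h10.
have [s [t [/andP[s0 sh] /andP[t0 th] E1]]] := second_difference i j m (ltW h0) C2f.
have [s' [t' [/andP[s0' sh'] /andP[t0' th'] E2]]] := second_difference j i m (ltW h0) C2f.
have hh1 : h <= h1 by rewrite ge_min lexx.
have hh2 : h <= h2 by rewrite ge_min lexx orbT.
have : `|partial i (partial j f) m - partial i (partial j f) (m + s' *: e j + t' *: e i)| < d / 2.
  by apply: H1; apply/andP; split=> //; apply: le_trans hh1.
have : `|partial j (partial i f) m - partial j (partial i f) (m + s *: e i + t *: e j)| < d / 2.
  by apply: H2; apply/andP; split=> //; apply: le_trans hh2.
have -> : partial i (partial j f) (m + s' *: e j + t' *: e i) =
          partial j (partial i f) (m + s *: e i + t *: e j).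
  apply: (@mulIf _ h); first by rewrite gt_eqF.
  apply: (@mulIf _ h); first by rewrite gt_eqF.
  have aux (A B C D : R) : A - B - (C - D) = A - C - (B - D) by ring.
  by apply: (etrans (esym E2)); apply: (etrans _ E1); rewrite [m + h *: e j + _]addrAC; exact: aux.
by move=> B2 A2; exact: dist_half A2 B2.
Qed.

Lemma schwarz_mx p q (f : plane -> 'M[R]_(p, q)) i j m : smooth f ->
  partial i (partial j f) m = partial j (partial i f) m.
Proof.
move=> sf; apply/matrixP => k l.
have df n : differentiable f n by exact: smooth_diff.
have E a b : partial a (partial b f) m k l = partial a (partial b (fun z => f z k l)) m.
  rewrite partial_mxE; last exact/smooth_diff/smooth_partial.
  rewrite (_ : (fun z => partial b f z k l) = partial b (fun z => f z k l))//.
  by apply/funext => z; rewrite partial_mxE.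
apply: (etrans (E i j)); apply: (etrans _ (esym (E j i))); apply: schwarz; move/smooth_mxP : sf => sf; exact: sf.
Qed.

Lemma partial_comp (V : normedModType R) (f : plane -> V) (y : plane -> plane) j m :
  differentiable f (y m) -> differentiable y m ->
  partial j (f \o y) m = partial j y m ord0 ord0 *: partial ord0 f (y m)
     + partial j y m ord0 ord_max *: partial ord_max f (y m).
Proof.
move=> df dy; apply: (etrans _ (derive_partial _ df)).
have dfy : differentiable (f \o y) m by exact: differentiable_comp.
apply: (etrans (deriveE _ dfy)); rewrite diff_comp//= (deriveE _ df).
by congr ('d f (y m) _); rewrite /partial deriveE.
Qed.

Lemma class_C_comp k (f : plane -> R) (y : plane -> plane) :
  smooth y -> class_C k f -> class_C k (f \o y).
Proof.
move=> sy; elim: k f => [|k IH] f /=.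
  by move=> cf m; apply: continuous_comp; [exact: (smooth_continuous sy)|exact: cf].
move=> [df Cf]; split=> [m|j].
  by apply: differentiable_comp => //; exact: smooth_diff.
have -> : partial j (f \o y) = fun z =>
   partial j y z ord0 ord0 * (partial ord0 f \o y) z
     + partial j y z ord0 ord_max * (partial ord_max f \o y) z.
  by apply/funext => z; rewrite partial_comp//; exact: smooth_diff.
by apply: class_CD; (apply: class_CM; [|exact/IH/Cf]); have /smooth_mxP := smooth_partial j sy; apply.
Qed.

Lemma smooth_comp p q (f : plane -> 'M[R]_(p, q)) (y : plane -> plane) :
  smooth y -> smooth f -> smooth (f \o y).
Proof.
move=> sy /smooth_mxP sf; apply/smooth_mxP => i j k.
by apply: (@class_C_comp k (fun z => f z i j)) => //; exact: sf.
Qed.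

End Lines.

(** * Linear ordinary differential equations *)

Section LinearODE.
Variable R : realType.

(** The primitive is needed on both sides of 0, where the equation is
    differentiated; the truncation at -1 makes it continuous on the whole
    line while integrals start at -2. *)
Lemma primitive_exists (f : R -> R) : continuous f ->
  exists F : R -> R, [/\ F 0 = 0, continuous F & forall t : R, -1 < t -> is_derive t 1 F (f t)].
Proof.
move=> cf.
pose G x := (\int[lebesgue_measure]_(t in `[(-2 : R), x]) f t)%R.
have dG (x : R) : -2 < x -> is_derive x 1 G (f x).
  move=> x2; have [||||dG Gf] := @continuous_FTC1 R f (BLeft (-2 : R)) x (x + 1).
  - by rewrite ltrDl.
  - apply: continuous_compact_integrable; first exact: segment_compact.
    exact: continuous_subspaceT.
  - by rewrite lte_fin.
  - exact: cf.
  rewrite derive1E in Gf; exact: (DeriveDef dG Gf).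
have cG (x : R) : -2 < x -> {for x, continuous G}.
  by move=> /dG [dG' _]; exact/differentiable_continuous/derivable1_diffP.
exists (fun x => G (Num.max x (-1)) - G 0); split.
- by rewrite max_l ?subrr// lerN10.
- move=> x.
  have cm : {for x, continuous (fun x : R => Num.max x (-1))}.
    exact: (@continuous_max R R id (cst (-1)) x (@cvg_id _ _) (@cst_continuous _ _ _ _)).
  have m2 : -2 < Num.max x (-1) by rewrite lt_max ltrN2 ltr1n orbT.
  exact: (continuousB (continuous_comp cm (cG _ m2)) (@cst_continuous _ _ _ _)).
move=> t t1.
have t2 : -2 < t by apply: lt_trans t1; rewrite ltrN2 ltr1n.
have H : is_derive t 1 (fun x => G x - G 0) (f t).
  by rewrite -[f t]subr0; apply: is_deriveB; apply: dG.
apply: (@near_eq_is_derive _ _ _ (fun x => G x - G 0)) => //.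
near=> x; rewrite max_l//; apply: ltW; near: x.
exact: lt_nbhsr.
Unshelve. all: by end_near. Qed.

Lemma MVT_bound (f df : R -> R) (a b K x y : R) : 
  (forall t : R, a < t < b -> is_derive t 1 f (df t)) -> (forall t, a < t < b -> `|df t| <= K) ->
  a < x < b -> a < y < b -> `|f y - f x| <= K * `|y - x|.
Proof.
move=> fd dfK; wlog xy : x y / x <= y => [H|] xab yab.
  case: (leP x y) => [xy|/ltW yx]; first exact: H.
  by rewrite distrC [`|y - x|]distrC; exact: H.
have sub t : x <= t <= y -> a < t < b.
  move: xab yab => /andP[ax _] /andP[_ yb] /andP[xt ty].
  by rewrite (lt_le_trans ax xt) (le_lt_trans ty yb).
have fc : {within `[x, y], continuous f}.
  apply: continuous_in_subspaceT => t; rewrite inE/= in_itv/= => /sub /fd [ft _].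
  exact/differentiable_continuous/derivable1_diffP.
have fd' t : t \in `]x, y[ -> is_derive t 1 f (df t).
  by rewrite in_itv/= => /andP[/ltW xt /ltW ty]; apply/fd/sub; rewrite xt.
have [c + ->] := @MVT_segment R f df x y xy fd' fc.
by rewrite in_itv/= => /sub cab; rewrite normrM ler_wpM2r//; exact: dfK.
Qed.

Section Dominated.
Variables (u M : R^nat).
Hypotheses (cM : cvgn (series M)) (uM : forall k, `|u k| <= M k).

Lemma dominated_cvg : cvgn (series u).
Proof.
apply: normed_cvg; apply: (series_le_cvg _ _ uM cM) => // k.
exact: le_trans (uM k).
Qed.

Lemma dominated_partial_le N n : (N <= n)%N ->
  `|series u n - series u N| <= series M n - series M N.
Proof.
move=> Nn; rewrite !sub_series_geq//.
by rewrite (le_trans (ler_norm_sum _ _ _))//; apply: ler_sum => k _; exact: uM.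
Qed.

Lemma dominated_tail N :
  `|limn (series u) - series u N| <= limn (series M) - series M N.
Proof.
have cu := dominated_cvg.
have c1 : (fun n => `|series u n - series u N|) @ \oo --> `|limn (series u) - series u N|.
  by apply: cvg_norm; apply: cvgB => //; exact: cvg_cst.
have c2 : (fun n => series M n - series M N) @ \oo --> limn (series M) - series M N.
  by apply: cvgB => //; exact: cvg_cst.
rewrite -(cvg_lim _ c1)// -(cvg_lim _ c2)//.
apply: ler_lim; [by apply/cvg_ex; exists (`|limn (series u) - series u N|)|by apply/cvg_ex; exists (limn (series M) - series M N)|].
by near=> n; apply: dominated_partial_le; near: n; exact: nbhs_infty_ge.
Unshelve. all: by end_near. Qed.

Lemma dominated_lim_le : `|limn (series u)| <= limn (series M).
Proof.
by have := dominated_tail 0; rewrite !seriesEnat/= !big_geq// !subr0.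
Qed.

End Dominated.

Lemma four_dist (A B C D T e : R) : `|A - B| <= T -> `|B - C| <= e / 4 -> `|D - C| <= T ->
  T <= e / 4 -> `|A - D| <= e.
Proof.
rewrite !ler_norml => /andP[? ?] /andP[? ?] /andP[? ?] ?; apply/andP; split; lra.
Qed.

(** The difference quotient is compared with that of a partial sum; both
    tails are controlled by the dominating series. *)
Lemma termwise_derive (f g : nat -> R -> R) (M : nat -> R) (a b : R) :
  cvgn (series M) ->
  (forall k (t : R), a < t < b -> is_derive t 1 (f k) (g k t)) ->
  (forall k t, a < t < b -> `|f k t| <= M k) ->
  (forall k t, a < t < b -> `|g k t| <= M k) ->
  forall t : R, a < t < b ->
  is_derive t 1 (fun t => limn (series (f^~ t))) (limn (series (g^~ t))).
Proof.
move=> cM fg fM gM t tab.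
pose S t := limn (series (f^~ t)); pose S' := limn (series (g^~ t)).
pose T N := limn (series M) - series M N.
have dS N (s : R) : a < s < b -> is_derive s 1 (fun t => series (f^~ t) N) (series (g^~ s) N).
  move=> sab; rewrite /series/=.
  have -> : (fun t => \sum_(0 <= k < N) f k t) = \sum_(k < N) (f k).
    by apply/funext => x; rewrite fct_sumE big_mkord.
  by rewrite big_mkord; apply: is_derive_sum => k; exact: fg.
have quot N h : a < h + t < b -> h != 0 ->
    `|h^-1 * (S (h + t) - S t) - h^-1 * (series (f^~ (h + t)) N - series (f^~ t) N)| <= T N.
  move=> htab h0; rewrite -mulrBr normrM normfV ler_pdivrMl ?normr_gt0// mulrC.
  have c1 : (fun n => `|(series (f^~ (h + t)) n - series (f^~ t) n)
       - (series (f^~ (h + t)) N - series (f^~ t) N)|) @ \oo -->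
      `|S (h + t) - S t - (series (f^~ (h + t)) N - series (f^~ t) N)|.
    apply: cvg_norm; apply: cvgB; last exact: cvg_cst.
    by apply: cvgB; apply: (dominated_cvg cM) => k; exact: fM.
  rewrite -(cvg_lim _ c1)//; apply: limr_le; first by apply/cvg_ex; eexists; exact: c1.
  near=> n.
  have Nn : (N <= n)%N by near: n; exact: nbhs_infty_ge.
  have -> (A B C D : R) : A - B - (C - D) = A - C - (B - D) by ring.
  have := @MVT_bound (fun s => series (f^~ s) n - series (f^~ s) N)
    (fun s => series (g^~ s) n - series (g^~ s) N) a b (T N) t (h + t).
  rewrite addrK; apply; [by move=> s sab; apply: is_deriveB; exact: dS|move=> s sab|exact: tab|exact: htab].
  rewrite (le_trans (@dominated_partial_le (g^~ s) M _ N n Nn))//; first by move=> k; exact: gM.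
  rewrite lerD2r; apply: nondecreasing_cvgn_le => //.
  apply: nondecreasing_series => k _ _.
  exact: (le_trans (normr_ge0 _) (gM k _ tab)).
suff H : (fun h => h^-1 *: (S (h *: 1 + t) - S t)) @ 0^' --> S'.
  by apply: DeriveDef; [apply/cvg_ex; exists S'|exact: cvg_lim].
apply/cvgrPdist_le => e e0.
have [N HN] : exists N, T N <= e / 4.
  have /cvgrPdist_le/(_ (e / 4)) : series M @ \oo --> limn (series M) by [].
  have e40 : 0 < e / 4 by rewrite divr_gt0.
  move=> /(_ e40) [N _ /(_ N (leqnn N)) HN]; exists N.
  exact: le_trans (ler_norm _) HN.
have [dN dNE] := dS N t tab.
have cl : (fun h : R => h^-1 *: (series (f^~ (h *: 1 + t)) N - series (f^~ t) N)) @ 0^' -->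
    series (g^~ t) N by rewrite -dNE; exact: dN.
have e20 : 0 < e / 4 by rewrite divr_gt0.
have near1 : \forall h \near 0^', `|series (g^~ t) N - h^-1 *: (series (f^~ (h *: 1 + t)) N - series (f^~ t) N)| <= e / 4.
  by move/cvgrPdist_le : cl; apply.
have near2 : \forall h \near 0^', a - t < h < b - t.
  apply: nbhs_dnbhs; near=> h; apply/andP; split; near: h.
    by apply: lt_nbhsr; rewrite subr_lt0; case/andP: tab.
  by apply: lt_nbhsl; rewrite subr_gt0; case/andP: tab.
near=> h.
have h0 : h != 0 by near: h; exact: nbhs_dnbhs_neq.
have htab : a < h + t < b.
  by rewrite -ltrBlDr -[h + t < b]ltrBrDr; near: h; exact: near2.
have nq : `|series (g^~ t) N - h^-1 *: (series (f^~ (h *: 1 + t)) N - series (f^~ t) N)| <= e / 4.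
  by near: h; exact: near1.
have q := quot N h htab h0.
have tl := @dominated_tail (g^~ t) M cM (fun k => gM k t tab) N.
have h1 : h *: (1 : R) + t = h + t by rewrite [h *: 1]mulr1.
rewrite h1 in nq *.
exact: (four_dist tl nq q HN).
Unshelve. all: by end_near. Qed.

(** The derivative of A s^(k+1) / (k+1) - f(s) is nonnegative. *)
Lemma power_growth_half (f df : R -> R) (t A : R) k : 0 <= t ->
  (forall s : R, 0 <= s <= t -> is_derive s 1 f (df s)) ->
  (forall s, 0 <= s <= t -> df s <= A * s ^+ k) ->
  f t - f 0 <= A * t ^+ k.+1 / k.+1%:R.
Proof.
move=> t0 fd dfA.
pose g := (fun s : R => A / k.+1%:R * s ^+ k.+1 - f s).
have gd (s : R) : 0 <= s <= t -> is_derive s 1 g (A * s ^+ k - df s).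
  move=> /fd fds; apply: is_deriveB.
  have -> : A * s ^+ k = A / k.+1%:R * (k.+1%:R * s ^+ k *: 1).
    by rewrite [_ *: 1]mulr1 mulrA divfK// pnatr_eq0.
  have H : is_derive s 1 (fun s : R => s ^+ k.+1) (k.+1%:R * s ^+ k *: 1).
    by rewrite (_ : (fun _ => _) = id ^+ k.+1); [exact: is_deriveX|apply/funext => x; rewrite fctE].
  exact: is_deriveZ.
have gc : {within `[0, t], continuous g}.
  apply: continuous_in_subspaceT => s; rewrite inE/= in_itv/= => /gd [gs _].
  exact/differentiable_continuous/derivable1_diffP.
have gd' s : s \in `]0, t[ -> is_derive s 1 g (A * s ^+ k - df s).
  by rewrite in_itv/= => /andP[/ltW xt /ltW ty]; apply/gd; rewrite xt.
have [c + E] := @MVT_segment R g _ 0 t t0 gd' gc.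
rewrite in_itv/= => /dfA dfc.
have : 0 <= g t - g 0 by rewrite E subr0 mulr_ge0// subr_ge0.
have -> : g t - g 0 = A * t ^+ k.+1 / k.+1%:R - (f t - f 0).
  by rewrite /g expr0n/= mulr0 mulrAC; move: (_ / _) (f t) (f 0) => X Y Z; ring.
by rewrite subr_ge0.
Qed.

Lemma power_growth (f df : R -> R) (b A : R) k :
  (forall s : R, -1 < s < b -> is_derive s 1 f (df s)) ->
  (forall s, -1 < s < b -> `|df s| <= A * `|s| ^+ k) -> f 0 = 0 -> 0 < b ->
  forall t, -1 < t < b -> `|f t| <= A * `|t| ^+ k.+1 / k.+1%:R.
Proof.
move=> fd dfA f0 b0 t /andP[t1 tb].
have N1 : -1 < (0 : R) by rewrite ltrN10.
case: (leP 0 t) => t0.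
  have sub s : 0 <= s <= t -> -1 < s < b.
    by move=> /andP[s0 st]; rewrite (lt_le_trans N1 s0) (le_lt_trans st tb).
  have H1 := @power_growth_half f df t A k t0 (fun s h => fd s (sub s h)).
  have H2 := @power_growth_half (fun s => - f s) (fun s => - df s) t A k t0
     (fun s h => is_deriveN (fd s (sub s h))).
  rewrite (ger0_norm t0) ler_norml lerNl; apply/andP; split.
    move: H2; rewrite f0 oppr0 subr0; apply=> s /[dup] /sub /dfA /[swap] /andP[s0 _].
    by rewrite (ger0_norm s0) ler_norml lerNl => /andP[].
  move: H1; rewrite f0 subr0; apply=> s /[dup] /sub /dfA /[swap] /andP[s0 _].
  by rewrite (ger0_norm s0) ler_norml => /andP[].
have sub s : 0 <= s <= - t -> -1 < - s < b.
  move=> /andP[s0 st]; apply/andP; split; first by apply: (lt_le_trans t1); rewrite lerNr.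
  by apply: (le_lt_trans _ b0); rewrite oppr_le0.
have fd' (s : R) : 0 <= s <= - t -> is_derive s 1 (fun s => f (- s)) (- df (- s)).
  move=> /sub /fd H.
  rewrite (_ : - df (- s) = df (- s) * - 1); last by rewrite mulrN1.
  exact: (is_derive1_comp H (is_deriveNid s 1)).
have t0' : 0 <= - t by rewrite oppr_ge0 ltW.
have H1 := @power_growth_half _ _ (- t) A k t0' fd'.
have H2 := @power_growth_half (fun s => - f (- s)) (fun s => - - df (- s)) (- t) A k t0'
     (fun s h => is_deriveN (fd' s h)).
rewrite (ltr0_norm t0) ler_norml lerNl; apply/andP; split.
  move: H2; rewrite opprK oppr0 f0 oppr0 subr0; apply=> s /[dup] /sub /dfA /[swap] /andP[s0 _].
  by rewrite normrN (ger0_norm s0) ler_norml opprK => /andP[].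
move: H1; rewrite opprK oppr0 f0 subr0; apply=> s /[dup] /sub /dfA /[swap] /andP[s0 _].
by rewrite normrN (ger0_norm s0) ler_norml lerNl => /andP[].
Qed.

(** A total choice of primitive lets the Picard iteration be a plain
    recursion. *)
Definition prim (f : R -> R) : R -> R :=
  if pselect (continuous f) is left cf then sval (cid (primitive_exists cf)) else 0.

Lemma primP (f : R -> R) : continuous f ->
  [/\ prim f 0 = 0, continuous (prim f) & forall t : R, -1 < t -> is_derive t 1 (prim f) (f t)].
Proof. by rewrite /prim; case: pselect => // cf _; case: cid. Qed.

Section Picard.
Variables (n : nat) (a : R -> 'M[R]_n).
Hypothesis ca : forall i j, continuous (fun t => a t i j).

Fixpoint picard k (t : R) : 'M[R]_n :=
  if k is k'.+1 then \matrix_(i, j) prim (fun s => (picard k' s *m a s) i j) t else 1%:M.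

Lemma continuous_mul_entry (y : R -> 'M[R]_n) : (forall i j, continuous (fun t => y t i j)) ->
  forall i j, continuous (fun t => (y t *m a t) i j).
Proof.
move=> cy i j.
have -> : (fun t => (y t *m a t) i j) = (fun t => \sum_l y t i l * a t l j).
  by apply/funext => t; rewrite mxE.
have cadd : continuous (fun x : R * R => x.1 + x.2) by move=> x; exact: add_continuous.
apply: (@continuous_big R _ +%R 0 xpredT cadd R) => l _ t.
by apply: cvgM; [exact: cy|exact: ca].
Qed.

Lemma picard_continuous k i j : continuous (fun t => picard k t i j).
Proof.
elim: k i j => [|k IH] i j /=; first by move=> t; exact: cst_continuous.
under eq_fun do rewrite mxE.
by have [] := primP (continuous_mul_entry IH (i := i) (j := j)).
Qed.

Lemma picardS_derive k i j (t : R) : -1 < t ->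
  is_derive t 1 (fun t => picard k.+1 t i j) ((picard k t *m a t) i j).
Proof.
move=> t1; have [_ _] := primP (continuous_mul_entry (@picard_continuous k) (i := i) (j := j)).
by move=> /(_ t t1); under [in X in _ -> X]eq_fun do rewrite mxE.
Qed.

Lemma picardS0 k i j : picard k.+1 0 i j = 0.
Proof.
by rewrite mxE; have [] := primP (continuous_mul_entry (@picard_continuous k) (i := i) (j := j)).
Qed.

Variable C : R.
Hypothesis aC : forall t i j, -1 < t < 2 -> `|a t i j| <= C.
Let K := n%:R * C.

Lemma mul_entry_bound (y : 'M[R]_n) (B t : R) i j : -1 < t < 2 -> 
  (forall i j, `|y i j| <= B) -> `|(y *m a t) i j| <= K * B.
Proof.
move=> t12 yB; rewrite mxE (le_trans (ler_norm_sum _ _ _))//.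
have -> : K * B = \sum_(l < n) B * C by rewrite sumr_const card_ord -[RHS]mulr_natl /K; ring.
by apply: ler_sum => l _; rewrite normrM; apply: ler_pM => //; exact: aC.
Qed.

(** The factorial comes from integrating |t|^k at each step. *)
Lemma picard_bound k t i j : -1 < t < 2 ->
  `|picard k t i j| <= K ^+ k / k`!%:R * `|t| ^+ k.
Proof.
elim: k t i j => [|k IH] t i j t12.
  by rewrite mxE !expr0 fact0 invr1 !mulr1; case: eqP; rewrite ?normr1// normr0.
have -> : K ^+ k.+1 / (k.+1)`!%:R * `|t| ^+ k.+1 = (K * (K ^+ k / k`!%:R)) * `|t| ^+ k.+1 / k.+1%:R.
  rewrite factS natrM invfM exprS; ring.
apply: (@power_growth (fun t => picard k.+1 t i j) (fun t => (picard k t *m a t) i j) 2) => //.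
- by move=> s /andP[s1 _]; exact: picardS_derive.
- by move=> s s12; rewrite -mulrA; apply: mul_entry_bound => // i' j'; exact: IH.
- exact: picardS0.
Qed.

Lemma ode_bound_ge0 : (0 < n)%N -> 0 <= C.
Proof.
move=> n0; have := @aC 0 (Ordinal n0) (Ordinal n0).
by rewrite ltrN10 ltr0n => /(_ isT); exact: le_trans.
Qed.

Let M := exp_coeff (4 * K).

Let dpicard k (t : R) : 'M[R]_n := if k is k'.+1 then picard k' t *m a t else 0.

Lemma K_ge0 : 0 <= K.
Proof.
rewrite /K; case: (posnP n) => [->|/ode_bound_ge0 C0]; first by rewrite mul0r.
by rewrite mulr_ge0.
Qed.

Lemma picard_dom k t i j : -1 < t < 2 -> `|picard k t i j| <= M k.
Proof.
move=> t12; apply: (le_trans (picard_bound k i j t12)).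
have -> : M k = 4 ^+ k * (K ^+ k / k`!%:R) by rewrite /M /exp_coeff/= exprMn mulrA.
rewrite mulrC; apply: ler_pM; rewrite ?exprn_ge0 ?divr_ge0 ?exprn_ge0 ?K_ge0//.
rewrite lerXn2r ?nnegrE//.
by move: t12 => /andP[? ?]; rewrite ler_norml; apply/andP; split; lra.
Qed.

Lemma dpicard_dom k t i j : -1 < t < 2 -> `|dpicard k t i j| <= M k.
Proof.
move=> t12; case: k => [|k].
  by rewrite mxE normr0 /M /exp_coeff /= expr0 fact0 invr1 mulr1.
have H : `|dpicard k.+1 t i j| <= K * (K ^+ k / k`!%:R * 2 ^+ k).
  apply: mul_entry_bound => // i' j'; apply: (le_trans (picard_bound k i' j' t12)).
  rewrite ler_wpM2l ?divr_ge0 ?exprn_ge0 ?K_ge0// lerXn2r ?nnegrE//.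
  by move: t12 => /andP[? ?]; rewrite ler_norml; apply/andP; split; lra.
apply: (le_trans H); rewrite /M /exp_coeff/= factS natrM invfM.
have -> : K * (K ^+ k / k`!%:R * 2 ^+ k) = K ^+ k.+1 / k`!%:R * 2 ^+ k by rewrite exprS; ring.
have -> : (4 * K) ^+ k.+1 * (k.+1%:R^-1 / k`!%:R) = K ^+ k.+1 / k`!%:R * (4 ^+ k.+1 / k.+1%:R).
  by rewrite exprMn; ring.
rewrite ler_wpM2l ?divr_ge0 ?exprn_ge0 ?K_ge0// ler_pdivlMr ?ltr0n//.
have -> : (4 : R) = 2 * 2 by ring.
rewrite exprMn exprS; apply: ler_pM; rewrite ?exprn_ge0//.
  by rewrite ler_peMl ?exprn_ge0// ler1n.
by rewrite -exprS -natrX ler_nat ltnW// ltn_expl.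
Qed.

Lemma picard_sum_bound t i j : -1 < t < 2 ->
  `|limn (series (fun k => picard k t i j))| <= expR (4 * K).
Proof.
move=> t12; apply: dominated_lim_le; first exact: is_cvg_series_exp_coeff.
by move=> k; exact: picard_dom.
Qed.

Lemma picard_sum_derive (t : R) i j : -1 < t < 2 ->
  is_derive t 1 (fun t => limn (series (fun k => picard k t i j)))
   (\sum_l limn (series (fun k => picard k t i l)) * a t l j).
Proof.
move=> t12.
have cM : cvgn (series M) by exact: is_cvg_series_exp_coeff.
have H := @termwise_derive (fun k t => picard k t i j) (fun k t => dpicard k t i j) M (-1) 2 cM.
have {H} := H _ _ _ t t12.
have -> : limn (series (fun k => dpicard k t i j)) =
   (\sum_l limn (series (fun k => picard k t i l)) * a t l j).
  apply: cvg_lim => //.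
  rewrite -cvg_shiftS.
  have -> : (fun N => series (fun k => dpicard k t i j) N.+1) =
      (fun N => \sum_l series (fun k => picard k t i l) N * a t l j).
    apply/funext => N; rewrite /series/= big_nat_recl//= mxE add0r.
    under eq_bigr do rewrite mxE.
    by rewrite exchange_big/=; apply: eq_bigr => l _; rewrite mulr_suml.
  apply: cvg_big => [x|l _]; first exact: add_continuous.
  by apply: cvgMr_tmp; exact: (dominated_cvg cM (fun k => picard_dom k i l t12)).
apply.
- move=> [|k] s /andP[s1 _]; last exact: picardS_derive.
  by rewrite [dpicard 0 s i j]mxE; exact: is_derive_cst.
- by move=> k s s12; exact: picard_dom.
- by move=> k s s12; exact: dpicard_dom.
Qed.

Lemma picard_sum0 i j : limn (series (fun k => picard k 0 i j)) = (1%:M : 'M[R]_n) i j.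
Proof.
apply: cvg_lim => //; rewrite -cvg_shiftS.
have -> : (fun N => series (fun k => picard k 0 i j) N.+1) = fun=> (1%:M : 'M[R]_n) i j.
  apply/funext => N; rewrite /series/= big_nat_recl//= big1 ?addr0// => k _.
  by have := picardS0 k i j.
exact: cvg_cst.
Qed.

End Picard.

(** The Picard series converges, and may be differentiated termwise, by
    comparison with the exponential series. *)
Lemma linear_ode n (a : R -> 'M[R]_n) (C0 : R) :
  (forall i j, continuous (fun t => a t i j)) ->
  (forall t i j, -1 < t < 2 -> `|a t i j| <= C0) ->
  exists Y : R -> 'M[R]_n, [/\ Y 0 = 1%:M,
    forall (t : R) i j, -1 < t < 2 -> is_derive t 1 (fun t => Y t i j) ((Y t *m a t) i j) &
    forall C, (forall t i j, -1 < t < 2 -> `|a t i j| <= C) ->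
      forall t i j, -1 < t < 2 -> `|Y t i j| <= expR (4 * (n%:R * C))].
Proof.
move=> ca aC0; exists (fun t => \matrix_(i, j) limn (series (fun k => picard a k t i j))).
split=> [|t i j t12|C aC t i j t12].
- by apply/matrixP => i j; rewrite mxE picard_sum0.
- rewrite (_ : (_ *m _) i j = \sum_l limn (series (fun k => picard a k t i l)) * a t l j).
    rewrite (_ : (fun _ => _) = fun t => limn (series (fun k => picard a k t i j))).
      exact: (picard_sum_derive ca aC0).
    by apply/funext => s; rewrite mxE.
  by rewrite mxE; apply: eq_bigr => l _; rewrite mxE.
- by rewrite mxE; exact: (picard_sum_bound ca aC).
Qed.

(** The candidate V for the inverse of Y solves the adjoint equation, hence
    obeys the same bound. *)
Lemma linear_ode_inverse n (a : R -> 'M[R]_n) (C0 : R) :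
  (forall i j, continuous (fun t => a t i j)) ->
  (forall t i j, -1 < t < 2 -> `|a t i j| <= C0) ->
  exists Y V : R -> 'M[R]_n, [/\ Y 0 = 1%:M, V 0 = 1%:M,
    forall (t : R) i j, -1 < t < 2 -> is_derive t 1 (fun t => Y t i j) ((Y t *m a t) i j),
    forall (t : R) i j, -1 < t < 2 -> is_derive t 1 (fun t => V t i j) (- (a t *m V t) i j) &
    forall C, (forall t i j, -1 < t < 2 -> `|a t i j| <= C) ->
      forall t i j, -1 < t < 2 -> `|Y t i j| <= expR (4 * (n%:R * C)) /\
                                  `|V t i j| <= expR (4 * (n%:R * C))].
Proof.
move=> ca aC0; have [Y [Y0 dY bY]] := linear_ode ca aC0.
pose a' t := - (a t)^T.
have ca' i j : continuous (fun t => a' t i j).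
  rewrite (_ : (fun _ => _) = fun t => - a t j i); last by apply/funext => t; rewrite !mxE.
  by move=> t; apply: cvgN; exact: ca.
have bound C : (forall t i j, -1 < t < 2 -> `|a t i j| <= C) ->
   (forall t i j, -1 < t < 2 -> `|a' t i j| <= C).
  by move=> aC t i j t12; rewrite !mxE normrN; exact: aC.
have [V [V0 dV bV]] := linear_ode ca' (bound _ aC0).
exists Y, (fun t => (V t)^T); split=> //.
- by rewrite V0 trmx1.
- move=> t i j t12; rewrite (_ : - _ = (V t *m a' t) j i).
    by under eq_fun do rewrite mxE; exact: dV.
  by rewrite mulmxN [RHS]mxE -[in RHS](trmxK (V t)) -trmx_mul [in RHS]mxE.
- by move=> C aC t i j t12; split; [exact: bY|rewrite mxE; exact: (bV _ (bound _ aC))].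
Qed.

End LinearODE.

(** * Quadratic remainders and Taylor bounds *)

Section QuadraticRemainder.
Variable R : realType.
Local Notation plane := (plane R).

Lemma diff0_of_quadratic (U V : normedModType R) (f : U -> V) (m : U) (K : R) :
  (forall h : U, `|h| <= 1 -> `|f (h + m) - f m| <= K * `|h| ^+ 2) ->
  differentiable f m /\ 'd f m = (\0 : U -> V) :> (U -> V).
Proof.
move=> fK.
have E : f \o shift m = cst (f m) + \0 +o_ (0 : U) id.
  apply/eqaddoP => e e0.
  near=> h; rewrite !fctE /= addr0.
  have h1 : `|h| <= 1.
    by near: h; apply: (cvgr0_norm_le _ (@cvg_id _ _)).
  apply: (le_trans (fK h h1)); rewrite expr2 mulrA ler_wpM2r//.
  have : `|h| <= e / (`|K| + 1).
    by near: h; apply: (cvgr0_norm_le _ (@cvg_id _ _)); rewrite divr_gt0// ltr_wpDl.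
  rewrite ler_pdivlMr ?ltr_wpDl// mulrDr mulr1 => H.
  apply: le_trans H; rewrite mulrC -[leLHS]addr0; apply: lerD => //.
  by rewrite ler_wpM2l// ler_norm.
have d0 : 'd f m = (\0 : U -> V) :> (U -> V).
  by apply: diff_unique => //; move=> x; exact: cst_continuous.
split=> //; apply/diff_locallyP; rewrite d0; split=> // x; exact: cst_continuous.
Unshelve. all: by end_near. Qed.

Lemma diff_of_quadratic (V : normedModType R) (f : plane -> V) (m : plane) (K : R) :
  (forall h : plane, `|h| <= 1 -> `|f (h + m) - f m| <= K * `|h| ^+ 2) ->
  differentiable f m /\ forall j, partial j f m = 0.
Proof.
by move=> /diff0_of_quadratic[df d0]; split=> // j; rewrite /partial deriveE// d0.
Qed.

Lemma partial_coord (i j : 'I_2) (m : plane) :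
  partial i (fun z : plane => z ord0 j) m = (j == i)%:R.
Proof.
rewrite -(@partial_mxE R 1 2 id) /partial; last exact: ex_diff.
by rewrite derive_id mxE eqxx.
Qed.

Lemma plane_coord_smooth (j : 'I_2) : smooth (fun z : plane => z ord0 j).
Proof.
move=> [|k] /=; first by move=> m; exact: coord_continuous.
split=> [m|i]; first exact: differentiable_coord.
rewrite (_ : partial i _ = fun=> ((j == i)%:R : R)); first exact: class_C_cst.
by apply/funext => z; exact: partial_coord.
Qed.

Lemma diff_of_quadratic_remainder (f : plane -> R) (m : plane) (p q K : R) :
  (forall h : plane, `|h| <= 1 ->
    `|f (m + h) - f m - (h ord0 ord0 * p + h ord0 ord_max * q)| <= K * `|h| ^+ 2) ->
  [/\ differentiable f m, partial ord0 f m = p & partial ord_max f m = q].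
Proof.
move=> fK.
pose g (z : plane) := (z ord0 ord0 - m ord0 ord0) * p + (z ord0 ord_max - m ord0 ord_max) * q.
have dc j : differentiable (fun z : plane => z ord0 j - m ord0 j) m.
  by apply: smooth_diff; apply: smoothB; [exact: plane_coord_smooth|exact: smooth_cst].
have dcp j c : differentiable (fun z : plane => (z ord0 j - m ord0 j) * c) m.
  by apply: differentiableM => //; exact: (smooth_diff _ (smooth_cst _)).
have dg : differentiable g m by apply: differentiableD.
have pc i j c : partial i (fun z : plane => (z ord0 j - m ord0 j) * c) m = (j == i)%:R * c.
  rewrite partialM// partial_cst mulr0 addr0 partialB//; last exact: differentiable_coord.
  by rewrite partial_coord partial_cst subr0.
have pg i : partial i g m = (ord0 == i)%:R * p + (ord_max == i)%:R * q.
  by rewrite partialD// !pc.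
have [|du pu] := @diff_of_quadratic R (fun z => f z - g z) m K.
  move=> h /fK; rewrite [m + h]addrC /g !mxE !subrr !mul0r addr0 subr0 !addrK.
  by rewrite addrAC.
have fE : f = (fun z => (f z - g z) + g z) by apply/funext => z; rewrite subrK.
have df : differentiable f m by rewrite fE; exact: differentiableD.
have pf i : partial i f m = partial i g m by rewrite {1}fE partialD// pu add0r.
by split=> //; rewrite pf pg /= ?mul1r ?mul0r ?addr0 ?add0r.
Qed.

Lemma norm_mx_le p q (A : 'M[R]_(p, q)) B : 0 <= B -> (forall i j, `|A i j| <= B) -> `|A| <= B.
Proof.
by move=> B0 AB; rewrite [`|A|]mx_normrE; apply/bigmax_leP; split=> // -[i j] _ /=.
Qed.

Lemma norm_entry_le p q (A : 'M[R]_(p, q)) i j : `|A i j| <= `|A|.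
Proof.
by rewrite [leRHS]mx_normrE; apply: (le_bigmax _ (fun ij => `|A ij.1 ij.2|) (i, j)).
Qed.

Lemma norm_mulmx_le p q r (A : 'M[R]_(p, q)) (B : 'M[R]_(q, r)) :
  `|A *m B| <= q%:R * `|A| * `|B|.
Proof.
apply: norm_mx_le => [|i j]; first by rewrite !mulr_ge0.
rewrite mxE (le_trans (ler_norm_sum _ _ _))//.
have -> : q%:R * `|A| * `|B| = \sum_(l < q) `|A| * `|B|.
  by rewrite sumr_const card_ord -mulrA mulr_natl.
by apply: ler_sum => l _; rewrite normrM ler_pM// norm_entry_le.
Qed.

Lemma bounded_on_ball (V : normedModType R) (f : plane -> V) (r : R) : continuous f ->
  exists2 M, 0 <= M & forall z, `|z| <= r -> `|f z| <= M.
Proof.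
move=> cf.
have cB : compact [set z : plane | `|z| <= r].
  apply: bounded_closed_compact.
    by exists r; split; [exact: num_real|move=> M rM z /le_trans; apply; exact: ltW].
  rewrite (_ : mkset _ = (fun z : plane => `|z|) @^-1` [set x | x <= r])//.
  by apply: closed_comp; [move=> x _; exact: norm_continuous|exact: closed_le].
have := compact_bounded (continuous_compact (continuous_subspaceT cf) cB).
move=> [M [_ HM]]; exists (`|M| + 1); first by rewrite addr_ge0.
move=> z zr; apply: (HM (`|M| + 1)); last by exists z.
by rewrite (le_lt_trans (ler_norm M))// ltrDl.
Qed.

End QuadraticRemainder.

Section Frobenius.
Variable R : realType.
Local Notation plane := (plane R).

Definition mx_derive p q (f : R -> 'M[R]_(p, q)) (t : R) (D : 'M[R]_(p, q)) :=
  forall i j, is_derive t 1 (fun s => f s i j) (D i j).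

Lemma mx_derive_mul p q r (f : R -> 'M[R]_(p, q)) (g : R -> 'M[R]_(q, r)) t D E :
  mx_derive f t D -> mx_derive g t E ->
  mx_derive (fun s => f s *m g s) t (D *m g t + f t *m E).
Proof.
move=> fD gE i j.
have -> : (fun s => (f s *m g s) i j) = \sum_l (fun s => f s i l * g s l j).
  by apply/funext => s; rewrite mxE fct_sumE.
rewrite !mxE -big_split/=; apply: is_derive_sum => l.
rewrite (_ : _ + _ = f t i l *: E l j + g t l j *: D i l); first exact: is_deriveM.
by rewrite [_ *: _]mulrC [_ *: D _ _]mulrC addrC mulrC; congr (_ + _); rewrite mulrC.
Qed.

Lemma mx_deriveD p q (f g : R -> 'M[R]_(p, q)) t D E :
  mx_derive f t D -> mx_derive g t E -> mx_derive (fun s => f s + g s) t (D + E).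
Proof.
move=> fD gE i j; rewrite mxE; under eq_fun do rewrite mxE.
exact: is_deriveD.
Qed.

Lemma mx_derive_cst p q (A : 'M[R]_(p, q)) t : mx_derive (fun=> A) t 0.
Proof. by move=> i j; rewrite mxE; exact: is_derive_cst. Qed.

Lemma mx_derive_idZ p q (f : R -> 'M[R]_(p, q)) (t : R) D :
  mx_derive f t D -> mx_derive (fun s => s *: f s) t (f t + t *: D).
Proof.
move=> fD i j; rewrite !mxE.
rewrite (_ : (fun s => _) = (fun s : R => id s * f s i j)); last first.
  by apply/funext => s; rewrite mxE.
rewrite (_ : _ + _ = t *: D i j + f t i j *: 1); first exact: is_deriveM.
by rewrite [f t i j *: 1]mulr1 addrC.
Qed.

Lemma mx_deriveZ p q (c : R) (f : R -> 'M[R]_(p, q)) (t : R) D :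
  mx_derive f t D -> mx_derive (fun s => c *: f s) t (c *: D).
Proof.
move=> fD i j; rewrite !mxE.
rewrite (_ : (fun s => _) = (fun s : R => c *: f s i j)); last first.
  by apply/funext => s; rewrite mxE.
exact: is_deriveZ.
Qed.

Lemma mx_derive_oppZ p q (A : 'M[R]_(p, q)) (t : R) :
  mx_derive (fun s => (- s) *: A) t (- A).
Proof.
move=> i j.
have H : is_derive t 1 (fun s : R => (- A i j) *: id s) ((- A i j) *: 1).
  exact: is_deriveZ.
rewrite [(- A i j) *: 1]mulr1 in H.
rewrite mxE (_ : (fun s => _) = (fun s : R => - A i j *: id s))//.
by apply/funext => s; rewrite mxE mulNr [RHS]mulNr mulrC.
Qed.

Lemma lin_entry p q (c d : R) (A B : 'M[R]_(p, q)) i j :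
  (c *: A + d *: B) i j = c * A i j + d * B i j.
Proof. by rewrite !mxE. Qed.

Lemma lin_sub p q (c d : R) (A B C D : 'M[R]_(p, q)) :
  c *: A + d *: B - (c *: C + d *: D) = c *: (A - C) + d *: (B - D).
Proof. by rewrite !scalerBr opprD addrACA. Qed.

Lemma mx_derive_line p q (f : plane -> 'M[R]_(p, q)) (a v : plane) t :
  (forall z, differentiable f z) ->
  mx_derive (fun s => f (a + s *: v)) t
    (v ord0 ord0 *: partial ord0 f (a + t *: v) + v ord0 ord_max *: partial ord_max f (a + t *: v)).
Proof.
move=> df i j.
have dfij := (differentiable_mxP f (a + t *: v)).1 (df _) i j.
have E k : partial k f (a + t *: v) i j = partial k (fun z => f z i j) (a + t *: v).
  exact: partial_mxE.
have key (g : R -> R) (c d x y : R) (A B : 'M[R]_(p, q)) : A i j = x -> B i j = y ->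
    is_derive t 1 g (c * x + d * y) -> is_derive t 1 g ((c *: A + d *: B) i j).
  by move=> <- <-; rewrite lin_entry.
apply: (key _ _ _ _ _ _ _ (E ord0) (E ord_max)).
have := is_derive_line dfij; rewrite derive_partial; last exact: dfij.
by apply.
Qed.

Lemma mx_MVT_bound p q (f df : R -> 'M[R]_(p, q)) (a b K x y : R) : 0 <= K ->
  (forall t : R, a < t < b -> mx_derive f t (df t)) -> (forall t, a < t < b -> `|df t| <= K) ->
  a < x < b -> a < y < b -> `|f y - f x| <= K * `|y - x|.
Proof.
move=> K0 fd dfK xab yab; apply: norm_mx_le => [|i j]; first by rewrite mulr_ge0.
rewrite !mxE; apply: (@MVT_bound R (fun s => f s i j) (fun s => df s i j) a b K) => //.
  by move=> t tab; exact: fd.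
by move=> t tab; exact: le_trans (norm_entry_le _ _ _) (dfK t tab).
Qed.

Lemma norm_lin_le p q (v : plane) (A B : 'M[R]_(p, q)) M : `|A| <= M -> `|B| <= M ->
  `|v ord0 ord0 *: A + v ord0 ord_max *: B| <= 2 * M * `|v|.
Proof.
move=> AM BM; apply: (le_trans (ler_normD _ _)); rewrite !normrZ.
have -> : 2 * M * `|v| = `|v| * M + `|v| * M by ring.
by apply: lerD; apply: ler_pM => //; exact: norm_entry_le.
Qed.

Lemma taylor1 p q (f : plane -> 'M[R]_(p, q)) (r M : R) : smooth f -> 0 <= M ->
  (forall i z, `|z| <= r -> `|partial i f z| <= M) ->
  forall z k, (forall s : R, -1 < s < 2 -> `|z + s *: k| <= r) ->
  `|f (z + k) - f z| <= 2 * M * `|k|.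
Proof.
move=> sf M0 fM z k zk.
have /= := @mx_MVT_bound p q (fun s => f (z + s *: k)) _ (-1) 2 (2 * M * `|k|) 0 1 _
  (fun t _ => @mx_derive_line p q f z k t (fun z => smooth_diff z sf)).
rewrite scale1r scale0r addr0 subr0 normr1 mulr1; apply.
- by rewrite !mulr_ge0.
- by move=> t /zk zt; apply: norm_lin_le; exact: fM.
- by rewrite ltrN10 ltr0n.
- by rewrite ltr1n (lt_trans (ltrN10 _)).
Qed.

(** The mean value inequality, with the derivative of the error bounded by
    [taylor1]. *)
Lemma taylor2 p q (f : plane -> 'M[R]_(p, q)) (r M : R) : smooth f -> 0 <= M ->
  (forall i j z, `|z| <= r -> `|partial i (partial j f) z| <= M) ->
  forall z k, (forall s : R, -1 < s < 2 -> `|z + s *: k| <= r) ->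
  `|f (z + k) - f z - (k ord0 ord0 *: partial ord0 f z + k ord0 ord_max *: partial ord_max f z)|
     <= 8 * M * `|k| ^+ 2.
Proof.
move=> sf M0 fM z k zk.
have sp j := smooth_partial j sf.
pose D t := k ord0 ord0 *: partial ord0 f (z + t *: k) + k ord0 ord_max *: partial ord_max f (z + t *: k).
have bound : forall t, -1 < t < 2 -> `|D t - D 0| <= 8 * M * `|k| ^+ 2.
  move=> t t12.
  have dp j : `|partial j f (z + t *: k) - partial j f z| <= 4 * M * `|k|.
    have /= := @mx_MVT_bound p q (fun s => partial j f (z + s *: k)) _ (-1) 2 (2 * M * `|k|) 0 t _
       (fun t _ => @mx_derive_line p q (partial j f) z k t (fun z => smooth_diff z (sp j))).
    rewrite scale0r addr0 subr0 => H.
    apply: (le_trans (H _ _ _ _)) => //.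
    - by rewrite !mulr_ge0.
    - by move=> s /zk zs; apply: norm_lin_le; exact: fM.
    - by rewrite ltrN10 ltr0n.
    - have -> : 4 * M * `|k| = 2 * M * `|k| * 2 by ring.
      rewrite ler_wpM2l ?mulr_ge0//; move: t12 => /andP[? ?].
      by rewrite ler_norml; apply/andP; split; lra.
  rewrite /D scale0r addr0.
  apply: (le_trans (eq_ind_r (fun x => `|x| <= _) (lexx _) (lin_sub _ _ _ _ _ _))).
  apply: (le_trans (norm_lin_le _ (dp _) (dp _))).
  by have -> : 2 * (4 * M * `|k|) * `|k| = 8 * M * `|k| ^+ 2 by ring.
have := @mx_MVT_bound _ _ (fun s => f (z + s *: k) + (- s) *: D 0) (fun s => D s - D 0) (-1) 2
   (8 * M * `|k| ^+ 2) 0 1; cbv beta.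
rewrite scale1r oppr0 !scale0r !addr0 normr1 mulr1 scaleN1r.
rewrite addrAC (_ : k ord0 ord0 *: _ + _ = D 0); last by rewrite /D scale0r addr0.
apply.
- by rewrite !mulr_ge0.
- move=> t _; apply: mx_deriveD; first by apply: mx_derive_line => w; exact: smooth_diff.
  exact: mx_derive_oppZ.
- exact: bound.
- by rewrite ltrN10 ltr0n.
- by rewrite ltr1n (lt_trans (ltrN10 _)).
Qed.

End Frobenius.

(** * The Frobenius theorem *)

Section FrobeniusTheorem.
Variable R : realType.
Local Notation plane := (plane R).

(** Along the ray through m, the candidate Y_m(t) (1 + t w(h)) for the
    solution along the neighbouring ray through m + h fails to satisfy its
    equation by this residual. The flatness of w cancels the terms of first
    order in h: what is left is of second order. *)
Lemma residual n (t m0 m1 h0 h1 c0 c1 : R) (A0 A1 D00 D01 D10 D11 B0 B1 : 'M[R]_n) :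
  c0 = m0 + h0 -> c1 = m1 + h1 ->
  D01 - D10 + (A0 *m A1 - A1 *m A0) = 0 ->
  let rho0 := B0 - A0 - ((t * h0) *: D00 + (t * h1) *: D10) in
  let rho1 := B1 - A1 - ((t * h0) *: D01 + (t * h1) *: D11) in
  let a := m0 *: A0 + m1 *: A1 in
  let a' := c0 *: B0 + c1 *: B1 in
  let th := t *: (h0 *: A0 + h1 *: A1) in
  let th' := (h0 *: A0 + h1 *: A1) +
             t *: (h0 *: (m0 *: D00 + m1 *: D10) + h1 *: (m0 *: D01 + m1 *: D11)) in
  a *m (1%:M + th) + th' - (1%:M + th) *m a' =
  - ((h0 *: ((t * h0) *: D00 + (t * h1) *: D10) + h1 *: ((t * h0) *: D01 + (t * h1) *: D11))
     + (c0 *: rho0 + c1 *: rho1)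
     + th *m ((h0 *: A0 + h1 *: A1) + (c0 *: (B0 - A0) + c1 *: (B1 - A1)))).
Proof.
move=> -> -> flat rho0 rho1 a a' th th'.
have D01E : D01 = D10 - (A0 *m A1 - A1 *m A0).
  by move/eqP: flat; rewrite addr_eq0 subr_eq addrC => /eqP.
have -> : (h0 *: A0 + h1 *: A1) + ((m0 + h0) *: (B0 - A0) + (m1 + h1) *: (B1 - A1)) = a' - a.
  by rewrite /a' /a; apply/matrixP => i j; rewrite !mxE; ring.
have comm : a *m th - th *m a = (t * (m0 * h1 - m1 * h0)) *: (A0 *m A1 - A1 *m A0).
  rewrite /a /th -scalemxAr -scalemxAl !mulmxDl !mulmxDr -!scalemxAl -!scalemxAr.
  move: (A0 *m A0) (A1 *m A1) (A0 *m A1) (A1 *m A0) => X Y Z W.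
  by apply/matrixP => i j; rewrite !mxE; ring.
rewrite mulmxDr mulmx1 mulmxDl mul1mx mulmxBr.
have -> : a *m th = th *m a + (t * (m0 * h1 - m1 * h0)) *: (A0 *m A1 - A1 *m A0).
  by rewrite -comm addrC subrK.
move: (th *m a) (th *m a') => X Y.
rewrite /th' /rho0 /rho1 /a /a' D01E.
move: (A0 *m A1 - A1 *m A0) => Z.
by apply/matrixP => i j; rewrite !mxE; ring.
Qed.

Lemma residual_bound n (t L M eta : R) (m h : plane) (A0 A1 D00 D01 D10 D11 B0 B1 : 'M[R]_n) :
  let rho0 := B0 - A0 - ((t * h ord0 ord0) *: D00 + (t * h ord0 ord_max) *: D10) in
  let rho1 := B1 - A1 - ((t * h ord0 ord0) *: D01 + (t * h ord0 ord_max) *: D11) in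
  `|t| <= 2 -> `|m + h| <= L -> `|A0| <= M -> `|A1| <= M ->
  `|D00| <= M -> `|D01| <= M -> `|D10| <= M -> `|D11| <= M ->
  `|B0 - A0| <= 4 * M * `|h| -> `|B1 - A1| <= 4 * M * `|h| ->
  `|rho0| <= 32 * M * `|h| ^+ 2 -> `|rho1| <= 32 * M * `|h| ^+ 2 ->
  `|- ((h ord0 ord0 *: ((t * h ord0 ord0) *: D00 + (t * h ord0 ord_max) *: D10)
      + h ord0 ord_max *: ((t * h ord0 ord0) *: D01 + (t * h ord0 ord_max) *: D11))
     + (((m + h) ord0 ord0) *: rho0 + ((m + h) ord0 ord_max) *: rho1)
     + (t *: (h ord0 ord0 *: A0 + h ord0 ord_max *: A1)) *m
       ((h ord0 ord0 *: A0 + h ord0 ord_max *: A1)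
        + (((m + h) ord0 ord0) *: (B0 - A0) + ((m + h) ord0 ord_max) *: (B1 - A1))))|
  <= (8 * M + 64 * M * L + n%:R * (4 * M) * (2 * M + 8 * M * L)) * `|h| ^+ 2.
Proof.
move=> rho0 rho1 t2 mL A0M A1M D00M D01M D10M D11M BA0 BA1 r0 r1.
have M0 : 0 <= M by apply: le_trans A0M.
have L0 : 0 <= L by apply: le_trans mL.
have hD (X Y : 'M[R]_n) : `|X| <= M -> `|Y| <= M ->
    `|(t * h ord0 ord0) *: X + (t * h ord0 ord_max) *: Y| <= 4 * M * `|h|.
  move=> XM YM; rewrite -!scalerA -scalerDr normrZ.
  have -> : 4 * M * `|h| = 2 * (2 * M * `|h|) by ring.
  by apply: ler_pM => //; exact: norm_lin_le.
have hA : `|h ord0 ord0 *: A0 + h ord0 ord_max *: A1| <= 2 * M * `|h| by exact: norm_lin_le.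
rewrite normrN.
have -> : (8 * M + 64 * M * L + n%:R * (4 * M) * (2 * M + 8 * M * L)) * `|h| ^+ 2 =
  2 * (4 * M * `|h|) * `|h| + 2 * (32 * M * `|h| ^+ 2) * L
  + n%:R * (2 * (2 * M * `|h|)) * (2 * M * `|h| + 2 * (4 * M * `|h|) * L) by ring.
apply: (le_trans (ler_normD _ _)); apply: lerD.
  apply: (le_trans (ler_normD _ _)); apply: lerD.
    by apply: norm_lin_le; exact: hD.
  apply: (le_trans (norm_lin_le _ r0 r1)); apply: ler_wpM2l => //.
  by rewrite !mulr_ge0.
apply: (le_trans (norm_mulmx_le _ _)); apply: ler_pM => //.
  by rewrite ler_wpM2l// normrZ; exact: ler_pM.
apply: (le_trans (ler_normD _ _)); apply: lerD => //.
apply: (le_trans (norm_lin_le _ BA0 BA1)); apply: ler_wpM2l => //.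
by rewrite !mulr_ge0.
Qed.

Variables (n : nat) (w : 'I_2 -> plane -> 'M[R]_n).
Hypothesis sw : forall j, smooth (w j).
Hypothesis flat : forall m, partial ord0 (w ord_max) m - partial ord_max (w ord0) m
  + (w ord0 m *m w ord_max m - w ord_max m *m w ord0 m) = 0.

Let lin (z v : plane) := v ord0 ord0 *: w ord0 z + v ord0 ord_max *: w ord_max z.
Let a (m : plane) (t : R) := lin (0 + t *: m) m.

Let radial_spec (m : plane) (YV : (R -> 'M[R]_n) * (R -> 'M[R]_n)) :=
  [/\ YV.1 0 = 1%:M, YV.2 0 = 1%:M,
    forall t : R, -1 < t < 2 -> mx_derive YV.1 t (YV.1 t *m a m t),
    forall t : R, -1 < t < 2 -> mx_derive YV.2 t (- (a m t *m YV.2 t)) &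
    forall C, (forall t, -1 < t < 2 -> `|a m t| <= C) ->
      forall t, -1 < t < 2 -> `|YV.1 t| <= expR (4 * (n%:R * C)) /\
                              `|YV.2 t| <= expR (4 * (n%:R * C))].

Lemma ord2_cases (j : 'I_2) : j = ord0 \/ j = ord_max.
Proof. by case: j => -[|[|//]] ?; [left|right]; exact: val_inj. Qed.

Lemma ord2_ind (P : 'I_2 -> Prop) : P ord0 -> P ord_max -> forall j, P j.
Proof. by move=> P0 P1 j; have [->|->] := ord2_cases j. Qed.

Lemma abs_lt2 (t : R) : -1 < t < 2 -> `|t| <= 2.
Proof. by move=> /andP[? ?]; rewrite ler_norml; apply/andP; split; lra. Qed.

Lemma radial_bound (m : plane) M : (forall j z, `|z| <= 2 * `|m| -> `|w j z| <= M) ->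
  forall t, -1 < t < 2 -> `|a m t| <= 2 * M * `|m|.
Proof.
move=> wM t t12; have tm : `|0 + t *: m| <= 2 * `|m|.
  by rewrite add0r normrZ ler_wpM2r// abs_lt2.
by apply: norm_lin_le; exact: wM.
Qed.

Lemma radial_exists (m : plane) : exists YV, radial_spec m YV.
Proof.
have [M0 _ H0] := bounded_on_ball (2 * `|m|) (smooth_continuous (sw ord0)).
have [M1 _ H1] := bounded_on_ball (2 * `|m|) (smooth_continuous (sw ord_max)).
have wM j z : `|z| <= 2 * `|m| -> `|w j z| <= Num.max M0 M1.
  move=> zm; have [->|->] : j = ord0 \/ j = ord_max by exact: ord2_cases.
  - by rewrite le_max H0.
  - by rewrite le_max H1// orbT.
have aM := radial_bound wM.
have ca i j : continuous (fun t => a m t i j).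
  apply/(@continuous_mxP R R n n (a m)).1 => t.
  have cl : continuous (fun t : R => 0 + t *: m).
    by move=> s; apply: cvgD; [exact: cvg_cst|apply: cvgZr_tmp; exact: cvg_id].
  rewrite /a /lin; apply: cvgD; apply: cvgZl_tmp.
    by apply: (continuous_comp (cl t)); exact: (smooth_continuous (sw ord0)).
  by apply: (continuous_comp (cl t)); exact: (smooth_continuous (sw ord_max)).
have [Y [V [Y0 V0 dY dV bYV]]] := linear_ode_inverse ca
  (fun t i j t12 => le_trans (norm_entry_le (a m t) i j) (aM t t12)).
exists (Y, V); split=> //=.
- by move=> t t12 i j; exact: dY.
- by move=> t t12 i j; rewrite mxE; exact: dV.
move=> C aC t t12.
have H i j := bYV C (fun t i j t12 => le_trans (norm_entry_le (a m t) i j) (aC t t12)) t i j t12.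
by split; apply: norm_mx_le => [|i j]; rewrite ?expR_ge0//; have [] := H i j.
Qed.

Let YV m := projT1 (cid (radial_exists m)).
Let Y m := (YV m).1.
Let V m := (YV m).2.

Lemma radialP m : radial_spec m (Y m, V m).
Proof. by rewrite /Y /V /YV; case: cid => -[]. Qed.

Lemma in01 (x : R) : 0 <= x <= 1 -> -1 < x < 2.
Proof. by move=> /andP[? ?]; apply/andP; split; lra. Qed.

Lemma radial_inverse m (t : R) : -1 < t < 2 -> Y m t *m V m t = 1%:M.
Proof.
move=> t12; have [/= Y0 V0 dY dV _] := radialP m.
have N0 : -1 < (0 : R) < 2 by apply: in01; rewrite lexx ler01.
have : `|Y m t *m V m t - Y m 0 *m V m 0| <= 0 * `|t - 0|.
  apply: (@mx_MVT_bound _ _ _ (fun s => Y m s *m V m s) (fun=> 0) (-1) 2) => //.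
    move=> s s12; have := mx_derive_mul (dY s s12) (dV s s12).
    by rewrite mulmxN -mulmxA subrr.
  by move=> s _; rewrite normr0.
by rewrite Y0 V0 mulmx1 mul0r normr_le0 subr_eq0 => /eqP.
Qed.

Definition radial_solution m := Y m 1.

(** Compare Y_(m+h) with Y_m U, where U(t) = 1 + t w_(tm)(h). The derivative
    of Y_m U V_(m+h), with V the inverse of Y, is of order h^2 by
    [residual], so the value at time 1 differs from the value 1 at time 0 by
    O(h^2). *)
Lemma radial_remainder (m : plane) : exists K : R, forall h : plane, `|h| <= 1 ->
  `|radial_solution (m + h) - radial_solution m
    - (h ord0 ord0 *: (radial_solution m *m w ord0 m)
       + h ord0 ord_max *: (radial_solution m *m w ord_max m))| <= K * `|h| ^+ 2.
Proof.
pose r := 2 * `|m| + 4.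
pose L := `|m| + 1.
have bnd (f : plane -> 'M[R]_n) : smooth f -> exists2 B, 0 <= B & forall z, `|z| <= r -> `|f z| <= B.
  by move=> /smooth_continuous; exact: bounded_on_ball.
have ex2 (P : 'I_2 -> plane -> 'M[R]_n) : (forall j, smooth (P j)) ->
    exists2 B, 0 <= B & forall j z, `|z| <= r -> `|P j z| <= B.
  move=> sP; have [B0 B00 H0] := bnd _ (sP ord0); have [B1 B10 H1] := bnd _ (sP ord_max).
  exists (B0 + B1); first by rewrite addr_ge0.
  move=> j z zr; have [->|->] : j = ord0 \/ j = ord_max by exact: ord2_cases.
  - by apply: (le_trans (H0 z zr)); rewrite lerDl.
  - by apply: (le_trans (H1 z zr)); rewrite lerDr.
have sp i j := smooth_partial i (sw j).
have spp i j k := smooth_partial i (sp j k).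
have [B1 B10 H1] := ex2 _ sw.
have [B2 B20 H2] := ex2 _ (sp ord0).
have [B3 B30 H3] := ex2 _ (sp ord_max).
have [B4 B40 H4] := ex2 _ (spp ord0 ord0).
have [B5 B50 H5] := ex2 _ (spp ord0 ord_max).
have [B6 B60 H6] := ex2 _ (spp ord_max ord0).
have [B7 B70 H7] := ex2 _ (spp ord_max ord_max).
pose M := B1 + B2 + B3 + B4 + B5 + B6 + B7.
have M0 : 0 <= M by rewrite /M; lra.
have wM j z : `|z| <= r -> `|w j z| <= M.
  by move=> /(H1 j) /le_trans; apply; rewrite /M; lra.
have dwM i j z : `|z| <= r -> `|partial i (w j) z| <= M.
  move=> zr; move: i; apply: ord2_ind.
    by apply: (le_trans (H2 j z zr)); rewrite /M; lra.
  by apply: (le_trans (H3 j z zr)); rewrite /M; lra.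
have ddwM i k j z : `|z| <= r -> `|partial i (partial k (w j)) z| <= M.
  move=> zr; move: i k; apply: ord2_ind; apply: ord2_ind.
  - by apply: (le_trans (H4 j z zr)); rewrite /M; lra.
  - by apply: (le_trans (H5 j z zr)); rewrite /M; lra.
  - by apply: (le_trans (H6 j z zr)); rewrite /M; lra.
  - by apply: (le_trans (H7 j z zr)); rewrite /M; lra.
clearbody M; clear H1 H2 H3 H4 H5 H6 H7.
pose E := expR (4 * (n%:R * (2 * M * L))).
have L0 : 0 <= L by rewrite addr_ge0.
have YVE (k : plane) : `|k| <= L -> forall t, -1 < t < 2 -> `|Y k t| <= E /\ `|V k t| <= E.
  move=> kL; have [/= _ _ _ _ H] := radialP k; apply: H => t t12.
  apply: (le_trans (@radial_bound k M _ t t12)); last by rewrite ler_wpM2l// mulr_ge0.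
  move=> j z zk; apply: wM; apply: (le_trans zk); rewrite /r.
  by have := kL; rewrite /L; lra.
pose K := 8 * M + 64 * M * L + n%:R * (4 * M) * (2 * M + 8 * M * L).
pose K' := n%:R * (n%:R * E * K) * E.
exists (n%:R * K' * E) => h h1.
have mhL : `|m + h| <= L by rewrite (le_trans (ler_normD _ _))// lerD2l.
have mL : `|m| <= L by rewrite lerDl.
have K0 : 0 <= K by rewrite /K !addr_ge0 ?mulr_ge0 ?addr_ge0 ?mulr_ge0.
have E0 : 0 <= E by exact: expR_ge0.
have [/= Y0 _ dY _ _] := radialP m.
have [/= _ V0 _ dV _] := radialP (m + h).
(* U is the first-order variation of the radial solution in the direction h. *)
pose U t := (1%:M : 'M[R]_n) + t *: lin (0 + t *: m) h.
pose dlin t := h ord0 ord0 *: (m ord0 ord0 *: partial ord0 (w ord0) (0 + t *: m)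
      + m ord0 ord_max *: partial ord_max (w ord0) (0 + t *: m))
  + h ord0 ord_max *: (m ord0 ord0 *: partial ord0 (w ord_max) (0 + t *: m)
      + m ord0 ord_max *: partial ord_max (w ord_max) (0 + t *: m)).
have dU t : mx_derive U t (lin (0 + t *: m) h + t *: dlin t).
  rewrite -[X in mx_derive _ _ X]add0r.
  apply: mx_deriveD; first exact: mx_derive_cst.
  apply: mx_derive_idZ; apply: mx_deriveD; apply: mx_deriveZ;
  apply: mx_derive_line => z; exact: smooth_diff.
pose rr t := a m t *m U t + (lin (0 + t *: m) h + t *: dlin t) - U t *m a (m + h) t.
have rrK t : -1 < t < 2 -> `|rr t| <= K * `|h| ^+ 2.
  move=> t12.
  have t2 := abs_lt2 t12.
  have tm : `|0 + t *: m| <= r.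
    rewrite add0r normrZ /r; have : `|t| * `|m| <= 2 * `|m| by rewrite ler_wpM2r.
    lra.
  have thh : `|t *: h| <= 2 * `|h| by rewrite normrZ ler_wpM2r.
  have seg (s : R) : -1 < s < 2 -> `|(0 + t *: m) + s *: (t *: h)| <= r.
    move=> /abs_lt2 s2; apply: (le_trans (ler_normD _ _)); rewrite /r; apply: lerD.
      by rewrite add0r normrZ ler_wpM2r.
    rewrite normrZ (le_trans (ler_pM _ _ s2 thh))//; lra.
  have zE : 0 + t *: (m + h) = (0 + t *: m) + t *: h by rewrite !add0r scalerDr.
  have rho j : `|w j (0 + t *: (m + h)) - w j (0 + t *: m)
     - ((t * h ord0 ord0) *: partial ord0 (w j) (0 + t *: m)
        + (t * h ord0 ord_max) *: partial ord_max (w j) (0 + t *: m))| <= 32 * M * `|h| ^+ 2.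
    have e k : t * h ord0 k = (t *: h) ord0 k by rewrite mxE.
    rewrite zE !e; apply: (le_trans (taylor2 (sw j) M0 (fun i k z => @ddwM i k j z) seg)).
    have -> : 32 * M * `|h| ^+ 2 = 8 * M * (2 * `|h|) ^+ 2 by ring.
    by rewrite ler_wpM2l ?mulr_ge0// lerXn2r ?nnegrE// mulr_ge0.
  have BA j : `|w j (0 + t *: (m + h)) - w j (0 + t *: m)| <= 4 * M * `|h|.
    rewrite zE; apply: (le_trans (taylor1 (sw j) M0 (fun i z => @dwM i j z) seg)).
    have -> : 4 * M * `|h| = 2 * M * (2 * `|h|) by ring.
    by rewrite ler_wpM2l ?mulr_ge0.
  have mhE k : (m + h) ord0 k = m ord0 k + h ord0 k by rewrite mxE.
  have rrE := residual t (partial ord0 (w ord0) (0 + t *: m))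
    (partial ord_max (w ord_max) (0 + t *: m)) (w ord0 (0 + t *: (m + h)))
    (w ord_max (0 + t *: (m + h))) (mhE ord0) (mhE ord_max) (flat (0 + t *: m)).
  rewrite /= in rrE; rewrite /rr /U /a /lin /dlin rrE.
  apply: residual_bound => //; try exact: wM; try exact: dwM; try exact: BA; exact: rho.
pose W t := Y m t *m U t *m V (m + h) t.
pose W' t := Y m t *m rr t *m V (m + h) t.
have dW t : -1 < t < 2 -> mx_derive W t (W' t).
  move=> t12.
  have := mx_derive_mul (mx_derive_mul (dY t t12) (dU t)) (dV t t12).
  have gen (P Q S D T X : 'M[R]_n) :
      (P *m Q *m S + P *m D) *m T + P *m S *m (- (X *m T)) = P *m (Q *m S + D - S *m X) *m T.
    by rewrite mulmxN mulmxBr mulmxBl mulmxDr !mulmxA.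
  by rewrite gen.
have WK t : -1 < t < 2 -> `|W' t| <= K' * `|h| ^+ 2.
  move=> t12; have [YE _] := YVE m mL t t12; have [_ VE] := YVE _ mhL t t12.
  rewrite /W'; apply: (le_trans (norm_mulmx_le _ _)).
  have -> : K' * `|h| ^+ 2 = n%:R * (n%:R * E * (K * `|h| ^+ 2)) * E by rewrite /K'; ring.
  apply: ler_pM => //.
  rewrite ler_wpM2l//; apply: (le_trans (norm_mulmx_le _ _)).
  by apply: ler_pM => //; [rewrite ler_wpM2l|exact: rrK].
(* W is constant up to second order in h, and W 0 = 1. *)
have W1 : `|W 1 - W 0| <= K' * `|h| ^+ 2.
  have -> : K' * `|h| ^+ 2 = K' * `|h| ^+ 2 * `|1 - 0 : R| by rewrite subr0 normr1 mulr1.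
  apply: (mx_MVT_bound (a := -1) (b := 2) _ dW WK); rewrite ?in01 ?lexx ?ler01//.
  by rewrite /K' !mulr_ge0.
have N1 : -1 < (1 : R) < 2 by apply: in01; rewrite lexx ler01.
have VY : V (m + h) 1 *m Y (m + h) 1 = 1%:M by apply: mulmx1C; exact: radial_inverse.
have W0 : W 0 = 1%:M by rewrite /W Y0 V0 /U scale0r addr0 !mulmx1.
have [YE _] := YVE _ mhL 1 N1.
have -> : radial_solution (m + h) - radial_solution m
    - (h ord0 ord0 *: (radial_solution m *m w ord0 m)
       + h ord0 ord_max *: (radial_solution m *m w ord_max m)) = (W 0 - W 1) *m Y (m + h) 1.
  rewrite W0 mulmxBl mul1mx /W -[Y m 1 *m U 1 *m V _ _ *m _]mulmxA VY mulmx1 /U scale1r.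
  rewrite /lin add0r scale1r mulmxDr mulmx1 mulmxDr -!scalemxAr.
  by rewrite [in RHS]opprD addrA.
apply: (le_trans (norm_mulmx_le _ _)).
have -> : n%:R * K' * E * `|h| ^+ 2 = n%:R * (K' * `|h| ^+ 2) * E by ring.
apply: ler_pM => //.
by rewrite ler_wpM2l// distrC.
Qed.

Lemma radial_solution_differentiable m : differentiable radial_solution m.
Proof.
have [K HK] := radial_remainder m.
apply/differentiable_mxP => i j.
have [] // := @diff_of_quadratic_remainder R (fun z => radial_solution z i j) m
  ((radial_solution m *m w ord0 m) i j) ((radial_solution m *m w ord_max m) i j) K.
move=> h /HK; apply: le_trans; apply: le_trans (norm_entry_le _ i j).
by rewrite !mxE.
Qed.

Lemma partial_radial_solution j m : partial j radial_solution m = radial_solution m *m w j m.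
Proof.
have [K HK] := radial_remainder m.
apply/matrixP => i k; rewrite partial_mxE; last exact: radial_solution_differentiable.
have [|_ P0 P1] := @diff_of_quadratic_remainder R (fun z => radial_solution z i k) m
  ((radial_solution m *m w ord0 m) i k) ((radial_solution m *m w ord_max m) i k) K.
  move=> h /HK; apply: le_trans; apply: le_trans (norm_entry_le _ i k).
  by rewrite !mxE.
by move: j; apply: ord2_ind.
Qed.

Lemma radial_solution0 : radial_solution 0 = 1%:M.
Proof.
have [/= Y0 _ dY _ _] := radialP 0.
have : `|Y 0 1 - Y 0 0| <= 0 * `|1 - 0 : R|.
  apply: (@mx_MVT_bound _ _ _ (Y 0) (fun=> 0) (-1) 2); rewrite ?in01 ?lexx ?ler01//.
    move=> t /dY; rewrite (_ : a 0 t = 0) ?mulmx0//.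
    by rewrite /a /lin !mxE !scale0r addr0.
  by move=> t _; rewrite normr0.
by rewrite Y0 mul0r normr_le0 subr_eq0 => /eqP.
Qed.

End FrobeniusTheorem.

Section FrobeniusCorollaries.
Variable R : realType.
Local Notation plane := (plane R).

(** The derivatives of F are polynomial in F and w, so regularity bootstraps
    from differentiability. *)
Lemma smooth_of_linear_system n p (w : 'I_2 -> plane -> 'M[R]_n) (F : plane -> 'M[R]_(p, n)) :
  (forall j, smooth (w j)) -> (forall m, differentiable F m) ->
  (forall j m, partial j F m = F m *m w j m) -> smooth F.
Proof.
move=> sw dF pF.
have E j : partial j F = fun m => F m *m w j m by apply/funext => m; exact: pF.
elim=> [|k IH] /=; first by move=> m; exact: differentiable_continuous.
by split=> // j; rewrite E; apply: class_C_mulmx => //; exact: sw.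
Qed.

(** The solution is radial: F(m) is the value at time 1 of the solution of
    Y' = Y w(t m)(m) starting from 1. Flatness of w makes its differential
    equal to F w ([radial_remainder]). *)
Theorem frobenius n (w : 'I_2 -> plane -> 'M[R]_n) : (forall j, smooth (w j)) ->
  (forall m, partial ord0 (w ord_max) m - partial ord_max (w ord0) m
    + (w ord0 m *m w ord_max m - w ord_max m *m w ord0 m) = 0) ->
  exists F : plane -> 'M[R]_n, [/\ smooth F, F 0 = 1%:M,
    forall j m, partial j F m = F m *m w j m & forall m, F m \in unitmx].
Proof.
move=> sw flat; exists (radial_solution sw); split.
- apply: (smooth_of_linear_system sw).
    exact: radial_solution_differentiable.
  exact: partial_radial_solution.
- exact: radial_solution0.
- exact: partial_radial_solution.
- move=> m.
  have N1 : -1 < (1 : R) < 2 by apply: in01; rewrite lexx ler01.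
  by have /mulmx1_unit[] := @radial_inverse R n w sw m 1 N1.
Qed.

End FrobeniusCorollaries.

(** * The cross product of imaginary octonions and its derivations *)

Ltac eval_coef := repeat match goal with |- context [oct_cyclic ?i ?j ?k] =>
  let b := eval vm_compute in (oct_cyclic i j k) in change (oct_cyclic i j k) with b end.

Section Cross.
Variable R : realType.
Local Notation vec := 'cV[R]_7.

Definition dot (u v : vec) : R := (u^T *m v) ord0 ord0.

Definition cross (u v : vec) : vec :=
  \col_k \sum_(i < 7) \sum_(j < 7) oct_coef R i.+1 j.+1 k.+1 * u i ord0 * v j ord0.

Definition co (u : vec) (n : nat) : R := u (inord n) ord0.

Lemma sum7 (V : nmodType) (F : 'I_7 -> V) : \sum_i F i =
  F (inord 0) + (F (inord 1) + (F (inord 2) + (F (inord 3) + (F (inord 4) + (F (inord 5) + F (inord 6)))))).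
Proof.
rewrite !big_ord_recl big_ord0 addr0.
by do !congr (_ + _); congr (F _); apply: val_inj; rewrite /= inordK.
Qed.

Lemma ord7_ind (P : 'I_7 -> Prop) : P (inord 0) -> P (inord 1) -> P (inord 2) ->
  P (inord 3) -> P (inord 4) -> P (inord 5) -> P (inord 6) -> forall i, P i.
Proof.
move=> P0 P1 P2 P3 P4 P5 P6 i; rewrite -(inord_val i).
by case: i => -[|[|[|[|[|[|[|//]]]]]]].
Qed.

Lemma co_eq (u v : vec) : co u 0 = co v 0 -> co u 1 = co v 1 -> co u 2 = co v 2 ->
  co u 3 = co v 3 -> co u 4 = co v 4 -> co u 5 = co v 5 -> co u 6 = co v 6 -> u = v.
Proof.
by move=> ? ? ? ? ? ? ?; apply/colP; apply: ord7_ind.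
Qed.

Lemma coD u v n : co (u + v) n = co u n + co v n. Proof. by rewrite /co mxE. Qed.
Lemma coN u n : co (- u) n = - co u n. Proof. by rewrite /co mxE. Qed.
Lemma coZ a u n : co (a *: u) n = a * co u n. Proof. by rewrite /co mxE. Qed.
Lemma co0 n : co 0 n = 0. Proof. by rewrite /co mxE. Qed.

Lemma dotE u v : dot u v = co u 0 * co v 0 + (co u 1 * co v 1 + (co u 2 * co v 2 +
  (co u 3 * co v 3 + (co u 4 * co v 4 + (co u 5 * co v 5 + co u 6 * co v 6))))).
Proof. by rewrite /dot mxE sum7 !mxE. Qed.

Ltac cross_coord := rewrite /co mxE sum7 !sum7 !inordK // /oct_coef /=; eval_coef; rewrite /=; ring.

Lemma crossE0 u v : co (cross u v) 0 =
  (co u 4 * co v 1 - co u 1 * co v 4) + (co u 5 * co v 2 - co u 2 * co v 5) + (co u 6 * co v 3 - co u 3 * co v 6).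
Proof. cross_coord. Qed.

Lemma crossE1 u v : co (cross u v) 1 =
  (co u 0 * co v 4 - co u 4 * co v 0) + (co u 6 * co v 2 - co u 2 * co v 6) + (co u 3 * co v 5 - co u 5 * co v 3).
Proof. cross_coord. Qed.

Lemma crossE2 u v : co (cross u v) 2 =
  (co u 0 * co v 5 - co u 5 * co v 0) + (co u 1 * co v 6 - co u 6 * co v 1) + (co u 4 * co v 3 - co u 3 * co v 4).
Proof. cross_coord. Qed.

Lemma crossE3 u v : co (cross u v) 3 =
  (co u 0 * co v 6 - co u 6 * co v 0) + (co u 5 * co v 1 - co u 1 * co v 5) + (co u 2 * co v 4 - co u 4 * co v 2).
Proof. cross_coord. Qed.

Lemma crossE4 u v : co (cross u v) 4 =
  (co u 1 * co v 0 - co u 0 * co v 1) + (co u 3 * co v 2 - co u 2 * co v 3) + (co u 5 * co v 6 - co u 6 * co v 5).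
Proof. cross_coord. Qed.

Lemma crossE5 u v : co (cross u v) 5 =
  (co u 2 * co v 0 - co u 0 * co v 2) + (co u 1 * co v 3 - co u 3 * co v 1) + (co u 6 * co v 4 - co u 4 * co v 6).
Proof. cross_coord. Qed.

Lemma crossE6 u v : co (cross u v) 6 =
  (co u 3 * co v 0 - co u 0 * co v 3) + (co u 2 * co v 1 - co u 1 * co v 2) + (co u 4 * co v 5 - co u 5 * co v 4).
Proof. cross_coord. Qed.

Definition crossE := (crossE0, crossE1, crossE2, crossE3, crossE4, crossE5, crossE6).
Definition coE := (coD, coN, coZ, co0).

Lemma crossDl u v w : cross (u + v) w = cross u w + cross v w.
Proof. by apply: co_eq; rewrite !(coE, crossE); ring. Qed.
Lemma crossDr u v w : cross w (u + v) = cross w u + cross w v.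
Proof. by apply: co_eq; rewrite !(coE, crossE); ring. Qed.
Lemma crossZl a u v : cross (a *: u) v = a *: cross u v.
Proof. by apply: co_eq; rewrite !(coE, crossE); ring. Qed.
Lemma crossZr a u v : cross u (a *: v) = a *: cross u v.
Proof. by apply: co_eq; rewrite !(coE, crossE); ring. Qed.
Lemma crossC u v : cross v u = - cross u v.
Proof. by apply: co_eq; rewrite !(coE, crossE); ring. Qed.
Lemma cross_dot u v w : dot (cross u v) w = dot u (cross v w).
Proof. by rewrite !dotE !crossE; ring. Qed.

(** The polarisation of u x (u x w) = (u.w) u - (u.u) w, which expresses
    that the octonions are alternative. *)
Lemma cross_cross u v w : cross u (cross v w) + cross v (cross u w) =
  - (2 * dot u v) *: w + dot u w *: v + dot v w *: u.
Proof. by apply: co_eq; rewrite !(coE, crossE) !dotE; ring. Qed.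
Lemma crossvv u : cross u u = 0.
Proof. by apply: co_eq; rewrite !(coE, crossE); ring. Qed.

Lemma dotC u v : dot u v = dot v u. Proof. by rewrite !dotE; ring. Qed.
Lemma dotDl u v w : dot (u + v) w = dot u w + dot v w.
Proof. by rewrite !dotE !coE; ring. Qed.
Lemma dotZl a u w : dot (a *: u) w = a * dot u w.
Proof. by rewrite !dotE !coE; ring. Qed.
Lemma dotNl u w : dot (- u) w = - dot u w.
Proof. by rewrite !dotE !coE; ring. Qed.
Lemma dot_ge0 u : 0 <= dot u u.
Proof. by rewrite dotE; rewrite -!expr2 !addr_ge0// sqr_ge0. Qed.
Lemma dot_eq0 u : dot u u = 0 -> u = 0.
Proof.
rewrite dotE -!expr2 => /eqP.
rewrite paddr_eq0 ?sqr_ge0 ?addr_ge0 ?sqr_ge0// sqrf_eq0 => /andP[/eqP e0].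
do 5 ![rewrite paddr_eq0 ?sqr_ge0 ?addr_ge0 ?sqr_ge0// sqrf_eq0 => /andP[/eqP ?]].
by rewrite sqrf_eq0 => /eqP ?; apply: co_eq; rewrite co0.
Qed.

Definition en (D : 'M[R]_7) (i j : nat) : R := D (inord i) (inord j).

Lemma en_eq (D E : 'M[R]_7) : (forall i j, (i < 7)%N -> (j < 7)%N -> en D i j = en E i j) -> D = E.
Proof.
move=> DE; apply/matrixP => i j; rewrite -(inord_val i) -(inord_val j).
exact: DE.
Qed.

Lemma co_mul D u n : co (D *m u) n = en D n 0 * co u 0 + (en D n 1 * co u 1 + (en D n 2 * co u 2 +
  (en D n 3 * co u 3 + (en D n 4 * co u 4 + (en D n 5 * co u 5 + en D n 6 * co u 6))))).
Proof. by rewrite /co mxE sum7. Qed.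

Lemma en_mul D E i j : en (D *m E) i j = en D i 0 * en E 0 j + (en D i 1 * en E 1 j + (en D i 2 * en E 2 j +
  (en D i 3 * en E 3 j + (en D i 4 * en E 4 j + (en D i 5 * en E 5 j + en D i 6 * en E 6 j))))).
Proof. by rewrite /en mxE sum7. Qed.

Lemma enD D E i j : en (D + E) i j = en D i j + en E i j. Proof. by rewrite /en mxE. Qed.
Lemma enN D i j : en (- D) i j = - en D i j. Proof. by rewrite /en mxE. Qed.
Lemma enZ a D i j : en (a *: D) i j = a * en D i j. Proof. by rewrite /en mxE. Qed.
Lemma enT D i j : en D^T i j = en D j i. Proof. by rewrite /en mxE. Qed.
Lemma en0 i j : en 0 i j = 0. Proof. by rewrite /en mxE. Qed.

Definition der (D : 'M[R]_7) : Prop :=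
  D^T = - D /\ forall u v, D *m cross u v = cross (D *m u) v + cross u (D *m v).

Definition g2_relations (D : 'M[R]_7) : Prop :=
  [/\ en D 5 6 = en D 0 1 + en D 2 3, en D 6 4 = en D 0 2 + en D 3 1 &
      en D 4 5 = en D 0 3 + en D 1 2] /\
  [/\ en D 4 0 + en D 5 3 - en D 6 2 = 0, en D 4 1 + en D 5 2 + en D 6 3 = 0,
      en D 4 2 - en D 5 1 + en D 6 0 = 0 & en D 4 3 - en D 5 0 - en D 6 1 = 0].

Definition ev (a : nat) : vec := delta_mx (inord a) ord0.

Lemma co_ev a n : (a < 7)%N -> (n < 7)%N -> co (ev a) n = (n == a)%:R.
Proof. by move=> a7 n7; rewrite /co mxE eqxx andbT -val_eqE/= !inordK. Qed.

Lemma skew_en D : D^T = - D -> forall i j, en D i j = - en D j i.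
Proof. by move=> DT i j; rewrite -enN -DT enT. Qed.

Lemma skew_diag D : D^T = - D -> forall i, en D i i = 0.
Proof. by move=> /skew_en DT i; have := DT i i; lra. Qed.

(** Evaluate the derivation rule on pairs of basis vectors. *)
Lemma der_relations D : der D -> g2_relations D.
Proof.
move=> [/[dup] /skew_diag diag /skew_en sk Dd].
have E a b k := congr1 (fun x => co x k) (Dd (ev a) (ev b)).
split; split.
- have := E 0%N 2%N 6%N; rewrite !(coE, crossE, co_mul) !co_ev//=; rewrite ?(sk 1 0) ?(sk 2 0) ?(sk 3 0) ?(sk 2 1) ?(sk 3 1) ?(sk 3 2) ?(sk 0 4) ?(sk 0 5) ?(sk 0 6) ?(sk 1 4) ?(sk 1 5) ?(sk 1 6) ?(sk 2 4) ?(sk 2 5) ?(sk 2 6) ?(sk 3 4) ?(sk 3 5) ?(sk 3 6) ?(sk 5 4) ?(sk 6 4) ?(sk 6 5); lra.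
- have := E 0%N 3%N 4%N; rewrite !(coE, crossE, co_mul) !co_ev//=; rewrite ?(sk 1 0) ?(sk 2 0) ?(sk 3 0) ?(sk 2 1) ?(sk 3 1) ?(sk 3 2) ?(sk 0 4) ?(sk 0 5) ?(sk 0 6) ?(sk 1 4) ?(sk 1 5) ?(sk 1 6) ?(sk 2 4) ?(sk 2 5) ?(sk 2 6) ?(sk 3 4) ?(sk 3 5) ?(sk 3 6) ?(sk 5 4) ?(sk 6 4) ?(sk 6 5); lra.
- have := E 0%N 1%N 5%N; rewrite !(coE, crossE, co_mul) !co_ev//=; rewrite ?(sk 1 0) ?(sk 2 0) ?(sk 3 0) ?(sk 2 1) ?(sk 3 1) ?(sk 3 2) ?(sk 0 4) ?(sk 0 5) ?(sk 0 6) ?(sk 1 4) ?(sk 1 5) ?(sk 1 6) ?(sk 2 4) ?(sk 2 5) ?(sk 2 6) ?(sk 3 4) ?(sk 3 5) ?(sk 3 6) ?(sk 5 4) ?(sk 6 4) ?(sk 6 5); lra.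
- have := E 0%N 2%N 3%N; rewrite !(coE, crossE, co_mul) !co_ev//=; rewrite ?(sk 1 0) ?(sk 2 0) ?(sk 3 0) ?(sk 2 1) ?(sk 3 1) ?(sk 3 2) ?(sk 0 4) ?(sk 0 5) ?(sk 0 6) ?(sk 1 4) ?(sk 1 5) ?(sk 1 6) ?(sk 2 4) ?(sk 2 5) ?(sk 2 6) ?(sk 3 4) ?(sk 3 5) ?(sk 3 6) ?(sk 5 4) ?(sk 6 4) ?(sk 6 5); lra.
- have := E 1%N 2%N 3%N; rewrite !(coE, crossE, co_mul) !co_ev//=; rewrite ?(sk 1 0) ?(sk 2 0) ?(sk 3 0) ?(sk 2 1) ?(sk 3 1) ?(sk 3 2) ?(sk 0 4) ?(sk 0 5) ?(sk 0 6) ?(sk 1 4) ?(sk 1 5) ?(sk 1 6) ?(sk 2 4) ?(sk 2 5) ?(sk 2 6) ?(sk 3 4) ?(sk 3 5) ?(sk 3 6) ?(sk 5 4) ?(sk 6 4) ?(sk 6 5); lra.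
- have := E 0%N 1%N 2%N; rewrite !(coE, crossE, co_mul) !co_ev//=; rewrite ?(sk 1 0) ?(sk 2 0) ?(sk 3 0) ?(sk 2 1) ?(sk 3 1) ?(sk 3 2) ?(sk 0 4) ?(sk 0 5) ?(sk 0 6) ?(sk 1 4) ?(sk 1 5) ?(sk 1 6) ?(sk 2 4) ?(sk 2 5) ?(sk 2 6) ?(sk 3 4) ?(sk 3 5) ?(sk 3 6) ?(sk 5 4) ?(sk 6 4) ?(sk 6 5); lra.
- have := E 0%N 1%N 3%N; rewrite !(coE, crossE, co_mul) !co_ev//=; rewrite ?(sk 1 0) ?(sk 2 0) ?(sk 3 0) ?(sk 2 1) ?(sk 3 1) ?(sk 3 2) ?(sk 0 4) ?(sk 0 5) ?(sk 0 6) ?(sk 1 4) ?(sk 1 5) ?(sk 1 6) ?(sk 2 4) ?(sk 2 5) ?(sk 2 6) ?(sk 3 4) ?(sk 3 5) ?(sk 3 6) ?(sk 5 4) ?(sk 6 4) ?(sk 6 5); lra.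
Qed.

(** Both sides are bilinear, so this is a polynomial identity in the 21
    entries of a skew matrix and the coordinates of two vectors. *)
Lemma relations_der D : D^T = - D -> g2_relations D -> der D.
Proof.
move=> /[dup] DT /[dup] /skew_diag diag /skew_en sk [[r67 r75 r56] [r1 r2 r3 r4]].
split=> // u v.
have e62 : en D 6 2 = en D 4 0 + en D 5 3 by lra.
have e63 : en D 6 3 = - (en D 4 1 + en D 5 2) by lra.
have e60 : en D 6 0 = en D 5 1 - en D 4 2 by lra.
have e61 : en D 6 1 = en D 4 3 - en D 5 0 by lra.
have e46 : en D 4 6 = - (en D 0 2 + en D 3 1) by rewrite -r75 -sk.
apply: co_eq; rewrite !(coE, crossE, co_mul) !diag.
all: rewrite ?(sk 1 0) ?(sk 2 0) ?(sk 3 0) ?(sk 2 1) ?(sk 3 1) ?(sk 3 2) ?(sk 0 4) ?(sk 0 5) ?(sk 0 6) ?(sk 1 4) ?(sk 1 5) ?(sk 1 6) ?(sk 2 4) ?(sk 2 5) ?(sk 2 6) ?(sk 3 4) ?(sk 3 5) ?(sk 3 6) ?(sk 5 4) ?(sk 6 4) ?(sk 6 5).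
all: rewrite ?e62 ?e63 ?e60 ?e61 ?e46 ?r67 ?r56.
all: rewrite ?(sk 1 0) ?(sk 2 0) ?(sk 3 0) ?(sk 2 1) ?(sk 3 1) ?(sk 3 2) ?(sk 0 4) ?(sk 0 5) ?(sk 0 6) ?(sk 1 4) ?(sk 1 5) ?(sk 1 6) ?(sk 2 4) ?(sk 2 5) ?(sk 2 6) ?(sk 3 4) ?(sk 3 5) ?(sk 3 6) ?(sk 5 4) ?(sk 6 4) ?(sk 6 5).
all: ring.
Qed.

End Cross.

(** * The splitting of g_2 and the maximal abelian plane a *)

Section LieAlgebra.
Variable R : realType.
Implicit Types A B D E X Y w : 'M[R]_7.

Definition mat7 (t : seq (seq R)) : 'M[R]_7 := \matrix_(i, j) nth 0 (nth [::] t i) j.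

Lemma en_mat7 t i j : (i < 7)%N -> (j < 7)%N -> en (mat7 t) i j = nth 0 (nth [::] t i) j.
Proof. by move=> i7 j7; rewrite /en mxE !inordK. Qed.

(** The last row is what the four relations defining p leave no choice for. *)
Definition p_table (x : nat -> R) : seq (seq R) :=
  [:: [:: 0; 0; 0; 0; - x 0; - x 4; - (x 5 - x 2)];
      [:: 0; 0; 0; 0; - x 1; - x 5; - (x 3 - x 4)];
      [:: 0; 0; 0; 0; - x 2; - x 6; - (x 0 + x 7)];
      [:: 0; 0; 0; 0; - x 3; - x 7; x 1 + x 6];
      [:: x 0; x 1; x 2; x 3; 0; 0; 0];
      [:: x 4; x 5; x 6; x 7; 0; 0; 0];
      [:: x 5 - x 2; x 3 - x 4; x 0 + x 7; - (x 1 + x 6); 0; 0; 0]].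

(** The lower block is the image of the upper one under nu. *)
Definition k_table (x : nat -> R) : seq (seq R) :=
  [:: [:: 0; x 0; x 1; x 2; 0; 0; 0];
      [:: - x 0; 0; x 3; x 4; 0; 0; 0];
      [:: - x 1; - x 3; 0; x 5; 0; 0; 0];
      [:: - x 2; - x 4; - x 5; 0; 0; 0; 0];
      [:: 0; 0; 0; 0; 0; x 2 + x 3; - (x 1 - x 4)];
      [:: 0; 0; 0; 0; - (x 2 + x 3); 0; x 0 + x 5];
      [:: 0; 0; 0; 0; x 1 - x 4; - (x 0 + x 5); 0]].

Definition pmat x := mat7 (p_table x).
Definition kmat x := mat7 (k_table x).

(** The projection onto R^3, the span of e_5, e_6 and e_7. *)
Definition P0 : 'M[R]_7 := \matrix_(i, j) ((i == j) && (4 <= i)%N)%:R.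

Definition in_k (w : 'M[R]_7) := der w /\ P0 *m w = w *m P0.

(** P0 X + X P0 = X says that X exchanges R^4 and R^3. *)
Definition in_p7 (X : 'M[R]_7) := der X /\ P0 *m X + X *m P0 = X.

Lemma en_P0l X i j : (i < 7)%N -> en (P0 *m X) i j = (4 <= i)%:R * en X i j.
Proof.
move=> i7; rewrite /en mxE (bigD1 (inord i))//= big1 => [|l li]; first by rewrite addr0 mxE eqxx inordK.
by rewrite mxE eq_sym (negbTE li) mul0r.
Qed.

Lemma en_P0r X i j : (j < 7)%N -> en (X *m P0) i j = (4 <= j)%:R * en X i j.
Proof.
move=> j7; rewrite /en mxE (bigD1 (inord j))//= big1 => [|l lj].
  by rewrite addr0 mxE eqxx inordK// mulrC.
by rewrite mxE (negbTE lj) mulr0.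
Qed.

Ltac cases7 := move=> [|[|[|[|[|[|[|//]]]]]]] _.

Lemma pmat_in_p x : in_p7 (pmat x).
Proof.
split; last first.
  apply: en_eq => i j i7 j7; rewrite enD en_P0l// en_P0r//; move: i i7 j j7.
  by cases7; cases7; rewrite !en_mat7//=; ring.
apply: relations_der.
  by apply: en_eq => i j i7 j7; rewrite enT enN; move: i i7 j j7; cases7; cases7; rewrite !en_mat7//=; ring.
by split; split; rewrite !en_mat7//=; ring.
Qed.

Lemma kmat_in_k x : in_k (kmat x).
Proof.
split; last first.
  apply: en_eq => i j i7 j7; rewrite en_P0l// en_P0r//; move: i i7 j j7.
  by cases7; cases7; rewrite !en_mat7//=; ring.
apply: relations_der.
  by apply: en_eq => i j i7 j7; rewrite enT enN; move: i i7 j j7; cases7; cases7; rewrite !en_mat7//=; ring.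
by split; split; rewrite !en_mat7//=; ring.
Qed.

Lemma in_pE X : in_p7 X -> exists x, X = pmat x.
Proof.
move=> [dX XP]; have [[DT _] [[r67 r75 r56] [r1 r2 r3 r4]]] := (dX, der_relations dX).
have sk := skew_en DT.
have Z i j : (i < 7)%N -> (j < 7)%N -> (4 <= i)%:R * en X i j + (4 <= j)%:R * en X i j = en X i j.
  by move=> i7 j7; rewrite -{3}XP enD en_P0l// en_P0r.
exists (nth 0 [:: en X 4 0; en X 4 1; en X 4 2; en X 4 3; en X 5 0; en X 5 1; en X 5 2; en X 5 3]).
apply: en_eq => i j i7 j7; have := Z i j i7 j7; have := sk i j; move: i i7 j j7.
clear Z XP dX DT.
by cases7; cases7; rewrite en_mat7//= => Hs Hz; try lra; have := sk 4 0; have := sk 4 1; lra.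
Qed.

Lemma in_kE X : in_k X -> exists x, X = kmat x.
Proof.
move=> [dX XP]; have [[DT _] [[r67 r75 r56] [r1 r2 r3 r4]]] := (dX, der_relations dX).
have sk := skew_en DT.
have Z i j : (i < 7)%N -> (j < 7)%N -> (4 <= i)%:R * en X i j = (4 <= j)%:R * en X i j.
  by move=> i7 j7; rewrite -en_P0l// XP en_P0r.
exists (nth 0 [:: en X 0 1; en X 0 2; en X 0 3; en X 1 2; en X 1 3; en X 2 3]).
have s13 := sk 3 1.
apply: en_eq => i j i7 j7; have := Z i j i7 j7; have := sk i j; move: i i7 j j7.
clear Z XP dX DT r1 r2 r3 r4.
by cases7; cases7; rewrite en_mat7//= => Hs Hz; lra.
Qed.

Lemma der0 : der (0 : 'M[R]_7).
Proof.
split=> [|u v]; first by rewrite trmx0 oppr0.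
have c0 (x : 'cV[R]_7) : cross 0 x = 0 :> 'cV[R]_7 by rewrite -(scale0r x) crossZl !scale0r.
by rewrite !mul0mx c0 crossC c0 oppr0 addr0.
Qed.

Lemma derD A B : der A -> der B -> der (A + B).
Proof.
move=> [At Ad] [Bt Bd]; split=> [|u v]; first by rewrite linearD /= At Bt opprD.
by rewrite !mulmxDl Ad Bd crossDl crossDr addrACA.
Qed.

Lemma derZ a A : der A -> der (a *: A).
Proof.
move=> [At Ad]; split=> [|u v]; first by rewrite linearZ /= At scalerN.
by rewrite -!scalemxAl Ad crossZl crossZr scalerDr.
Qed.

Lemma derN A : der A -> der (- A).
Proof. by rewrite -scaleN1r; exact: derZ. Qed.

Lemma der_comm A B : der A -> der B -> der (commutator A B).
Proof.
move=> [At Ad] [Bt Bd]; split=> [|u v].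
  by rewrite /commutator linearB /= !trmx_mul At Bt !mulmxN !mulNmx !opprK opprB.
rewrite /commutator !mulmxBl -!mulmxA Ad Bd !mulmxDr !Ad !Bd.
have crossNl (x y : 'cV[R]_7) : cross (- x) y = - cross x y :> 'cV[R]_7.
  by rewrite -scaleN1r crossZl scaleN1r.
have crossNr (x y : 'cV[R]_7) : cross x (- y) = - cross x y :> 'cV[R]_7.
  by rewrite -scaleN1r crossZr scaleN1r.
rewrite !crossDl !crossDr !crossNl !crossNr.
by apply: co_eq; rewrite !coE; ring.
Qed.

Lemma in_p7D A B : in_p7 A -> in_p7 B -> in_p7 (A + B).
Proof. by move=> [dA PA] [dB PB]; split; [exact: derD|rewrite mulmxDr mulmxDl addrACA PA PB]. Qed.

Lemma in_p7Z a A : in_p7 A -> in_p7 (a *: A).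
Proof. by move=> [dA PA]; split; [exact: derZ|rewrite -scalemxAr -scalemxAl -scalerDr PA]. Qed.

Lemma in_p7B A B : in_p7 A -> in_p7 B -> in_p7 (A - B).
Proof. by move=> pA pB; rewrite -scaleN1r; apply: in_p7D => //; exact: in_p7Z. Qed.

Lemma in_kD A B : in_k A -> in_k B -> in_k (A + B).
Proof. by move=> [dA PA] [dB PB]; split; [exact: derD|rewrite mulmxDr mulmxDl PA PB]. Qed.

Lemma in_kZ a A : in_k A -> in_k (a *: A).
Proof. by move=> [dA PA]; split; [exact: derZ|rewrite -scalemxAr -scalemxAl PA]. Qed.

Lemma comm_kp w X : in_k w -> in_p7 X -> in_p7 (commutator w X).
Proof.
move=> [dw Pw] [dX PX]; split; first exact: der_comm.
have e1 : P0 *m (w *m X) + w *m X *m P0 = w *m X by rewrite mulmxA Pw -!mulmxA -mulmxDr PX.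
have e2 : P0 *m (X *m w) + X *m w *m P0 = X *m w.
  by rewrite -[X *m w *m _]mulmxA -Pw !mulmxA -mulmxDl PX.
by rewrite /commutator mulmxBr mulmxBl addrACA -opprD e1 e2.
Qed.

Lemma comm_pp X Y : in_p7 X -> in_p7 Y -> in_k (commutator X Y).
Proof.
move=> [dX PX] [dY PY]; split; first exact: der_comm.
have H A B : P0 *m A + A *m P0 = A -> P0 *m B + B *m P0 = B ->
    P0 *m (A *m B) = A *m B *m P0.
  move=> HA HB; have -> : P0 *m (A *m B) = A *m B - A *m P0 *m B.
    by apply/eqP; rewrite eq_sym subr_eq mulmxA -mulmxDl HA.
  by apply/eqP; rewrite subr_eq -!mulmxA -mulmxDr addrC HB.
by rewrite /commutator mulmxBr mulmxBl !H.
Qed.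

Lemma in_p_eq X Y : in_p7 X -> in_p7 Y ->
  [/\ en X 4 0 = en Y 4 0, en X 4 1 = en Y 4 1, en X 4 2 = en Y 4 2 & en X 4 3 = en Y 4 3] ->
  [/\ en X 5 0 = en Y 5 0, en X 5 1 = en Y 5 1, en X 5 2 = en Y 5 2 & en X 5 3 = en Y 5 3] -> X = Y.
Proof.
move=> /in_pE[x ->] /in_pE[y ->]; rewrite !en_mat7//= => -[e0 e1 e2 e3] [e4 e5 e6 e7].
by rewrite /pmat /p_table e0 e1 e2 e3 e4 e5 e6 e7.
Qed.

Lemma in_k_eq X Y : in_k X -> in_k Y ->
  [/\ en X 0 1 = en Y 0 1, en X 0 2 = en Y 0 2 & en X 0 3 = en Y 0 3] ->
  [/\ en X 1 2 = en Y 1 2, en X 1 3 = en Y 1 3 & en X 2 3 = en Y 2 3] -> X = Y.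
Proof.
move=> /in_kE[x ->] /in_kE[y ->]; rewrite !en_mat7//= => -[e0 e1 e2] [e3 e4 e5].
by rewrite /kmat /k_table e0 e1 e2 e3 e4 e5.
Qed.

Lemma in_k0 : in_k (0 : 'M[R]_7). Proof. by split; [exact: der0|rewrite mulmx0 mul0mx]. Qed.

End LieAlgebra.

Section RootSpaces.
Variable R : realType.
Implicit Types A B D E X Y w W : 'M[R]_7.

(** The matrices b_1 and b_2 without their last row and column, numbered
    from 0 like the coordinates of the plane. *)
Definition b0 : 'M[R]_7 := pmat (fun n => (n == 0%N)%:R).
Definition b1 : 'M[R]_7 := pmat (fun n => (n == 7%N)%:R).

Definition in_a (X : 'M[R]_7) := exists s t, X = s *: b0 + t *: b1.

Lemma b0_in_p : in_p7 b0. Proof. exact: pmat_in_p. Qed.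
Lemma b1_in_p : in_p7 b1. Proof. exact: pmat_in_p. Qed.

Lemma in_a_in_p X : in_a X -> in_p7 X.
Proof. by move=> [s [t ->]]; apply: in_p7D; apply: in_p7Z; [exact: b0_in_p|exact: b1_in_p]. Qed.

Lemma comm_entry (A B C : 'M[R]_7) i j : commutator A B = C ->
  en (A *m B) i j - en (B *m A) i j = en C i j.
Proof. by move=> <-; rewrite /commutator enD enN. Qed.

Ltac entry E i j := have := E i j; rewrite /b0 /b1 ?(enD, enN, enZ, en0) !en_mul ?(enD, enN, enZ, en0) !en_mat7//=.

Lemma b_comm : commutator b0 b1 = 0.
Proof.
apply: (in_k_eq (comm_pp b0_in_p b1_in_p) (@in_k0 R));
  by rewrite /commutator !enD !enN !en_mul !en0 /b0 /b1; split; rewrite !en_mat7//=; ring.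
Qed.

(** b_1 + 2 b_2 lies on no wall of the abelian plane a, so its centralizer
    in p is as small as possible. *)
Lemma centralizer_regular X : in_p7 X -> commutator X (b0 + 2 *: b1) = 0 -> in_a X.
Proof.
move=> /[dup] pX /in_pE[x Xx] /comm_entry H; exists (x 0%N), (x 7%N).
rewrite Xx in H.
entry H 0%N 1%N; entry H 0%N 2%N; entry H 0%N 3%N; entry H 1%N 2%N; entry H 1%N 3%N; entry H 2%N 3%N.
move=> H1 H2 H3 H4 H5 H6.
have [e1 e2 e3] : [/\ x 1%N = 0, x 2%N = 0 & x 3%N = 0] by split; lra.
have [e4 e5 e6] : [/\ x 4%N = 0, x 5%N = 0 & x 6%N = 0] by split; lra.
clear H H1 H2 H3 H4 H5 H6.
apply: in_p_eq => //; first by apply: in_a_in_p; do 2 eexists.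
  by rewrite Xx !enD !enZ /b0 /b1; split; rewrite !en_mat7//= ?e1 ?e2 ?e3; ring.
by rewrite Xx !enD !enZ /b0 /b1; split; rewrite !en_mat7//= ?e4 ?e5 ?e6; ring.
Qed.

Lemma centralizer_k w : in_k w -> commutator w b0 = 0 -> commutator w b1 = 0 -> w = 0.
Proof.
move=> /[dup] kw /in_kE[x wx] /comm_entry H /comm_entry H'.
rewrite wx in H H'.
entry H 4%N 1%N; entry H 4%N 2%N; entry H 4%N 3%N; entry H 5%N 0%N; entry H 5%N 2%N.
entry H' 4%N 2%N => K2 H1 H2 H3 H4 H5.
have [e1 e2 e3] : [/\ x 0%N = 0, x 1%N = 0 & x 2%N = 0] by split; lra.
have [e4 e5 e6] : [/\ x 3%N = 0, x 4%N = 0 & x 5%N = 0] by split; lra.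
clear H H' H1 H2 H3 H4 H5 K2.
by apply: (in_k_eq kw (@in_k0 R)); rewrite wx !en0; split; rewrite !en_mat7.
Qed.

(** The condition is the derivative of the commutation relation. The
    directions in which a commuting pair can move are therefore those along
    a and those along the orbits of the stabiliser of R^3. *)
Lemma tangent_to_a X0 X1 : in_p7 X0 -> in_p7 X1 -> commutator X0 b1 = commutator X1 b0 ->
  exists2 w, in_k w & in_a (X0 - commutator w b0) /\ in_a (X1 - commutator w b1).
Proof.
move=> /[dup] pX0 /in_pE[y Xy] /[dup] pX1 /in_pE[z Xz] /comm_entry.
rewrite Xy Xz => H.
have {}H i j : en (pmat y *m b1) i j - en (b1 *m pmat y) i j =
    en (pmat z *m b0) i j - en (b0 *m pmat z) i j.
  by rewrite (H i j) /commutator enD enN.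
pose w := kmat (nth 0 [:: - y 1%N; z 2%N - y 2%N; - y 3%N; y 3%N - y 4%N; 2 * z 2%N - y 2%N; y 6%N + y 1%N]).
entry H 0%N 1%N; entry H 0%N 2%N; entry H 0%N 3%N; entry H 1%N 2%N; entry H 1%N 3%N; entry H 2%N 3%N.
move=> H1 H2 H3 H4 H5 H6; clear H.
have [e1 e2 e3] : [/\ y 5%N = 0, z 1%N = 0 & z 3%N = - y 4%N] by split; lra.
have [e4 e5 e6] : [/\ z 4%N = - y 3%N, z 5%N = 2 * z 2%N - y 2%N & z 6%N = y 1%N + 2 * y 6%N].
  by split; lra.
clear H1 H2 H3 H4 H5 H6.
have kw : in_k w by exact: kmat_in_k.
exists w => //; split.
  exists (y 0%N), (y 7%N); rewrite -Xy.
  apply: in_p_eq.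
  - by apply: in_p7B => //; apply: comm_kp => //; exact: b0_in_p.
  - by apply: in_a_in_p; do 2 eexists.
  - rewrite Xy /commutator !enD !enN !enD !enN !enZ !en_mul /b0 /b1 /w; split; rewrite !en_mat7//= ?e1 ?e2 ?e3; ring.
  - rewrite Xy /commutator !enD !enN !enD !enN !enZ !en_mul /b0 /b1 /w; split; rewrite !en_mat7//= ?e1 ?e2 ?e3; ring.
exists (z 0%N), (z 7%N); rewrite -Xz.
apply: in_p_eq.
- by apply: in_p7B => //; apply: comm_kp => //; exact: b1_in_p.
- by apply: in_a_in_p; do 2 eexists.
- rewrite Xz /commutator !enD !enN !enD !enN !enZ !en_mul /b0 /b1 /w; split; rewrite !en_mat7//= ?e1 ?e2 ?e3; ring.
- rewrite Xz /commutator !enD !enN !enD !enN !enZ !en_mul /b0 /b1 /w; split; rewrite !en_mat7//= ?e4 ?e5 ?e6; ring.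
Qed.

(** The coordinates of b_1 and b_2 in a solution are free and set to 0; the
    others can be read off from single entries of the two equations. *)
Definition potential (W0 W1 : 'M[R]_7) : 'M[R]_7 :=
  pmat (nth 0 [:: 0; - en W0 0 1; en W1 1 3 - en W1 0 2; - en W0 0 3; en W1 0 3; en W1 1 3;
                  en W0 2 3 + en W0 0 1; 0]).

Lemma potential_in_p W0 W1 : in_p7 (potential W0 W1). Proof. exact: pmat_in_p. Qed.

(** The map V |-> ([b_1, V], [b_2, V]) is onto the pairs satisfying this
    compatibility condition, a Poincare lemma for the adjoint action of a. *)
Lemma potentialP W0 W1 : in_k W0 -> in_k W1 -> commutator b0 W1 = commutator b1 W0 ->
  commutator b0 (potential W0 W1) = W0 /\ commutator b1 (potential W0 W1) = W1.
Proof.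
move=> /[dup] kW0 /in_kE[y Wy] /[dup] kW1 /in_kE[z Wz] /comm_entry.
rewrite Wy Wz => H.
have {}H i j : en (b0 *m kmat z) i j - en (kmat z *m b0) i j =
    en (b1 *m kmat y) i j - en (kmat y *m b1) i j.
  by rewrite (H i j) /commutator enD enN.
entry H 4%N 1%N; entry H 4%N 2%N; entry H 4%N 3%N; entry H 5%N 0%N; entry H 5%N 1%N; entry H 5%N 2%N.
move=> H1 H2 H3 H4 H5 H6; clear H.
have [e1 e2 e3] : [/\ z 0%N = 0, y 4%N = 0 & y 3%N = - y 2%N - z 2%N] by split; lra.
have [e4 e5 e6] : [/\ z 3%N = - y 2%N - z 2%N, y 1%N = 2 * z 1%N - z 4%N & z 5%N = y 0%N + 2 * y 5%N].
  by split; lra.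
clear H1 H2 H3 H4 H5 H6.
have pV := potential_in_p (kmat y) (kmat z).
rewrite -Wy -Wz; split.
- apply: in_k_eq => //; first by apply: comm_pp; [exact: b0_in_p|exact: potential_in_p].
  by rewrite ?Wy ?Wz /commutator !enD !enN !en_mul /potential ?en_mat7//= /b0 /b1; split; rewrite ?en_mat7//= ?e1 ?e2 ?e3 ?e4 ?e5 ?e6; ring.
  by rewrite ?Wy ?Wz /commutator !enD !enN !en_mul /potential ?en_mat7//= /b0 /b1; split; rewrite ?en_mat7//= ?e1 ?e2 ?e3 ?e4 ?e5 ?e6; ring.
- apply: in_k_eq => //; first by apply: comm_pp; [exact: b1_in_p|exact: potential_in_p].
  by rewrite ?Wy ?Wz /commutator !enD !enN !en_mul /potential ?en_mat7//= /b0 /b1; split; rewrite ?en_mat7//= ?e1 ?e2 ?e3 ?e4 ?e5 ?e6; ring.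
  by rewrite ?Wy ?Wz /commutator !enD !enN !en_mul /potential ?en_mat7//= /b0 /b1; split; rewrite ?en_mat7//= ?e1 ?e2 ?e3 ?e4 ?e5 ?e6; ring.
Qed.

Lemma k_zero (w : 'M[R]_7) : in_k w -> (forall i j, (i < 4)%N -> (j < 4)%N -> en w i j = 0) -> w = 0.
Proof. by move=> kw H; apply: (in_k_eq kw (@in_k0 R)); rewrite !en0; split; exact: H. Qed.

End RootSpaces.

(** * The group G_2 *)

Section Octonions.
Variable R : realType.
Local Notation vec := 'cV[R]_7.
Implicit Types (x y z : oct R) (u v w : vec) (f g : 'M[R]_7).

Definition ore x : R := x ord0 ord0.
Definition oim x : vec := dsubmx x.

Lemma sum8 (V : nmodType) (F : 'I_(1 + 7) -> V) : \sum_i F i =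
  F ord0 + (F (rshift 1 (inord 0)) + (F (rshift 1 (inord 1)) + (F (rshift 1 (inord 2)) +
  (F (rshift 1 (inord 3)) + (F (rshift 1 (inord 4)) + (F (rshift 1 (inord 5)) + F (rshift 1 (inord 6)))))))).
Proof.
rewrite big_split_ord big_ord1 sum7; congr (F _ + _); exact: val_inj.
Qed.

Lemma ore_mul x y : ore (oct_mul x y) = ore x * ore y - dot (oim x) (oim y).
Proof.
rewrite /ore mxE sum8 !sum8 /= !inordK // /oct_coef /=; eval_coef; rewrite /=.
rewrite dotE /co !mxE; ring.
Qed.

Lemma oim_mul x y : oim (oct_mul x y) = ore x *: oim y + ore y *: oim x + cross (oim x) (oim y).
Proof.
apply: co_eq; rewrite !(coE, crossE) /co /ore !mxE sum8 !sum8 /= !inordK // /oct_coef /=; eval_coef;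
rewrite /=; ring.
Qed.

Lemma lshift70 : lshift 7 (ord0 : 'I_1) = (ord0 : 'I_(1 + 7)).
Proof. exact: val_inj. Qed.

Lemma oct_eq x y : ore x = ore y -> oim x = oim y -> x = y.
Proof.
move=> e0 e1; rewrite -[x]vsubmxK -[y]vsubmxK; congr col_mx => //.
apply/matrixP => i j; rewrite !mxE !ord1.
by rewrite lshift70.
Qed.

Lemma ore_im u : ore (oct_im u) = 0.
Proof.
rewrite /ore /oct_im -lshift70.
by rewrite col_mxEu mxE.
Qed.

Lemma oim_im u : oim (oct_im u) = u. Proof. exact: col_mxKd. Qed.

Lemma oim_one : oim (oct_one R) = 0. Proof. exact: col_mxKd. Qed.

Let G f : 'M[R]_(1 + 7) := block_mx 1%:M 0 0 f.

Lemma Gmul f x : G f *m x = col_mx (usubmx x) (f *m oim x).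
Proof.
by rewrite -{1}[x]vsubmxK /G mul_block_col !mul0mx mul1mx addr0 add0r.
Qed.

Lemma ore_G f x : ore (G f *m x) = ore x.
Proof.
rewrite Gmul /ore -lshift70.
by rewrite col_mxEu mxE.
Qed.

Lemma oim_G f x : oim (G f *m x) = f *m oim x. Proof. by rewrite Gmul; exact: col_mxKd. Qed.

Lemma dot_mul f u v : dot (f *m u) v = dot u (f^T *m v).
Proof. by rewrite /dot trmx_mul mulmxA. Qed.

Lemma dot_ev D i j : (i < 7)%N -> (j < 7)%N -> dot (ev R i) (D *m ev R j) = en D i j.
Proof.
move=> i7 j7; rewrite /dot /ev /en trmx_delta mulmxA -rowE mxE (bigD1 (inord j))//= big1 => [|l lj].
  by rewrite addr0 !mxE !eqxx mulr1.
by rewrite !mxE (negbTE lj) mulr0.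
Qed.

(** The octonion product is expressed through the scalar and the cross
    product, which an automorphism fixing 1 must preserve separately. *)
Lemma G2E g : G2 g <-> g^T *m g = 1%:M /\ forall u v, g *m cross u v = cross (g *m u) (g *m v).
Proof.
split=> [[gu Hg]|[gT gc]].
  have H u v := Hg (oct_im u) (oct_im v).
  have Hd u v : dot (g *m u) (g *m v) = dot u v.
    have := congr1 ore (H u v); rewrite -!/(G g) ore_G !ore_mul !oim_G !ore_G !ore_im !oim_im mul0r.
    by rewrite !sub0r => /oppr_inj.
  split=> [|u v].
    apply: en_eq => i j i7 j7; rewrite -!dot_ev// -mulmxA dotC dot_mul trmxK Hd.
    by rewrite mul1mx dotC.
  have := congr1 oim (H u v); rewrite -!/(G g) oim_G !oim_mul !oim_G !ore_G !ore_im !oim_im.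
  by rewrite !scale0r !add0r.
have gd u v : dot (g *m u) (g *m v) = dot u v by rewrite dot_mul mulmxA gT mul1mx.
split; first by have [] := mulmx1_unit gT.
move=> x y; apply: oct_eq; rewrite -!/(G g) ?ore_G ?oim_G ?ore_mul ?oim_mul !ore_G !oim_G ?gd//.
by rewrite !mulmxDr -!scalemxAr gc.
Qed.

Lemma G2_orth g : G2 g -> g^T *m g = 1%:M. Proof. by move=> /G2E[]. Qed.
Lemma G2_orthr g : G2 g -> g *m g^T = 1%:M. Proof. by move=> /G2_orth /mulmx1C. Qed.
Lemma G2_cross g u v : G2 g -> g *m cross u v = cross (g *m u) (g *m v). Proof. by move=> /G2E[]. Qed.

Lemma G2_1 : G2 (1%:M : 'M[R]_7).
Proof. by apply/G2E; rewrite trmx1 mul1mx; split=> // u v; rewrite !mul1mx. Qed.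

Lemma G2_mul f g : G2 f -> G2 g -> G2 (f *m g).
Proof.
move=> Gf Gg; apply/G2E; split.
  by rewrite trmx_mul -mulmxA (mulmxA f^T) G2_orth// mul1mx G2_orth.
by move=> u v; rewrite -!mulmxA !G2_cross.
Qed.

Lemma G2_tr g : G2 g -> G2 g^T.
Proof.
move=> Gg; apply/G2E; rewrite trmxK G2_orthr//; split=> // u v.
apply: (can_inj (f := mulmx g) (g := mulmx g^T)); first by move=> w; rewrite mulmxA G2_orth// mul1mx.
by rewrite [RHS](G2_cross _ _ Gg) !mulmxA (G2_orthr Gg) !mul1mx.
Qed.

Lemma der_conj g D : G2 g -> der D -> der (g *m D *m g^T).
Proof.
move=> Gg [Dt Dd]; split=> [|u v].
  by rewrite !trmx_mul trmxK Dt mulNmx mulmxN -mulmxA.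
rewrite -!mulmxA !(G2_cross _ _ (G2_tr Gg)) Dd mulmxDr !G2_cross//.
by rewrite !(mulmxA g g^T) G2_orthr// !mul1mx.
Qed.

Lemma der_conj' g D : G2 g -> der D -> der (g^T *m D *m g).
Proof. by move=> /G2_tr Gg /(der_conj Gg); rewrite trmxK. Qed.

End Octonions.

(** * Adapted frames and associative planes *)

Section Frames.
Variable R : realType.
Local Notation vec := 'cV[R]_7.
Implicit Types (u v w z : vec) (f g Q : 'M[R]_7) (A E : {vspace vec}).

Lemma dotDr u v w : dot u (v + w) = dot u v + dot u w.
Proof. by rewrite dotC dotDl !(dotC u). Qed.
Lemma dotZr a u v : dot u (a *: v) = a * dot u v.
Proof. by rewrite dotC dotZl dotC. Qed.
Lemma dotNr u v : dot u (- v) = - dot u v.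
Proof. by rewrite dotC dotNl dotC. Qed.

Lemma cross_sq u v : cross u (cross u v) = - dot u u *: v + dot u v *: u.
Proof. by apply: co_eq; rewrite !(coE, crossE) !dotE; ring. Qed.

Definition frame_cols (u v z : vec) : seq vec :=
  let q := cross u v in [:: z; cross z u; cross z v; cross z q; u; v; q].

Definition frame_mx (s : seq vec) : 'M[R]_7 := \matrix_(i, j) (nth 0 s j) i ord0.

Lemma en_frame s i j : (i < 7)%N -> (j < 7)%N -> en (frame_mx s) i j = co (nth 0 s j) i.
Proof. by move=> i7 j7; rewrite /en mxE /co inordK. Qed.

Lemma dot_cols s i j : (i < 7)%N -> (j < 7)%N ->
  en ((frame_mx s)^T *m frame_mx s) i j = dot (nth 0 s i) (nth 0 s j).
Proof. by move=> i7 j7; rewrite en_mul !enT !en_frame// dotE. Qed.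

Ltac cases7 := move=> [|[|[|[|[|[|[|//]]]]]]] _.

(** The products of three orthonormal imaginary octonions, the third
    orthogonal to the algebra generated by the other two, satisfy the
    multiplication table of the basis, so that the frame is an automorphism. *)
Lemma frame_G2 u v z : dot u u = 1 -> dot v v = 1 -> dot z z = 1 -> dot u v = 0 ->
  dot z u = 0 -> dot z v = 0 -> dot z (cross u v) = 0 -> G2 (frame_mx (frame_cols u v z)).
Proof.
move=> uu vv zz uv zu zv zq.
set q := cross u v in zq *.
have vu : dot v u = 0 by rewrite dotC.
have uz : dot u z = 0 by rewrite dotC.
have vz : dot v z = 0 by rewrite dotC.
have qz : dot q z = 0 by rewrite dotC.
have cc (x y : vec) : dot x y = 0 -> dot y x = 0 -> cross x (cross x y) = - dot x x *: y.
  by move=> xy _; rewrite cross_sq xy scale0r addr0.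
have anti (x y w : vec) : dot x y = 0 -> dot x w = 0 -> dot y w = 0 -> cross x (cross y w) = - cross y (cross x w).
  move=> xy xw yw; apply/eqP; rewrite -addr_eq0 cross_cross xy xw yw mulr0 oppr0 !scale0r !addr0.
  by [].
have cNr (x y : vec) : cross x (- y) = - cross x y by rewrite -scaleN1r crossZr scaleN1r.
have uq0 : cross u q = - v by rewrite cc// uu scaleN1r.
have vq0 : cross v q = u.
  by rewrite /q (crossC v u) cNr cc// vv scaleN1r opprK.
have uq : dot u q = 0 by rewrite /q -cross_dot crossvv dotE !co0; ring.
have vq : dot v q = 0 by rewrite /q dotC cross_dot crossvv dotE !co0; ring.
have qu : dot q u = 0 by rewrite dotC.
have qv : dot q v = 0 by rewrite dotC.
have qq : dot q q = 1 by rewrite {1}/q cross_dot vq0 uu.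
have quv : cross q u = v by rewrite (crossC u q) uq0 opprK.
have qvu : cross q v = - u by rewrite (crossC v q) vq0.
have zx (x : vec) : dot z x = 0 -> dot x z = 0 -> cross z (cross z x) = - x.
  by move=> ? ?; rewrite cc// zz scaleN1r.
pose p1 := cross z u; pose p2 := cross z v; pose p3 := cross z q.
have zp1 : cross z p1 = - u by exact: zx.
have zp2 : cross z p2 = - v by exact: zx.
have zp3 : cross z p3 = - q by exact: zx.
have dzc (x y : vec) : dot (cross z x) (cross z y) = dot x (- cross z (cross z y)).
  by rewrite (crossC x z) dotNl cross_dot dotNr.
have up1 : cross u p1 = z by rewrite /p1 (crossC u z) cNr cc// uu scaleN1r opprK.
have vp2 : cross v p2 = z by rewrite /p2 (crossC v z) cNr cc// vv scaleN1r opprK.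
have qp3 : cross q p3 = z by rewrite /p3 (crossC q z) cNr cc// qq scaleN1r opprK.
have up2 : cross u p2 = - p3 by rewrite /p2 anti.
have vp1 : cross v p1 = p3 by rewrite /p1 anti// (crossC u v) -/q cNr opprK.
have up3 : cross u p3 = p2 by rewrite /p3 anti// uq0 cNr opprK.
have qp1 : cross q p1 = - p2 by rewrite /p1 anti// quv.
have vp3 : cross v p3 = - p1 by rewrite /p3 anti// vq0.
have qp2 : cross q p2 = p1 by rewrite /p2 anti// qvu cNr opprK.
have dzp (x : vec) : dot z (cross z x) = 0 by rewrite -cross_dot crossvv dotE !co0; ring.
have dp (x y : vec) : dot (cross z x) y = dot z (cross x y) by rewrite cross_dot.
have ap (x y : vec) : dot z x = 0 -> dot z y = 0 -> dot (cross z x) (cross z y) = dot x y.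
  by move=> zx0 zy0; rewrite dzc (zx y) ?opprK// dotC.
have p1z : dot p1 z = 0 by rewrite dotC dzp.
have p2z : dot p2 z = 0 by rewrite dotC dzp.
have p1v : dot p1 v = 0 by rewrite dp.
have p1q : dot p1 q = 0 by rewrite dp uq0 dotNr zv oppr0.
have p2q : dot p2 q = 0 by rewrite dp vq0.
have p1p2 : cross p1 p2 = - q by rewrite /p2 anti// (crossC v p1) vp1 cNr opprK zp3.
have p1p3 : cross p1 p3 = v by rewrite /p3 anti// (crossC q p1) qp1 opprK zp2 opprK.
have p2p3 : cross p2 p3 = - u by rewrite /p3 anti// (crossC q p2) qp2 cNr opprK zp1.
set s := frame_cols u v z.
have sE : s = [:: z; p1; p2; p3; u; v; q] by [].
apply/G2E; split.
  have dot0 (x : vec) : dot x 0 = 0 by rewrite dotE !co0 !mulr0 !addr0.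
  have d11 : dot p1 p1 = 1 by rewrite ap.
  have d22 : dot p2 p2 = 1 by rewrite ap.
  have d33 : dot p3 p3 = 1 by rewrite ap.
  have d12 : dot p1 p2 = 0 by rewrite ap.
  have d13 : dot p1 p3 = 0 by rewrite ap.
  have d23 : dot p2 p3 = 0 by rewrite ap.
  have d14 : dot p1 u = 0 by rewrite dp crossvv dot0.
  have d24 : dot p2 u = 0 by rewrite dp (crossC u v) dotNr zq oppr0.
  have d25 : dot p2 v = 0 by rewrite dp crossvv dot0.
  have d34 : dot p3 u = 0 by rewrite dp quv.
  have d35 : dot p3 v = 0 by rewrite dp qvu dotNr zu oppr0.
  have d36 : dot p3 q = 0 by rewrite dp crossvv dot0.
  have p3z : dot p3 z = 0 by rewrite dotC dzp.
  apply: en_eq => i j i7 j7; rewrite dot_cols// sE (_ : en 1%:M i j = (i == j)%:R); last first.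
    by rewrite /en mxE -val_eqE/= !inordK.
  by move: i i7 j j7; cases7; cases7; rewrite /=; first [assumption | rewrite dotC; assumption].
have t00 : cross z z = 0 by rewrite crossvv.
have t01 : cross z p1 = - u by first [assumption | rewrite crossC; first [by rewrite ?up1 ?vp2 ?qp3 ?up2 ?vp1 ?up3 ?qp1 ?vp3 ?qp2 ?zp1 ?zp2 ?zp3 ?p1p2 ?p1p3 ?p2p3 ?uq0 ?vq0 ?quv ?qvu ?opprK] | done].
have t02 : cross z p2 = - v by first [assumption | rewrite crossC; first [by rewrite ?up1 ?vp2 ?qp3 ?up2 ?vp1 ?up3 ?qp1 ?vp3 ?qp2 ?zp1 ?zp2 ?zp3 ?p1p2 ?p1p3 ?p2p3 ?uq0 ?vq0 ?quv ?qvu ?opprK] | done].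
have t03 : cross z p3 = - q by first [assumption | rewrite crossC; first [by rewrite ?up1 ?vp2 ?qp3 ?up2 ?vp1 ?up3 ?qp1 ?vp3 ?qp2 ?zp1 ?zp2 ?zp3 ?p1p2 ?p1p3 ?p2p3 ?uq0 ?vq0 ?quv ?qvu ?opprK] | done].
have t04 : cross z u = p1 by first [assumption | rewrite crossC; first [by rewrite ?up1 ?vp2 ?qp3 ?up2 ?vp1 ?up3 ?qp1 ?vp3 ?qp2 ?zp1 ?zp2 ?zp3 ?p1p2 ?p1p3 ?p2p3 ?uq0 ?vq0 ?quv ?qvu ?opprK] | done].
have t05 : cross z v = p2 by first [assumption | rewrite crossC; first [by rewrite ?up1 ?vp2 ?qp3 ?up2 ?vp1 ?up3 ?qp1 ?vp3 ?qp2 ?zp1 ?zp2 ?zp3 ?p1p2 ?p1p3 ?p2p3 ?uq0 ?vq0 ?quv ?qvu ?opprK] | done].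
have t06 : cross z q = p3 by first [assumption | rewrite crossC; first [by rewrite ?up1 ?vp2 ?qp3 ?up2 ?vp1 ?up3 ?qp1 ?vp3 ?qp2 ?zp1 ?zp2 ?zp3 ?p1p2 ?p1p3 ?p2p3 ?uq0 ?vq0 ?quv ?qvu ?opprK] | done].
have t10 : cross p1 z = u by first [assumption | rewrite crossC; first [by rewrite ?up1 ?vp2 ?qp3 ?up2 ?vp1 ?up3 ?qp1 ?vp3 ?qp2 ?zp1 ?zp2 ?zp3 ?p1p2 ?p1p3 ?p2p3 ?uq0 ?vq0 ?quv ?qvu ?opprK] | done].
have t11 : cross p1 p1 = 0 by rewrite crossvv.
have t12 : cross p1 p2 = - q by first [assumption | rewrite crossC; first [by rewrite ?up1 ?vp2 ?qp3 ?up2 ?vp1 ?up3 ?qp1 ?vp3 ?qp2 ?zp1 ?zp2 ?zp3 ?p1p2 ?p1p3 ?p2p3 ?uq0 ?vq0 ?quv ?qvu ?opprK] | done].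
have t13 : cross p1 p3 = v by first [assumption | rewrite crossC; first [by rewrite ?up1 ?vp2 ?qp3 ?up2 ?vp1 ?up3 ?qp1 ?vp3 ?qp2 ?zp1 ?zp2 ?zp3 ?p1p2 ?p1p3 ?p2p3 ?uq0 ?vq0 ?quv ?qvu ?opprK] | done].
have t14 : cross p1 u = - z by first [assumption | rewrite crossC; first [by rewrite ?up1 ?vp2 ?qp3 ?up2 ?vp1 ?up3 ?qp1 ?vp3 ?qp2 ?zp1 ?zp2 ?zp3 ?p1p2 ?p1p3 ?p2p3 ?uq0 ?vq0 ?quv ?qvu ?opprK] | done].
have t15 : cross p1 v = - p3 by first [assumption | rewrite crossC; first [by rewrite ?up1 ?vp2 ?qp3 ?up2 ?vp1 ?up3 ?qp1 ?vp3 ?qp2 ?zp1 ?zp2 ?zp3 ?p1p2 ?p1p3 ?p2p3 ?uq0 ?vq0 ?quv ?qvu ?opprK] | done].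
have t16 : cross p1 q = p2 by first [assumption | rewrite crossC; first [by rewrite ?up1 ?vp2 ?qp3 ?up2 ?vp1 ?up3 ?qp1 ?vp3 ?qp2 ?zp1 ?zp2 ?zp3 ?p1p2 ?p1p3 ?p2p3 ?uq0 ?vq0 ?quv ?qvu ?opprK] | done].
have t20 : cross p2 z = v by first [assumption | rewrite crossC; first [by rewrite ?up1 ?vp2 ?qp3 ?up2 ?vp1 ?up3 ?qp1 ?vp3 ?qp2 ?zp1 ?zp2 ?zp3 ?p1p2 ?p1p3 ?p2p3 ?uq0 ?vq0 ?quv ?qvu ?opprK] | done].
have t21 : cross p2 p1 = q by first [assumption | rewrite crossC; first [by rewrite ?up1 ?vp2 ?qp3 ?up2 ?vp1 ?up3 ?qp1 ?vp3 ?qp2 ?zp1 ?zp2 ?zp3 ?p1p2 ?p1p3 ?p2p3 ?uq0 ?vq0 ?quv ?qvu ?opprK] | done].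
have t22 : cross p2 p2 = 0 by rewrite crossvv.
have t23 : cross p2 p3 = - u by first [assumption | rewrite crossC; first [by rewrite ?up1 ?vp2 ?qp3 ?up2 ?vp1 ?up3 ?qp1 ?vp3 ?qp2 ?zp1 ?zp2 ?zp3 ?p1p2 ?p1p3 ?p2p3 ?uq0 ?vq0 ?quv ?qvu ?opprK] | done].
have t24 : cross p2 u = p3 by first [assumption | rewrite crossC; first [by rewrite ?up1 ?vp2 ?qp3 ?up2 ?vp1 ?up3 ?qp1 ?vp3 ?qp2 ?zp1 ?zp2 ?zp3 ?p1p2 ?p1p3 ?p2p3 ?uq0 ?vq0 ?quv ?qvu ?opprK] | done].
have t25 : cross p2 v = - z by first [assumption | rewrite crossC; first [by rewrite ?up1 ?vp2 ?qp3 ?up2 ?vp1 ?up3 ?qp1 ?vp3 ?qp2 ?zp1 ?zp2 ?zp3 ?p1p2 ?p1p3 ?p2p3 ?uq0 ?vq0 ?quv ?qvu ?opprK] | done].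
have t26 : cross p2 q = - p1 by first [assumption | rewrite crossC; first [by rewrite ?up1 ?vp2 ?qp3 ?up2 ?vp1 ?up3 ?qp1 ?vp3 ?qp2 ?zp1 ?zp2 ?zp3 ?p1p2 ?p1p3 ?p2p3 ?uq0 ?vq0 ?quv ?qvu ?opprK] | done].
have t30 : cross p3 z = q by first [assumption | rewrite crossC; first [by rewrite ?up1 ?vp2 ?qp3 ?up2 ?vp1 ?up3 ?qp1 ?vp3 ?qp2 ?zp1 ?zp2 ?zp3 ?p1p2 ?p1p3 ?p2p3 ?uq0 ?vq0 ?quv ?qvu ?opprK] | done].
have t31 : cross p3 p1 = - v by first [assumption | rewrite crossC; first [by rewrite ?up1 ?vp2 ?qp3 ?up2 ?vp1 ?up3 ?qp1 ?vp3 ?qp2 ?zp1 ?zp2 ?zp3 ?p1p2 ?p1p3 ?p2p3 ?uq0 ?vq0 ?quv ?qvu ?opprK] | done].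
have t32 : cross p3 p2 = u by first [assumption | rewrite crossC; first [by rewrite ?up1 ?vp2 ?qp3 ?up2 ?vp1 ?up3 ?qp1 ?vp3 ?qp2 ?zp1 ?zp2 ?zp3 ?p1p2 ?p1p3 ?p2p3 ?uq0 ?vq0 ?quv ?qvu ?opprK] | done].
have t33 : cross p3 p3 = 0 by rewrite crossvv.
have t34 : cross p3 u = - p2 by first [assumption | rewrite crossC; first [by rewrite ?up1 ?vp2 ?qp3 ?up2 ?vp1 ?up3 ?qp1 ?vp3 ?qp2 ?zp1 ?zp2 ?zp3 ?p1p2 ?p1p3 ?p2p3 ?uq0 ?vq0 ?quv ?qvu ?opprK] | done].
have t35 : cross p3 v = p1 by first [assumption | rewrite crossC; first [by rewrite ?up1 ?vp2 ?qp3 ?up2 ?vp1 ?up3 ?qp1 ?vp3 ?qp2 ?zp1 ?zp2 ?zp3 ?p1p2 ?p1p3 ?p2p3 ?uq0 ?vq0 ?quv ?qvu ?opprK] | done].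
have t36 : cross p3 q = - z by first [assumption | rewrite crossC; first [by rewrite ?up1 ?vp2 ?qp3 ?up2 ?vp1 ?up3 ?qp1 ?vp3 ?qp2 ?zp1 ?zp2 ?zp3 ?p1p2 ?p1p3 ?p2p3 ?uq0 ?vq0 ?quv ?qvu ?opprK] | done].
have t40 : cross u z = - p1 by first [assumption | rewrite crossC; first [by rewrite ?up1 ?vp2 ?qp3 ?up2 ?vp1 ?up3 ?qp1 ?vp3 ?qp2 ?zp1 ?zp2 ?zp3 ?p1p2 ?p1p3 ?p2p3 ?uq0 ?vq0 ?quv ?qvu ?opprK] | done].
have t41 : cross u p1 = z by first [assumption | rewrite crossC; first [by rewrite ?up1 ?vp2 ?qp3 ?up2 ?vp1 ?up3 ?qp1 ?vp3 ?qp2 ?zp1 ?zp2 ?zp3 ?p1p2 ?p1p3 ?p2p3 ?uq0 ?vq0 ?quv ?qvu ?opprK] | done].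
have t42 : cross u p2 = - p3 by first [assumption | rewrite crossC; first [by rewrite ?up1 ?vp2 ?qp3 ?up2 ?vp1 ?up3 ?qp1 ?vp3 ?qp2 ?zp1 ?zp2 ?zp3 ?p1p2 ?p1p3 ?p2p3 ?uq0 ?vq0 ?quv ?qvu ?opprK] | done].
have t43 : cross u p3 = p2 by first [assumption | rewrite crossC; first [by rewrite ?up1 ?vp2 ?qp3 ?up2 ?vp1 ?up3 ?qp1 ?vp3 ?qp2 ?zp1 ?zp2 ?zp3 ?p1p2 ?p1p3 ?p2p3 ?uq0 ?vq0 ?quv ?qvu ?opprK] | done].
have t44 : cross u u = 0 by rewrite crossvv.
have t45 : cross u v = q by first [assumption | rewrite crossC; first [by rewrite ?up1 ?vp2 ?qp3 ?up2 ?vp1 ?up3 ?qp1 ?vp3 ?qp2 ?zp1 ?zp2 ?zp3 ?p1p2 ?p1p3 ?p2p3 ?uq0 ?vq0 ?quv ?qvu ?opprK] | done].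
have t46 : cross u q = - v by first [assumption | rewrite crossC; first [by rewrite ?up1 ?vp2 ?qp3 ?up2 ?vp1 ?up3 ?qp1 ?vp3 ?qp2 ?zp1 ?zp2 ?zp3 ?p1p2 ?p1p3 ?p2p3 ?uq0 ?vq0 ?quv ?qvu ?opprK] | done].
have t50 : cross v z = - p2 by first [assumption | rewrite crossC; first [by rewrite ?up1 ?vp2 ?qp3 ?up2 ?vp1 ?up3 ?qp1 ?vp3 ?qp2 ?zp1 ?zp2 ?zp3 ?p1p2 ?p1p3 ?p2p3 ?uq0 ?vq0 ?quv ?qvu ?opprK] | done].
have t51 : cross v p1 = p3 by first [assumption | rewrite crossC; first [by rewrite ?up1 ?vp2 ?qp3 ?up2 ?vp1 ?up3 ?qp1 ?vp3 ?qp2 ?zp1 ?zp2 ?zp3 ?p1p2 ?p1p3 ?p2p3 ?uq0 ?vq0 ?quv ?qvu ?opprK] | done].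
have t52 : cross v p2 = z by first [assumption | rewrite crossC; first [by rewrite ?up1 ?vp2 ?qp3 ?up2 ?vp1 ?up3 ?qp1 ?vp3 ?qp2 ?zp1 ?zp2 ?zp3 ?p1p2 ?p1p3 ?p2p3 ?uq0 ?vq0 ?quv ?qvu ?opprK] | done].
have t53 : cross v p3 = - p1 by first [assumption | rewrite crossC; first [by rewrite ?up1 ?vp2 ?qp3 ?up2 ?vp1 ?up3 ?qp1 ?vp3 ?qp2 ?zp1 ?zp2 ?zp3 ?p1p2 ?p1p3 ?p2p3 ?uq0 ?vq0 ?quv ?qvu ?opprK] | done].
have t54 : cross v u = - q by first [assumption | rewrite crossC; first [by rewrite ?up1 ?vp2 ?qp3 ?up2 ?vp1 ?up3 ?qp1 ?vp3 ?qp2 ?zp1 ?zp2 ?zp3 ?p1p2 ?p1p3 ?p2p3 ?uq0 ?vq0 ?quv ?qvu ?opprK] | done].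
have t55 : cross v v = 0 by rewrite crossvv.
have t56 : cross v q = u by first [assumption | rewrite crossC; first [by rewrite ?up1 ?vp2 ?qp3 ?up2 ?vp1 ?up3 ?qp1 ?vp3 ?qp2 ?zp1 ?zp2 ?zp3 ?p1p2 ?p1p3 ?p2p3 ?uq0 ?vq0 ?quv ?qvu ?opprK] | done].
have t60 : cross q z = - p3 by first [assumption | rewrite crossC; first [by rewrite ?up1 ?vp2 ?qp3 ?up2 ?vp1 ?up3 ?qp1 ?vp3 ?qp2 ?zp1 ?zp2 ?zp3 ?p1p2 ?p1p3 ?p2p3 ?uq0 ?vq0 ?quv ?qvu ?opprK] | done].
have t61 : cross q p1 = - p2 by first [assumption | rewrite crossC; first [by rewrite ?up1 ?vp2 ?qp3 ?up2 ?vp1 ?up3 ?qp1 ?vp3 ?qp2 ?zp1 ?zp2 ?zp3 ?p1p2 ?p1p3 ?p2p3 ?uq0 ?vq0 ?quv ?qvu ?opprK] | done].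
have t62 : cross q p2 = p1 by first [assumption | rewrite crossC; first [by rewrite ?up1 ?vp2 ?qp3 ?up2 ?vp1 ?up3 ?qp1 ?vp3 ?qp2 ?zp1 ?zp2 ?zp3 ?p1p2 ?p1p3 ?p2p3 ?uq0 ?vq0 ?quv ?qvu ?opprK] | done].
have t63 : cross q p3 = z by first [assumption | rewrite crossC; first [by rewrite ?up1 ?vp2 ?qp3 ?up2 ?vp1 ?up3 ?qp1 ?vp3 ?qp2 ?zp1 ?zp2 ?zp3 ?p1p2 ?p1p3 ?p2p3 ?uq0 ?vq0 ?quv ?qvu ?opprK] | done].
have t64 : cross q u = v by first [assumption | rewrite crossC; first [by rewrite ?up1 ?vp2 ?qp3 ?up2 ?vp1 ?up3 ?qp1 ?vp3 ?qp2 ?zp1 ?zp2 ?zp3 ?p1p2 ?p1p3 ?p2p3 ?uq0 ?vq0 ?quv ?qvu ?opprK] | done].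
have t65 : cross q v = - u by first [assumption | rewrite crossC; first [by rewrite ?up1 ?vp2 ?qp3 ?up2 ?vp1 ?up3 ?qp1 ?vp3 ?qp2 ?zp1 ?zp2 ?zp3 ?p1p2 ?p1p3 ?p2p3 ?uq0 ?vq0 ?quv ?qvu ?opprK] | done].
have t66 : cross q q = 0 by rewrite crossvv.
move=> x y; have fE t : frame_mx s *m t = co t 0 *: z + (co t 1 *: p1 + (co t 2 *: p2 + (co t 3 *: p3 +
    (co t 4 *: u + (co t 5 *: v + co t 6 *: q))))).
  by apply: co_eq; rewrite co_mul !en_frame// !coE sE /=; ring.
rewrite !fE !crossE !(crossDl, crossDr, crossZl, crossZr) t00 t01 t02 t03 t04 t05 t06 t10 t11 t12 t13 t14 t15 t16 t20 t21 t22 t23 t24 t25 t26 t30 t31 t32 t33 t34 t35 t36 t40 t41 t42 t43 t44 t45 t46 t50 t51 t52 t53 t54 t55 t56 t60 t61 t62 t63 t64 t65 t66.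

clearbody p1 p2 p3 q.
by apply/colP => i; rewrite !mxE; ring.
Qed.

End Frames.

Section AssociativePlanes.
Variable R : realType.
Local Notation vec := 'cV[R]_7.
Implicit Types (u v w z : vec) (f g Q : 'M[R]_7) (A E : {vspace vec}).

Definition frame_proj f : 'M[R]_7 := f *m P0 R *m f^T.

Definition frame_plane f : {vspace vec} :=
  <<[:: col (inord 4) f; col (inord 5) f; col (inord 6) f]>>%VS.

Lemma span2P u v w : reflect (exists a b, w = a *: u + b *: v) (w \in <<[:: u; v]>>%VS).
Proof.
rewrite span_cons span_seq1; apply: (iffP memv_addP) => [[x /vlineP[a ->] [y /vlineP[b ->] ->]]|[a [b ->]]].
  by exists a, b.
by exists (a *: u); [by apply/vlineP; exists a|exists (b *: v) => //; by apply/vlineP; exists b].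
Qed.

Lemma span3P u v t w :
  reflect (exists a b c, w = a *: u + (b *: v + c *: t)) (w \in <<[:: u; v; t]>>%VS).
Proof.
rewrite span_cons; apply: (iffP memv_addP) => [[x /vlineP[a ->] [y /span2P[b [c ->]] ->]]|[a [b [c ->]]]].
  by exists a, b, c.
exists (a *: u); first by apply/vlineP; exists a.
by exists (b *: v + c *: t) => //; apply/span2P; exists b, c.
Qed.

Lemma P0_tr : (P0 R)^T = P0 R.
Proof. by apply/matrixP => i j; rewrite !mxE (eq_sym j i); case: (i =P j) => [->|_]. Qed.

Lemma P0_idem : P0 R *m P0 R = P0 R.
Proof.
apply: en_eq => i j i7 j7; rewrite en_P0l//.
by rewrite /en !mxE inordK//; case: (_ == _); case: (_ <= _)%N; rewrite ?mul0r ?mul1r.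
Qed.

Lemma frame_proj_tr f : (frame_proj f)^T = frame_proj f.
Proof. by rewrite /frame_proj !trmx_mul trmxK P0_tr mulmxA. Qed.

Lemma frame_proj_idem f : f^T *m f = 1%:M -> frame_proj f *m frame_proj f = frame_proj f.
Proof.
move=> ff; rewrite /frame_proj -!mulmxA (mulmxA f^T) ff mul1mx (mulmxA (P0 R) (P0 R)).
by rewrite P0_idem.
Qed.

Lemma co_P0 w n : (n < 7)%N -> co (P0 R *m w) n = (4 <= n)%:R * co w n.
Proof.
move=> n7; rewrite /co mxE (bigD1 (inord n))//= big1 => [|l li]; first by rewrite addr0 mxE eqxx inordK.
by rewrite mxE eq_sym (negbTE li) mul0r.
Qed.

Lemma frame_mul f w : f *m w = co w 0 *: col (inord 0) f + (co w 1 *: col (inord 1) f +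
  (co w 2 *: col (inord 2) f + (co w 3 *: col (inord 3) f + (co w 4 *: col (inord 4) f +
  (co w 5 *: col (inord 5) f + co w 6 *: col (inord 6) f))))).
Proof. by apply/colP => i; rewrite mxE sum7 !mxE /co; ring. Qed.

Lemma frame_planeP f w : f^T *m f = 1%:M ->
  reflect (frame_proj f *m w = w) (w \in frame_plane f).
Proof.
move=> ff; apply: (iffP (span3P _ _ _ _)) => [[a [b [c ->]]]|H].
  have E (t : vec) : P0 R *m t = t -> frame_proj f *m (f *m t) = f *m t.
    by move=> Pt; rewrite /frame_proj -!mulmxA (mulmxA f^T) ff mul1mx Pt.
  have -> : a *: col (inord 4) f + (b *: col (inord 5) f + c *: col (inord 6) f) =
      f *m (a *: ev R 4 + (b *: ev R 5 + c *: ev R 6)).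
    by rewrite !mulmxDr -!scalemxAr /ev -!colE.
  apply: E; apply: co_eq; rewrite co_P0// ?mul1r//= mul0r !coE !co_ev//=; ring.
pose t := P0 R *m (f^T *m w).
exists (co t 4), (co t 5), (co t 6).
have wE : w = f *m t by rewrite -{1}H /frame_proj -!mulmxA.
rewrite {1}wE frame_mul [co t 0]co_P0// [co t 1]co_P0// [co t 2]co_P0// [co t 3]co_P0//=.
by rewrite !mul0r !scale0r !add0r.
Qed.

Lemma dot0r w : dot w 0 = 0. Proof. by rewrite /dot mulmx0 mxE. Qed.

Lemma orthonormal3_dim u v t : dot u u = 1 -> dot v v = 1 -> dot t t = 1 ->
  dot u v = 0 -> dot u t = 0 -> dot v t = 0 -> \dim <<[:: u; v; t]>>%VS = 3.
Proof.
move=> uu vv tt uv ut vt.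
have -> : \dim <<[:: u; v; t]>>%VS = size [:: u; v; t].
  apply/eqP; rewrite -/(free _) !free_cons; apply/and3P; split.
  - apply/negP => /span2P[a [b E]]; have := uu; rewrite {2}E dotDr !dotZr uv ut.
    by rewrite !mulr0 addr0 => /esym/eqP; rewrite oner_eq0.
  - apply/negP; rewrite span_seq1 => /vlineP[a E]; have := vv; rewrite {2}E dotZr vt.
    by rewrite mulr0 => /esym/eqP; rewrite oner_eq0.
  - rewrite nil_free andbT span_nil memv0; apply/eqP => E; have := tt.
    by rewrite {2}E dot0r => /esym/eqP; rewrite oner_eq0.
by [].
Qed.

Lemma dot_col f i j : (i < 7)%N -> (j < 7)%N ->
  dot (col (inord i) f) (col (inord j) f) = en (f^T *m f) i j.
Proof. by move=> i7 j7; rewrite !colE dot_mul mulmxA dot_ev. Qed.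

Lemma frame_plane_dim f : f^T *m f = 1%:M -> \dim (frame_plane f) = 3.
Proof.
move=> ff; have E i j : (i < 7)%N -> (j < 7)%N ->
    dot (col (inord i) f) (col (inord j) f) = (i == j)%:R.
  by move=> i7 j7; rewrite dot_col// ff /en mxE -val_eqE/= !inordK.
by apply: orthonormal3_dim; rewrite E.
Qed.

Lemma P0_cross u v : P0 R *m u = u -> P0 R *m v = v -> P0 R *m cross u v = cross u v.
Proof.
move=> Pu Pv.
have z (t : vec) n : P0 R *m t = t -> (n < 4)%N -> co t n = 0.
  by move=> <- n4; rewrite co_P0 ?(ltn_trans n4)// leqNgt n4 mul0r.
have zu n := z u n Pu; have zv n := z v n Pv.
apply: co_eq; rewrite co_P0//= ?mul1r// mul0r crossE.
all: by rewrite ?(zu 0%N)// ?(zu 1%N)// ?(zu 2%N)// ?(zu 3%N)// ?(zv 0%N)// ?(zv 1%N)// ?(zv 2%N)// ?(zv 3%N)//; ring.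
Qed.

Lemma P0_assoc u v w : P0 R *m u = u -> P0 R *m v = v -> P0 R *m w = w ->
  cross u (cross v w) - dot v w *: u = cross (cross u v) w - dot u v *: w.
Proof.
have z (t : vec) n : P0 R *m t = t -> (n < 4)%N -> co t n = 0.
  by move=> <- n4; rewrite co_P0 ?(ltn_trans n4)// leqNgt n4 mul0r.
move=> /z Pu /z Pv /z Pw.
apply: co_eq; rewrite !(coE, crossE) !dotE ?(Pu 0%N)// ?(Pu 1%N)// ?(Pu 2%N)// ?(Pu 3%N)//
 ?(Pv 0%N)// ?(Pv 1%N)// ?(Pv 2%N)// ?(Pv 3%N)// ?(Pw 0%N)// ?(Pw 1%N)// ?(Pw 2%N)// ?(Pw 3%N)//; ring.
Qed.

Lemma frame_proj_fix f u : G2 f -> frame_proj f *m u = u -> P0 R *m (f^T *m u) = f^T *m u.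
Proof. by move=> Gf H; rewrite -[in RHS]H /frame_proj !mulmxA G2_orth// mul1mx. Qed.

Lemma frame_fixK f u : G2 f -> f *m (f^T *m u) = u.
Proof. by move=> Gf; rewrite mulmxA G2_orthr// mul1mx. Qed.

Lemma frame_cross f u v : G2 f -> frame_proj f *m u = u -> frame_proj f *m v = v ->
  frame_proj f *m cross u v = cross u v.
Proof.
move=> Gf /(frame_proj_fix Gf) Pu /(frame_proj_fix Gf) Pv.
by rewrite /frame_proj -!mulmxA (G2_cross _ _ (G2_tr Gf)) P0_cross// G2_cross// !frame_fixK.
Qed.

Lemma frame_assoc f u v w : G2 f -> frame_proj f *m u = u -> frame_proj f *m v = v ->
  frame_proj f *m w = w ->
  cross u (cross v w) - dot v w *: u = cross (cross u v) w - dot u v *: w.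
Proof.
move=> Gf /(frame_proj_fix Gf) Pu /(frame_proj_fix Gf) Pv /(frame_proj_fix Gf) Pw.
have := congr1 (mulmx f) (P0_assoc Pu Pv Pw).
rewrite !mulmxBr -!scalemxAr !G2_cross// !frame_fixK//.
by rewrite !dot_mul trmxK !frame_fixK.
Qed.

Definition frame_algebra_mx f : 'M[R]_(7, 1 + 7) := row_mx 0 (1%:M - frame_proj f).

(** The octonions with imaginary part in the plane; a kernel, so that
    membership is an equation. *)
Definition frame_algebra f : {vspace oct R} := lker (linfun (mulmx (frame_algebra_mx f))).

Lemma frame_algebraP f (x : oct R) :
  reflect (frame_proj f *m oim x = oim x) (x \in frame_algebra f).
Proof.
have E : frame_algebra_mx f *m x = oim x - frame_proj f *m oim x.
  by rewrite -{1}[x]vsubmxK mul_row_col mul0mx add0r mulmxBl mul1mx.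
rewrite memv_ker lfunE /= E subr_eq0.
by apply: (iffP eqP) => /esym.
Qed.

(** The span of e_5, e_6, e_7 is closed under the cross product and carries
    the quaternion algebra, and G_2 acts by automorphisms. *)
Lemma frame_plane_associative f : G2 f -> associative_plane (frame_plane f).
Proof.
move=> Gf; have ff := G2_orth Gf; split; first exact: frame_plane_dim.
have gen (x : oct R) : oct_generated (frame_plane f) x -> frame_proj f *m oim x = oim x.
  move=> H; apply/frame_algebraP/H; first split.
  - by apply/frame_algebraP; rewrite oim_one mulmx0.
  - move=> a b /frame_algebraP fa /frame_algebraP fb; apply/frame_algebraP.
    by rewrite oim_mul !mulmxDr -!scalemxAr fa fb frame_cross.
  - by move=> u /(frame_planeP _ ff) fu; apply/frame_algebraP; rewrite oim_im.
move=> x y z /gen fx /gen fy /gen fz.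
apply: oct_eq.
  rewrite !ore_mul !oim_mul ?ore_mul !(dotDl, dotDr, dotZl, dotZr) cross_dot; ring.
rewrite !oim_mul !ore_mul !(crossDl, crossDr, crossZl, crossZr).
move: (frame_assoc Gf fx fy fz) => /eqP; rewrite subr_eq => /eqP ->.
by apply: co_eq; rewrite !coE; ring.
Qed.

(** Take w in A orthogonal to u and v. Imaginary octonions orthogonal to
    each other anticommute, so associativity of u, v and w forces (u x v) x
    w to equal its opposite. Then w is proportional to u x v. *)
Lemma associative_cross A u v : associative_plane A -> u \in A -> v \in A ->
  dot u u = 1 -> dot v v = 1 -> dot u v = 0 -> cross u v \in A.
Proof.
move=> [dA assA] uA vA uu vv uv.
have vu : dot v u = 0 by rewrite dotC.
(* A third direction exists because A has dimension 3. *)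
have [w wA [w0 [wu wv]]] : exists2 w, w \in A & w != 0 /\ (dot w u = 0 /\ dot w v = 0).
  have : ~~ (A <= <<[:: u; v]>>)%VS.
    apply/negP => /dimvS; rewrite dA => /leq_trans/(_ (dim_span _)).
    by [].
  move=> /subvPn[t tA tn].
  exists (t - dot t u *: u - dot t v *: v).
    by rewrite !rpredB ?rpredZ.
  split; last first.
    rewrite -!scaleNr !dotDl !dotZl uu vv uv vu !mulr0 !mulr1 !addr0.
    by rewrite !subrr.
  apply/negP => /eqP E; move/negP: tn; apply; apply/span2P; exists (dot t u), (dot t v).
  by apply/eqP; rewrite -subr_eq0 opprD addrA E.
set q := cross u v.
have inA (t : vec) : t \in A -> oct_generated A (oct_im t) by move=> tA S _ /(_ t tA).
have := congr1 (@oim R) (assA _ _ _ (inA u uA) (inA v vA) (inA w wA)).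
rewrite !(oim_mul, ore_mul, oim_im, ore_im, mul0r, sub0r, scale0r, add0r).
rewrite (dotC v w) wv uv !oppr0 !scale0r !add0r => H1.
have uw : dot u w = 0 by rewrite dotC.
have vw : dot v w = 0 by rewrite dotC.
have zero (a : vec) : a = - a -> a = 0.
  by move/eqP; rewrite -addr_eq0 -mulr2n -scaler_nat scaler_eq0 pnatr_eq0 => /eqP.
have anti (x y t : vec) : dot x y = 0 -> dot x t = 0 -> dot y t = 0 -> cross x (cross y t) = - cross y (cross x t).
  move=> xy xt yt; apply/eqP; rewrite -addr_eq0 cross_cross xy xt yt mulr0 oppr0 !scale0r !addr0.
  by [].
have cNr (x y : vec) : cross x (- y) = - cross x y by rewrite -scaleN1r crossZr scaleN1r.
have qw0 : cross q w = 0.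
  apply: zero; rewrite -{1}H1.
  by rewrite (crossC w q) opprK /q [RHS]anti// (crossC v w) cNr opprK.
have qq : dot q q = 1.
  by rewrite {1}/q cross_dot /q (crossC v u) cNr cross_sq vu vv scale0r addr0 scaleN1r opprK.
have := cross_sq q w; rewrite qw0 qq => H.
have c0 : cross q 0 = 0 by have := crossZr 0 q q; rewrite !scale0r.
have wE : w = dot q w *: q.
  by move: H; rewrite c0 scaleN1r => /esym/eqP; rewrite addrC subr_eq0 => /eqP.
have qw_neq0 : dot q w != 0.
  by apply: contraNneq w0 => E; rewrite wE E scale0r.
have -> : q = (dot q w)^-1 *: w by rewrite {2}wE scalerA mulVf// scale1r.
exact: rpredZ.
Qed.

(** So an associative plane is determined by any two of its orthonormal
    vectors. *)
Lemma associative_planeE A u v : associative_plane A -> u \in A -> v \in A ->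
  dot u u = 1 -> dot v v = 1 -> dot u v = 0 -> A = <<[:: u; v; cross u v]>>%VS.
Proof.
move=> aA uA vA uu vv uv.
have qA := associative_cross aA uA vA uu vv uv.
have cNr (x y : vec) : cross x (- y) = - cross x y by rewrite -scaleN1r crossZr scaleN1r.
apply/esym/eqP; rewrite eqEdim; apply/andP; split.
  by apply/span_subvP => x; rewrite !inE => /or3P[] /eqP ->.
have [-> _] := aA; rewrite orthonormal3_dim//.
- by rewrite cross_dot (crossC v u) cNr cross_sq (dotC v u) uv vv scale0r addr0 scaleN1r opprK.
- by rewrite -cross_dot crossvv dotC dot0r.
- by rewrite dotC cross_dot crossvv dot0r.
Qed.

Lemma exists_normal u v t : exists z, dot z z = 1 /\ [/\ dot z u = 0, dot z v = 0 & dot z t = 0].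
Proof.
pose M : 'M[R]_(7, 1 + (1 + 1)) := row_mx u (row_mx v t : 'M[R]_(7, 1 + 1)).
have : kermx M != 0.
  rewrite -mxrank_eq0 mxrank_ker -lt0n subn_gt0.
  exact: leq_ltn_trans (rank_leq_col _) _.
move=> /rowV0Pn[x /sub_kermxP xM x0].
pose y := x^T; have y0 : y != 0 by apply: contraNneq x0 => /(congr1 trmx); rewrite trmxK trmx0 => ->.
have yd : [/\ dot y u = 0, dot y v = 0 & dot y t = 0].
  move: xM; rewrite /M !mul_mx_row -(@row_mx0 _ 1 1 2) => /eq_row_mx[e1].
  rewrite -(@row_mx0 _ 1 1 1) => /eq_row_mx[e2 e3].
  by split; rewrite /dot /y trmxK ?e1 ?e2 ?e3 mxE.
have yy : 0 < dot y y.
  by rewrite lt_neqAle dot_ge0 andbT eq_sym; apply: contra y0 => /eqP/dot_eq0 ->.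
exists ((Num.sqrt (dot y y))^-1 *: y); rewrite !dotZl dotZr; split.
  rewrite mulrA -expr2 exprVn sqr_sqrtr ?dot_ge0// mulVf// gt_eqF//.
by have [-> -> ->] := yd; rewrite !mulr0.
Qed.

Lemma exists_frame u v : dot u u = 1 -> dot v v = 1 -> dot u v = 0 ->
  exists f, [/\ G2 f, col (inord 4) f = u, col (inord 5) f = v & col (inord 6) f = cross u v].
Proof.
move=> uu vv uv; have [z [zz [zu zv zq]]] := exists_normal u v (cross u v).
exists (frame_mx (frame_cols u v z)); split; first exact: frame_G2.
all: by apply/colP => i; rewrite [LHS]mxE [LHS]mxE inordK.
Qed.

Lemma gram_schmidt (p q : vec) : \dim <<[:: p; q]>>%VS = 2 -> exists u v,
  [/\ dot u u = 1, dot v v = 1, dot u v = 0 & <<[:: p; q]>>%VS = <<[:: u; v]>>%VS].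
Proof.
move=> d2.
have fr : free [:: p; q] by rewrite /free d2.
move: (fr); rewrite free_cons => /andP[pq]; rewrite free_cons => /andP[q0 _].
rewrite span_nil memv0 in q0.
have norm (y : vec) : y != 0 -> exists2 a : R, a != 0 & dot (a *: y) (a *: y) = 1.
  move=> y0; have yy : 0 < dot y y.
    by rewrite lt_neqAle dot_ge0 andbT eq_sym; apply: contra y0 => /eqP/dot_eq0 ->.
  exists (Num.sqrt (dot y y))^-1; first by rewrite invr_eq0 gt_eqF// sqrtr_gt0.
  by rewrite dotZl dotZr mulrA -expr2 exprVn sqr_sqrtr ?dot_ge0// mulVf// gt_eqF.
have [a a0 vv] := norm _ q0; set v := a *: q in vv.
pose p' := p - dot p v *: v.
have p'0 : p' != 0.
  apply: contraNneq pq => /eqP; rewrite subr_eq0 => /eqP ->.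
  by rewrite span_seq1 !rpredZ// memv_line.
have [b b0 uu] := norm _ p'0.
exists (b *: p'), v; split=> //.
  by rewrite dotZl /p' dotDl -scaleNr dotZl vv mulr1 subrr mulr0.
apply/eqP; rewrite eqEsubv; apply/andP; split; apply/span_subvP => x; rewrite !inE => /orP[] /eqP ->.
- apply/span2P; exists b^-1, (dot p v); rewrite scalerA mulVf// scale1r /p' subrK//.
- by apply/span2P; exists 0, a^-1; rewrite scale0r add0r /v scalerA mulVf// scale1r.
- apply/span2P; exists b, (- (b * (dot p v * a))).
  by rewrite /p' /v scalerBr !scalerA scaleNr !mulrA.
- by apply/span2P; exists 0, a; rewrite scale0r add0r.
Qed.

Lemma assoc_extE f E : G2 f -> \dim E = 2 -> (E <= frame_plane f)%VS ->
  (exists p q, E = <<[:: p; q]>>%VS) -> assoc_ext E = frame_plane f.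
Proof.
move=> Gf dE Ef [p [q Epq]]; rewrite Epq in dE.
have [u [v [uu vv uv Euv]]] := gram_schmidt dE.
have uE : u \in E by rewrite Epq Euv; apply/span2P; exists 1, 0; rewrite scale1r scale0r addr0.
have vE : v \in E by rewrite Epq Euv; apply/span2P; exists 0, 1; rewrite scale1r scale0r add0r.
have H A : associative_plane A -> (E <= A)%VS -> A = <<[:: u; v; cross u v]>>%VS.
  by move=> aA /subvP EA; apply: associative_planeE => //; exact: EA.
rewrite (H _ (frame_plane_associative Gf) Ef) /assoc_ext; apply: xget_unique.
  split; rewrite -(H _ (frame_plane_associative Gf) Ef)//.
  exact: frame_plane_associative.
by move=> B [aB EB]; exact: H.
Qed.

Lemma exists_adapted E : \dim E = 2 -> (exists p q, E = <<[:: p; q]>>%VS) ->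
  exists2 f, G2 f & (E <= frame_plane f)%VS /\ assoc_ext E = frame_plane f.
Proof.
move=> dE [p [q Epq]]; have dE' := dE; rewrite Epq in dE'.
have [u [v [uu vv uv Euv]]] := gram_schmidt dE'.
have [f [Gf f4 f5 f6]] := exists_frame uu vv uv.
have Ef : (E <= frame_plane f)%VS.
  rewrite Epq Euv; apply/span_subvP => x; rewrite !inE => /orP[] /eqP ->; apply/span3P.
    by exists 1, 0, 0; rewrite f4 scale1r !scale0r !addr0.
  by exists 0, 1, 0; rewrite f5 scale1r !scale0r addr0 add0r.
by exists f => //; split=> //; apply: assoc_extE => //; exists p, q.
Qed.

End AssociativePlanes.

(** * Projections onto Gauss planes and curves in G_2 *)

Section OrthProj.
Variable R : realType.
Local Notation vec := 'cV[R]_7.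

(** Both matrices are symmetric and have the same image, which each of them
    fixes. *)
Lemma orth_projE (A : {vspace vec}) (Q : 'M[R]_7) : Q^T = Q -> Q *m Q = Q ->
  (forall v, reflect (Q *m v = v) (v \in A)) -> orth_proj A = Q.
Proof.
move=> QT QQ AQ; rewrite /orth_proj.
set M := \matrix_(i, j) _.
have McolE (c : 'cV[R]_(\dim A)) : M *m c = \sum_j c j ord0 *: (vbasis A)`_j.
  apply/colP => i; rewrite mxE summxE; apply: eq_bigr => j _.
  by rewrite !mxE mulrC.
have colA j : (vbasis A)`_j \in A by case: (ltnP j (\dim A)) => ja;
  [apply: vbasis_mem; rewrite mem_nth ?size_tuple|rewrite nth_default ?size_tuple// mem0v].
have QM : Q *m M = M.
  apply/matrixP => i j; have /AQ/(congr1 (fun x : vec => x i ord0)) := colA j.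
  rewrite !mxE => <-; apply: eq_bigr => l _; by rewrite !mxE.
have MQ : exists C, Q = M *m C.
  exists (\matrix_(j, k) coord (vbasis A) j (col k Q)).
  apply/matrixP => i k.
  have qA : col k Q \in A by apply/AQ; rewrite colE mulmxA QQ.
  have := coord_vbasis qA => /(congr1 (fun x : vec => x i ord0)).
  rewrite mxE => ->; rewrite summxE mxE; apply: eq_bigr => j _.
  by rewrite !mxE mulrC.
have MMu : M^T *m M \in unitmx.
  rewrite -row_free_unit; apply: inj_row_free => x xM.
  have : M *m x^T = 0.
    apply: dot_eq0; rewrite /dot trmx_mul trmxK -mulmxA (mulmxA M^T).
    by rewrite mulmxA xM mul0mx mxE.
  rewrite McolE => S0; apply/rowP => j; rewrite !mxE.
  have /freeP/(_ (fun j => x^T j ord0) S0 j) := basis_free (vbasisP A).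
  by rewrite mxE.
set P := _ *m M^T.
have PT : P^T = P by rewrite /P !trmx_mul trmxK trmx_inv trmx_mul trmxK mulmxA.
have QP : Q *m P = P by rewrite /P !mulmxA QM.
have PQ : P *m Q = Q.
  by have [C ->] := MQ; rewrite /P -!mulmxA (mulmxA M^T) mulKmx.
by rewrite -QP -[LHS]trmxK trmx_mul PT QT PQ QT.
Qed.

Lemma orth_proj_frame (f : 'M[R]_7) : f^T *m f = 1%:M -> orth_proj (frame_plane f) = frame_proj f.
Proof.
move=> ff; apply: orth_projE; [exact: frame_proj_tr|exact: frame_proj_idem|].
by move=> v; exact: frame_planeP.
Qed.

End OrthProj.

Section Curves.
Variable R : realType.
Local Notation plane := (plane R).
Local Notation vec := 'cV[R]_7.

Definition cross_coef (i : 'I_7) : 'M[R]_7 := \matrix_(k, j) oct_coef R i.+1 j.+1 k.+1.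

Lemma cross_mulE (u v : vec) :
  cross u v = \sum_i (cross_coef i *m v) *m ((delta_mx ord0 i : 'rV_7) *m u).
Proof.
apply/colP => k; rewrite mxE summxE; apply: eq_bigr => i _.
rewrite mxE big_ord1 mxE mulr_suml; apply: eq_bigr => j _.
by rewrite -rowE !mxE mulrAC.
Qed.

Lemma differentiable_cst_mx p q (A : 'M[R]_(p, q)) (m : plane) :
  differentiable (fun _ : plane => A) m.
Proof. exact: smooth_diff (smooth_cst _). Qed.

Lemma differentiable_sum_mx p q n (F : 'I_n -> plane -> 'M[R]_(p, q)) m :
  (forall i, differentiable (F i) m) -> differentiable (fun z => \sum_i F i z) m.
Proof.
move=> dF; have -> : (fun z => \sum_(i < n) F i z) = \sum_(i < n) F i.
  by apply/funext => z; rewrite fct_sumE.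
exact: differentiable_sum.
Qed.

Lemma partial_mulmx_cstl p q r j (A : 'M[R]_(p, q)) (g : plane -> 'M[R]_(q, r)) m :
  differentiable g m -> partial j (fun z => A *m g z) m = A *m partial j g m.
Proof.
move=> dg; apply: (etrans (partial_mulmx j (differentiable_cst_mx A m) dg)).
by rewrite partial_cst mul0mx add0r.
Qed.

Lemma partial_mulmx_cstr p q r j (A : 'M[R]_(q, r)) (g : plane -> 'M[R]_(p, q)) m :
  differentiable g m -> partial j (fun z => g z *m A) m = partial j g m *m A.
Proof.
move=> dg; apply: (etrans (partial_mulmx j dg (differentiable_cst_mx A m))).
by rewrite partial_cst mulmx0 addr0.
Qed.

Lemma differentiable_mulmx_cstl p q r (A : 'M[R]_(p, q)) (g : plane -> 'M[R]_(q, r)) m :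
  differentiable g m -> differentiable (fun z => A *m g z) m.
Proof. exact: differentiable_mulmx (differentiable_cst_mx A m). Qed.

Lemma differentiable_mulmx_cstr p q r (A : 'M[R]_(q, r)) (g : plane -> 'M[R]_(p, q)) m :
  differentiable g m -> differentiable (fun z => g z *m A) m.
Proof. by move=> dg; apply: differentiable_mulmx => //; exact: differentiable_cst_mx. Qed.

Lemma differentiable_cross (f g : plane -> vec) m : differentiable f m -> differentiable g m ->
  differentiable (fun z => cross (f z) (g z)) m.
Proof.
move=> df dg; under eq_fun do rewrite cross_mulE.
apply: differentiable_sum_mx => i; apply: differentiable_mulmx; exact: differentiable_mulmx_cstl.
Qed.

Lemma partial_cross j (f g : plane -> vec) m : differentiable f m -> differentiable g m ->
  partial j (fun z => cross (f z) (g z)) m = cross (partial j f m) (g m) + cross (f m) (partial j g m).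
Proof.
move=> df dg; under eq_fun do rewrite cross_mulE.
have d1 i := differentiable_mulmx_cstl (cross_coef i) dg.
have d2 i := differentiable_mulmx_cstl (delta_mx ord0 i : 'rV[R]_7) df.
rewrite partial_sum => [|i]; last exact: differentiable_mulmx.
rewrite !cross_mulE -big_split/=; apply: eq_bigr => i _.
apply: (etrans (partial_mulmx j (d1 i) (d2 i))).
by rewrite (partial_mulmx_cstl j _ dg) (partial_mulmx_cstl j _ df) addrC.
Qed.

(** F F^T and F (F^T u x F^T v) are constant because w is skew and a
    derivation. *)
Lemma G2_of_linear_system (w : 'I_2 -> plane -> 'M[R]_7) (F : plane -> 'M[R]_7) :
  (forall m, differentiable F m) -> (forall j m, partial j F m = F m *m w j m) ->
  (forall j m, der (w j m)) -> G2 (F 0) -> forall m, G2 (F m).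
Proof.
move=> dF pF dw G0.
have dT m : differentiable (fun z => (F z)^T) m by exact: differentiable_trmx.
have pT j m : partial j (fun z => (F z)^T) m = - (w j m *m (F m)^T).
  by rewrite (partial_trmx j (dF m)) pF trmx_mul (dw j m).1 mulNmx.
have FF m : F m *m (F m)^T = 1%:M.
  rewrite -(G2_orthr G0); apply: (partial0_cst_mx (f := fun z => F z *m (F z)^T)).
    by move=> z; exact: differentiable_mulmx.
  move=> j z; apply: (etrans (partial_mulmx j (dF z) (dT z))).
  by rewrite pF pT mulmxN -mulmxA subrr.
move=> m; apply/G2E; split; first exact: mulmx1C.
have key U V : F m *m cross ((F m)^T *m U) ((F m)^T *m V) = cross U V.
  pose h z := F z *m cross ((F z)^T *m U) ((F z)^T *m V).
  have dTU z (W : vec) : differentiable (fun z => (F z)^T *m W) z by exact: differentiable_mulmx_cstr.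
  have dC z : differentiable (fun z => cross ((F z)^T *m U) ((F z)^T *m V)) z.
    exact: differentiable_cross.
  have -> : cross U V = h 0 by rewrite /h G2_cross// !mulmxA G2_orthr// !mul1mx.
  apply: (partial0_cst_mx (f := h)); first by move=> z; exact: differentiable_mulmx.
  move=> j z; apply: (etrans (partial_mulmx j (dF z) (dC z))).
  rewrite (partial_cross j (dTU z U) (dTU z V)) pF.
  rewrite (partial_mulmx_cstr j U (dT z)) (partial_mulmx_cstr j V (dT z)) pT.
  have e (W : vec) : - (w j z *m (F z)^T) *m W = - 1 *: (w j z *m ((F z)^T *m W)).
    by rewrite mulNmx mulmxA scaleN1r.
  rewrite !e crossZl crossZr -scalerDr -(dw j z).2 scaleN1r mulmxN mulmxA subrr.
  by [].
move=> u v; rewrite -[in RHS]key !mulmxA (mulmx1C (FF m)) !mul1mx.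
by [].
Qed.

(** Differentiate the two equations defining G_2. *)
Lemma der_of_G2_curve (F : plane -> 'M[R]_7) j m : (forall z, differentiable F z) ->
  (forall z, G2 (F z)) -> der ((F m)^T *m partial j F m).
Proof.
move=> dF GF; have FF z := G2_orth (GF z).
have dT z : differentiable (fun z => (F z)^T) z by exact: differentiable_trmx.
split=> [|u v].
  apply/eqP; rewrite -addr_eq0 trmx_mul trmxK -(partial_trmx j (dF m)).
  rewrite -(partial_mulmx j (dT m) (dF m)).
  by rewrite (_ : (fun _ => _) = fun=> 1%:M) ?partial_cst//; apply/funext.
have dFu (t : vec) z : differentiable (fun z => F z *m t) z by exact: differentiable_mulmx_cstr.
have pFu (t : vec) : partial j (fun z => F z *m t) m = partial j F m *m t.
  exact: (partial_mulmx_cstr j t (dF m)).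
have E : partial j (fun z => F z *m cross u v) m = partial j (fun z => cross (F z *m u) (F z *m v)) m.
  by congr (partial j _ m); apply/funext => z; exact: G2_cross.
move: E; rewrite (partial_cross j (dFu u m) (dFu v m)) !pFu.
move: (partial j F m) => D E; rewrite -!mulmxA E mulmxDr.
by rewrite !(G2_cross _ _ (G2_tr (GF m))) !mulmxA FF !mul1mx.
Qed.

End Curves.

(** * Conjugacy of commuting pairs in p *)

Section ContinuousMatrices.
Variables (R : realType) (V : normedModType R).

Lemma continuous_sum (I : Type) (r : seq I) (P : pred I) (F : I -> V -> R) :
  (forall i, P i -> continuous (F i)) -> continuous (fun z => \sum_(i <- r | P i) F i z).
Proof.
have cadd : continuous (fun x : R * R => x.1 + x.2) by move=> x; exact: add_continuous.
exact: (@continuous_big R _ +%R 0 P cadd V).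
Qed.

Lemma continuous_mulmx p q r (f : V -> 'M[R]_(p, q)) (g : V -> 'M[R]_(q, r)) :
  continuous f -> continuous g -> continuous (fun z => f z *m g z).
Proof.
move=> /continuous_mxP cf /continuous_mxP cg; apply/continuous_mxP => i j.
under eq_fun do rewrite mxE.
by apply: continuous_sum => l _ z; exact: (continuousM (cf i l z) (cg l j z)).
Qed.

Lemma continuous_trmx p q (f : V -> 'M[R]_(p, q)) : continuous f -> continuous (fun z => (f z)^T).
Proof.
move=> /continuous_mxP cf; apply/continuous_mxP => i j.
by under eq_fun do rewrite mxE; exact: cf.
Qed.

Lemma closed_eq_mx p q (f g : V -> 'M[R]_(p, q)) : continuous f -> continuous g ->
  closed [set z | f z = g z].
Proof.
move=> /continuous_mxP cf /continuous_mxP cg.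
have -> : [set z | f z = g z] = \bigcap_(ij in [set: 'I_p * 'I_q])
    ((fun z => f z ij.1 ij.2 - g z ij.1 ij.2) @^-1` [set 0]).
  apply/seteqP; split=> z /=; first by move=> fg ij _ /=; rewrite fg subrr.
  move=> H; apply/matrixP => i j; apply/eqP; rewrite -subr_eq0; apply/eqP.
  exact: (H (i, j)).
apply: closed_bigI => ij _; apply: closed_comp; last exact: closed_eq.
by move=> z _; exact: (continuousB (cf _ _ z) (cg _ _ z)).
Qed.

End ContinuousMatrices.

Section Maximum.
Variable R : realType.
Local Notation plane := (plane R).
Local Notation vec := 'cV[R]_7.

Definition centralizer_G2 (Z : set 'M[R]_7) : set 'M[R]_7 :=
  [set g | G2 g /\ forall z, Z z -> g *m z = z *m g].

Let codes (Z : set 'M[R]_7) : set 'rV[R]_(7 * 7) := [set r | centralizer_G2 Z (vec_mx r)].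

Lemma continuous_vec_mx : continuous (fun r : 'rV[R]_(7 * 7) => (vec_mx r : 'M[R]_7)).
Proof.
apply/continuous_mxP => i j; under eq_fun do rewrite mxE.
by move=> r; exact: coord_continuous.
Qed.

Lemma continuous_cross (V : normedModType R) (f g : V -> vec) : continuous f -> continuous g ->
  continuous (fun z => cross (f z) (g z)).
Proof.
move=> cf cg; apply/continuous_mxP => k l; under eq_fun do rewrite mxE.
move/continuous_mxP : cf => cf; move/continuous_mxP : cg => cg.
apply: continuous_sum => i _; apply: continuous_sum => j _ z.
apply: (continuousM _ (cg j ord0 z)).
exact: (continuousM (@cst_continuous _ _ _ _) (cf i ord0 z)).
Qed.

Lemma orthogonal_entry_le n (g : 'M[R]_n) : g^T *m g = 1%:M -> forall i j, `|g i j| <= 1.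
Proof.
move=> gg i j; have := congr1 (fun M : 'M[R]_n => M j j) gg.
rewrite !mxE eqxx (bigD1 i)//= !mxE => E.
rewrite -(@expr_le1 _ 2)// real_normK ?num_real// -[leRHS]E expr2 lerDl.
by apply: sumr_ge0 => k _; rewrite mxE -expr2 sqr_ge0.
Qed.

(** The centralizer is defined by closed equations among orthogonal
    matrices. *)
Lemma centralizer_compact Z : compact (codes Z).
Proof.
have cv := continuous_vec_mx.
have cst p q (A : 'M[R]_(p, q)) : continuous (fun _ : 'rV[R]_(7 * 7) => A).
  by move=> x; exact: cst_continuous.
apply: bounded_closed_compact.
  exists 1; split; first exact: num_real.
  move=> M M1 r [/= Gr _]; apply: (le_trans _ (ltW M1)).
  apply: norm_mx_le => // i k; rewrite ord1 -(vec_mxK r).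
  case/mxvec_indexP: k => a b; rewrite mxvecE.
  exact: orthogonal_entry_le (G2_orth Gr) a b.
have -> : codes Z = [set r | (vec_mx r)^T *m vec_mx r = 1%:M] `&`
   (\bigcap_(uv in [set: vec * vec]) [set r | vec_mx r *m cross uv.1 uv.2 =
      cross (vec_mx r *m uv.1) (vec_mx r *m uv.2)]) `&`
   (\bigcap_(z in Z) [set r | vec_mx r *m z = z *m vec_mx r]).
  apply/seteqP; split=> r /=.
    move=> [/= /G2E[gT gc] gZ]; split; last exact: gZ.
    by split=> // -[u v] _; exact: gc.
  move=> [[gT gc] gZ]; split; last exact: gZ.
  by apply/G2E; split=> // u v; exact: (gc (u, v) I).
apply: closedI; first apply: closedI.
- by apply: closed_eq_mx; [apply: continuous_mulmx; [exact: continuous_trmx|exact: cv]|exact: cst].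
- apply: closed_bigI => -[u v] _; apply: closed_eq_mx; first exact: continuous_mulmx.
  by apply: continuous_cross; apply: continuous_mulmx.
- by apply: closed_bigI => z _; apply: closed_eq_mx; exact: continuous_mulmx.
Qed.

(** The one-parameter group generated by xi, obtained as the solution of a
    linear system that is constant in the second variable. *)
Lemma exists_one_parameter (xi : 'M[R]_7) : der xi -> exists E : plane -> 'M[R]_7,
  [/\ smooth E, E 0 = 1%:M, forall m, G2 (E m), partial ord0 E 0 = xi &
      forall z, xi *m z = z *m xi -> forall m, E m *m z = z *m E m].
Proof.
move=> dxi; pose w (j : 'I_2) := fun _ : plane => if j == ord0 then xi else 0.
have sw j : smooth (w j) by exact: smooth_cst.
have [||E [sE E0 pE _]] := @frobenius R 7 w; first exact: sw.
  by move=> m; rewrite /w !partial_cst subrr add0r /= mulmx0 mul0mx subrr.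
have dE m : differentiable E m by exact: smooth_diff.
have dw j m : der (w j m) by rewrite /w; case: ifP => // _; exact: der0.
have GE : forall m, G2 (E m).
  by apply: (G2_of_linear_system dE pE dw); rewrite E0; exact: G2_1.
exists E; split=> //; first by rewrite pE E0 mul1mx.
move=> z xz m.
have dT n : differentiable (fun z => (E z)^T) n by exact: differentiable_trmx.
have dEz n : differentiable (fun x => E x *m z) n by exact: differentiable_mulmx_cstr.
have H : E m *m z *m (E m)^T = E 0 *m z *m (E 0)^T.
  apply: (partial0_cst_mx (f := fun x => E x *m z *m (E x)^T)).
    by move=> n; exact: differentiable_mulmx.
  move=> j n; apply: (etrans (partial_mulmx j (dEz n) (dT n))).
  rewrite (partial_mulmx_cstr j z (dE n)) (partial_trmx j (dE n)) pE trmx_mul.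
  rewrite (dw j n).1 mulNmx mulmxN -!mulmxA -mulmxBr !mulmxA -mulmxBl.
  rewrite (_ : w j n *m z - z *m w j n = 0) ?mul0mx ?mulmx0//.
  by rewrite /w; case: ifP => _; rewrite ?xz ?subrr// mul0mx mulmx0 subrr.
rewrite -[in LHS](mulmx1 z).
have -> : E m *m (z *m 1%:M) = E m *m z *m (E m)^T *m E m by rewrite -!mulmxA (G2_orth (GE m)).
by rewrite H E0 mul1mx trmx1 mulmx1.
Qed.

Lemma partial_at_max (f : plane -> R) j : (forall m, differentiable f m) ->
  (forall m, f m <= f 0) -> partial j f 0 = 0.
Proof.
move=> df fmax.
have d (t : R) := is_derive_line_partial (df (0 + t *: (delta_mx ord0 j : plane))).
have N1 : -1 <= (1 : R) by rewrite (le_trans (lerN10 R)).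
have [|||_ v0] := @derive1_at_max R (fun s => f (0 + s *: (delta_mx ord0 j : plane))) (-1) 1 0 N1.
- by move=> t _; have [] := d t.
- by rewrite in_itv/= ltrN10 ltr01.
- by move=> t _; rewrite scale0r addr0; exact: fmax.
by have [_] := d 0; rewrite v0 scale0r addr0 => <-.
Qed.

Lemma partial_mxtrace j (f : plane -> 'M[R]_7) m : differentiable f m ->
  partial j (fun z => \tr (f z)) m = \tr (partial j f m).
Proof.
move=> df; have dfi i : differentiable (fun z => f z i i) m.
  by have := (differentiable_mxP f m).1 df i i.
apply: (etrans (partial_sum j dfi)).
by rewrite /mxtrace; apply: eq_bigr => i _; rewrite partial_mxE.
Qed.

(** The compact group of elements of G_2 commuting with Z has a point where
    tr (g^T B g H) is maximal; its derivative vanishes there. *)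
Lemma trace_critical_point (Z : set 'M[R]_7) (B H : 'M[R]_7) : exists2 g, centralizer_G2 Z g &
  forall xi, der xi -> (forall z, Z z -> xi *m z = z *m xi) ->
    \tr (xi *m commutator (g^T *m B *m g) H) = 0.
Proof.
pose phi g := \tr (g^T *m B *m g *m H).
have cv := continuous_vec_mx.
have cst (A : 'M[R]_7) : continuous (fun _ : 'rV[R]_(7 * 7) => A).
  by move=> x; exact: cst_continuous.
have cphi : continuous (fun r : 'rV[R]_(7 * 7) => phi (vec_mx r)).
  have cM : continuous (fun r : 'rV[R]_(7 * 7) => (vec_mx r)^T *m B *m vec_mx r *m H).
    apply: continuous_mulmx; last exact: cst.
    apply: continuous_mulmx; last exact: cv.
    by apply: continuous_mulmx; [exact: continuous_trmx|exact: cst].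
  by apply: continuous_sum => i _; exact: ((continuous_mxP _).1 cM i i).
have ne : codes Z !=set0.
  exists (mxvec 1%:M); rewrite /codes /= mxvecK; split; first exact: G2_1.
  by move=> z _; rewrite mul1mx mulmx1.
have [r rZ rmax] := compact_EVT_max ne (@centralizer_compact Z) (continuous_subspaceT cphi).
have {}rZ : codes Z r by move: rZ; rewrite inE.
exists (vec_mx r); first exact: rZ.
move: rZ rmax; rewrite /codes /=; set g := vec_mx r => -[Gg gZ] gmax xi dxi xiZ.
have [E [sE E0 GE pE EZ]] := exists_one_parameter dxi.
have dE m : differentiable E m by exact: smooth_diff.
set B' := g^T *m B *m g.
have phiE m : phi (g *m E m) = \tr ((E m)^T *m B' *m E m *m H).
  by rewrite /phi trmx_mul /B' !mulmxA.
have d1 m : differentiable (fun z => (E z)^T *m B') m.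
  by apply: differentiable_mulmx_cstr; exact: differentiable_trmx.
have d2 m : differentiable (fun z => (E z)^T *m B' *m E z) m by exact: differentiable_mulmx.
have d3 m : differentiable (fun z => (E z)^T *m B' *m E z *m H) m by exact: differentiable_mulmx_cstr.
have dphi m : differentiable (fun z => phi (g *m E z)) m.
  rewrite (_ : (fun z => _) = \sum_i (fun z => ((E z)^T *m B' *m E z *m H) i i)).
    by apply: differentiable_sum => i; apply: (differentiable_mxP _ _).1.
  by apply/funext => z; rewrite phiE fct_sumE.
have := partial_at_max ord0 dphi; have H1 m : phi (g *m E m) <= phi (g *m E 0).
  rewrite E0 mulmx1 -[g *m E m]mxvecK; apply: gmax; rewrite inE /= mxvecK; split; first exact: G2_mul.
  by move=> z zZ; rewrite -mulmxA (EZ z (xiZ z zZ)) mulmxA gZ// mulmxA.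
move=> /(_ H1); rewrite (_ : (fun z => phi _) = fun z => \tr ((E z)^T *m B' *m E z *m H)); last first.
  by apply/funext => z; exact: phiE.
rewrite partial_mxtrace; last exact: d3.
rewrite (partial_mulmx_cstr ord0 H (d2 0)) (partial_mulmx ord0 (d1 0) (dE 0)).
rewrite (partial_mulmx_cstr ord0 B' (differentiable_trmx (dE 0))) (partial_trmx ord0 (dE 0)).
rewrite pE E0 trmx1 mul1mx mulmx1 dxi.1 mulNmx mulmxDl mulNmx raddfD raddfN /= => tr0.
clearbody B'; rewrite /commutator mulmxBr raddfB /=.
apply/eqP; rewrite -oppr_eq0 opprB; apply/eqP.
move: tr0; rewrite addrC => <-; rewrite !mulmxA; congr (_ - _).
by rewrite mxtrace_mulC mulmxA.
Qed.

Lemma trace_skew_eq0 n (xi : 'M[R]_n) : xi^T = - xi -> \tr (xi *m xi) = 0 -> xi = 0.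
Proof.
move=> xT tr0.
have E : \tr (xi *m xi) = \sum_i \sum_j - (xi j i ^+ 2).
  rewrite /mxtrace; apply: eq_bigr => i _; rewrite mxE; apply: eq_bigr => j _.
  have := congr1 (fun M : 'M[R]_n => M j i) xT; rewrite !mxE => ->.
  by rewrite expr2 mulNr.
have : \sum_i \sum_j xi j i ^+ 2 = 0.
  move: tr0; rewrite E; under eq_bigr do rewrite sumrN; rewrite sumrN => /eqP.
  by rewrite oppr_eq0 => /eqP.
move/eqP; rewrite psumr_eq0; last by move=> i _; apply: sumr_ge0 => j _; exact: sqr_ge0.
move=> /allP H; apply/matrixP => j i; rewrite mxE.
have := H i (mem_index_enum _); rewrite /= psumr_eq0; last by move=> l _; exact: sqr_ge0.
by move=> /allP/(_ j (mem_index_enum _)); rewrite /= sqrf_eq0 => /eqP.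
Qed.

Lemma comm_jacobi n (A B C : 'M[R]_n) : commutator A (commutator B C) =
  commutator (commutator A B) C + commutator B (commutator A C).
Proof.
rewrite /commutator !mulmxBl !mulmxBr !mulmxA.
move: (A *m B *m C) (A *m C *m B) (B *m A *m C) (B *m C *m A) (C *m A *m B) (C *m B *m A) => a b c d e f.
by apply/matrixP => i j; rewrite !mxE; ring.
Qed.

Lemma comm_conj (g A B : 'M[R]_7) : g *m g^T = 1%:M ->
  g^T *m commutator A B *m g = commutator (g^T *m A *m g) (g^T *m B *m g).
Proof.
move=> gg; have E (X Y : 'M[R]_7) : g^T *m X *m g *m (g^T *m Y *m g) = g^T *m (X *m Y) *m g.
  by rewrite !mulmxA -(mulmxA (g^T *m X)) gg mulmx1.
by rewrite /commutator !E mulmxBr mulmxBl.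
Qed.

Lemma comm0P n (A B : 'M[R]_n) : commutator A B = 0 <-> A *m B = B *m A.
Proof.
by split=> [/eqP|AB]; rewrite /commutator; [rewrite subr_eq0 => /eqP|rewrite AB subrr].
Qed.

Lemma commC n (A B : 'M[R]_n) : commutator B A = - commutator A B.
Proof. by rewrite /commutator opprB. Qed.

Lemma in_p7_conj (g X : 'M[R]_7) : G2 g -> g *m P0 R = P0 R *m g -> in_p7 X -> in_p7 (g^T *m X *m g).
Proof.
move=> Gg gP [dX PX]; split; first exact: der_conj'.
have gTP : P0 R *m g^T = g^T *m P0 R by rewrite -[P0 R in LHS]P0_tr -trmx_mul gP trmx_mul P0_tr.
have e1 : P0 R *m (g^T *m X *m g) = g^T *m (P0 R *m X) *m g by rewrite !mulmxA gTP.
have e2 : g^T *m X *m g *m P0 R = g^T *m (X *m P0 R) *m g by rewrite -!mulmxA gP.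
by rewrite e1 e2 -mulmxDl -mulmxDr PX.
Qed.

Definition regular_element : 'M[R]_7 := b0 R + 2 *: b1 R.

Lemma regular_in_p : in_p7 regular_element.
Proof. by apply: in_p7D; [exact: b0_in_p|apply: in_p7Z; exact: b1_in_p]. Qed.

Lemma comm_in_a (X Y : 'M[R]_7) : in_a X -> in_a Y -> commutator X Y = 0.
Proof.
move=> [s [t ->]] [s' [t' ->]]; have /comm0P bb := b_comm R.
rewrite /commutator !mulmxDl !mulmxDr -!scalemxAl -!scalemxAr bb.
move: (b0 R *m b0 R) (b1 R *m b0 R) (b1 R *m b1 R) => a b c.
by apply/matrixP => i j; rewrite !mxE; ring.
Qed.

Lemma regular_in_a : in_a regular_element.
Proof. by exists 1, 2; rewrite scale1r. Qed.

(** Maximise tr (g^T X0 g H) over the stabiliser of R^3, with H = b_1 + 2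
    b_2. At the maximum the bracket of g^T X0 g and H is an element of k
    that is orthogonal to k, so it is zero and g^T X0 g lies in the
    centralizer a of H. The same argument within the stabiliser of g^T X0 g
    moves the second element. *)
Lemma normal_form (X0 X1 : 'M[R]_7) : in_p7 X0 -> in_p7 X1 -> commutator X0 X1 = 0 ->
  exists g, [/\ G2 g, g *m P0 R = P0 R *m g, in_a (g^T *m X0 *m g) & in_a (g^T *m X1 *m g)].
Proof.
move=> p0 p1 X01; pose H := regular_element.
have pH := regular_in_p.
have [g [Gg gZ] gcrit] := trace_critical_point [set P0 R] X0 H.
have gP : g *m P0 R = P0 R *m g by exact: gZ.
set Y0 := g^T *m X0 *m g in gcrit; set Y1 := g^T *m X1 *m g.
have pY0 : in_p7 Y0 by exact: in_p7_conj.
have pY1 : in_p7 Y1 by exact: in_p7_conj.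
have aY0 : in_a Y0.
  apply: centralizer_regular => //; have [dxi Pxi] := comm_pp pY0 pH.
  apply: trace_skew_eq0; first exact: dxi.1.
  by apply: gcrit => // z ->; rewrite Pxi.
have Y01 : commutator Y0 Y1 = 0.
  by rewrite -(comm_conj X0 X1 (G2_orthr Gg)) X01 mulmx0 mul0mx.
(* The second maximisation fixes Y0, so that the first element stays in a. *)
have [h [Gh hZ] hcrit] := trace_critical_point [set z | z = P0 R \/ z = Y0] Y1 H.
have hP : h *m P0 R = P0 R *m h by apply: hZ; left.
have hY : h *m Y0 = Y0 *m h by apply: hZ; right.
have hY0 : h^T *m Y0 *m h = Y0 by rewrite -mulmxA -hY mulmxA G2_orth// mul1mx.
set Z1 := h^T *m Y1 *m h in hcrit.
have pZ1 : in_p7 Z1 by exact: in_p7_conj.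
have Z01 : commutator Y0 Z1 = 0.
  by rewrite -{1}hY0 -(comm_conj Y0 Y1 (G2_orthr Gh)) Y01 mulmx0 mul0mx.
exists (g *m h); rewrite trmx_mul; split.
- exact: G2_mul.
- by rewrite -mulmxA hP mulmxA gP mulmxA.
- by rewrite -mulmxA (mulmxA X0) -!mulmxA !(mulmxA g^T) (mulmxA (g^T *m X0)) -/Y0 mulmxA hY0.
have -> : h^T *m g^T *m X1 *m (g *m h) = Z1 by rewrite /Z1 /Y1 !mulmxA.
apply: centralizer_regular => //; have [dxi Pxi] := comm_pp pZ1 pH.
apply: trace_skew_eq0; first exact: dxi.1.
apply: hcrit => // z [->|->]; first by rewrite Pxi.
apply/esym/comm0P; rewrite comm_jacobi Z01 (comm_in_a aY0 regular_in_a).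
by rewrite /commutator mul0mx !mulmx0 mul0mx subrr addr0.
Qed.

End Maximum.

(** * The Lie algebra of motions *)

Section Blocks.
Variable R : realType.
Local Notation plane := (plane R).
Local Notation vec := 'cV[R]_7.

Definition pblk (B : 'M[R]_(3, 4)) : 'M[R]_7 := (block_mx 0 (- B^T) B 0 : 'M[R]_(4 + 3)).

Definition bb (l : 'I_2) : 'M[R]_7 := if l == ord0 then b0 R else b1 R.

Lemma inord_lshift i : (i < 4)%N -> (inord i : 'I_7) = lshift 3 (inord i : 'I_4).
Proof. by move=> i4; apply: val_inj; rewrite /= !inordK// (ltn_trans i4). Qed.

Lemma inord_rshift i : (i < 3)%N -> (inord (4 + i) : 'I_7) = rshift 4 (inord i : 'I_3).
Proof. by move=> i3; apply: val_inj; rewrite /= !inordK// (leq_trans _ (_ : 4 + 3 <= 7)%N)// ltn_add2l. Qed.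

Lemma en_pblk_ul B i j : (i < 4)%N -> (j < 4)%N -> en (pblk B) i j = 0.
Proof. by move=> i4 j4; rewrite /en (inord_lshift i4) (inord_lshift j4) [LHS]block_mxEul mxE. Qed.
Lemma en_pblk_dl B i j : (i < 3)%N -> (j < 4)%N -> en (pblk B) (4 + i) j = B (inord i) (inord j).
Proof. by move=> i4 j4; rewrite /en (inord_rshift i4) (inord_lshift j4) [LHS]block_mxEdl. Qed.
Lemma en_pblk_dr B i j : (i < 3)%N -> (j < 3)%N -> en (pblk B) (4 + i) (4 + j) = 0.
Proof. by move=> i4 j4; rewrite /en (inord_rshift i4) (inord_rshift j4) [LHS]block_mxEdr mxE. Qed.

Lemma P0_block : P0 R = (block_mx 0 0 0 1%:M : 'M[R]_(4 + 3)).
Proof.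
apply/matrixP => i j; rewrite mxE.
case: (splitP (i : 'I_(4 + 3))) => i' ii; case: (splitP (j : 'I_(4 + 3))) => j' jj.
- have -> : i = lshift 3 i' by exact: val_inj.
  have -> : j = lshift 3 j' by exact: val_inj.
  by rewrite [RHS]block_mxEul mxE /= leqNgt ltn_ord andbF.
- have -> : i = lshift 3 i' by exact: val_inj.
  have -> : j = rshift 4 j' by exact: val_inj.
  by rewrite [RHS]block_mxEur mxE /= [(4 <= _)%N]leqNgt ltn_ord andbF.
- have -> : i = rshift 4 i' by exact: val_inj.
  have -> : j = lshift 3 j' by exact: val_inj.
  by rewrite [RHS]block_mxEdl mxE /= -val_eqE /= gtn_eqF// ltn_addr.
- have -> : i = rshift 4 i' by exact: val_inj.
  have -> : j = rshift 4 j' by exact: val_inj.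
  by rewrite [RHS]block_mxEdr mxE /= leq_addr andbT -val_eqE /= eqn_add2l.
Qed.

Lemma pblk_P0 B : P0 R *m pblk B + pblk B *m P0 R = pblk B.
Proof.
have E : (block_mx 0 0 0 1%:M : 'M[R]_(4 + 3)) *m (block_mx 0 (- B^T) B 0 : 'M[R]_(4 + 3)) +
    (block_mx 0 (- B^T) B 0 : 'M[R]_(4 + 3)) *m (block_mx 0 0 0 1%:M : 'M[R]_(4 + 3)) =
    block_mx 0 (- B^T) B 0.
  rewrite !mulmx_block !mul0mx !mulmx0 !mulmx1 !mul1mx !addr0 !add0r.
  by rewrite add_block_mx !addr0 !add0r.
by rewrite P0_block; exact: E.
Qed.

Lemma pblk_skew B : (pblk B)^T = - pblk B.
Proof.
have E : (block_mx 0 (- B^T) B 0 : 'M[R]_(4 + 3))^T = - (block_mx 0 (- B^T) B 0 : 'M[R]_(4 + 3)).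
  by rewrite tr_block_mx opp_block_mx !trmx0 linearN /= trmxK !oppr0 opprK.
exact: E.
Qed.

Lemma in_p_pblk B : in_p B <-> in_p7 (pblk B).
Proof.
split.
  move=> [/= r1 r2 r3 r4]; split; last exact: pblk_P0.
  apply: relations_der; first exact: pblk_skew.
  have ul := en_pblk_ul B; have dr i j := @en_pblk_dr B i j.
  have dl i j := @en_pblk_dl B i j.
  split; split.
  - by rewrite (dr 1%N 2%N)// !ul// addr0.
  - by rewrite (dr 2%N 0%N)// !ul// addr0.
  - by rewrite (dr 0%N 1%N)// !ul// addr0.
  - by rewrite (dl 0%N 0%N)// (dl 1%N 3%N)// (dl 2%N 2%N).
  - by rewrite (dl 0%N 1%N)// (dl 1%N 2%N)// (dl 2%N 3%N).
  - by rewrite (dl 0%N 2%N)// (dl 1%N 1%N)// (dl 2%N 0%N).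
  - by rewrite (dl 0%N 3%N)// (dl 1%N 0%N)// (dl 2%N 1%N).
move=> [/der_relations[_ [r1 r2 r3 r4]] _].
have dl i j := @en_pblk_dl B i j.
split=> /=.
- by move: r1; rewrite (dl 0%N 0%N)// (dl 1%N 3%N)// (dl 2%N 2%N).
- by move: r2; rewrite (dl 0%N 1%N)// (dl 1%N 2%N)// (dl 2%N 3%N).
- by move: r3; rewrite (dl 0%N 2%N)// (dl 1%N 1%N)// (dl 2%N 0%N).
- by move: r4; rewrite (dl 0%N 3%N)// (dl 1%N 0%N)// (dl 2%N 1%N).
Qed.

Lemma in_p7_block (X : 'M[R]_7) : in_p7 X ->
  in_p (dlsubmx (X : 'M[R]_(4 + 3))) /\ X = pblk (dlsubmx (X : 'M[R]_(4 + 3))).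
Proof.
move=> pX; set B := dlsubmx _.
have [/der_relations[_ [r1 r2 r3 r4]] _] := pX.
have E i j : (i < 3)%N -> (j < 4)%N -> B (inord i) (inord j) = en X (4 + i) j.
  by move=> i3 j4; rewrite /B /en (inord_rshift i3) (inord_lshift j4) !mxE.
have pB : in_p B by split=> /=; rewrite !E.
split=> //; apply: in_p_eq => //; first exact/in_p_pblk.
- by split; rewrite (@en_pblk_dl B 0)// E.
- by split; rewrite (@en_pblk_dl B 1)// E.
Qed.

Lemma pblk_a_mx l : pblk (a_mx R l) = bb l.
Proof.
have E (X : 'M[R]_7) : in_p7 X -> (forall i j, (i < 3)%N -> (j < 4)%N ->
    a_mx R l (inord i) (inord j) = en X (4 + i) j) -> pblk (a_mx R l) = X.
  move=> pX aX; have [pB ->] := in_p7_block pX; congr pblk.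
  apply/matrixP => i j; rewrite -(inord_val i) -(inord_val j) aX//.
  by rewrite /en (inord_rshift (ltn_ord i)) (inord_lshift (ltn_ord j)) !mxE.
apply: E; rewrite /bb /a_mx; case: ifP => _; [exact: b0_in_p|exact: b1_in_p| |].
- move=> i j i3 j4; rewrite en_mat7 ?(leq_trans j4)// ?(leq_ltn_trans _ (_ : 4 + 2 < 7)%N)// ?leq_add2l// !mxE -!val_eqE /= !inordK//.
  by move: i i3 j j4 => [|[|[|]]]// _ [|[|[|[|]]]]//= _; rewrite ?addr0 ?add0r ?subr0 ?subrr ?oppr0.
- move=> i j i3 j4; rewrite en_mat7 ?(leq_trans j4)// ?(leq_ltn_trans _ (_ : 4 + 2 < 7)%N)// ?leq_add2l// !mxE -!val_eqE /= !inordK//.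
  by move: i i3 j j4 => [|[|[|]]]// _ [|[|[|[|]]]]//= _; rewrite ?addr0 ?add0r ?subr0 ?subrr ?oppr0.
Qed.

End Blocks.

Section Motions.
Variable R : realType.
Local Notation plane := (plane R).
Local Notation vec := 'cV[R]_7.

Lemma differentiable_block p q r s (A : plane -> 'M[R]_(p, r)) (B : plane -> 'M[R]_(p, s))
    (C : plane -> 'M[R]_(q, r)) (D : plane -> 'M[R]_(q, s)) m :
  differentiable A m -> differentiable B m -> differentiable C m -> differentiable D m ->
  differentiable (fun z => block_mx (A z) (B z) (C z) (D z)) m.
Proof.
move=> /differentiable_mxP dA /differentiable_mxP dB /differentiable_mxP dC /differentiable_mxP dD.
apply/differentiable_mxP => i k; case: (split_ordP i) => i' ->; case: (split_ordP k) => k' ->.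
- by under eq_fun do rewrite block_mxEul; exact: dA.
- by under eq_fun do rewrite block_mxEur; exact: dB.
- by under eq_fun do rewrite block_mxEdl; exact: dC.
- by under eq_fun do rewrite block_mxEdr; exact: dD.
Qed.

Lemma partial_block p q r s j (A : plane -> 'M[R]_(p, r)) (B : plane -> 'M[R]_(p, s))
    (C : plane -> 'M[R]_(q, r)) (D : plane -> 'M[R]_(q, s)) m :
  differentiable A m -> differentiable B m -> differentiable C m -> differentiable D m ->
  partial j (fun z => block_mx (A z) (B z) (C z) (D z)) m =
  block_mx (partial j A m) (partial j B m) (partial j C m) (partial j D m).
Proof.
move=> dA dB dC dD; apply/matrixP => i k; rewrite partial_mxE; last exact: differentiable_block.
case: (split_ordP i) => i' ->; case: (split_ordP k) => k' ->.
- apply: (etrans _ (esym (block_mxEul _ _ _ _ _ _))); apply: (etrans _ (esym (partial_mxE _ _ _ dA))).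
  by congr (partial j _ m); apply/funext => z; exact: block_mxEul.
- apply: (etrans _ (esym (block_mxEur _ _ _ _ _ _))); apply: (etrans _ (esym (partial_mxE _ _ _ dB))).
  by congr (partial j _ m); apply/funext => z; exact: block_mxEur.
- apply: (etrans _ (esym (block_mxEdl _ _ _ _ _ _))); apply: (etrans _ (esym (partial_mxE _ _ _ dC))).
  by congr (partial j _ m); apply/funext => z; exact: block_mxEdl.
- apply: (etrans _ (esym (block_mxEdr _ _ _ _ _ _))); apply: (etrans _ (esym (partial_mxE _ _ _ dD))).
  by congr (partial j _ m); apply/funext => z; exact: block_mxEdr.
Qed.

Lemma smooth_block p q r s (A : plane -> 'M[R]_(p, r)) (B : plane -> 'M[R]_(p, s))
    (C : plane -> 'M[R]_(q, r)) (D : plane -> 'M[R]_(q, s)) :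
  smooth A -> smooth B -> smooth C -> smooth D ->
  smooth (fun z => block_mx (A z) (B z) (C z) (D z)).
Proof.
move=> /smooth_mxP dA /smooth_mxP dB /smooth_mxP dC /smooth_mxP dD.
apply/smooth_mxP => i k; case: (split_ordP i) => i' ->; case: (split_ordP k) => k' ->.
- by under eq_fun do rewrite block_mxEul; exact: dA.
- by under eq_fun do rewrite block_mxEur; exact: dB.
- by under eq_fun do rewrite block_mxEdl; exact: dC.
- by under eq_fun do rewrite block_mxEdr; exact: dD.
Qed.

(** The element of the Lie algebra of motions with linear part A and
    translation part c. *)
Definition mot (A : 'M[R]_7) (c : vec) : 'M[R]_(7 + 1) := block_mx A c 0 0.

Lemma mot_inj A c A' c' : mot A c = mot A' c' -> A = A' /\ c = c'.
Proof. by move=> /eq_block_mx[-> ->]. Qed.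

Lemma mot_mul A c A' c' : mot A c *m mot A' c' = mot (A *m A') (A *m c').
Proof. by rewrite /mot mulmx_block !mulmx0 !mul0mx !addr0. Qed.

Lemma motD A c A' c' : mot A c + mot A' c' = mot (A + A') (c + c').
Proof. by rewrite /mot add_block_mx !addr0. Qed.

Lemma motN A c : - mot A c = mot (- A) (- c).
Proof. by rewrite /mot opp_block_mx !oppr0. Qed.

Lemma motZ a A c : a *: mot A c = mot (a *: A) (a *: c).
Proof. by rewrite /mot scale_block_mx !scaler0. Qed.

Lemma mot0 : mot 0 0 = 0.
Proof. by rewrite /mot; exact: block_mx0. Qed.

Lemma mot_comm A c A' c' :
  commutator (mot A c) (mot A' c') = mot (commutator A A') (A *m c' - A' *m c).
Proof. by rewrite /commutator !mot_mul motN motD. Qed.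

Lemma partial_mot j (A : plane -> 'M[R]_7) (c : plane -> vec) m :
  differentiable A m -> differentiable c m ->
  partial j (fun z => mot (A z) (c z)) m = mot (partial j A m) (partial j c m).
Proof.
move=> dA dc; apply: (etrans (partial_block j dA dc (differentiable_cst _ _) (differentiable_cst _ _))).
by rewrite !partial_cst.
Qed.

Lemma b_mx_mot l : b_mx R l = mot (bb R l) 0.
Proof. by rewrite /b_mx /phat_mx -pblk_a_mx /mot col_mx0. Qed.

Lemma P0_col (u : vec) : P0 R *m u = 0 <-> u = (col_mx (usubmx (u : 'cV[R]_(4 + 3))) 0 : 'cV[R]_(4 + 3)).
Proof.
have E (X : 'cV[R]_4) (Y : 'cV[R]_3) :
    (block_mx 0 0 0 1%:M : 'M[R]_(4 + 3)) *m (col_mx X Y) = col_mx 0 Y.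
  by rewrite mul_block_col !mul0mx mul1mx !addr0 add0r.
have := E (usubmx (u : 'cV[R]_(4 + 3))) (dsubmx (u : 'cV[R]_(4 + 3))).
rewrite vsubmxK P0_block => Pu; split=> [u0|->]; last by apply: (etrans (E _ _)); exact: col_mx0.
have : (0 : 'cV[R]_(4 + 3)) = col_mx 0 (dsubmx (u : 'cV[R]_(4 + 3))) by rewrite -Pu; exact/esym.
move=> /esym/eqP; rewrite col_mx_eq0 => /andP[_ /eqP d0].
by rewrite -[in X in col_mx _ X]d0 vsubmxK.
Qed.

Lemma in_phat_mot v : in_phat v <-> exists V u, [/\ in_p7 V, P0 R *m u = 0 & v = mot V u].
Proof.
split=> [[B [X [pB ->]]]|[V [u [pV u0 ->]]]].
  exists (pblk B), (col_mx X 0); split=> //; first exact/in_p_pblk.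
  by apply/P0_col; rewrite col_mxKu.
have [pB VB] := in_p7_block pV; exists (dlsubmx (V : 'M[R]_(4 + 3))), (usubmx (u : 'cV[R]_(4 + 3))).
split=> //; rewrite {1}VB /phat_mx /mot; congr block_mx; exact/P0_col.
Qed.

Lemma bb_in_p l : in_p7 (bb R l).
Proof. by rewrite /bb; case: ifP => _; [exact: b0_in_p|exact: b1_in_p]. Qed.

Lemma bb_comm k l : commutator (bb R k) (bb R l) = 0.
Proof.
rewrite /bb; case: ifP => _; case: ifP => _; rewrite ?b_comm//; try by rewrite /commutator subrr.
by rewrite commC b_comm oppr0.
Qed.

Lemma b_mx_comm k l : commutator (b_mx R k) (b_mx R l) = 0.
Proof. by rewrite !b_mx_mot mot_comm bb_comm !mulmx0 subrr mot0. Qed.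

Lemma invmx_motion (g : 'M[R]_7) c : g^T *m g = 1%:M ->
  invmx (motion g c) = block_mx g^T (- (g^T *m c)) 0 1%:M.
Proof.
move=> gg; have gg' := mulmx1C gg.
have E : (block_mx g^T (- (g^T *m c)) 0 1%:M : 'M[R]_(7 + 1)) *m block_mx g c 0 1%:M = 1%:M.
  rewrite mulmx_block gg !mulmx0 !mul0mx !mul1mx !addr0 mulmx1 subrr add0r.
  exact: esym (scalar_mx_block _ _ _).
have U : (motion g c : 'M[R]_(7 + 1)) \in unitmx by have [] := mulmx1_unit E.
by rewrite -[LHS]mul1mx -E; exact: (mulmxK U).
Qed.

Lemma maurer_cartanE F phi j m : G2 (F m) -> differentiable F m -> differentiable phi m ->
  maurer_cartan F phi j m = mot ((F m)^T *m partial j F m) ((F m)^T *m partial j phi m).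
Proof.
move=> G dF dphi; rewrite /maurer_cartan invmx_motion; last exact: G2_orth.
have -> : partial j (fun z => motion (F z) (phi z) : 'M[R]_8) m = mot (partial j F m) (partial j phi m).
  apply: (etrans (partial_block j dF dphi (differentiable_cst _ _) (differentiable_cst _ _))).
  by rewrite !partial_cst.
move: (partial j F m) (partial j phi m) => A c.
by apply: (etrans (mulmx_block _ _ _ _ _ _ _ _)); rewrite !mulmx0 !mul0mx !addr0.
Qed.

End Motions.

(** * Flatness of the family *)

Section RealForm.
Variable R : realType.
Local Notation plane := (plane R).
Local Notation vec := 'cV[R]_7.

Lemma complexifyD n (A B : 'M[R]_n) : complexify (A + B) = complexify A + complexify B.
Proof. exact: (map_mxD (real_complex R)). Qed.
Lemma complexifyN n (A : 'M[R]_n) : complexify (- A) = - complexify A.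
Proof. exact: (map_mxN (real_complex R)). Qed.
Lemma complexifyM n (A B : 'M[R]_n) : complexify (A *m B) = complexify A *m complexify B.
Proof. exact: (map_mxM (real_complex R)). Qed.
Lemma complexifyZ n a (A : 'M[R]_n) : complexify (a *: A) = Complex a 0 *: complexify A.
Proof. exact: (map_mxZ (real_complex R)). Qed.
Lemma complexify_sum n p (A : 'I_p -> 'M[R]_n) :
  complexify (\sum_i A i) = \sum_i complexify (A i).
Proof. exact: (raddf_sum (map_mx (real_complex R))). Qed.
Lemma complexify0 n : complexify (0 : 'M[R]_n) = 0.
Proof. exact: (map_mx0 (real_complex R)). Qed.
Lemma complexify_comm n (A B : 'M[R]_n) :
  complexify (commutator A B) = commutator (complexify A) (complexify B).
Proof. by rewrite /commutator complexifyD complexifyN !complexifyM. Qed.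
Lemma complexify_inj n : injective (@complexify R n).
Proof. by move=> A B /matrixP AB; apply/matrixP => i j; have := AB i j; rewrite !mxE => -[]. Qed.

Lemma commDl n (A B C : 'M[R]_n) : commutator (A + B) C = commutator A C + commutator B C.
Proof. by rewrite /commutator mulmxDl mulmxDr opprD addrACA. Qed.
Lemma commDr n (A B C : 'M[R]_n) : commutator A (B + C) = commutator A B + commutator A C.
Proof. by rewrite /commutator mulmxDl mulmxDr opprD addrACA. Qed.
Lemma commZl n a (A B : 'M[R]_n) : commutator (a *: A) B = a *: commutator A B.
Proof. by rewrite /commutator -scalemxAl -scalemxAr scalerBr. Qed.
Lemma commZr n a (A B : 'M[R]_n) : commutator A (a *: B) = a *: commutator A B.
Proof. by rewrite /commutator -scalemxAl -scalemxAr scalerBr. Qed.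

(** The b-valued form sum_l b_l dx_l, evaluated on the j-th coordinate
    field. *)
Definition bform n (b : 'I_2 -> 'M[R]_n) (x : plane -> plane) (j : 'I_2) (m : plane) : 'M[R]_n :=
  \sum_(l < 2) partial j x m ord0 l *: b l.

Lemma bform_comm n (b : 'I_2 -> 'M[R]_n) x i j m : (forall k l, commutator (b k) (b l) = 0) ->
  commutator (bform b x i m) (bform b x j m) = 0.
Proof.
move=> bC; rewrite /bform; move: (partial i x m) (partial j x m) => s t.
by rewrite !big_ord_recr !big_ord0 /= !add0r commDl !commDr !commZl !commZr !bC !scaler0 !addr0.
Qed.

Lemma smooth_entry p q (f : plane -> 'M[R]_(p, q)) i j : smooth f -> smooth (fun z => f z i j).
Proof. by move/smooth_mxP. Qed.

Lemma smooth_bform n (b : 'I_2 -> 'M[R]_n) x j : smooth x -> smooth (bform b x j).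
Proof.
move=> sx; apply: smooth_sum => l _; apply: smooth_scale; last exact: smooth_cst.
exact/smooth_entry/smooth_partial.
Qed.

Lemma bform_closed n (b : 'I_2 -> 'M[R]_n) x m : smooth x ->
  partial ord0 (bform b x ord_max) m = partial ord_max (bform b x ord0) m.
Proof.
move=> sx; have E i j : partial i (bform b x j) m = \sum_(l < 2) (partial i (partial j x) m) ord0 l *: b l.
  have sxj := smooth_partial j sx.
  have d l : differentiable (fun z => partial j x z ord0 l) m.
    by apply: smooth_diff; exact: smooth_entry.
  have dl l : differentiable (fun z => partial j x z ord0 l *: b l) m.
    by apply: smooth_diff; apply: smooth_scale; [exact: smooth_entry|exact: smooth_cst].
  apply: (etrans (partial_sum i dl)); apply: eq_bigr => l _.
  apply: (etrans (partial_scale _ _ _)); [exact: d|exact: differentiable_cst|].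
  rewrite partial_cst scaler0 addr0; congr (_ *: _).
  by apply/esym; apply: partial_mxE; exact: smooth_diff.
by rewrite !E; apply: eq_bigr => l _; rewrite (schwarz_mx ord0 ord_max m sx).
Qed.

Lemma partial_comm n j (A B : plane -> 'M[R]_n) m : differentiable A m -> differentiable B m ->
  partial j (fun z => commutator (A z) (B z)) m =
  commutator (partial j A m) (B m) + commutator (A m) (partial j B m).
Proof.
move=> dA dB.
apply: (etrans (partialB j (differentiable_mulmx dA dB) (differentiable_mulmx dB dA))).
apply: (etrans (congr2 (fun a b => a - b) (partial_mulmx j dA dB) (partial_mulmx j dB dA))).
by rewrite /commutator [X in _ - X]addrC opprD addrACA.
Qed.

Lemma smooth_comm n (A B : plane -> 'M[R]_n) : smooth A -> smooth B ->
  smooth (fun z => commutator (A z) (B z)).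
Proof. by move=> sA sB; apply: smoothB; exact: smooth_mulmx. Qed.

Definition rflat n (w : 'I_2 -> plane -> 'M[R]_n) : Prop :=
  forall m, partial ord0 (w ord_max) m - partial ord_max (w ord0) m
    + commutator (w ord0 m) (w ord_max m) = 0.

(** The member theta_1 of the family, as a real form. *)
Definition rth (x : plane -> plane) (v : plane -> 'M[R]_8) (j : 'I_2) (m : plane) : 'M[R]_8 :=
  bform (b_mx R) x j m + commutator (bform (b_mx R) x j m) (v m).

Lemma comm_sum n (c : 'I_2 -> R) (b : 'I_2 -> 'M[R]_n) (v : 'M[R]_n) :
  commutator (\sum_(l < 2) c l *: b l) v = \sum_(l < 2) c l *: commutator (b l) v.
Proof. by rewrite !big_ord_recr !big_ord0 /= !add0r commDl !commZl. Qed.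

Lemma thetaE x (v : plane -> 'M[R]_8) lambda j m : theta x v lambda j m =
  lambda *: complexify (bform (b_mx R) x j m) +
  complexify (commutator (bform (b_mx R) x j m) (v m)).
Proof.
rewrite /theta /bform; move: (partial j x m) => s; rewrite comm_sum !complexify_sum scaler_sumr -big_split.
apply: eq_bigr => l _; rewrite !complexifyZ scalerDr !scalerA; congr (_ *: _ + _); exact: mulrC.
Qed.

Lemma theta1 x v j m : theta x v 1 j m = complexify (rth x v j m).
Proof. by rewrite thetaE scale1r; exact: esym (complexifyD _ _). Qed.

Lemma cpartial_pencil n lambda j (A B : plane -> 'M[R]_n.+1) m : differentiable A m -> differentiable B m ->
  cpartial j (fun z => lambda *: complexify (A z) + complexify (B z)) m =
  lambda *: complexify (partial j A m) + complexify (partial j B m).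
Proof.
case: lambda => a b dA dB; rewrite /cpartial.
have -> : (fun z => map_mx (@complex.Re R) (Complex a b *: complexify (A z) + complexify (B z)))
    = (fun z => a *: A z + B z).
  by apply/funext => z; apply/matrixP => i k; rewrite !mxE /= mulr0 subr0.
have -> : (fun z => map_mx (@complex.Im R) (Complex a b *: complexify (A z) + complexify (B z)))
    = (fun z => b *: A z).
  by apply/funext => z; apply/matrixP => i k; rewrite !mxE /= mulr0 add0r addr0.
have E c : partial j (fun z => c *: A z) m = c *: partial j A m.
  apply: (etrans (partial_scale _ (differentiable_cst _ _) dA)).
  by rewrite partial_cst scale0r add0r.
have dc c : differentiable (fun z => c *: A z) m by exact: differentiableZ.
rewrite (_ : partial j (fun z => a *: A z + B z) m = a *: partial j A m + partial j B m); last first.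
  by apply: (etrans (partialD j (dc a) dB)); rewrite E.
rewrite E; move: (partial j A m) (partial j B m) => A' B'.
by apply/matrixP => i k; rewrite !mxE; apply/eqP; rewrite eq_complex /=; apply/andP; split; apply/eqP; ring.
Qed.

(** By the Jacobi identity this is the bracket of [P, Q] with V. *)
Lemma comm_pencil n (P Q V : 'M[R]_n) : commutator P Q = 0 ->
  commutator P (commutator Q V) + commutator (commutator P V) Q = 0.
Proof.
move=> PQ; rewrite comm_jacobi PQ (commC _ Q) [commutator 0 V]/commutator mul0mx mulmx0 subrr.
by rewrite add0r addNr.
Qed.

(** The terms of degree two and one in l are those assumed to vanish, and dP
    occurs twice because P is closed. *)
Lemma flat_pencil (K : comNzRingType) n (l : K) (P Q G H dP dG dH : 'M[K]_n) : commutator P Q = 0 ->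
  commutator P H + commutator G Q = 0 ->
  (l *: dP + dH) - (l *: dP + dG) + commutator (l *: P + G) (l *: Q + H) = dH - dG + commutator G H.
Proof.
move=> PQ PH.
have -> : commutator (l *: P + G) (l *: Q + H) =
    (l * l) *: commutator P Q + l *: (commutator P H + commutator G Q) + commutator G H.
  rewrite /commutator !mulmxDl !mulmxDr -!scalemxAl -!scalemxAr.
  move: (P *m Q) (Q *m P) (P *m H) (H *m P) (G *m Q) (Q *m G) (G *m H) (H *m G) => t1 t2 t3 t4 t5 t6 t7 t8.
  by apply/matrixP => i k; rewrite !mxE; ring.
rewrite PQ PH !scaler0 !add0r; congr (_ + _).
by rewrite opprD addrACA subrr add0r.
Qed.

(** The curvature of theta_lambda does not depend on lambda, so all members
    are flat as soon as the real form theta_1 is. *)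
Lemma flat_family_real x v : smooth x -> smooth (v : plane -> 'M[R]_8) ->
  (forall m, in_phat (v m)) -> flat_family x v <-> rflat (rth x v).
Proof.
move=> sx sv pv.
pose B := @bform 8 (b_mx R) x; pose G j z := @commutator R 8 (B j z) (v z).
have sB j : smooth (B j) by exact: smooth_bform.
have sG j : smooth (G j) by exact: smooth_comm.
have BB m : commutator (B ord0 m) (B ord_max m) = 0 by apply: bform_comm; exact: b_mx_comm.
have BG m : commutator (B ord0 m) (G ord_max m) + commutator (G ord0 m) (B ord_max m) = 0.
  exact: comm_pencil.
pose Om m := partial ord0 (G ord_max) m - partial ord_max (G ord0) m + commutator (G ord0 m) (G ord_max m).
have dB m : partial ord0 (B ord_max) m = partial ord_max (B ord0) m by exact: bform_closed.
have real m : partial ord0 (rth x v ord_max) m - partial ord_max (rth x v ord0) m +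
    commutator (rth x v ord0 m) (rth x v ord_max m) = Om m.
  have E i j : partial i (rth x v j) m = 1 *: partial i (B j) m + partial i (G j) m.
    rewrite scale1r; exact: (partialD i (smooth_diff m (sB j)) (smooth_diff m (sG j))).
  have T j : rth x v j m = 1 *: B j m + G j m by rewrite scale1r.
  rewrite !E !T dB; exact: flat_pencil.
have cplx lambda m : cpartial ord0 (theta x v lambda ord_max) m - cpartial ord_max (theta x v lambda ord0) m
   + commutator (theta x v lambda ord0 m) (theta x v lambda ord_max m) = complexify (Om m).
  have T j : theta x v lambda j = fun z => lambda *: complexify (B j z) + complexify (G j z).
    by apply/funext => z; exact: thetaE.
  have E i j : cpartial i (theta x v lambda j) m =
      lambda *: complexify (partial i (B j) m) + complexify (partial i (G j) m).
    rewrite T; exact: (@cpartial_pencil 7 lambda i _ _ m (smooth_diff m (sB j)) (smooth_diff m (sG j))).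
  have -> : complexify (Om m) = complexify (partial ord0 (G ord_max) m) - complexify (partial ord_max (G ord0) m)
      + commutator (complexify (G ord0 m)) (complexify (G ord_max m)).
    apply: (etrans (complexifyD _ _)); rewrite complexify_comm; congr (_ + _).
    by apply: (etrans (complexifyD _ _)); rewrite complexifyN.
  rewrite !E dB !T; apply: flat_pencil; first by rewrite -complexify_comm BB; exact: complexify0.
  rewrite -!complexify_comm; apply: (etrans (esym (complexifyD _ _))).
  by rewrite BG; exact: complexify0.
split=> [[_ _ /(_ 1) H] m|H].
  by apply: complexify_inj; rewrite real -(cplx 1); apply: (etrans (H m)); exact/esym/complexify0.
split=> // lambda m; apply: (etrans (cplx lambda m)).
by rewrite -real H; exact: complexify0.
Qed.

End RealForm.

(** * Structure equations of framed surfaces *)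

Section Structure.
Variable R : realType.
Local Notation plane := (plane R).
Local Notation vec := 'cV[R]_7.

Lemma smooth_sub p q r s (f : plane -> 'M[R]_(p, q)) (g : 'I_r -> 'I_p) (h : 'I_s -> 'I_q) :
  smooth f -> smooth (fun z => mxsub g h (f z)).
Proof.
move=> /smooth_mxP sf; apply/smooth_mxP => i j.
by under eq_fun do rewrite mxE; exact: sf.
Qed.

Lemma partial_sub p q r s j (f : plane -> 'M[R]_(p, q)) (g : 'I_r -> 'I_p) (h : 'I_s -> 'I_q) m :
  differentiable f m -> partial j (fun z => mxsub g h (f z)) m = mxsub g h (partial j f m).
Proof.
move=> df; apply/matrixP => i k.
have ds : differentiable (fun z => mxsub g h (f z)) m.
  by apply/differentiable_mxP => i' k'; under eq_fun do rewrite mxE; move/differentiable_mxP : df.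
apply: (etrans (partial_mxE _ _ _ ds)); apply: (etrans _ (esym (mxE _ _ _ _))).
apply: (etrans _ (esym (partial_mxE _ _ _ df))); congr (partial j _ m).
by apply/funext => z; exact: mxE.
Qed.

(** Symmetry of second derivatives of a solution of dG = G w. *)
Lemma mc_flat n (G : plane -> 'M[R]_n) (w : 'I_2 -> plane -> 'M[R]_n) : smooth G ->
  (forall m, G m \in unitmx) -> (forall j, smooth (w j)) ->
  (forall j m, partial j G m = G m *m w j m) -> rflat w.
Proof.
move=> sG uG sw dG m.
have E i j : partial i (partial j G) m = G m *m (w i m *m w j m + partial i (w j) m).
  rewrite (_ : partial j G = fun z => G z *m w j z); last by apply/funext => z; exact: dG.
  apply: (etrans (partial_mulmx i (smooth_diff m sG) (smooth_diff m (sw j)))).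
  by rewrite dG mulmxDr mulmxA.
have := schwarz_mx ord0 ord_max m sG; rewrite !E => /(can_inj (mulKmx (uG m))).
rewrite /commutator; move: (partial _ _ _) (partial _ _ _) => a b e.
by rewrite addrACA -opprD [a + _]addrC [b + _]addrC e subrr.
Qed.

(** A closed form c with values in R^n is a flat form with values in the
    nilpotent algebra of matrices with a single nonzero column; the last
    column of a solution is a potential. *)
Lemma poincare n (c : 'I_2 -> plane -> 'cV[R]_n) : (forall j, smooth (c j)) ->
  (forall m, partial ord0 (c ord_max) m = partial ord_max (c ord0) m) ->
  exists f : plane -> 'cV[R]_n, smooth f /\ forall j m, partial j f m = c j m.
Proof.
move=> sc dc; pose w j z : 'M[R]_(n + 1) := block_mx 0 (c j z) 0 0.
have s0 p q : smooth (fun _ : plane => 0 : 'M[R]_(p, q)) by exact: smooth_cst.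
have sw j : smooth (w j) by exact: smooth_block.
have ww i j m : w i m *m w j m = 0.
  by rewrite /w mulmx_block !mulmx0 !mul0mx !addr0; exact: block_mx0.
have dw i j m : partial i (w j) m = block_mx 0 (partial i (c j) m) 0 0.
  have d0 p q : differentiable (fun _ : plane => 0 : 'M[R]_(p, q)) m by exact: differentiable_cst.
  apply: (etrans (partial_block i (d0 _ _) (smooth_diff m (sc j)) (d0 _ _) (d0 _ _))).
  by rewrite !partial_cst.
have [|F [sF F0 dF _]] := frobenius sw.
  by move=> m; rewrite !dw dc !ww !subrr addr0.
have dsub p q (g : 'I_p -> 'I_(n + 1)) (h : 'I_q -> 'I_(n + 1)) j m :
    partial j (fun z => mxsub g h (F z)) m = mxsub g h (F m *m w j m).
  by apply: (etrans (partial_sub j g h (smooth_diff m sF))); rewrite dF.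
have blockE (X : 'M[R]_(n + 1)) j m : X *m w j m = block_mx 0 (ulsubmx X *m c j m) 0 (dlsubmx X *m c j m).
  by rewrite -{1}[X]submxK /w mulmx_block !mulmx0 !addr0.
have ul m : ulsubmx (F m) = 1%:M.
  rewrite (@partial0_cst_mx R n n (fun z => ulsubmx (F z))).
  - by rewrite F0; apply/matrixP => i k; rewrite !mxE (inj_eq (@lshift_inj _ _)).
  - move=> z; apply: smooth_diff; rewrite (_ : (fun z => ulsubmx (F z)) = fun z => mxsub (@lshift n 1) (@lshift n 1) (F z)).
      exact: smooth_sub.
    by apply/funext => t; apply/matrixP => i k; rewrite !mxE.
  - move=> j z; rewrite (_ : (fun z => ulsubmx (F z)) = fun z => mxsub (@lshift n 1) (@lshift n 1) (F z)); last first.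
      by apply/funext => t; apply/matrixP => i k; rewrite !mxE.
    apply: (etrans (dsub _ _ _ _ _ _)); rewrite blockE.
    by apply/matrixP => i k; rewrite mxE block_mxEul.
exists (fun z => mxsub (@lshift n 1) (@rshift n 1) (F z)); split=> [|j m]; first exact: smooth_sub.
rewrite dsub blockE ul mul1mx.
by apply/matrixP => i k; rewrite mxE block_mxEur.
Qed.

Definition rot_part (v : 'M[R]_8) : 'M[R]_7 := ulsubmx (v : 'M[R]_(7 + 1)).
Definition trans_part (v : 'M[R]_8) : vec := ursubmx (v : 'M[R]_(7 + 1)).

Lemma in_phatE v : in_phat v ->
  [/\ in_p7 (rot_part v), P0 R *m trans_part v = 0 & v = mot (rot_part v) (trans_part v)].
Proof.
move=> /in_phat_mot[V [u [pV u0 ->]]].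
have -> : rot_part (mot V u) = V by rewrite /rot_part /mot; exact: block_mxKul.
by have -> : trans_part (mot V u) = u by rewrite /trans_part /mot; exact: block_mxKur.
Qed.

Lemma smooth_rot_part (v : plane -> 'M[R]_8) : smooth v -> smooth (fun z => rot_part (v z)).
Proof.
move=> /smooth_mxP sv; apply/smooth_mxP => i j.
by under eq_fun do rewrite !mxE; exact: sv.
Qed.

Lemma smooth_trans_part (v : plane -> 'M[R]_8) : smooth v -> smooth (fun z => trans_part (v z)).
Proof.
move=> /smooth_mxP sv; apply/smooth_mxP => i j.
by under eq_fun do rewrite !mxE; exact: sv.
Qed.

Lemma bform_mot x j m : bform (b_mx R) x j m = mot (bform (bb R) x j m) 0.
Proof.
rewrite /bform; move: (partial j x m) => s.
by rewrite !big_ord_recr !big_ord0 /= !add0r !b_mx_mot !motZ motD !scaler0 addr0.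
Qed.

Definition rot_form x (v : plane -> 'M[R]_8) j m : 'M[R]_7 :=
  bform (bb R) x j m + commutator (bform (bb R) x j m) (rot_part (v m)).
Definition trans_form x (v : plane -> 'M[R]_8) j m : vec :=
  bform (bb R) x j m *m trans_part (v m).

Lemma rth_mot x v j m : in_phat (v m) -> rth x v j m = mot (rot_form x v j m) (trans_form x v j m).
Proof.
move=> /in_phatE[_ _ vE]; rewrite /rth {1}vE bform_mot [X in _ + X]mot_comm motD.
by rewrite mulmx0 subr0 add0r.
Qed.

Lemma smooth_rot_form x v j : smooth x -> smooth v -> smooth (rot_form x v j).
Proof.
move=> sx sv; apply: smoothD; first exact: smooth_bform.
by apply: smooth_comm; [exact: smooth_bform|exact: smooth_rot_part].
Qed.

Lemma smooth_trans_form x v j : smooth x -> smooth v -> smooth (trans_form x v j).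
Proof.
by move=> sx sv; apply: smooth_mulmx; [exact: smooth_bform|exact: smooth_trans_part].
Qed.

Lemma rflat_mot (A : 'I_2 -> plane -> 'M[R]_7) (c : 'I_2 -> plane -> vec) :
  (forall j, smooth (A j)) -> (forall j, smooth (c j)) ->
  rflat (fun j m => mot (A j m) (c j m)) <-> rflat A /\
    forall m, partial ord0 (c ord_max) m - partial ord_max (c ord0) m +
      (A ord0 m *m c ord_max m - A ord_max m *m c ord0 m) = 0.
Proof.
move=> sA sc.
have E m : partial ord0 (fun z => mot (A ord_max z) (c ord_max z)) m -
    partial ord_max (fun z => mot (A ord0 z) (c ord0 z)) m +
    commutator (mot (A ord0 m) (c ord0 m)) (mot (A ord_max m) (c ord_max m)) =
  mot (partial ord0 (A ord_max) m - partial ord_max (A ord0) m + commutator (A ord0 m) (A ord_max m))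
    (partial ord0 (c ord_max) m - partial ord_max (c ord0) m +
      (A ord0 m *m c ord_max m - A ord_max m *m c ord0 m)).
  have P i j := partial_mot i (smooth_diff m (sA j)) (smooth_diff m (sc j)).
  by rewrite !P mot_comm motN !motD.
split=> [H|[H1 H2] m].
  split=> m; have := H m; rewrite E -[0](mot0 R) => /mot_inj[]//.
by rewrite E H1 H2; exact: mot0.
Qed.

Lemma integratesP x v F phi : smooth x -> smooth (v : plane -> 'M[R]_8) -> (forall m, in_phat (v m)) ->
  integrates x v F phi <-> [/\ smooth F, smooth phi, forall m, G2 (F m) &
    forall j m, partial j F m = F m *m rot_form x v j m /\ partial j phi m = F m *m trans_form x v j m].
Proof.
move=> sx sv pv.
have E j m : smooth F -> smooth phi -> G2 (F m) -> complexify (maurer_cartan F phi j m) = theta x v 1 j m <->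
    partial j F m = F m *m rot_form x v j m /\ partial j phi m = F m *m trans_form x v j m.
  move=> sF sphi G; rewrite theta1 (rth_mot x j (pv m)).
  rewrite (maurer_cartanE j G (smooth_diff m sF) (smooth_diff m sphi)).
  have K := G2_orthr G; have K' := G2_orth G.
  split=> [/complexify_inj/mot_inj[<- <-]|[-> ->]]; first by rewrite !mulmxA K !mul1mx.
  by rewrite !mulmxA K' !mul1mx.
split=> -[sF sphi G H]; split=> // j m; exact/E.
Qed.

(** The motions by F and phi solve dG = G w, so [mc_flat] applies. *)
Lemma mc_structure (F : plane -> 'M[R]_7) (phi : plane -> vec) (A : 'I_2 -> plane -> 'M[R]_7)
    (c : 'I_2 -> plane -> vec) : smooth F -> smooth phi -> (forall m, G2 (F m)) ->
  (forall j, smooth (A j)) -> (forall j, smooth (c j)) ->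
  (forall j m, partial j F m = F m *m A j m) -> (forall j m, partial j phi m = F m *m c j m) ->
  rflat (fun j m => mot (A j m) (c j m)).
Proof.
move=> sF sphi G sA sc dF dphi.
pose H z : 'M[R]_(7 + 1) := block_mx (F z) (phi z) 0 1%:M.
have s0 p q (X : 'M[R]_(p, q)) : smooth (fun _ : plane => X) by exact: smooth_cst.
apply: (@mc_flat _ H).
- exact: smooth_block.
- move=> m; have /mulmx1_unit[//] : H m *m block_mx (F m)^T (- ((F m)^T *m phi m)) 0 1%:M = 1%:M.
  rewrite /H mulmx_block.
  rewrite !mulmx0 !mul0mx !mulmx1 !addr0 !add0r mulmxN mulmxA (G2_orthr (G m)) mul1mx addNr.
  exact: esym (scalar_mx_block _ _ _).
- by move=> j; apply: smooth_block.
- move=> j m; have d0 p q (X : 'M[R]_(p, q)) : differentiable (fun _ : plane => X) m by exact: differentiable_cst.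
  apply: (etrans (partial_block j (smooth_diff m sF) (smooth_diff m sphi) (d0 _ _ _) (d0 _ _ _))).
  rewrite !partial_cst dF dphi; apply: (etrans _ (esym (mulmx_block _ _ _ _ _ _ _ _))).
  by rewrite !mulmx0 !mul0mx !addr0.
Qed.

Lemma integrates_flat x v F phi : smooth x -> smooth (v : plane -> 'M[R]_8) -> (forall m, in_phat (v m)) ->
  integrates x v F phi -> flat_family x v.
Proof.
move=> sx sv pv /(integratesP _ _ sx sv pv)[sF sphi G H].
apply/(flat_family_real sx sv pv).
rewrite (_ : rth x v = fun j m => mot (rot_form x v j m) (trans_form x v j m)); last first.
  by apply/funext => j; apply/funext => m; exact: rth_mot.
apply: (mc_structure sF sphi G) => [j|j|j m|j m]; [exact: smooth_rot_form|exact: smooth_trans_form| |].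
  by have [] := H j m.
by have [] := H j m.
Qed.

Lemma flat_family_structure x v : smooth x -> flat_family x v ->
  rflat (rot_form x v) /\ forall m, partial ord0 (trans_form x v ord_max) m - partial ord_max (trans_form x v ord0) m +
      (rot_form x v ord0 m *m trans_form x v ord_max m - rot_form x v ord_max m *m trans_form x v ord0 m) = 0.
Proof.
move=> sx /[dup] -[sv pv _] /(flat_family_real sx sv pv) H.
apply/rflat_mot => [j|j|]; [exact: smooth_rot_form|exact: smooth_trans_form|].
move: H; rewrite (_ : rth x v = fun j m => mot (rot_form x v j m) (trans_form x v j m))//.
by apply/funext => j; apply/funext => m; exact: rth_mot.
Qed.

End Structure.

(** * Curvature of the bundle of normal planes *)

Section PlaneFields.
Variable R : realType.
Local Notation plane := (plane R).
Local Notation vec := 'cV[R]_7.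

Lemma dim_span2 (V : vectType R) (p q : V) :
  \dim <<[:: p; q]>>%VS = 2 <-> forall a b : R, a *: p + b *: q = 0 -> a = 0 /\ b = 0.
Proof.
split=> [d2 a b E|H].
  have : free [:: p; q] by rewrite /free d2.
  rewrite free_cons span_seq1 free_cons span_nil memv0 => /and3P[pq q0 _].
  have a0 : a = 0.
    apply/eqP; apply: contraR pq => a0; apply/vlineP; exists (- (a^-1 * b)).
    move/eqP: E; rewrite addr_eq0 => /eqP E.
    by rewrite -[LHS]scale1r -(mulVf a0) -scalerA E scalerN scalerA scaleNr.
  by move: E; rewrite a0 scale0r add0r => /eqP; rewrite scaler_eq0 (negbTE q0) orbF => /eqP.
have : free [:: p; q].
  rewrite free_cons span_seq1 free_cons span_nil memv0 nil_free andbT; apply/andP; split.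
    apply/negP => /vlineP[k pE]; have [|/eqP] := H 1 (- k); first by rewrite pE scale1r scaleNr subrr.
    by rewrite oner_eq0.
  apply/eqP => q0; have [|_ /eqP] := H 0 1; first by rewrite q0 scaler0 addr0 scale0r.
  by rewrite oner_eq0.
by rewrite /free => /eqP.
Qed.

Lemma bb_free (s t : R) : s *: b0 R + t *: b1 R = 0 -> s = 0 /\ t = 0.
Proof.
move=> E; split.
  have := congr1 (fun X => en X 4 0) E; rewrite enD !enZ en0 /b0 /b1 !en_mat7//=.
  by rewrite mulr1 mulr0 addr0.
have := congr1 (fun X => en X 5 3) E; rewrite enD !enZ en0 /b0 /b1 !en_mat7//=.
by rewrite mulr1 mulr0 add0r.
Qed.

Lemma proj_offdiag n (P X : 'M[R]_n) : P *m P = P -> P *m X + X *m P = X -> P *m X *m P = 0.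
Proof.
move=> PP E; have := congr1 (mulmx P) E; rewrite mulmxDr !mulmxA PP.
by move=> /(canRL (addKr _)); rewrite addNr.
Qed.

Lemma proj_offdiagC n (P X : 'M[R]_n) : P *m P = P -> P *m X + X *m P = X ->
  commutator X P = 0 -> X = 0.
Proof.
move=> PP E /comm0P XP; have Z := proj_offdiag PP E.
by move: E Z; rewrite -mulmxA XP mulmxA PP => E Z; rewrite -E Z addr0.
Qed.

(** On matrices exchanging the image and the kernel of P, [X, P] is the
    product of X with the reflection 2 P - 1, which anticommutes with them;
    therefore [X, P] [Y, P] = - X Y. *)
Lemma proj_comm n (P X Y : 'M[R]_n) : P *m P = P -> P *m X + X *m P = X -> P *m Y + Y *m P = Y ->
  commutator (commutator X P) (commutator Y P) = - commutator X Y.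
Proof.
move=> PP EX EY.
have M (A B : 'M[R]_n) : P *m A + A *m P = A -> P *m B + B *m P = B ->
    commutator A P *m commutator B P = - (A *m B).
  move=> EA EB; have ZA := proj_offdiag PP EA; have ZB := proj_offdiag PP EB.
  have e1 : A *m P *m (B *m P) = 0 by rewrite mulmxA -(mulmxA A P) -(mulmxA A) ZB mulmx0.
  have e2 : P *m A *m (P *m B) = 0 by rewrite mulmxA ZA mul0mx.
  have e3 : A *m P *m (P *m B) = A *m (P *m B) by rewrite mulmxA -(mulmxA A P P) PP mulmxA.
  have PA : P *m A = A - A *m P by rewrite -{2}EA addrK.
  have e4 : P *m A *m (B *m P) = A *m (B *m P) by rewrite PA mulmxBl e1 subr0.
  by rewrite /commutator mulmxBl !mulmxBr e1 e2 e3 e4 sub0r subr0 -opprD -mulmxDr EB.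
by rewrite [LHS]/commutator (M _ _ EX EY) (M _ _ EY EX) -opprD.
Qed.

(** A section satisfies P s = 0, hence nabla_j s = s_j + P_j s; the terms of
    second order are symmetric, and (1 - P) P_j (1 - P) = 0 turns the
    remaining ones into the bracket of P_1 and P_2. *)
Lemma curvature (P : plane -> 'M[R]_7) (s : plane -> vec) m : smooth P -> smooth s ->
  (forall z, P z *m P z = P z) -> (forall z, P z *m s z = 0) ->
  let nabla j (t : plane -> vec) z := (1%:M - P z) *m partial j t z in
  nabla ord0 (nabla ord_max s) m - nabla ord_max (nabla ord0 s) m =
  (1%:M - P m) *m (commutator (partial ord0 P m) (partial ord_max P m) *m s m).
Proof.
move=> sP ss PP Ps nabla.
have dPs j z : P z *m partial j s z = - (partial j P z *m s z).
  have := partial_mulmx j (smooth_diff z sP) (smooth_diff z ss).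
  rewrite (_ : (fun z => P z *m s z) = fun=> 0); last exact/funext.
  by rewrite partial_cst => /esym/eqP; rewrite addrC addr_eq0 => /eqP.
have N j : nabla j s = fun z => partial j s z + partial j P z *m s z.
  by apply/funext => z; rewrite /nabla mulmxBl mul1mx dPs opprK.
have dPP j z : partial j P z *m P z + P z *m partial j P z = partial j P z.
  rewrite -(partial_mulmx j (smooth_diff z sP) (smooth_diff z sP)).
  by congr (partial j _ z); apply/funext.
pose S i j := (1%:M - P m) *m (partial i (partial j s) m + partial i (partial j P) m *m s m).
have SC : S ord0 ord_max = S ord_max ord0.
  by rewrite /S (schwarz_mx ord0 ord_max m ss) (schwarz_mx ord0 ord_max m sP).
have NN i j : nabla i (nabla j s) m = S i j + (1%:M - P m) *m (partial j P m *m partial i s m).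
  rewrite N /nabla /S -mulmxDr; congr (_ *m _).
  have sj := smooth_partial j ss; have sPj := smooth_partial j sP.
  apply: (etrans (partialD i (smooth_diff m sj) (differentiable_mulmx (smooth_diff m sPj) (smooth_diff m ss)))).
  by rewrite (partial_mulmx i (smooth_diff m sPj) (smooth_diff m ss)) addrA.
have Q i j : (1%:M - P m) *m (partial j P m *m partial i s m) =
    - ((1%:M - P m) *m (partial j P m *m (partial i P m *m s m))).
  have := dPs i m; have := dPP j m.
  move: (partial j P m) (partial i P m) (partial i s m) (s m) => X Y t u E Pt.
  have QP : (1%:M - P m) *m P m = 0 by rewrite mulmxBl mul1mx PP subrr.
  by rewrite -mulmxN -mulmxN -Pt !mulmxA -[in LHS]E mulmxDr !mulmxA QP mul0mx addr0.
have NQ i j : nabla i (nabla j s) m = S i j - (1%:M - P m) *m (partial j P m *m (partial i P m *m s m)).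
  by apply: (etrans (NN i j)); congr (_ + _).
apply: (etrans (congr2 (fun a b => a - b) (NQ ord0 ord_max) (NQ ord_max ord0))).
rewrite SC; move: (S _ _) (partial ord0 P m) (partial ord_max P m) (P m) (s m) => a X Y p u.
by rewrite opprD addrACA subrr add0r opprK /commutator (mulmxBl (X *m Y)) mulmxBr -!mulmxA addrC.
Qed.

End PlaneFields.

(** * From the family to the surface *)

Section FamilyToSurface.
Variable R : realType.
Local Notation plane := (plane R).
Local Notation vec := 'cV[R]_7.

Lemma bform_in_p (x : plane -> plane) j m : in_p7 (bform (bb R) x j m).
Proof.
rewrite /bform; move: (partial j x m) => s.
rewrite !big_ord_recr big_ord0 /= add0r; apply: in_p7D; apply: in_p7Z; exact: bb_in_p.
Qed.

Lemma rot_form_der (x : plane -> plane) (v : plane -> 'M[R]_8) j m : in_phat (v m) -> der (rot_form x v j m).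
Proof.
move=> /in_phatE[[dV _] _ _]; have [dB _] := bform_in_p x j m.
by apply: derD => //; exact: der_comm.
Qed.

Lemma rot_form_P0 (x : plane -> plane) (v : plane -> 'M[R]_8) j m : in_phat (v m) ->
  commutator (rot_form x v j m) (P0 R) = commutator (bform (bb R) x j m) (P0 R).
Proof.
move=> /in_phatE[pV _ _]; have [_ kP] := comm_pp (bform_in_p x j m) pV.
rewrite /rot_form commDl; rewrite [X in _ + X = _](_ : _ = 0) ?addr0//.
exact/comm0P/esym.
Qed.

Lemma surface_exists (x : plane -> plane) (v : plane -> 'M[R]_8) : smooth x -> flat_family x v ->
  exists F phi, integrates x v F phi.
Proof.
move=> sx fv; have [sv pv _] := fv; have [fA fc] := flat_family_structure sx fv.
have sA j : smooth (rot_form x v j) by exact: smooth_rot_form.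
have sc j : smooth (trans_form x v j) by exact: smooth_trans_form.
have [F [sF F0 dF _]] := frobenius sA fA.
have GF m : G2 (F m).
  apply: (G2_of_linear_system (fun m => smooth_diff m sF) dF) => [j z|]; first exact: rot_form_der.
  by rewrite F0; exact: G2_1.
pose c j z : 'cV[R]_7 := F z *m trans_form x v j z.
have scF j : smooth (c j) by exact: smooth_mulmx.
have E i j m : partial i (c j) m =
   F m *m (rot_form x v i m *m trans_form x v j m + partial i (trans_form x v j) m).
  apply: (etrans (partial_mulmx i (smooth_diff m sF) (smooth_diff m (sc j)))).
  by rewrite dF mulmxDr mulmxA.
have cc m : partial ord0 (c ord_max) m = partial ord_max (c ord0) m.
  refine (etrans (E ord0 ord_max m) (etrans _ (esym (E ord_max ord0 m)))); apply: (congr1 (mulmx (F m))).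
  move: (fc m); move: (partial ord0 (trans_form x v ord_max) m) (partial ord_max (trans_form x v ord0) m) => a b e; apply/eqP.
  by rewrite -subr_eq0 -[X in _ == X]e opprD addrACA addrC.
have [phi [sphi dphi]] := poincare scF cc.
by exists F, phi; apply/(integratesP _ _ sx sv pv); split.
Qed.

(** F' F^T is constant because F and F' have the same Maurer-Cartan form. *)
Lemma surface_unique (x : plane -> plane) (v : plane -> 'M[R]_8) F phi F' phi' : smooth x -> flat_family x v ->
  integrates x v F phi -> integrates x v F' phi' ->
  exists g c, G2 g /\ forall m, F' m = g *m F m /\ phi' m = g *m phi m + c.
Proof.
move=> sx [sv pv _] /(integratesP _ _ sx sv pv)[sF sphi GF H] /(integratesP _ _ sx sv pv)[sF' sphi' GF' H'].
have dF m := smooth_diff m sF; have dF' m := smooth_diff m sF'.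
have dT m := differentiable_trmx (dF m).
pose g m := F' m *m (F m)^T.
have gE m : g m = g 0.
  apply: partial0_cst_mx => [z|j z]; first exact: differentiable_mulmx.
  apply: (etrans (partial_mulmx j (dF' z) (dT z))).
  have [-> _] := H' j z; rewrite (partial_trmx j (dF z)); have [-> _] := H j z.
  have [dA _] := rot_form_der x j (pv z).
  by rewrite trmx_mul dA mulNmx mulmxN mulmxA subrr.
have FE m : F' m = g 0 *m F m by rewrite -(gE m) /g -mulmxA G2_orth// mulmx1.
have dg m : differentiable (fun z => g 0 *m phi z) m.
  by apply: differentiable_mulmx; [exact: differentiable_cst|exact: smooth_diff].
have cE m : phi' m - g 0 *m phi m = phi' 0 - g 0 *m phi 0.
  apply: (@partial0_cst_mx _ _ _ (fun z => phi' z - g 0 *m phi z)) => [z|j z].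
    by apply: differentiableB; [exact: smooth_diff|exact: dg].
  apply: (etrans (partialB j (smooth_diff z sphi') (dg z))).
  rewrite (partial_mulmx j (differentiable_cst _ _) (smooth_diff z sphi)) partial_cst mul0mx add0r.
  have [_ ->] := H' j z; have [_ ->] := H j z.
  by rewrite FE mulmxA subrr.
exists (g 0), (phi' 0 - g 0 *m phi 0); split; first by apply: G2_mul => //; exact: G2_tr.
by move=> m; split=> //; rewrite -(cE m) addrC subrK.
Qed.

(** The translation part is b_l u with u in R^4, and b_l maps R^4 to R^3. *)
Lemma integrates_tangent (x : plane -> plane) (v : plane -> 'M[R]_8) F phi j m : smooth x -> flat_family x v -> integrates x v F phi ->
  partial j phi m \in frame_plane (F m).
Proof.
move=> sx [sv pv _] /(integratesP _ _ sx sv pv)[sF sphi GF H].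
have [_ ->] := H j m; apply/frame_planeP; first exact: G2_orth.
have [_ Pu _] := in_phatE (pv m); have [_ PB] := bform_in_p x j m.
rewrite /frame_proj /trans_form.
rewrite -mulmxA (mulmxA (F m)^T) G2_orth// mul1mx -mulmxA; congr (_ *m _).
by rewrite -[in RHS]PB mulmxDl -[X in _ = _ + X]mulmxA Pu mulmx0 addr0 mulmxA.
Qed.

Lemma integrates_gauss (x : plane -> plane) (v : plane -> 'M[R]_8) F phi m : smooth x -> flat_family x v -> integrates x v F phi ->
  surface phi -> gauss phi m = frame_plane (F m).
Proof.
move=> sx fv int [_ /(_ m) d2]; have [sv pv _] := fv.
have [_ _ /(_ m) GF _] := int.
apply: assoc_extE => //; last by do 2 eexists.
apply/span_subvP => w; rewrite !inE => /orP[] /eqP ->; exact: integrates_tangent int.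
Qed.

Lemma integrates_proj_partial (x : plane -> plane) (v : plane -> 'M[R]_8) F phi j m : smooth x -> flat_family x v -> integrates x v F phi ->
  partial j (fun z => frame_proj (F z)) m =
  F m *m commutator (bform (bb R) x j m) (P0 R) *m (F m)^T.
Proof.
move=> sx [sv pv _] /(integratesP _ _ sx sv pv)[sF sphi GF H].
have dF := smooth_diff m sF; have dT := differentiable_trmx dF.
have dP : differentiable (fun z => F z *m P0 R) m by exact: differentiable_mulmx_cstr.
apply: (etrans (partial_mulmx j dP dT)).
rewrite (partial_trmx j dF) (partial_mulmx j dF (differentiable_cst _ _)) partial_cst mulmx0 addr0.
have [-> _] := H j m; have [dA _] := rot_form_der x j (pv m).
rewrite -(rot_form_P0 x j (pv m)) trmx_mul dA /commutator mulmxBr mulmxBl !mulNmx mulmxN !mulmxA.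
by [].
Qed.

Lemma proj_conj_comm (f : 'M[R]_7) (X Y : 'M[R]_7) : f^T *m f = 1%:M ->
  commutator (f *m X *m f^T) (f *m Y *m f^T) = f *m commutator X Y *m f^T.
Proof.
move=> ff; rewrite /commutator mulmxBr mulmxBl.
by rewrite !mulmxA -!(mulmxA _ f^T f) ff !mulmx1.
Qed.

Lemma conj_comm_lin (f X Y P : 'M[R]_7) (a b : R) : f^T *m f = 1%:M ->
  a *: (f *m commutator X P *m f^T) + b *: (f *m commutator Y P *m f^T) = 0 ->
  commutator (a *: X + b *: Y) P = 0.
Proof.
move=> ff /(congr1 (fun Z => f^T *m Z *m f)).
have cE (C : 'M[R]_7) : f^T *m (f *m C *m f^T) *m f = C.
  by rewrite !mulmxA ff mul1mx -mulmxA ff mulmx1.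
by rewrite mulmxDr mulmxDl -!scalemxAr -!scalemxAl !cE mulmx0 mul0mx -!commZl -commDl.
Qed.

(** The derivative of the Gauss projection is F [beta_j, P0] F^T with beta
    the form sum_l b_l dx_l. By [proj_comm] the bracket of two such
    derivatives is that of beta_1 and beta_2, which vanishes; they are
    independent since X |-> [X, P0] is injective on p. *)
Lemma integrates_surface (x : plane -> plane) (v : plane -> 'M[R]_8) F phi : local_diffeo x -> flat_family x v -> integrates x v F phi ->
  surface phi -> [/\ abelian_surface phi, nondegenerate_surface phi & adapted_frame phi F].
Proof.
move=> [sx dx] fv int sphi; have [sv pv _] := fv.
have [sF _ GF _] := int.
have gE m : gauss phi m = frame_plane (F m) by exact: integrates_gauss int sphi.
have PE m : orth_proj (gauss phi m) = frame_proj (F m).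
  by rewrite gE orth_proj_frame// G2_orth.
have sP : smooth (fun z => frame_proj (F z)).
  apply: smooth_mulmx; last exact: smooth_trmx.
  by apply: smooth_mulmx; [|exact: smooth_cst].
have dP j m := integrates_proj_partial j m sx fv int.
have P0P := @P0_idem R.
have HP : (fun m => orth_proj (gauss phi m)) = fun z => frame_proj (F z) by exact/funext.
have bP j m := bform_in_p x j m.
have PP z : frame_proj (F z) *m frame_proj (F z) = frame_proj (F z).
  by apply: frame_proj_idem; exact: G2_orth.
split; last by split.
- move=> s [ss Ps] m.
  pose nabla j (t : plane -> vec) z := (1%:M - frame_proj (F z)) *m partial j t z.
  have NE j (t : plane -> vec) : W_nabla phi j t = nabla j t.
    by apply/funext => z; rewrite /W_nabla PE.
  have Ps' z : frame_proj (F z) *m s z = 0 by rewrite -PE.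
  have := curvature m sP ss PP Ps'; rewrite -/nabla !dP.
  rewrite proj_conj_comm; last exact: G2_orth.
  rewrite (proj_comm (@P0_idem R) (bP _ _).2 (bP _ _).2).
  rewrite (bform_comm _ _ _ _ (@bb_comm R)) oppr0 !mulmx0 !mul0mx mulmx0 => /eqP.
  rewrite subr_eq0 => /eqP E.
  by rewrite (NE ord_max s) (NE ord0 s) (NE ord0) (NE ord_max).
- rewrite /nondegenerate_surface HP; split=> // m; apply/dim_span2 => a b.
  rewrite !dP => /(conj_comm_lin (G2_orth (GF m))) C0.
  have pX := in_p7D (in_p7Z a (bP ord0 m)) (in_p7Z b (bP ord_max m)).
  have := proj_offdiagC (@P0_idem R) pX.2 C0.
  have /dim_span2 := dx m; rewrite /bform.
  move: (partial ord0 x m) (partial ord_max x m) => s t st.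
  rewrite !big_ord_recr !big_ord0 /= !add0r !scalerDr !scalerA addrACA -!scalerDl.
  move=> /bb_free[e0 e1]; apply: st; apply/rowP => l; rewrite !mxE.
  have e l' : l' = widen_ord (leqnSn 1) ord_max \/ l' = ord_max :> 'I_2.
    by case: l' => [[|[|//]] p]; [left|right]; exact: val_inj.
  by case: (e l) => ->.
Qed.

End FamilyToSurface.

(** * Regular pairs *)

Section RegularPairs.
Variable R : realType.
Local Notation mat := 'M[R]_7.

(** A basis of a maximal abelian subspace of p. *)
Definition regular_pair (X0 X1 : mat) := [/\ in_p7 X0, in_p7 X1, commutator X0 X1 = 0 &
  forall a b : R, a *: X0 + b *: X1 = 0 -> a = 0 /\ b = 0].

Lemma in_aD (X Y : mat) : in_a X -> in_a Y -> in_a (X + Y).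
Proof.
move=> [s [t ->]] [s' [t' ->]]; exists (s + s'), (t + t').
by rewrite !scalerDl addrACA.
Qed.

Lemma in_aZ a (X : mat) : in_a X -> in_a (a *: X).
Proof. by move=> [s [t ->]]; exists (a * s), (a * t); rewrite scalerDr !scalerA. Qed.

Lemma conjK (g X : mat) : g *m g^T = 1%:M -> g *m (g^T *m X *m g) *m g^T = X.
Proof. by move=> gg; rewrite !mulmxA gg mul1mx -mulmxA gg mulmx1. Qed.

Lemma conj_inj (g X Y : mat) : g *m g^T = 1%:M -> g^T *m X *m g = g^T *m Y *m g -> X = Y.
Proof. by move=> gg E; rewrite -(conjK X gg) E conjK. Qed.

Lemma conj_lin (g X Y : mat) (a b : R) :
  g^T *m (a *: X + b *: Y) *m g = a *: (g^T *m X *m g) + b *: (g^T *m Y *m g).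
Proof. by rewrite mulmxDr mulmxDl -!scalemxAr -!scalemxAl. Qed.

Lemma conj0 (g : mat) : g^T *m 0 *m g = 0. Proof. by rewrite mulmx0 mul0mx. Qed.

Lemma conjB (g X Y : mat) : g^T *m (X - Y) *m g = g^T *m X *m g - g^T *m Y *m g.
Proof. by rewrite mulmxBr mulmxBl. Qed.

Lemma conj_commP (g A B : mat) : g *m g^T = 1%:M ->
  commutator (g^T *m A *m g) (g^T *m B *m g) = 0 <-> commutator A B = 0.
Proof.
move=> gg; rewrite -comm_conj//; split=> [E|->]; last exact: conj0.
by apply: (conj_inj gg); rewrite E conj0.
Qed.

Lemma in_k_conj (g w : mat) : G2 g -> g *m P0 R = P0 R *m g -> in_k w -> in_k (g^T *m w *m g).
Proof.
move=> Gg gP [dw wP]; split; first exact: der_conj'.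
have gTP : P0 R *m g^T = g^T *m P0 R by rewrite -[P0 R in LHS]P0_tr -trmx_mul gP trmx_mul P0_tr.
by rewrite !mulmxA gTP -(mulmxA g^T) wP -!mulmxA gP.
Qed.

Lemma tr_commute (g : mat) : g *m P0 R = P0 R *m g -> g^T *m P0 R = P0 R *m g^T.
Proof. by move=> gP; rewrite -[P0 R in LHS]P0_tr -trmx_mul -gP trmx_mul P0_tr. Qed.

Lemma in_k_conjV (g w : mat) : G2 g -> g *m P0 R = P0 R *m g -> in_k w -> in_k (g *m w *m g^T).
Proof.
by move=> Gg gP kw; have := in_k_conj (G2_tr Gg) (tr_commute gP) kw; rewrite trmxK.
Qed.

Lemma det_neq0 (a b c d : R) : (forall s t, s * a + t * c = 0 -> s * b + t * d = 0 -> s = 0 /\ t = 0) ->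
  a * d - b * c != 0.
Proof.
move=> Z; apply/eqP => det0.
have [d0 /eqP] : d = 0 /\ - b = 0 by apply: Z; [rewrite -det0; ring|ring].
rewrite oppr_eq0 => /eqP b0.
have [/eqP + a0] : - c = 0 /\ a = 0 by apply: Z; [ring|rewrite -det0; ring].
rewrite oppr_eq0 => /eqP c0.
have [/eqP] : (1 : R) = 0 /\ (0 : R) = 0 by apply: Z; rewrite ?a0 ?b0 ?c0 ?d0; ring.
by rewrite oner_eq0.
Qed.

Lemma regular_pair_nf (X0 X1 : mat) : regular_pair X0 X1 -> exists g a b c d,
  [/\ G2 g, g *m P0 R = P0 R *m g, a * d - b * c != 0,
      g^T *m X0 *m g = a *: b0 R + b *: b1 R & g^T *m X1 *m g = c *: b0 R + d *: b1 R].
Proof.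
move=> [p0 p1 XX free]; have [g [Gg gP [a [b E0]] [c [d E1]]]] := normal_form p0 p1 XX.
have gg := G2_orthr Gg.
exists g, a, b, c, d; split=> //; apply: det_neq0 => s t e1 e2.
apply: free; apply: (conj_inj gg); rewrite conj_lin conj0 E0 E1.
by rewrite !scalerDr !scalerA addrACA -!scalerDl e1 e2 !scale0r addr0.
Qed.

Lemma regular_pair_centralizer_k (X0 X1 w : mat) : regular_pair X0 X1 -> in_k w ->
  commutator w X0 = 0 -> commutator w X1 = 0 -> w = 0.
Proof.
move=> /regular_pair_nf[g [a [b [c [d [Gg gP det E0 E1]]]]]] kw w0 w1.
have gg := G2_orthr Gg; apply: (conj_inj gg); rewrite conj0.
move: w0 w1 => /(conj_commP _ _ gg) + /(conj_commP _ _ gg).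
rewrite E0 E1 !commDr !commZr => e0 e1.
have Z (P Q : mat) : a *: P + b *: Q = 0 -> c *: P + d *: Q = 0 -> P = 0 /\ Q = 0.
  move=> /matrixP e /matrixP e'.
  split; apply/matrixP => i j; have := e i j; have := e' i j; rewrite !mxE => h1 h2; apply: (mulfI det); rewrite mulr0.
    by transitivity (d * (a * P i j + b * Q i j) - b * (c * P i j + d * Q i j)); [ring|rewrite h1 h2; ring].
  by transitivity (a * (c * P i j + d * Q i j) - c * (a * P i j + b * Q i j)); [ring|rewrite h1 h2; ring].
have [z0 z1] := Z _ _ e0 e1.
by apply: centralizer_k => //; exact: in_k_conj.
Qed.

Lemma regular_pair_centralizer (X0 X1 Z : mat) : regular_pair X0 X1 -> in_p7 Z ->
  commutator Z X0 = 0 -> commutator Z X1 = 0 -> exists s t, Z = s *: X0 + t *: X1.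
Proof.
move=> /regular_pair_nf[g [a [b [c [d [Gg gP det E0 E1]]]]]] pZ w0 w1.
have gg := G2_orthr Gg.
pose k := (a * d - b * c)^-1.
have bE : b0 R = (k * d) *: (g^T *m X0 *m g) + (- (k * b)) *: (g^T *m X1 *m g).
  by rewrite E0 E1; apply/matrixP => i j; rewrite !mxE /k; field.
have bE1 : b1 R = (- (k * c)) *: (g^T *m X0 *m g) + (k * a) *: (g^T *m X1 *m g).
  by rewrite E0 E1; apply/matrixP => i j; rewrite !mxE /k; field.
have [s [t Zst]] : in_a (g^T *m Z *m g).
  apply: centralizer_regular; first exact: in_p7_conj.
  rewrite commDr commZr {1}bE bE1 !commDr !commZr.
  by rewrite ((conj_commP _ _ gg).2 w0) ((conj_commP _ _ gg).2 w1) !scaler0 !addr0 scaler0 ?addr0 ?add0r.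
exists (s * (k * d) + t * - (k * c)), (s * - (k * b) + t * (k * a)).
apply: (conj_inj gg); rewrite conj_lin Zst {1}bE bE1.
by rewrite !scalerDr !scalerA addrACA -!scalerDl.
Qed.

(** [tangent_to_a] transported to an arbitrary regular pair by the
    conjugation of [regular_pair_nf]. *)
Lemma regular_pair_tangent (X0 X1 U0 U1 : mat) : regular_pair X0 X1 -> in_p7 U0 -> in_p7 U1 ->
  commutator U0 X1 = commutator U1 X0 -> exists2 w, in_k w &
    forall U X Y, (U, X) \in [:: (U0, X0); (U1, X1)] -> Y \in [:: X0; X1] ->
      commutator (U - commutator w X) Y = 0.
Proof.
move=> /regular_pair_nf[g [a [b [c [d [Gg gP det E0 E1]]]]]] pU0 pU1 UX.
have gg := G2_orthr Gg.
pose k := (a * d - b * c)^-1.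
pose V0 := g^T *m U0 *m g; pose V1 := g^T *m U1 *m g.
have pV0 : in_p7 V0 by exact: in_p7_conj.
have pV1 : in_p7 V1 by exact: in_p7_conj.
have VY : c *: commutator V0 (b0 R) + d *: commutator V0 (b1 R) =
    a *: commutator V1 (b0 R) + b *: commutator V1 (b1 R).
  by rewrite -!commZr -!commDr -E0 -E1 /V0 /V1 -!comm_conj// UX.
have [w' kw' [aZ0 aZ1]] : exists2 w, in_k w &
    in_a ((k * d) *: V0 - (k * b) *: V1 - commutator w (b0 R)) /\
    in_a ((k * a) *: V1 - (k * c) *: V0 - commutator w (b1 R)).
  apply: tangent_to_a; [by apply: in_p7B; exact: in_p7Z..|].
  have BZ x y (A B C : mat) : commutator (x *: A - y *: B) C = x *: commutator A C - y *: commutator B C.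
    by rewrite -(scaleNr y B) commDl !commZl scaleNr.
  rewrite !BZ.
  move: VY; move: (commutator V0 (b0 R)) (commutator V0 (b1 R)) (commutator V1 (b0 R)) (commutator V1 (b1 R)) => p q r s.
  move=> /matrixP VY; apply/matrixP => i j; have := VY i j; rewrite !mxE => e.
  apply/eqP; rewrite -subr_eq0; apply/eqP.
  by transitivity (k * (c * p i j + d * q i j - (a * r i j + b * s i j))); [ring|rewrite e subrr mulr0].
have gg' := G2_orth Gg.
exists (g *m w' *m g^T); first exact: in_k_conjV.
have wK : g^T *m (g *m w' *m g^T) *m g = w' by rewrite !mulmxA gg' mul1mx -mulmxA gg' mulmx1.
have aU0 : in_a (g^T *m (U0 - commutator (g *m w' *m g^T) X0) *m g).
  rewrite conjB comm_conj// wK E0 commDr !commZr -/V0.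
  have := in_aD (in_aZ a aZ0) (in_aZ b aZ1); congr in_a.
  by move: (commutator w' (b0 R)) (commutator w' (b1 R)) => p q; apply/matrixP => i j; rewrite !mxE /k; field.
have aU1 : in_a (g^T *m (U1 - commutator (g *m w' *m g^T) X1) *m g).
  rewrite conjB comm_conj// wK E1 commDr !commZr -/V1.
  have := in_aD (in_aZ c aZ0) (in_aZ d aZ1); congr in_a.
  by move: (commutator w' (b0 R)) (commutator w' (b1 R)) => p q; apply/matrixP => i j; rewrite !mxE /k; field.
move=> U X Y UXin Yin; apply/(conj_commP _ _ gg); apply: comm_in_a.
  by move: UXin; rewrite !inE => /orP[] /eqP[-> ->].
by move: Yin; rewrite !inE => /orP[] /eqP ->; [exists a, b|exists c, d].
Qed.

Lemma trace_skew_le0 n (xi : 'M[R]_n) : xi^T = - xi -> \tr (xi *m xi) <= 0.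
Proof.
move=> xT; rewrite -oppr_ge0 -raddfN -mulNmx -xT; apply: sumr_ge0 => i _; rewrite mxE.
by apply: sumr_ge0 => j _; rewrite mxE -expr2 sqr_ge0.
Qed.

Lemma trace_double_comm n (w X : 'M[R]_n) :
  \tr (commutator (commutator w X) X *m w) = - \tr (commutator w X *m commutator w X).
Proof.
set Z := commutator w X; rewrite [commutator Z X]/commutator mulmxBl raddfB /= -!mulmxA.
rewrite (mxtrace_mulC X) -mulmxA -raddfB -mulmxBr (_ : _ - _ = - Z); last by rewrite /Z /commutator opprB.
by rewrite mulmxN raddfN.
Qed.

(** The trace of the double bracket against w is the sum of the square norms
    of the skew matrices [w, X_i], so these vanish. *)
Lemma regular_pair_double (X0 X1 w : mat) : regular_pair X0 X1 -> in_k w ->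
  commutator (commutator w X0) X0 + commutator (commutator w X1) X1 = 0 -> w = 0.
Proof.
move=> rp kw E; have [[dX0 _] [dX1 _] _ _] := rp; have [dw _] := kw.
have s0 := (der_comm dw dX0).1; have s1 := (der_comm dw dX1).1.
have := congr1 (fun Z => \tr (Z *m w)) E.
rewrite mulmxDl raddfD /= !trace_double_comm mul0mx mxtrace0 -opprD => /eqP.
rewrite oppr_eq0 naddr_eq0; [|exact: trace_skew_le0..].
move=> /andP[/eqP z0 /eqP z1].
apply: (regular_pair_centralizer_k rp kw); exact: trace_skew_eq0.
Qed.

End RegularPairs.

(** * Smooth solutions of linear equations in k *)

Section SmoothSolution.
Variable R : realType.
Local Notation plane := (plane R).
Local Notation mat := 'M[R]_7.

Definition k_pos : seq (nat * nat) := [:: (0, 1); (0, 2); (0, 3); (1, 2); (1, 3); (2, 3)]%N.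

Definition k_coord (w : mat) : 'cV[R]_6 :=
  \col_i en w (nth (0, 0) k_pos i).1%N (nth (0, 0) k_pos i).2%N.

Definition k_basis (b : 'I_6) : mat := kmat (fun n => (n == b)%:R).

Definition k_comb (x : 'cV[R]_6) : mat := \sum_b x b ord0 *: k_basis b.

Lemma k_comb_in_k x : in_k (k_comb x).
Proof.
apply: (big_ind (@in_k R)); [exact: in_k0|exact: in_kD|move=> b _; apply: in_kZ; exact: kmat_in_k].
Qed.

Lemma en_sum (I : finType) (F : I -> mat) i j : en (\sum_b F b) i j = \sum_b en (F b) i j.
Proof. by rewrite /en summxE. Qed.

Lemma k_coord_comb x : k_coord (k_comb x) = x.
Proof.
have kb (a b : 'I_6) : en (k_basis b) (nth (0, 0) k_pos a).1%N (nth (0, 0) k_pos a).2%N = (a == b)%:R.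
  by rewrite -val_eqE; case: a => [[|[|[|[|[|[|]]]]]]]// ?; rewrite en_mat7.
apply/colP => a; rewrite mxE en_sum (bigD1 a)//= enZ kb eqxx mulr1 big1 ?addr0// => b ba.
by rewrite enZ kb eq_sym (negbTE ba) mulr0.
Qed.

Lemma k_coord_inj w w' : in_k w -> in_k w' -> k_coord w = k_coord w' -> w = w'.
Proof.
move=> kw kw' /colP E; have e i (i6 : (i < 6)%N) := E (Ordinal i6).
apply: in_k_eq => //; split.
- by have := e 0%N isT; rewrite !mxE.
- by have := e 1%N isT; rewrite !mxE.
- by have := e 2%N isT; rewrite !mxE.
- by have := e 3%N isT; rewrite !mxE.
- by have := e 4%N isT; rewrite !mxE.
- by have := e 5%N isT; rewrite !mxE.
Qed.

Lemma k_combK w : in_k w -> k_comb (k_coord w) = w.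
Proof. by move=> kw; apply: k_coord_inj => //; [exact: k_comb_in_k|rewrite k_coord_comb]. Qed.

Lemma injective_unitmx n (M : 'M[R]_n) : (forall x : 'cV[R]_n, M *m x = 0 -> x = 0) -> M \in unitmx.
Proof.
move=> inj; rewrite -unitmx_tr -row_free_unit -kermx_eq0; apply/eqP/row_matrixP => i.
rewrite row0; apply: trmx_inj; rewrite trmx0; apply: inj.
by rewrite -{1}[M]trmxK -trmx_mul -row_mul mulmx_ker row0 trmx0.
Qed.

(** A symmetric operator on k, definite by [regular_pair_double]; it turns
    the overdetermined equation for w into a square linear system. *)
Definition double_comm (X0 X1 w : mat) := commutator (commutator w X0) X0 + commutator (commutator w X1) X1.

Lemma double_comm_k (X0 X1 w : mat) : in_p7 X0 -> in_p7 X1 -> in_k w -> in_k (double_comm X0 X1 w).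
Proof. by move=> p0 p1 kw; apply: in_kD; apply: comm_pp => //; exact: comm_kp. Qed.

Lemma double_comm_comb (X0 X1 : mat) x : double_comm X0 X1 (k_comb x) =
  \sum_b x b ord0 *: double_comm X0 X1 (k_basis b).
Proof.
pose f w := double_comm X0 X1 w.
have fD a w w' : f (a *: w + w') = a *: f w + f w'.
  have D X : commutator (commutator (a *: w + w') X) X =
      a *: commutator (commutator w X) X + commutator (commutator w' X) X.
    by rewrite (commDl (a *: w) w' X) (commZl a w X) (commDl (a *: _)) commZl.
  by rewrite /f /double_comm !D addrACA -[X in X + _ = _]scalerDr.
have f0 : f 0 = 0 by have := fD (-1) 0 0; rewrite scaler0 addr0 scaleN1r addNr.
have fA : {morph f : w w' / w + w'} by move=> w w'; have := fD 1 w w'; rewrite !scale1r.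
apply: (etrans (big_morph f fA f0 _ _ _)); apply: eq_bigr => b _.
by have := fD (x b ord0) (k_basis b) 0; rewrite f0 !addr0.
Qed.

Lemma smooth_double_comm (X0 X1 w : plane -> mat) : smooth X0 -> smooth X1 -> smooth w ->
  smooth (fun z => double_comm (X0 z) (X1 z) (w z)).
Proof. by move=> s0 s1 sw; apply: smoothD; apply: smooth_comm => //; exact: smooth_comm. Qed.

Lemma smooth_k_coord (w : plane -> mat) : smooth w -> smooth (fun z => k_coord (w z)).
Proof.
move=> /smooth_mxP sw; apply/smooth_mxP => i j.
by under eq_fun do rewrite mxE; exact: sw.
Qed.

(** In the six coordinates of k the double bracket is an invertible matrix
    depending smoothly on the point, so w is obtained from its image by
    Cramer's rule. *)
Lemma smooth_solution (X0 X1 w : plane -> mat) : smooth X0 -> smooth X1 ->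
  (forall m, regular_pair (X0 m) (X1 m)) -> (forall m, in_k (w m)) ->
  smooth (fun z => double_comm (X0 z) (X1 z) (w z)) -> smooth w.
Proof.
move=> s0 s1 rp kw ss.
pose M z : 'M[R]_6 := \matrix_(a, b) k_coord (double_comm (X0 z) (X1 z) (k_basis b)) a ord0.
have ME z x : M z *m x = k_coord (double_comm (X0 z) (X1 z) (k_comb x)).
  rewrite double_comm_comb; apply/colP => a; rewrite !mxE en_sum.
  by apply: eq_bigr => b _; rewrite !mxE enZ mulrC.
have uM z : M z \in unitmx.
  apply: injective_unitmx => x; rewrite ME => E; have [p0 p1 _ _] := rp z.
  have Z : double_comm (X0 z) (X1 z) (k_comb x) = 0.
    apply: k_coord_inj; [exact: double_comm_k (k_comb_in_k x)|exact: in_k0|].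
    by rewrite E; apply/colP => a; rewrite !mxE en0.
  rewrite -(k_coord_comb x) (regular_pair_double (rp z) (k_comb_in_k x) Z).
  by apply/colP => a; rewrite !mxE en0.
have sM : smooth M.
  apply/smooth_mxP => a b.
  rewrite (_ : (fun z => M z a b) = fun z => k_coord (double_comm (X0 z) (X1 z) (k_basis b)) a ord0).
    apply: smooth_entry; apply: smooth_k_coord; apply: smooth_double_comm => //; exact: smooth_cst.
  by apply/funext => z; rewrite mxE.
rewrite (_ : w = fun z => k_comb (invmx (M z) *m k_coord (double_comm (X0 z) (X1 z) (w z)))).
  apply: smooth_sum => b _; apply: smooth_scale; last exact: smooth_cst.
  apply: smooth_entry; apply: smooth_mulmx; [exact: smooth_invmx|exact: smooth_k_coord].
apply/funext => z; rewrite -{2}(k_combK (kw z)) -ME mulKmx ?uM// k_combK//.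
Qed.

End SmoothSolution.

(** * The parallel frame of an abelian surface *)

Section ParallelFrame.
Variable R : realType.
Local Notation plane := (plane R).
Local Notation mat := 'M[R]_7.

(** The automorphism of the octonions that is 1 on the quaternions and -1 on
    their orthogonal complement. *)
Lemma involution_G2 : G2 (2 *: P0 R - 1%:M).
Proof.
have PP := @P0_idem R.
have E u n : (n < 7)%N -> co ((2 *: P0 R - 1%:M) *m u) n = (2 * (4 <= n)%:R - 1) * co u n.
  by move=> n7; rewrite mulmxBl mul1mx -scalemxAl coD coN coZ co_P0//; ring.
apply/G2E; split.
  have -> : (2 *: P0 R - 1%:M)^T = 2 *: P0 R - 1%:M by rewrite linearB /= linearZ /= P0_tr trmx1.
  rewrite mulmxBl !mulmxBr mul1mx !mulmx1 -!scalemxAl -!scalemxAr PP.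
  by apply/matrixP => i j; rewrite !mxE; ring.
by move=> u v; apply: co_eq; rewrite E// !crossE !E//=; ring.
Qed.

(** The covariant derivative of X in the frame E. *)
Lemma partial_conj (E A X : plane -> mat) j m : differentiable E m -> differentiable X m ->
  partial j E m = - (E m *m A m) -> (A m)^T = - A m ->
  partial j (fun z => E z *m X z *m (E z)^T) m =
  E m *m (partial j X m - commutator (A m) (X m)) *m (E m)^T.
Proof.
move=> dE dX EA AT; have dT := differentiable_trmx dE.
apply: (etrans (partial_mulmx j (differentiable_mulmx dE dX) dT)).
have EAT : (- (E m *m A m))^T = A m *m (E m)^T by rewrite [LHS]raddfN /= trmx_mul AT mulNmx opprK.
rewrite (partial_mulmx j dE dX) (partial_trmx j dE) EA EAT; move: (partial j X m) => Y.
rewrite /commutator mulNmx mulmxDl mulNmx !mulmxBr !mulmxBl !mulmxA.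
by rewrite opprB addrA [- _ + _]addrC addrAC.
Qed.

Lemma comm_family n (a : 'I_2 -> 'M[R]_n) : commutator (a ord0) (a ord_max) = 0 ->
  forall i j, commutator (a i) (a j) = 0.
Proof.
move=> a01 i j; move: i; apply: ord2_ind; move: j; apply: ord2_ind => //; try exact: subrr.
by rewrite commC a01 oppr0.
Qed.

Lemma frobenius_left n (A : 'I_2 -> plane -> 'M[R]_n) : (forall j, smooth (A j)) ->
  (forall m, partial ord0 (A ord_max) m - partial ord_max (A ord0) m = commutator (A ord0 m) (A ord_max m)) ->
  exists E : plane -> 'M[R]_n, [/\ smooth E, E 0 = 1%:M & forall j m, partial j E m = - (E m *m A j m)].
Proof.
move=> sA fA; pose w j z := - A j z.
have dN i j m : partial i (w j) m = - partial i (A j) m by exact: (partialN i (smooth_diff m (sA j))).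
have cN m : commutator (w ord0 m) (w ord_max m) = commutator (A ord0 m) (A ord_max m).
  by rewrite /w /commutator !mulNmx !mulmxN !opprK.
have fw m : partial ord0 (w ord_max) m - partial ord_max (w ord0) m + commutator (w ord0 m) (w ord_max m) = 0.
  rewrite (dN ord0) (dN ord_max) cN -fA; move: (partial _ _ m) (partial _ _ m) => a b.
  by rewrite opprK addrACA addNr subrr addr0.
have [|E [sE E0 dE _]] := frobenius _ fw; first by move=> j; exact: smoothN.
by exists E; split=> // j m; rewrite dE mulmxN.
Qed.

Section Gauss.
Variables (P : plane -> mat).
Hypothesis sP : smooth P.
Hypothesis frameP : forall m, exists2 f, G2 f & P m = frame_proj f.

Let alpha j m := commutator (partial j P m) (P m).

Lemma proj_field_idem m : P m *m P m = P m.
Proof. by have [f Gf ->] := frameP m; apply: frame_proj_idem; exact: G2_orth. Qed.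

Lemma proj_field_tr m : (P m)^T = P m.
Proof. by have [f Gf ->] := frameP m; exact: frame_proj_tr. Qed.

Lemma proj_field_partial j m : P m *m partial j P m + partial j P m *m P m = partial j P m.
Proof.
have dP := smooth_diff m sP; rewrite addrC; apply: (etrans (esym (partial_mulmx j dP dP))).
by rewrite (_ : (fun z => P z *m P z) = P)//; apply/funext => z; exact: proj_field_idem.
Qed.

Lemma smooth_alpha j : smooth (alpha j).
Proof. by apply: smooth_comm => //; exact: smooth_partial. Qed.

Lemma alpha_offdiag j m : P m *m alpha j m + alpha j m *m P m = alpha j m.
Proof.
rewrite /alpha; have := proj_offdiag (proj_field_idem m) (proj_field_partial j m).
have := proj_field_idem m; move: (P m) (partial j P m) => Q X QQ Z.
by rewrite /commutator mulmxBr mulmxBl !mulmxA QQ Z sub0r -(mulmxA X) QQ subr0 addrC.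
Qed.

Lemma alpha_comm j m : commutator (alpha j m) (P m) = partial j P m.
Proof.
rewrite /alpha; have := proj_offdiag (proj_field_idem m) (proj_field_partial j m).
have := proj_field_partial j m; have := proj_field_idem m; move: (P m) (partial j P m) => Q X QQ E Z.
rewrite /commutator mulmxBr mulmxBl !mulmxA QQ Z sub0r -(mulmxA X) QQ subr0 opprK addrC.
exact: E.
Qed.

(** 2 P - 1 is a curve in G_2, and alpha_j is minus half of its logarithmic
    derivative. *)
Lemma alpha_der j m : der (alpha j m).
Proof.
pose s z := 2 *: P z - 1%:M.
have ds z : differentiable s z.
  by apply: smooth_diff; apply: smoothB; [apply: smooth_scale => //|]; exact: smooth_cst.
have Gs z : G2 (s z).
  have [f Gf Pf] := frameP z.
  have -> : s z = f *m (2 *: P0 R - 1%:M) *m f^T.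
    by rewrite /s Pf /frame_proj mulmxBr mulmxBl mulmx1 G2_orthr// -scalemxAr -scalemxAl.
  by apply: G2_mul; [apply: G2_mul => //; exact: involution_G2|exact: G2_tr].
have := der_of_G2_curve j m ds Gs.
have -> : partial j s m = 2 *: partial j P m.
  have dP := smooth_diff m sP; have dc := differentiable_cst (2 : R) m.
  have d2 : differentiable (fun z => 2 *: P z) m by apply: smooth_diff; apply: smooth_scale => //; exact: smooth_cst.
  apply: (etrans (partialB j d2 (differentiable_cst _ _))).
  by rewrite partial_cst subr0 (partial_scale j dc dP) partial_cst scale0r add0r.
have sT : (s m)^T = s m by rewrite /s linearB /= linearZ /= trmx1 proj_field_tr.
rewrite sT /s /alpha => /(derZ (- 2^-1)); congr der.
have := proj_field_partial j m; move: (P m) (partial j P m) => Q X E.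
rewrite /commutator -scalemxAr mulmxBl mul1mx -scalemxAl scalerA -{2}E.
by move: (Q *m X) (X *m Q) => A B; apply/matrixP => i k; rewrite !mxE; field.
Qed.

Lemma proj_partial_comm m : commutator (partial ord0 P m) (partial ord_max P m) =
  - commutator (alpha ord0 m) (alpha ord_max m).
Proof.
apply: (etrans _ (proj_comm (proj_field_idem m) (alpha_offdiag ord0 m) (alpha_offdiag ord_max m))).
exact: (esym (congr2 (@commutator R 7) (alpha_comm ord0 m) (alpha_comm ord_max m))).
Qed.

Hypothesis curv : forall m (c : 'cV[R]_7),
  (1%:M - P m) *m (commutator (partial ord0 P m) (partial ord_max P m) *m ((1%:M - P m) *m c)) = 0.

(** The bracket lies in k, and vanishing curvature says that its part on the
    normal bundle is zero. An element of k is determined by that part, so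
    the bundle of Gauss planes is flat as well. *)
Lemma alpha_commute m : commutator (alpha ord0 m) (alpha ord_max m) = 0.
Proof.
have [f Gf Pf] := frameP m; have ff := G2_orth Gf; have ff' := G2_orthr Gf.
have PfE : f^T *m P m *m f = P0 R by rewrite Pf /frame_proj !mulmxA ff mul1mx -mulmxA ff mulmx1.
have pa j : in_p7 (f^T *m alpha j m *m f).
  split; first by apply: der_conj' => //; exact: alpha_der.
  have E (X Y : mat) : f^T *m X *m f *m (f^T *m Y *m f) = f^T *m (X *m Y) *m f.
    by rewrite !mulmxA -(mulmxA (f^T *m X)) ff' mulmx1.
  by rewrite -PfE !E -mulmxDl -mulmxDr alpha_offdiag.
have kc := comm_pp (pa ord0) (pa ord_max).
apply: (conj_inj ff'); rewrite conj0 (comm_conj _ _ ff').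
set C := commutator (f^T *m _ *m f) _ in kc *.
have CE : C = f^T *m commutator (alpha ord0 m) (alpha ord_max m) *m f by rewrite (comm_conj _ _ ff').
have PE : commutator (alpha ord0 m) (alpha ord_max m) =
    - commutator (partial ord0 P m) (partial ord_max P m).
  by rewrite proj_partial_comm opprK.
have Z : (1%:M - P0 R) *m C *m (1%:M - P0 R) = 0.
  have Q : 1%:M - P0 R = f^T *m (1%:M - P m) *m f by rewrite conjB PfE mulmx1 ff.
  have E (X Y : mat) : f^T *m X *m f *m (f^T *m Y *m f) = f^T *m (X *m Y) *m f.
    by rewrite !mulmxA -(mulmxA (f^T *m X)) ff' mulmx1.
  rewrite Q CE !E PE; move: (curv m).
  move: (commutator (partial ord0 P m) (partial ord_max P m)) (1%:M - P m) => K S KS.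
  have SKS : S *m K *m S = 0.
    apply/matrixP => i j; have := KS (delta_mx j ord0).
    by rewrite !mulmxA -colE => /colP/(_ i); rewrite mxE => ->; rewrite !mxE.
  by rewrite mulmxN mulNmx SKS oppr0 conj0.
apply: k_zero => // i j i4 j4; have i7 : (i < 7)%N by exact: ltn_trans i4 _.
have j7 : (j < 7)%N by exact: ltn_trans j4 _.
have := congr1 (fun M => en M i j) Z; rewrite en0 mulmxBl mul1mx mulmxBr mulmx1.
rewrite enD enN en_P0r// [in X in _ - X]enD enN en_P0l// enD enN en_P0l//.
by rewrite [(4 <= i)%N]leqNgt i4 [(4 <= j)%N]leqNgt j4 /= !mul0r !subr0.
Qed.

(** The difference of the two sides is a multiple of [P_1, P_2], which is
    minus the bracket of alpha_1 and alpha_2. *)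
Lemma alpha_closed m : partial ord0 (alpha ord_max) m = partial ord_max (alpha ord0) m.
Proof.
have dP := smooth_diff m sP; have dPj j := smooth_diff m (smooth_partial j sP).
have E i j : partial i (alpha j) m = commutator (partial i (partial j P) m) (P m) +
    commutator (partial j P m) (partial i P m) by exact: partial_comm.
have PP0 : commutator (partial ord0 P m) (partial ord_max P m) = 0.
  by rewrite proj_partial_comm alpha_commute oppr0.
apply: (etrans (E ord0 ord_max)); apply: (etrans _ (esym (E ord_max ord0))).
by rewrite (schwarz_mx ord0 ord_max m sP) (commC (partial ord0 P m)) PP0 oppr0.
Qed.

Hypothesis indep : forall m (a b : R), a *: partial ord0 P m + b *: partial ord_max P m = 0 -> a = 0 /\ b = 0.

(** As alpha_1 and alpha_2 commute and alpha is closed, it satisfies the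
    flatness equation for either sign; in a frame E with dE = - E alpha the
    projection P becomes constant, and alpha becomes a form beta with values
    in p. *)
Lemma parallel_frame : exists (E : plane -> mat) (beta : 'I_2 -> plane -> mat),
  [/\ smooth E, forall m, G2 (E m), forall m, E m *m P m *m (E m)^T = P0 R,
      forall j m, partial j E m = - (beta j m *m E m) &
      [/\ forall j, smooth (beta j), forall m, regular_pair (beta ord0 m) (beta ord_max m) &
          forall m, partial ord0 (beta ord_max) m = partial ord_max (beta ord0) m]].
Proof.
have fl m : partial ord0 (alpha ord_max) m - partial ord_max (alpha ord0) m =
    commutator (alpha ord0 m) (alpha ord_max m).
  by rewrite alpha_closed alpha_commute subrr.
have [E' [sE' E'0 dE']] := frobenius_left smooth_alpha fl.
have [f Gf Pf] := frameP 0; have ff := G2_orth Gf; have ff' := G2_orthr Gf.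
pose E z := f^T *m E' z.
have sE : smooth E by apply: smooth_mulmx => //; exact: smooth_cst.
have dE j m : partial j E m = - (E m *m alpha j m).
  apply: (etrans (partial_mulmx j (differentiable_cst _ _) (smooth_diff m sE'))).
  by rewrite partial_cst mul0mx add0r dE' mulmxN mulmxA.
have GE m : G2 (E m).
  apply: (G2_of_linear_system (w := fun j z => - alpha j z) (fun z => smooth_diff z sE)).
  - by move=> j z; rewrite dE mulmxN.
  - by move=> j z; apply: derN; exact: alpha_der.
  - by rewrite /E E'0 mulmx1; exact: G2_tr.
have aT j m := (alpha_der j m).1.
have conjE (X : plane -> mat) j m : smooth X -> partial j (fun z => E z *m X z *m (E z)^T) m =
    E m *m (partial j X m - commutator (alpha j m) (X m)) *m (E m)^T.
  by move=> sX; apply: partial_conj => //; exact: smooth_diff.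
have EP m : E m *m P m *m (E m)^T = P0 R.
  rewrite (@partial0_cst_mx R 7 7 (fun z => E z *m P z *m (E z)^T)).
  - by rewrite /E E'0 mulmx1 trmxK Pf /frame_proj !mulmxA ff mul1mx -mulmxA ff mulmx1.
  - by move=> z; apply: smooth_diff; do 2? apply: smooth_mulmx => //; exact: smooth_trmx.
  - by move=> j z; rewrite conjE// alpha_comm subrr mulmx0 mul0mx.
clearbody E.
pose beta j z := E z *m alpha j z *m (E z)^T.
have EE m (X Y : mat) : E m *m X *m (E m)^T *m (E m *m Y *m (E m)^T) = E m *m (X *m Y) *m (E m)^T.
  by rewrite !mulmxA -(mulmxA (E m *m X)) G2_orth// mulmx1.
have aa i j m : commutator (alpha i m) (alpha j m) = 0.
  exact: (comm_family (a := fun i => alpha i m)) (alpha_commute m) i j.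
exists E, beta; split; [exact: sE|exact: GE|exact: EP| |split].
- by move=> j m; rewrite dE /beta -!mulmxA G2_orth// mulmx1.
- by move=> j; do 2? apply: smooth_mulmx => //; [exact: smooth_alpha|exact: smooth_trmx].
- move=> m; have pb j : in_p7 (beta j m).
    split; first by apply: der_conj => //; exact: alpha_der.
    by rewrite -(EP m) !EE -mulmxDl -mulmxDr alpha_offdiag.
  split=> //.
    apply: (etrans (proj_conj_comm (alpha ord0 m) (alpha ord_max m) (G2_orth (GE m)))).
    by rewrite alpha_commute mulmx0 mul0mx.
  move=> a b ab; apply: (indep (m := m)).
  have ET := G2_orth (GE m).
  have : a *: alpha ord0 m + b *: alpha ord_max m = 0.
    apply: (conj_inj (g := (E m)^T)); first by rewrite trmxK.
    by rewrite conj_lin conj0 trmxK.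
  move=> ab0.
  apply: (etrans (congr2 (fun X Y => a *: X + b *: Y) (esym (alpha_comm ord0 m)) (esym (alpha_comm ord_max m)))).
  move: (alpha ord0 m) (alpha ord_max m) ab0 => A B ab0; rewrite -!commZl -commDl ab0.
  by rewrite /commutator mul0mx mulmx0 subrr.
- have db i j m : partial i (beta j) m = E m *m partial i (alpha j) m *m (E m)^T.
    by apply: (etrans (conjE (alpha j) i m (smooth_alpha j))); rewrite aa subr0.
  move=> m; apply: (etrans (db ord0 ord_max m)); apply: (etrans _ (esym (db ord_max ord0 m))).
  by rewrite alpha_closed.
Qed.

End Gauss.
End ParallelFrame.

(** * The smooth gauge transformation *)

Section Gauge.
Variable R : realType.
Local Notation plane := (plane R).
Local Notation mat := 'M[R]_7.

Lemma partial_der (X : plane -> mat) j m : (forall z, differentiable X z) -> (forall z, der (X z)) ->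
  der (partial j X m).
Proof.
move=> dX derX; split.
  apply: (etrans (esym (partial_trmx j (dX m)))); apply: (etrans _ (partialN j (dX m))).
  by apply: (congr1 (fun f => partial j f m)); apply/funext => z; have [] := derX z.
move=> u v.
have dXu (w : 'cV[R]_7) : differentiable (fun z => X z *m w) m by exact: differentiable_mulmx_cstr.
have pXu (w : 'cV[R]_7) : partial j (fun z => X z *m w) m = partial j X m *m w by exact: partial_mulmx_cstr.
have dc (w : 'cV[R]_7) : differentiable (fun _ : plane => w) m by exact: differentiable_cst.
apply: (etrans (esym (pXu _))).
have -> : (fun z => X z *m cross u v) = fun z => cross (X z *m u) v + cross u (X z *m v).
  by apply/funext => z; have [_ ->] := derX z.
apply: (etrans (partialD j (differentiable_cross (dXu u) (dc v)) (differentiable_cross (dc u) (dXu v)))).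
rewrite (partial_cross j (dXu u) (dc v)) (partial_cross j (dc u) (dXu v)) !pXu !partial_cst.
have c0 (w : 'cV[R]_7) : cross 0 w = 0 by have := crossZl 0 0 w; rewrite !scale0r.
have c0' (w : 'cV[R]_7) : cross w 0 = 0 by rewrite crossC c0 oppr0.
by rewrite c0 c0' addr0 add0r.
Qed.

Lemma partial_in_p (X : plane -> mat) j m : (forall z, differentiable X z) -> (forall z, in_p7 (X z)) ->
  in_p7 (partial j X m).
Proof.
move=> dX pX; split; first by apply: partial_der => // z; have [] := pX z.
rewrite -(partial_mulmx_cstl j (P0 R) (dX m)) -(partial_mulmx_cstr j (P0 R) (dX m)).
apply: (etrans (esym (partialD j (differentiable_mulmx_cstl _ (dX m)) (differentiable_mulmx_cstr _ (dX m))))).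
by apply: (congr1 (fun f => partial j f m)); apply/funext => z; have [] := pX z.
Qed.

Lemma partial_in_k (X : plane -> mat) j m : (forall z, differentiable X z) -> (forall z, in_k (X z)) ->
  in_k (partial j X m).
Proof.
move=> dX kX; split; first by apply: partial_der => // z; have [] := kX z.
rewrite -(partial_mulmx_cstl j (P0 R) (dX m)) -(partial_mulmx_cstr j (P0 R) (dX m)).
by apply: (congr1 (fun f => partial j f m)); apply/funext => z; have [] := kX z.
Qed.

Lemma partial_bigsum I (r : seq I) (f : I -> plane -> R) j m : (forall i, smooth (f i)) ->
  partial j (fun z => \sum_(i <- r) f i z) m = \sum_(i <- r) partial j (f i) m.
Proof.
move=> sf; elim: r => [|a r IH].
  rewrite big_nil (_ : (fun z => _) = fun=> 0) ?partial_cst//.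
  by apply/funext => z; rewrite big_nil.
rewrite big_cons -IH (_ : (fun z => _) = fun z => f a z + \sum_(i <- r) f i z); last first.
  by apply/funext => z; rewrite big_cons.
apply: partialD; first exact: smooth_diff.
by apply: smooth_diff; apply: smooth_sum.
Qed.

(** The Plucker coordinates of the plane spanned by X0 and X1. *)
Definition plucker (X0 X1 : mat) (a b : 'I_7 * 'I_7) : R :=
  X0 a.1 a.2 * X1 b.1 b.2 - X0 b.1 b.2 * X1 a.1 a.2.

Lemma plucker0 (X0 X1 : mat) a : (forall s t : R, s *: X0 + t *: X1 = 0 -> s = 0 /\ t = 0) ->
  (forall b, plucker X0 X1 a b = 0) -> X0 a.1 a.2 = 0 /\ X1 a.1 a.2 = 0.
Proof.
move=> free H; have [|-> /eqP] := free (X1 a.1 a.2) (- X0 a.1 a.2); last by rewrite oppr_eq0 => /eqP ->.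
apply/matrixP => i j; have := H (i, j); rewrite /plucker !mxE /= => h.
by apply/eqP; rewrite -oppr_eq0; apply/eqP; rewrite -[RHS]h; ring.
Qed.

(** The derivatives stay in the plane spanned by X_1 and X_2, so the Plucker
    vector is multiplied by a scalar to first order, and the quotients of
    its squared coordinates by its squared norm are constant. Those that
    vanish at the origin vanish everywhere. *)
Lemma span_constant (X : 'I_2 -> plane -> mat) : (forall i, smooth (X i)) ->
  (forall m, regular_pair (X ord0 m) (X ord_max m)) ->
  (forall j i m, exists s t, partial j (X i) m = s *: X ord0 m + t *: X ord_max m) ->
  (forall i, in_a (X i 0)) -> forall i m, in_a (X i m).
Proof.
move=> sX rp dX a0.
pose psi a b z := plucker (X ord0 z) (X ord_max z) a b.
have sen i (a : 'I_7 * 'I_7) : smooth (fun z => X i z a.1 a.2) by apply: smooth_entry.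
have spsi a b : smooth (psi a b) by apply: smoothB; apply: smoothM; exact: sen.
pose n z := \sum_(ab : ('I_7 * 'I_7) * ('I_7 * 'I_7)) psi ab.1 ab.2 z * psi ab.1 ab.2 z.
have sn : smooth n by apply: smooth_sum => ab _; exact: smoothM.
have n0 z : n z != 0.
  apply/eqP => nz; have [_ _ _ free] := rp z.
  have Z a b : psi a b z = 0.
    have := nz; rewrite /n => /eqP; rewrite psumr_eq0 => [/allP /(_ (a, b))|ab _]; last by rewrite -expr2 sqr_ge0.
    by rewrite mem_index_enum => /(_ isT) /=; rewrite -expr2 sqrf_eq0 => /eqP.
  have X00 : X ord0 z = 0.
    by apply/matrixP => i j; have [e _] := plucker0 free (Z (i, j)); rewrite mxE.
  have [|/eqP] := free 1 0; first by rewrite X00 scaler0 scale0r addr0.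
  by rewrite oner_eq0.
have dpsi j m : exists c, forall a b, partial j (psi a b) m = c * psi a b m.
  have [s [t e0]] := dX j ord0 m; have [s' [t' e1]] := dX j ord_max m.
  exists (s + t') => a b.
  have d i (c : 'I_7 * 'I_7) := smooth_diff m (sen i c).
  have pe i (c : 'I_7 * 'I_7) : partial j (fun z => X i z c.1 c.2) m = partial j (X i) m c.1 c.2.
    by apply/esym/partial_mxE; exact: smooth_diff.
  apply: (etrans (partialB j (smooth_diff m (smoothM (sen ord0 a) (sen ord_max b)))
     (smooth_diff m (smoothM (sen ord0 b) (sen ord_max a))))).
  rewrite (partialM j (d ord0 a) (d ord_max b)) (partialM j (d ord0 b) (d ord_max a)) !pe e0 e1.
  rewrite /psi /plucker !mxE; ring.
have const a b m : psi a b 0 = 0 -> psi a b m = 0.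
  move=> p0; pose f z := psi a b z * psi a b z * (n z)^-1.
  have sq ab := smoothM (spsi ab.1 ab.2) (spsi ab.1 ab.2).
  have sV := smoothV n0 sn.
  have sf : smooth f by apply: smoothM => //; exact: (sq (a, b)).
  have df j z : partial j f z = 0.
    have [c cE] := dpsi j z.
    have psq (ab : ('I_7 * 'I_7) * ('I_7 * 'I_7)) : partial j (fun z => psi ab.1 ab.2 z * psi ab.1 ab.2 z) z =
        2 * c * (psi ab.1 ab.2 z * psi ab.1 ab.2 z).
      have dp := smooth_diff z (spsi ab.1 ab.2).
      by apply: (etrans (partialM j dp dp)); rewrite cE; ring.
    have pn : partial j n z = 2 * c * n z.
      rewrite /n mulr_sumr; apply: (etrans (partial_bigsum _ j z sq)).
      by apply: eq_bigr => ab _; exact: psq.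
    have pV : partial j (fun z => (n z)^-1) z = - (2 * c) * (n z)^-1.
      have := partialM j (smooth_diff z sn) (smooth_diff z sV).
      rewrite (_ : (fun z => n z * (n z)^-1) = fun=> 1); last by apply/funext => y; rewrite mulfV.
      rewrite partial_cst pn => /esym e; apply: (mulfI (n0 z)).
      move: e; move: (partial _ _ z) => r; rewrite -mulrA mulfV// mulr1 => /eqP; rewrite addrC addr_eq0 => /eqP ->.
      by field.
    apply: (etrans (partialM j (smooth_diff z (sq (a, b))) (smooth_diff z sV))).
    rewrite (psq (a, b)) pV /=; ring.
  have fm := @partial0_cst R f (fun z => smooth_diff z sf) df m.
  have : f m = 0 by rewrite fm /f p0 !mul0r.
  move=> /eqP; rewrite /f mulf_eq0 invr_eq0 (negbTE (n0 m)) orbF -expr2 sqrf_eq0 => /eqP.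
  by [].
have zero (a : nat * nat) i m : (a.1 < 7)%N -> (a.2 < 7)%N -> en (b0 R) a.1 a.2 = 0 -> en (b1 R) a.1 a.2 = 0 ->
   en (X i m) a.1 a.2 = 0.
  move=> a1 a2 e0 e1; pose c : 'I_7 * 'I_7 := (inord a.1, inord a.2).
  have X0 k : X k 0 c.1 c.2 = 0.
    have [s [t ->]] := a0 k; have := enD (s *: b0 R) (t *: b1 R) a.1 a.2.
    by rewrite !enZ e0 e1 !mulr0 addr0.
  have [_ _ _ free] := rp m.
  have [|p q] := @plucker0 (X ord0 m) (X ord_max m) c free.
    by move=> b; apply: const; rewrite /psi /plucker !X0 mul0r mulr0 subrr.
  by move: i; apply: ord2_ind.
move=> i m; exists (en (X i m) 4 0), (en (X i m) 5 3).
have pX : in_p7 (X i m) by have [p0 p1 _ _] := rp m; move: i; apply: ord2_ind.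
apply: in_p_eq => //; first by apply: in_p7D; apply: in_p7Z; [exact: b0_in_p|exact: b1_in_p].
  split; rewrite !enD !enZ; [|rewrite (zero (4, 1))//|rewrite (zero (4, 2))//|rewrite (zero (4, 3))//];
    rewrite /b0 /b1 !en_mat7//=; ring.
split; rewrite !enD !enZ; [rewrite (zero (5, 0))//|rewrite (zero (5, 1))//|rewrite (zero (5, 2))//|];
    rewrite /b0 /b1 !en_mat7//=; ring.
Qed.

End Gauge.

Section Gauge.
Variable R : realType.
Local Notation plane := (plane R).
Local Notation mat := 'M[R]_7.

(** The commutator of the two covariant derivatives [d_j - w_j, -] is the
    bracket with the curvature of w. *)
Lemma gauge_curvature n (S a b u v w0 w1 X : 'M[R]_n) :
  (S - (commutator a X + commutator w1 u) - commutator w0 (v - commutator w1 X)) -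
  (S - (commutator b X + commutator w0 v) - commutator w1 (u - commutator w0 X)) =
  - commutator (a - b - commutator w0 w1) X.
Proof.
rewrite /commutator !mulmxBl !mulmxBr !mulmxA.
move: (a *m X) (X *m a) (b *m X) (X *m b) (w1 *m u) (u *m w1) (w0 *m v) (v *m w0) => t1 t2 t3 t4 t5 t6 t7 t8.
move: (w0 *m w1 *m X) (w0 *m X *m w1) (w1 *m X *m w0) (X *m w1 *m w0) => q1 q2 q3 q4.
move: (w1 *m w0 *m X) (X *m w0 *m w1) => q5 q6.
by apply/matrixP => i j; rewrite !mxE; ring.
Qed.

(** The covariant derivative is a derivation of the bracket. *)
Lemma gauge_derivation n (g dg b dgam w B : 'M[R]_n) : commutator g B = 0 ->
  commutator dg B + commutator g b = 0 -> b = dgam + commutator w B -> commutator g dgam = 0 ->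
  commutator (dg - commutator w g) B = 0.
Proof.
move=> gB E bE gd; have J := comm_jacobi w g B.
rewrite gB [commutator w 0]/commutator mulmx0 mul0mx subrr in J.
move: E; rewrite bE commDr gd add0r => E.
have -> : commutator (dg - commutator w g) B = commutator dg B - commutator (commutator w g) B.
  by rewrite -[in LHS]scaleN1r commDl commZl scaleN1r.
by rewrite (canRL (addrK _) E) sub0r -opprD addrC -J oppr0.
Qed.

Lemma comm_oppB0 n (A B C : 'M[R]_n) : commutator A C = 0 -> commutator B C = 0 ->
  commutator (- (A - B)) C = 0.
Proof. by move=> A0 B0; rewrite opprB -(scaleN1r A) commDl commZl A0 B0 scaler0 addr0. Qed.

Lemma regular_pair_conj (k X0 X1 : mat) : G2 k -> k *m P0 R = P0 R *m k -> regular_pair X0 X1 ->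
  regular_pair (k *m X0 *m k^T) (k *m X1 *m k^T).
Proof.
move=> Gk kP [p0 p1 XX free]; have kk := G2_orth Gk.
have pk X : in_p7 X -> in_p7 (k *m X *m k^T).
  by move=> pX; have := in_p7_conj (G2_tr Gk) (tr_commute kP) pX; rewrite trmxK.
split; [exact: pk|exact: pk| |].
  by rewrite proj_conj_comm// XX mulmx0 mul0mx.
move=> a b E; apply: free; apply: (conj_inj (g := k^T)); first by rewrite trmxK.
by rewrite conj_lin conj0 trmxK.
Qed.

Lemma comm_regular (X0 X1 Z Z' : mat) : regular_pair X0 X1 -> in_p7 Z' ->
  commutator Z X0 = 0 -> commutator Z X1 = 0 -> commutator Z' X0 = 0 -> commutator Z' X1 = 0 ->
  commutator Z Z' = 0.
Proof.
move=> rp pZ' z0 z1 z0' z1'; have [s [t ->]] := regular_pair_centralizer rp pZ' z0' z1'.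
by rewrite commDr !commZr z0 z1 !scaler0 addr0.
Qed.

Variable beta : 'I_2 -> plane -> mat.
Hypothesis sbeta : forall j, smooth (beta j).
Hypothesis rbeta : forall m, regular_pair (beta ord0 m) (beta ord_max m).

Lemma beta_in_p j m : in_p7 (beta j m).
Proof. by have [p0 p1 _ _] := rbeta m; move: j; apply: ord2_ind. Qed.

Lemma beta_comm i j m : commutator (beta i m) (beta j m) = 0.
Proof. by have [_ _ c _] := rbeta m; exact: (comm_family (a := fun i => beta i m)). Qed.

(** Differentiating the commutation relation puts d_j beta in the situation
    of [regular_pair_tangent]; the solution is unique, hence smooth. *)
Lemma gauge_potential : exists w : 'I_2 -> plane -> mat,
  [/\ forall j, smooth (w j), forall j m, in_k (w j m) &
      forall j i l m, commutator (partial j (beta i) m - commutator (w j m) (beta i m)) (beta l m) = 0].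
Proof.
have db z i := smooth_diff z (sbeta i).
have dp j i m : in_p7 (partial j (beta i) m) by apply: partial_in_p => z; [exact: db|exact: beta_in_p].
have sym j m : commutator (partial j (beta ord0) m) (beta ord_max m) =
    commutator (partial j (beta ord_max) m) (beta ord0 m).
  have := partial_comm j (db m ord0) (db m ord_max).
  rewrite (_ : (fun z => commutator (beta ord0 z) (beta ord_max z)) = fun=> 0); last first.
    by apply/funext => z; exact: beta_comm.
  rewrite partial_cst => /esym/eqP; rewrite addr_eq0 => /eqP E; apply: (etrans E).
  exact/esym/commC.
have ex (jm : 'I_2 * plane) : exists w, in_k w /\ forall i l,
    commutator (partial jm.1 (beta i) jm.2 - commutator w (beta i jm.2)) (beta l jm.2) = 0.
  case: jm => j m /=.
  have [w kw H] := regular_pair_tangent (rbeta m) (dp j ord0 m) (dp j ord_max m) (sym j m).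
  exists w; split=> // i l; apply: H.
    by move: i; apply: ord2_ind; rewrite !inE eqxx ?orbT.
  by move: l; apply: ord2_ind; rewrite !inE eqxx ?orbT.
have [w Hw] := choice ex.
exists (fun j m => w (j, m)); split=> [j|j m|j i l m]; [|by have [] := Hw (j, m)|by have [_ ] := Hw (j, m)].
apply: (smooth_solution (sbeta ord0) (sbeta ord_max) rbeta) => [m|]; first by have [] := Hw (j, m).
rewrite (_ : (fun z => _) = fun z => commutator (partial j (beta ord0) z) (beta ord0 z) +
    commutator (partial j (beta ord_max) z) (beta ord_max z)); last first.
  apply/funext => z; have [_ H] := Hw (j, z).
  have E i : commutator (commutator (w (j, z)) (beta i z)) (beta i z) = commutator (partial j (beta i) z) (beta i z).
    have := H i i; rewrite /= -[X in commutator X _]scale1r scalerBr scale1r scale1r.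
    have -> (A B C : mat) : commutator (A - B) C = commutator A C - commutator B C.
      by rewrite -[in LHS]scaleN1r commDl commZl scaleN1r.
    by move=> /eqP; rewrite subr_eq0 => /eqP.
  by rewrite /double_comm !E.
by apply: smoothD; apply: smooth_comm => //; exact: smooth_partial.
Qed.

(** The covariant derivatives gamma of beta along w lie in the centralizer
    of beta, which is abelian. Differentiating [gamma, beta] = 0 shows that
    the covariant derivatives of gamma commute with beta too; so the
    curvature of w has vanishing double brackets with beta, and is zero. The
    solution k of dk = - k w transports beta into forms whose span is
    constant. *)
Lemma gauge : exists (k : plane -> mat) (w : 'I_2 -> plane -> mat),
  [/\ smooth k, forall m, G2 (k m), forall m, k m *m P0 R = P0 R *m k m,
      forall j m, partial j k m = - (k m *m w j m) &
      [/\ forall j, smooth (w j), forall j m, in_k (w j m) &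
          forall j m, in_a (k m *m beta j m *m (k m)^T)]].
Proof.
have [w [sw kw H]] := gauge_potential.
pose gam j i z := partial j (beta i) z - commutator (w j z) (beta i z).
have sgam j i : smooth (gam j i).
  by apply: smoothB; [exact: smooth_partial|exact: smooth_comm].
have db z i := smooth_diff z (sbeta i).
have dw z i := smooth_diff z (sw i).
have pgam j i m : in_p7 (gam j i m).
  apply: in_p7B; last by apply: comm_kp => //; exact: beta_in_p.
  by apply: partial_in_p => z; [exact: db|exact: beta_in_p].
have gg j i j' i' m : commutator (gam j i m) (gam j' i' m) = 0.
  by apply: (comm_regular (rbeta m)); [exact: pgam|exact: H..].
have Dgam k j i l m : commutator (partial k (gam j i) m - commutator (w k m) (gam j i m)) (beta l m) = 0.
  have dg := smooth_diff m (sgam j i).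
  apply: (@gauge_derivation 7 (gam j i m) _ (partial k (beta l) m) (gam k l m)).
  - exact: H.
  - apply: (etrans (esym (partial_comm k dg (db m l)))).
    rewrite (_ : (fun z => commutator (gam j i z) (beta l z)) = fun=> 0) ?partial_cst//.
    by apply/funext => z; exact: H.
  - by rewrite /gam subrK.
  - exact: gg.
have fw m : partial ord0 (w ord_max) m - partial ord_max (w ord0) m = commutator (w ord0 m) (w ord_max m).
  (* The curvature of w. *)
  pose Om := partial ord0 (w ord_max) m - partial ord_max (w ord0) m - commutator (w ord0 m) (w ord_max m).
  have kB (A B : mat) : in_k A -> in_k B -> in_k (A - B).
    by move=> kA kB; rewrite -scaleN1r; apply: in_kD => //; exact: in_kZ.
  have kdw i j : in_k (partial i (w j) m) by apply: partial_in_k => z; [exact: dw|exact: kw].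
  have kOm : in_k Om.
    apply: (kB); first exact: kB.
    have [dw0 c0] := kw ord0 m; have [dw1 c1] := kw ord_max m; split; first exact: der_comm.
    by rewrite /commutator mulmxBr mulmxBl !mulmxA c0 c1 -!mulmxA c0 c1.
  have pgamE k j i : partial k (gam j i) m = partial k (partial j (beta i)) m -
      (commutator (partial k (w j) m) (beta i m) + commutator (w j m) (partial k (beta i) m)).
    have sj := smooth_partial j (sbeta i).
    apply: (etrans (partialB k (smooth_diff m sj) (smooth_diff m (smooth_comm (sw j) (sbeta i))))).
    by apply: (congr1 (fun x => _ - x)); exact: partial_comm.
  have OmE i : commutator Om (beta i m) = - ((partial ord0 (gam ord_max i) m - commutator (w ord0 m) (gam ord_max i m))
     - (partial ord_max (gam ord0 i) m - commutator (w ord_max m) (gam ord0 i m))).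
    rewrite (pgamE ord0) (pgamE ord_max) (schwarz_mx ord0 ord_max m (sbeta i)).
    by apply/esym; apply: (canLR opprK); exact: gauge_curvature.
  have OmC i l : commutator (commutator Om (beta i m)) (beta l m) = 0.
    rewrite OmE; exact: comm_oppB0 (Dgam ord0 ord_max i l m) (Dgam ord_max ord0 i l m).
  have Om0 : Om = 0 by apply: (regular_pair_double (rbeta m) kOm); rewrite !OmC addr0.
  by apply/eqP; rewrite -subr_eq0; apply/eqP.
have [E' [sE' E'0 dE']] := frobenius_left sw fw.
have [g0 [Gg0 g0P a0 a1]] : exists g, [/\ G2 g, g *m P0 R = P0 R *m g,
    in_a (g^T *m beta ord0 0 *m g) & in_a (g^T *m beta ord_max 0 *m g)].
  by have [p0 p1 c _] := rbeta 0; exact: normal_form.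
pose k z := g0^T *m E' z.
have k0 : k 0 = g0^T by rewrite /k E'0 mulmx1.
have sk : smooth k by apply: smooth_mulmx => //; exact: smooth_cst.
have dk j m : partial j k m = - (k m *m w j m).
  apply: (etrans (partial_mulmx_cstl j g0^T (smooth_diff m sE'))).
  by rewrite dE' mulmxN mulmxA.
clearbody k.
have dk' m := smooth_diff m sk.
have Gk m : G2 (k m).
  apply: (G2_of_linear_system (w := fun j z => - w j z) dk').
  - by move=> j z; rewrite dk mulmxN.
  - by move=> j z; apply: derN; have [] := kw j z.
  - by rewrite k0; exact: G2_tr.
have wT j m : (w j m)^T = - w j m by have [[] ] := kw j m.
have kPk m : k m *m P0 R *m (k m)^T = P0 R.
  rewrite (@partial0_cst_mx R 7 7 (fun z => k z *m P0 R *m (k z)^T)).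
  - by rewrite k0 trmxK (tr_commute g0P) -mulmxA G2_orth// mulmx1.
  - move=> z; apply: differentiable_mulmx; last exact: differentiable_trmx.
    exact: differentiable_mulmx_cstr.
  - move=> j z; apply: (etrans (partial_conj (A := w j) (X := fun=> P0 R) (dk' z) (differentiable_cst _ _) (dk j z) (wT j z))).
    have [_ c] := kw j z; rewrite partial_cst (comm0P _ _).2; last exact/esym.
    by rewrite subrr mulmx0 mul0mx.
have kP m : k m *m P0 R = P0 R *m k m.
  by rewrite -[in RHS](kPk m) -mulmxA G2_orth// mulmx1.
exists k, w; split; [exact: sk|exact: Gk|exact: kP|exact: dk|split; [exact: sw|exact: kw|]].
apply: (@span_constant R (fun j z => k z *m beta j z *m (k z)^T)).
- move=> i; apply: smooth_mulmx; last exact: smooth_trmx.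
  exact: smooth_mulmx.
- by move=> m; exact: regular_pair_conj.
- move=> j i m; have [s [t st]] := regular_pair_centralizer (rbeta m) (pgam j i m) (H j i ord0 m) (H j i ord_max m).
  exists s, t; apply: (etrans (partial_conj (A := w j) (dk' m) (db m i) (dk j m) (wT j m))).
  by rewrite -/(gam j i m) st mulmxDr mulmxDl -!scalemxAr -!scalemxAl.
- by apply: ord2_ind; rewrite k0 trmxK.
Qed.

End Gauge.

(** * Coordinates and potentials *)

Section Coordinates.
Variable R : realType.
Local Notation plane := (plane R).
Local Notation vec := 'cV[R]_7.
Local Notation mat := 'M[R]_7.

(** The trace of [w, X] against b_l is that of w against [X, b_l] = 0, and
    an element of p orthogonal to both b_l has these two entries equal to
    zero. *)
Lemma comm_ka_entries (w X : mat) : in_k w -> in_a X ->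
  en (commutator w X) 4 0 = 0 /\ en (commutator w X) 5 3 = 0.
Proof.
move=> /in_kE[x ->] [s [t ->]]; rewrite commDr !commZr !enD !enZ.
by split; rewrite /commutator !enD !enN !en_mul /b0 /b1 /kmat !en_mat7//=; ring.
Qed.

Lemma in_a_entries (X : mat) : in_a X -> X = en X 4 0 *: b0 R + en X 5 3 *: b1 R.
Proof.
move=> [s [t ->]]; rewrite !enD !enZ /b0 /b1 !en_mat7//=.
by rewrite !mulr0 !mulr1 addr0 add0r.
Qed.

(** The solutions of w0 = a s + b t, w1 = c s + d t: passing from the
    coordinates of the plane to x_1, x_2. *)
Definition solve0 p q (a b c d : R) (w0 w1 : 'M[R]_(p, q)) :=
  (a * d - b * c)^-1 *: (d *: w0 + (- b) *: w1).
Definition solve1 p q (a b c d : R) (w0 w1 : 'M[R]_(p, q)) :=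
  (a * d - b * c)^-1 *: (a *: w1 + (- c) *: w0).

Lemma solveP p q (a b c d : R) (w0 w1 : 'M[R]_(p, q)) : a * d - b * c != 0 ->
  w0 = a *: solve0 a b c d w0 w1 + b *: solve1 a b c d w0 w1 /\
  w1 = c *: solve0 a b c d w0 w1 + d *: solve1 a b c d w0 w1.
Proof. by move=> D; split; apply/matrixP => i j; rewrite !mxE; field. Qed.

Lemma solve_comm (a b c d : R) (w0 w1 : mat) :
  commutator (a *: b0 R + b *: b1 R) w1 = commutator (c *: b0 R + d *: b1 R) w0 ->
  commutator (b0 R) (solve1 a b c d w0 w1) = commutator (b1 R) (solve0 a b c d w0 w1).
Proof.
move=> H; rewrite /solve0 /solve1 !commZr !commDr !commZr; congr (_ *: _).
move: H; rewrite !commDl !commZl.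
move: (commutator (b0 R) w1) (commutator (b1 R) w1) (commutator (b0 R) w0) (commutator (b1 R) w0) => p q r s.
move=> /matrixP H; apply/matrixP => i j; have := H i j; rewrite !mxE => h.
by rewrite mulNr -[LHS]addr0 -(subrr (b * q i j)) addrACA h; ring.
Qed.

Lemma solve_mul (a b c d : R) (w0 w1 : vec) :
  (a *: b0 R + b *: b1 R) *m w1 = (c *: b0 R + d *: b1 R) *m w0 ->
  b0 R *m solve1 a b c d w0 w1 = b1 R *m solve0 a b c d w0 w1.
Proof.
move=> H; rewrite /solve0 /solve1 -!scalemxAr !mulmxDr -!scalemxAr; congr (_ *: _).
move: H; rewrite !mulmxDl -!scalemxAl.
move: (b0 R *m w1) (b1 R *m w1) (b0 R *m w0) (b1 R *m w0) => p q r s.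
move=> /matrixP H; apply/matrixP => i j; have := H i j; rewrite !mxE => h.
by rewrite mulNr -[LHS]addr0 -(subrr (b * q i j)) addrACA h; ring.
Qed.

Lemma solve_in_k (a b c d : R) (w0 w1 : mat) : in_k w0 -> in_k w1 ->
  in_k (solve0 a b c d w0 w1) /\ in_k (solve1 a b c d w0 w1).
Proof. by move=> k0 k1; split; apply: in_kZ; apply: in_kD; exact: in_kZ. Qed.

Lemma solve_P0 (a b c d : R) (w0 w1 : vec) : P0 R *m w0 = w0 -> P0 R *m w1 = w1 ->
  P0 R *m solve0 a b c d w0 w1 = solve0 a b c d w0 w1 /\
  P0 R *m solve1 a b c d w0 w1 = solve1 a b c d w0 w1.
Proof.
by move=> k0 k1; rewrite /solve0 /solve1 -!scalemxAr !mulmxDr -!scalemxAr k0 k1.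
Qed.

Lemma smooth_solve p q (a b c d : plane -> R) (w0 w1 : plane -> 'M[R]_(p, q)) :
  smooth a -> smooth b -> smooth c -> smooth d -> smooth w0 -> smooth w1 ->
  (forall z, a z * d z - b z * c z != 0) ->
  smooth (fun z => solve0 (a z) (b z) (c z) (d z) (w0 z) (w1 z)) /\
  smooth (fun z => solve1 (a z) (b z) (c z) (d z) (w0 z) (w1 z)).
Proof.
move=> sa sb sc sd s0 s1 D.
have sD : smooth (fun z => (a z * d z - b z * c z)^-1).
  by apply: smoothV => //; apply: smoothB; exact: smoothM.
by split; apply: smooth_scale => //; apply: smoothD; apply: smooth_scale => //; exact: smoothN.
Qed.

(** The vector u of R^4 whose images under b_1 and b_2 are prescribed; b_1
    sees the entries 0 and 2, b_2 the entries 2 and 3. *)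
Definition trans_potential (Z0 Z1 : vec) : vec :=
  \col_i nth 0 [:: co Z0 4; 0; co Z0 6; co Z1 5; 0; 0; 0] i.

Lemma trans_potentialP (Z0 Z1 : vec) : P0 R *m Z0 = Z0 -> P0 R *m Z1 = Z1 -> b0 R *m Z1 = b1 R *m Z0 ->
  [/\ P0 R *m trans_potential Z0 Z1 = 0, b0 R *m trans_potential Z0 Z1 = Z0 &
      b1 R *m trans_potential Z0 Z1 = Z1].
Proof.
move=> PZ0 PZ1 H.
have z (t : vec) n : P0 R *m t = t -> (n < 4)%N -> co t n = 0.
  move=> Pt n4; rewrite -Pt co_P0; last exact: ltn_trans n4 _.
  by rewrite leqNgt n4 mul0r.
have tE n : (n < 7)%N -> co (trans_potential Z0 Z1) n = nth 0 [:: co Z0 4; 0; co Z0 6; co Z1 5; 0; 0; 0] n.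
  by move=> n7; rewrite /co mxE inordK.
have h n := congr1 (fun t => co t n) H.
have [z00 z01 z02 z03] := And4 (z Z0 0%N PZ0 isT) (z Z0 1%N PZ0 isT) (z Z0 2%N PZ0 isT) (z Z0 3%N PZ0 isT).
have [z10 z11 z12 z13] := And4 (z Z1 0%N PZ1 isT) (z Z1 1%N PZ1 isT) (z Z1 2%N PZ1 isT) (z Z1 3%N PZ1 isT).
have h0 := h 0%N; have h2 := h 2%N; have h3 := h 3%N.
rewrite !co_mul /b0 /b1 !en_mat7//= in h0 h2 h3.
have e0 : co Z1 4 = 0 by lra.
have e2 : co Z1 6 = co Z0 6 by lra.
have e3 : co Z0 5 = 0 by lra.
clear h h0 h2 h3 H PZ0 PZ1 z.
split; apply: co_eq; rewrite ?co_P0// ?co_mul ?tE//= /b0 /b1 ?en_mat7//= ?co0; rewrite ?z00 ?z01 ?z02 ?z03 ?z10 ?z11 ?z12 ?z13 ?e0 ?e2 ?e3; ring.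
Qed.

Lemma smooth_co (Z : plane -> vec) n : smooth Z -> smooth (fun z => co (Z z) n).
Proof. exact: smooth_entry. Qed.

Lemma smooth_trans_potential (Z0 Z1 : plane -> vec) : smooth Z0 -> smooth Z1 ->
  smooth (fun z => trans_potential (Z0 z) (Z1 z)).
Proof.
move=> s0 s1; apply/smooth_mxP => i j.
rewrite (_ : (fun z => _) = fun z => nth 0 [:: co (Z0 z) 4; 0; co (Z0 z) 6; co (Z1 z) 5; 0; 0; 0] i); last first.
  by apply/funext => z; rewrite mxE.
have c0 : smooth (fun _ : plane => 0 : R) by exact: smooth_cst.
by move: i; apply: ord7_ind; rewrite !inordK//=; exact: smooth_co.
Qed.

Lemma smooth_en (X : plane -> mat) i j : smooth X -> smooth (fun z => en (X z) i j).
Proof. exact: smooth_entry. Qed.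

Lemma pmat_sum (x : nat -> R) : pmat x = \sum_(n < 8) x n *: pmat (fun k => (k == n)%:R).
Proof.
apply: in_p_eq; first exact: pmat_in_p.
- apply: (big_ind (@in_p7 R)) => [|X Y|n _]; [|exact: in_p7D|apply: in_p7Z; exact: pmat_in_p].
  by split; [exact: der0|rewrite mulmx0 mul0mx addr0].
- rewrite !big_ord_recr big_ord0 /= add0r.
  by split; rewrite !enD !enZ /pmat !en_mat7//=; ring.
- rewrite !big_ord_recr big_ord0 /= add0r.
  by split; rewrite !enD !enZ /pmat !en_mat7//=; ring.
Qed.

Lemma smooth_potential (W0 W1 : plane -> mat) : smooth W0 -> smooth W1 ->
  smooth (fun z => potential (W0 z) (W1 z)).
Proof.
move=> s0 s1.
rewrite (_ : (fun z => _) = fun z => \sum_(n < 8)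
    nth 0 [:: 0; - en (W0 z) 0 1; en (W1 z) 1 3 - en (W1 z) 0 2; - en (W0 z) 0 3; en (W1 z) 0 3; en (W1 z) 1 3;
                  en (W0 z) 2 3 + en (W0 z) 0 1; 0] n *: pmat (fun k => (k == n)%:R)).
  apply: smooth_sum => n _; apply: smooth_scale; last exact: smooth_cst.
  have c0 : smooth (fun _ : plane => 0 : R) by exact: smooth_cst.
  have e0 i j := smooth_en i j s0; have e1 i j := smooth_en i j s1.
  case: n => [[|[|[|[|[|[|[|[|//]]]]]]]] ?] /=;
    [exact: c0|exact: smoothN|exact: smoothB|exact: smoothN|exact: e1|exact: e1|exact: smoothD|exact: c0].
by apply/funext => z; rewrite /potential pmat_sum.
Qed.

(** The R^4-part of the equation: a and w_j Y_i lie in R^3, B_j Y_i in R^4. *)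
Lemma translation_compat (a : vec) (B0 B1 w0 w1 : mat) (Y0 Y1 : vec) : in_p7 B0 -> in_p7 B1 ->
  in_k w0 -> in_k w1 -> P0 R *m a = a -> P0 R *m Y0 = Y0 -> P0 R *m Y1 = Y1 ->
  a + ((B0 + w0) *m Y1 - (B1 + w1) *m Y0) = 0 -> B0 *m Y1 = B1 *m Y0.
Proof.
move=> [_ p0] [_ p1] [_ k0] [_ k1] Pa P0Y P1Y E.
have pz (B : mat) (Y : vec) : P0 R *m B + B *m P0 R = B -> P0 R *m Y = Y -> P0 R *m (B *m Y) = 0.
  by move=> pB PY; rewrite -PY !mulmxA (proj_offdiag (@P0_idem R) pB) mul0mx.
have kz (w : mat) (Y : vec) : P0 R *m w = w *m P0 R -> P0 R *m Y = Y -> P0 R *m (w *m Y) = w *m Y.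
  by move=> kw PY; rewrite mulmxA kw -mulmxA PY.
have := congr1 (mulmx (P0 R)) E.
rewrite mulmx0 mulmxDr Pa mulmxBr !mulmxDl !mulmxDr (pz B0) // (pz B1) // (kz w0) // (kz w1) // !add0r => E'.
move: E; rewrite !mulmxDl -[X in _ = X]E' => /addrI/eqP.
by rewrite opprD addrACA -subr_eq0 addrK subr_eq0 => /eqP.
Qed.

End Coordinates.

(** * From the surface to the family *)

Section SurfaceToFamily.
Variable R : realType.
Local Notation plane := (plane R).
Local Notation vec := 'cV[R]_7.
Local Notation mat := 'M[R]_7.

(** The structure equation in p says that the coefficients eta of B are
    closed, so they are the derivatives of coordinates x, and that W,
    expressed in these coordinates, satisfies the hypothesis of
    [potentialP]. The structure equation for the translation part does the
    same for Y. *)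
Lemma adapted_family (phi : plane -> vec) (F : plane -> mat) (B W : 'I_2 -> plane -> mat) :
  smooth phi -> smooth F -> (forall m, G2 (F m)) ->
  (forall j, smooth (B j)) -> (forall j, smooth (W j)) ->
  (forall j m, partial j F m = F m *m (B j m + W j m)) ->
  (forall j m, in_a (B j m)) -> (forall m, regular_pair (B ord0 m) (B ord_max m)) ->
  (forall j m, in_k (W j m)) ->
  (forall m, partial ord0 (B ord_max) m - partial ord_max (B ord0) m =
     commutator (W ord_max m) (B ord0 m) - commutator (W ord0 m) (B ord_max m)) ->
  (forall j m, P0 R *m ((F m)^T *m partial j phi m) = (F m)^T *m partial j phi m) ->
  exists x v, [/\ local_diffeo x, flat_family x v & integrates x v F phi].
Proof.
move=> sphi sF GF sB sW dF aB rB kW dB PY.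
pose eta j (l : 'I_2) z := if l == ord0 then en (B j z) 4 0 else en (B j z) 5 3.
have seta j l : smooth (eta j l).
  by rewrite /eta; case: (l == ord0); exact: smooth_en.
have BE j z : B j z = eta j ord0 z *: b0 R + eta j ord_max z *: b1 R by exact: in_a_entries.
have pen i j m a b : partial i (fun z => en (B j z) a b) m = en (partial i (B j) m) a b.
  by apply/esym; apply: partial_mxE; exact: smooth_diff.
pose c j z : 'cV[R]_2 := \col_l eta j l z.
have sc j : smooth (c j).
  apply/smooth_mxP => l k; rewrite (_ : (fun z => _) = eta j l)//.
  by apply/funext => z; rewrite mxE.
have deta l m : partial ord0 (eta ord_max l) m = partial ord_max (eta ord0 l) m.
  have [e0 e1] := comm_ka_entries (kW ord_max m) (aB ord0 m).
  have [e2 e3] := comm_ka_entries (kW ord0 m) (aB ord_max m).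
  have H a b : en (partial ord0 (B ord_max) m) a b - en (partial ord_max (B ord0) m) a b =
      en (commutator (W ord_max m) (B ord0 m)) a b - en (commutator (W ord0 m) (B ord_max m)) a b.
    have sub (X Y : mat) : en (X - Y) a b = en X a b - en Y a b by rewrite enD enN.
    by apply: (etrans (esym (sub _ _))); rewrite dB sub.
  apply/eqP; rewrite -subr_eq0; apply/eqP; move: l; apply: ord2_ind.
    apply: (etrans (congr2 (fun x y => x - y) (pen ord0 ord_max m 4 0) (pen ord_max ord0 m 4 0))).
    by apply: (etrans (H 4%N 0%N)); rewrite e0 e2 subrr.
  apply: (etrans (congr2 (fun x y => x - y) (pen ord0 ord_max m 5 3) (pen ord_max ord0 m 5 3))).
  by apply: (etrans (H 5%N 3%N)); rewrite e1 e3 subrr.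
have dc m : partial ord0 (c ord_max) m = partial ord_max (c ord0) m.
  have pc i j l : partial i (c j) m l ord0 = partial i (eta j l) m.
    apply: (etrans (partial_mxE _ _ _ (smooth_diff m (sc j)))).
    by apply: (congr1 (fun f => partial i f m)); apply/funext => z; rewrite mxE.
  by apply/colP => l; apply: (etrans (pc _ _ _)); apply: (etrans (deta _ _)); exact/esym/pc.
have [xi [sxi dxi]] := poincare sc dc.
pose x z : plane := (xi z)^T.
have sx : smooth x by exact: smooth_trmx.
have dx j m l : partial j x m ord0 l = eta j l m.
  by rewrite (partial_trmx j (smooth_diff m sxi)) dxi !mxE.
have bB j m : bform (bb R) x j m = B j m.
  by rewrite /bform !big_ord_recr big_ord0 /= add0r !dx BE /bb.
have dB0 m : partial ord0 (B ord_max) m = partial ord_max (B ord0) m.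
  have bBf j : bform (bb R) x j = B j by apply/funext => z; exact: bB.
  by have := bform_closed (bb R) m sx; rewrite (bBf ord0) (bBf ord_max).
have dxl : local_diffeo x.
  split=> // m; apply/dim_span2 => a b E; have [_ _ _ free] := rB m; apply: free.
  have e l : a * eta ord0 l m + b * eta ord_max l m = 0.
    by have := congr1 (fun X : 'rV[R]_2 => X ord0 l) E; rewrite -!dx; move: (partial ord0 x m) (partial ord_max x m) => s t; rewrite !mxE.
  by rewrite !BE !scalerDr !scalerA addrACA -!scalerDl !e !scale0r addr0.
have D z : eta ord0 ord0 z * eta ord_max ord_max z - eta ord0 ord_max z * eta ord_max ord0 z != 0.
  have [_ _ _ free] := rB z; apply: det_neq0 => s t h0 h1; apply: free.
  by rewrite !BE !scalerDr !scalerA addrACA -!scalerDl h0 h1 !scale0r addr0.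
pose S0 p q (w : 'I_2 -> plane -> 'M[R]_(p, q)) z := solve0 (eta ord0 ord0 z) (eta ord0 ord_max z)
  (eta ord_max ord0 z) (eta ord_max ord_max z) (w ord0 z) (w ord_max z).
pose S1 p q (w : 'I_2 -> plane -> 'M[R]_(p, q)) z := solve1 (eta ord0 ord0 z) (eta ord0 ord_max z)
  (eta ord_max ord0 z) (eta ord_max ord_max z) (w ord0 z) (w ord_max z).
have sS p q (w : 'I_2 -> plane -> 'M[R]_(p, q)) : (forall j, smooth (w j)) -> smooth (S0 p q w) /\ smooth (S1 p q w).
  by move=> sw; apply: smooth_solve.
have SE p q (w : 'I_2 -> plane -> 'M[R]_(p, q)) j z : w j z = eta j ord0 z *: S0 p q w z + eta j ord_max z *: S1 p q w z.
  by have [e0 e1] := solveP (w ord0 z) (w ord_max z) (D z); move: j; apply: ord2_ind.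
pose Y j z := (F z)^T *m partial j phi z.
have sY j : smooth (Y j) by apply: smooth_mulmx; [exact: smooth_trmx|exact: smooth_partial].
have dphi j m : partial j phi m = F m *m Y j m by rewrite mulmxA G2_orthr// mul1mx.
have PYY j m : P0 R *m Y j m = Y j m by exact: PY.
clearbody Y.
pose V z := potential (S0 _ _ W z) (S1 _ _ W z).
pose u z := trans_potential (S0 _ _ Y z) (S1 _ _ Y z).
pose v z := mot (V z) (u z).
have VP z : commutator (b0 R) (V z) = S0 _ _ W z /\ commutator (b1 R) (V z) = S1 _ _ W z.
  have [k0 k1] := solve_in_k (eta ord0 ord0 z) (eta ord0 ord_max z)
    (eta ord_max ord0 z) (eta ord_max ord_max z) (kW ord0 z) (kW ord_max z).
  apply: potentialP => //; apply: solve_comm.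
  have := dB z; rewrite dB0 subrr => /esym/eqP; rewrite subr_eq0 -!BE => /eqP E.
  by rewrite (commC (W ord_max z)) E -(commC (W ord0 z)).
have uP z : [/\ P0 R *m u z = 0, b0 R *m u z = S0 _ _ Y z & b1 R *m u z = S1 _ _ Y z].
  have [k0 k1] := solve_P0 (eta ord0 ord0 z) (eta ord0 ord_max z)
    (eta ord_max ord0 z) (eta ord_max ord_max z) (PYY ord0 z) (PYY ord_max z).
  apply: (trans_potentialP k0 k1); apply: solve_mul; rewrite -(BE ord0) -(BE ord_max).
  have sBW j : smooth (fun z => B j z + W j z) by exact: smoothD.
  have /(rflat_mot sBW sY)[_ /(_ z)] := mc_structure sF sphi GF sBW sY dF dphi.
  have PdY i j : P0 R *m partial i (Y j) z = partial i (Y j) z.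
    apply: (etrans (esym (partial_mulmx_cstl i (P0 R) (smooth_diff z (sY j))))).
    by apply: (congr1 (fun f => partial i f z)); apply/funext => t; exact: PYY.
  have Pa : P0 R *m (partial ord0 (Y ord_max) z - partial ord_max (Y ord0) z) =
      partial ord0 (Y ord_max) z - partial ord_max (Y ord0) z.
    exact: (etrans (mulmxBr _ _ _) (congr2 (fun x y => x - y) (PdY ord0 ord_max) (PdY ord_max ord0))).
  have [p0 p1 _ _] := rB z.
  exact: (translation_compat p0 p1 (kW ord0 z) (kW ord_max z) Pa (PYY ord0 z) (PYY ord_max z)).
have sv : smooth (v : plane -> 'M[R]_8).
  have s0 p q : smooth (fun _ : plane => 0 : 'M[R]_(p, q)) by exact: smooth_cst.
  have [sW0 sW1] := sS _ _ W sW; have [sY0 sY1] := sS _ _ Y sY.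
  by apply: smooth_block => //; [exact: smooth_potential|exact: smooth_trans_potential].
have pv m : in_phat (v m).
  by apply/in_phat_mot; exists (V m), (u m); split=> //; [exact: potential_in_p|have [] := uP m].
have rv m : rot_part (v m) = V m by rewrite /rot_part /v /mot; exact: block_mxKul.
have tv m : trans_part (v m) = u m by rewrite /trans_part /v /mot; exact: block_mxKur.
have int : integrates x v F phi.
  apply/(integratesP _ _ sx sv pv); split=> // j m; rewrite dF dphi /rot_form /trans_form bB rv tv.
  have [V0 V1] := VP m; have [_ u0 u1] := uP m; split; congr (_ *m _).
    by congr (_ + _); rewrite BE commDl !commZl V0 V1 -SE.
  by rewrite BE mulmxDl -!scalemxAl u0 u1 -SE.
by exists x, v; split=> //; exact: (integrates_flat sx sv pv int).
Qed.

End SurfaceToFamily.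

(** * The equivalence *)

Section Main.
Variable R : realType.
Local Notation plane := (plane R).
Local Notation vec := 'cV[R]_7.
Local Notation mat := 'M[R]_7.

Lemma gauss_frame (phi : plane -> vec) m : surface phi -> exists2 f, G2 f &
  [/\ forall j, partial j phi m \in frame_plane f, gauss phi m = frame_plane f &
      orth_proj (gauss phi m) = frame_proj f].
Proof.
move=> [_ /(_ m) d2].
have [|f Gf [sub E]] := exists_adapted d2; first by do 2 eexists.
have ge : gauss phi m = frame_plane f by exact: E.
exists f => //; split=> //; last by rewrite ge orth_proj_frame// G2_orth.
move=> j; move/span_subvP : sub; apply.
by have [->|->] := ord2_cases j; [exact: mem_head|apply: mem_behead; exact: mem_head].
Qed.

(** Apply the vanishing of the curvature to the section (1 - P) c. *)
Lemma surface_curvature (phi : plane -> vec) m (c : vec) : surface phi -> abelian_surface phi ->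
  smooth (fun z => orth_proj (gauss phi z) : mat) ->
  let P z := orth_proj (gauss phi z) in
  (1%:M - P m) *m (commutator (partial ord0 P m) (partial ord_max P m) *m ((1%:M - P m) *m c)) = 0.
Proof.
move=> sphi ab sP P.
have PP z : P z *m P z = P z.
  by have [f Gf [_ _ PE]] := gauss_frame z sphi; rewrite /P PE; apply: frame_proj_idem; exact: G2_orth.
pose s z := (1%:M - P z) *m c.
have ss : smooth s.
  by apply: smooth_mulmx; [apply: smoothB => //|]; exact: smooth_cst.
have Ps z : P z *m s z = 0 by rewrite /s mulmxA mulmxBr mulmx1 PP subrr mul0mx.
apply: (etrans (esym (curvature m sP ss PP Ps))); apply/eqP; rewrite subr_eq0; apply/eqP.
exact: (ab s (conj ss Ps) m).
Qed.

Lemma frame_plane_eq (f g : mat) : G2 f -> G2 g -> frame_proj f = frame_proj g -> frame_plane f = frame_plane g.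
Proof.
move=> Gf Gg E; apply/vspaceP => w.
by apply/(frame_planeP _ (G2_orth Gf))/(frame_planeP _ (G2_orth Gg)); rewrite E.
Qed.

(** The frame is F = (k E)^T, with E the parallel frame of the Gauss planes
    and k the gauge transformation that moves its form into a. *)
Lemma surface_to_family (phi : plane -> vec) : surface phi -> abelian_surface phi ->
  nondegenerate_surface phi -> exists x F v,
  [/\ local_diffeo x, flat_family x v, adapted_frame phi F & integrates x v F phi].
Proof.
move=> sphi ab [sP dP2]; pose P z := orth_proj (gauss phi z).
have frameP m : exists2 f, G2 f & P m = frame_proj f.
  by have [f Gf [_ _ PE]] := gauss_frame m sphi; exists f.
have curv m c := surface_curvature m c sphi ab sP.
have indep m : forall a b : R, a *: partial ord0 P m + b *: partial ord_max P m = 0 -> a = 0 /\ b = 0.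
  by apply/dim_span2; exact: dP2.
have [E [beta [sE GE EP dE [sbeta rbeta dbeta]]]] := parallel_frame sP frameP curv indep.
have [k [w [sk Gk kP dk [sw kw ak]]]] := gauge sbeta rbeta.
have ssphi : smooth phi by case: sphi.
pose F z := (k z *m E z)^T.
have skE : smooth (fun z => k z *m E z) by exact: smooth_mulmx.
have sF : smooth F by exact: smooth_trmx.
have GF m : G2 (F m) by apply: G2_tr; exact: G2_mul.
have kk m : (k m)^T *m k m = 1%:M by exact: G2_orth.
pose B j z := k z *m beta j z *m (k z)^T.
pose W j z := k z *m w j z *m (k z)^T.
have sB j : smooth (B j) by apply: smooth_mulmx; [exact: smooth_mulmx|exact: smooth_trmx].
have sW j : smooth (W j) by apply: smooth_mulmx; [exact: smooth_mulmx|exact: smooth_trmx].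
have kW j m : in_k (W j m) by apply: in_k_conjV => //; exact: kw.
have rB m : regular_pair (B ord0 m) (B ord_max m) by exact: regular_pair_conj.
have BWT j m : (B j m + W j m)^T = - (B j m + W j m).
  have dB : der (B j m) by apply: der_conj => //; have [] := beta_in_p rbeta j m.
  by have [dW _] := kW j m; have [] := derD dB dW.
have dF j m : partial j F m = F m *m (B j m + W j m).
  have dk' := smooth_diff m sk; have dE' := smooth_diff m sE.
  apply: (etrans (partial_trmx j (smooth_diff m skE))).
  have -> : partial j (fun z => k z *m E z) m = - ((B j m + W j m) *m (k m *m E m)).
    apply: (etrans (partial_mulmx j dk' dE')); rewrite dk dE /B /W.
    by rewrite mulmxDl -!mulmxA !(mulmxA (k m)^T (k m)) kk !mul1mx mulNmx mulmxN -opprD addrC !mulmxA.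
  by rewrite [LHS]raddfN /= trmx_mul BWT mulmxN opprK.
have FPF m : P m = frame_proj (F m).
  rewrite /frame_proj /F trmxK trmx_mul.
  have ET := G2_orth (GE m); have kT := G2_orth (Gk m).
  rewrite -!mulmxA (mulmxA (P0 R)) -kP -(mulmxA (k m)) (mulmxA (k m)^T) kT mul1mx.
  by rewrite -(EP m) -!mulmxA ET mulmx1 !mulmxA ET mul1mx.
have gF m : gauss phi m = frame_plane (F m).
  have [f Gf [_ ge PE]] := gauss_frame m sphi.
  by rewrite ge; apply: frame_plane_eq => //; rewrite -PE -FPF.
have PY j m : P0 R *m ((F m)^T *m partial j phi m) = (F m)^T *m partial j phi m.
  have [f Gf [tan ge _]] := gauss_frame m sphi.
  apply: frame_proj_fix => //; apply/frame_planeP; first exact: G2_orth.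
  by rewrite -gF ge; exact: tan.
have dB m : partial ord0 (B ord_max) m - partial ord_max (B ord0) m =
     commutator (W ord_max m) (B ord0 m) - commutator (W ord0 m) (B ord_max m).
  have pB i j : partial i (B j) m = k m *m partial i (beta j) m *m (k m)^T - commutator (W i m) (B j m).
    have wT : (w i m)^T = - w i m by have [[] ] := kw i m.
    apply: (etrans (partial_conj (smooth_diff m sk) (smooth_diff m (sbeta j)) (dk i m) wT)).
    apply: (etrans (congr1 (mulmx^~ _) (mulmxBr _ _ _))); apply: (etrans (mulmxBl _ _ _)).
    by apply: (congr1 (fun X => _ - X)); apply/esym; exact: proj_conj_comm.
  apply: (etrans (congr2 (fun X Y => X - Y) (pB ord0 ord_max) (pB ord_max ord0))).
  rewrite dbeta; move: (k m *m _ *m _) (commutator _ _) (commutator _ _) => a b c.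
  by rewrite opprD opprK addrACA subrr add0r addrC.
have [x [v [dx fv int]]] := adapted_family ssphi sF GF sB sW dF ak rB kW dB PY.
by exists x, F, v; split.
Qed.

Lemma smooth_id : smooth (id : plane -> plane).
Proof.
by apply/smooth_mxP => i l; rewrite (ord1 i); exact: plane_coord_smooth.
Qed.

Lemma partial_id j m l : partial j (id : plane -> plane) m ord0 l = (l == j)%:R :> R.
Proof. by rewrite /partial derive_id mxE. Qed.

Lemma row_comb_lin n (b : 'I_2 -> 'M[R]_n) (a c : R) (s t : 'rV[R]_2) :
  \sum_(l < 2) (a *: s + c *: t) ord0 l *: b l =
  a *: (\sum_(l < 2) s ord0 l *: b l) + c *: (\sum_(l < 2) t ord0 l *: b l).
Proof.
by rewrite !scaler_sumr -big_split; apply: eq_bigr => l _; rewrite !mxE scalerDl !scalerA.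
Qed.

(** Since dx . dy is the identity, the forms dx_l pulled back by y are the
    standard ones, and all structure equations pull back by the chain rule. *)
Lemma reparametrize (x y : plane -> plane) (v : plane -> 'M[R]_8) (F : plane -> mat) (phi : plane -> vec) :
  smooth x -> smooth y -> cancel y x -> surface phi -> flat_family x v -> integrates x v F phi ->
  [/\ flat_family id (v \o y), adapted_frame (phi \o y) (F \o y) & integrates id (v \o y) (F \o y) (phi \o y)].
Proof.
move=> sx sy yK [_ dphi2] [sv pv _] /(integratesP _ _ sx sv pv)[sF sphi GF H].
have svy : smooth ((v \o y) : plane -> 'M[R]_8) by exact: smooth_comp.
have pvy m : in_phat ((v \o y) m) by exact: pv.
have sFy : smooth (F \o y) by exact: smooth_comp.
have sphiy : smooth (phi \o y) by exact: smooth_comp.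
(* The inverse function rule for x o y = id. *)
have pid j m : partial j id m = partial j y m ord0 ord0 *: partial ord0 x (y m) +
    partial j y m ord0 ord_max *: partial ord_max x (y m).
  have := partial_comp j (smooth_diff (y m) sx) (smooth_diff m sy).
  by rewrite (_ : x \o y = id)//; apply/funext => z; exact: yK.
have J j l m : partial j y m ord0 ord0 * partial ord0 x (y m) ord0 l +
    partial j y m ord0 ord_max * partial ord_max x (y m) ord0 l = (l == j)%:R.
  apply: (etrans _ (partial_id j m l)); apply: (etrans _ (congr1 (fun X : 'rV[R]_2 => X ord0 l) (esym (pid j m)))).
  move: (partial ord0 x (y m)) (partial ord_max x (y m)) (partial j y m) => s t r.
  by rewrite !mxE.
have bJ j m : partial j y m ord0 ord0 *: bform (bb R) x ord0 (y m) +
    partial j y m ord0 ord_max *: bform (bb R) x ord_max (y m) = bform (bb R) id j m.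
  apply: (etrans (esym (row_comb_lin _ _ _ _ _))).
  exact: (congr1 (fun s : 'rV[R]_2 => \sum_(l < 2) s ord0 l *: bb R l) (esym (pid j m))).
have int : integrates id (v \o y) (F \o y) (phi \o y).
  apply/(integratesP _ _ smooth_id svy pvy); split=> // [m|j m]; first exact: GF.
  have rF : rot_form id (v \o y) j m = partial j y m ord0 ord0 *: rot_form x v ord0 (y m) +
      partial j y m ord0 ord_max *: rot_form x v ord_max (y m).
    apply: (etrans (congr1 (fun X => X + commutator X (rot_part (v (y m)))) (esym (bJ j m)))).
    rewrite /rot_form; move: (bform (bb R) x ord0 (y m)) (bform (bb R) x ord_max (y m)) => X X'.
    move: (partial j y m ord0 ord0) (partial j y m ord0 ord_max) (rot_part _) => a b Y.
    rewrite (commDl (a *: X)) (commZl a) (commZl b).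
    by move: (commutator X Y) (commutator X' Y) => Z Z'; rewrite !scalerDr addrACA.
  have tF : trans_form id (v \o y) j m = partial j y m ord0 ord0 *: trans_form x v ord0 (y m) +
      partial j y m ord0 ord_max *: trans_form x v ord_max (y m).
    apply: (etrans (congr1 (fun X => X *m trans_part (v (y m))) (esym (bJ j m)))).
    rewrite /trans_form; move: (bform (bb R) x ord0 (y m)) (bform (bb R) x ord_max (y m)) => X X'.
    by rewrite mulmxDl -!scalemxAl.
  rewrite rF tF; split.
    apply: (etrans (partial_comp j (smooth_diff (y m) sF) (smooth_diff m sy))).
    apply: (etrans (congr2 (fun X X' => partial j y m ord0 ord0 *: X + partial j y m ord0 ord_max *: X')
      (H ord0 (y m)).1 (H ord_max (y m)).1)).
    by move: (rot_form x v ord0 _) (rot_form x v ord_max _) => X X'; rewrite mulmxDr -!scalemxAr.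
  apply: (etrans (partial_comp j (smooth_diff (y m) sphi) (smooth_diff m sy))).
  apply: (etrans (congr2 (fun X X' => partial j y m ord0 ord0 *: X + partial j y m ord0 ord_max *: X')
    (H ord0 (y m)).2 (H ord_max (y m)).2)).
  by move: (trans_form x v ord0 _) (trans_form x v ord_max _) => X X'; rewrite mulmxDr -!scalemxAr.
have fid : flat_family id (v \o y) by exact: (integrates_flat smooth_id svy pvy int).
have surf : surface (phi \o y).
  split=> // m; apply/dim_span2 => a b.
  have pc j := partial_comp j (smooth_diff (y m) sphi) (smooth_diff m sy).
  rewrite (pc ord0) (pc ord_max).
  have /dim_span2 free := dphi2 (y m).
  have J00 := J ord0 ord0 m; have J01 := J ord0 ord_max m; have J10 := J ord_max ord0 m; have J11 := J ord_max ord_max m.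
  move: free J00 J01 J10 J11; move: (partial ord0 phi (y m)) (partial ord_max phi (y m)) => p q free.
  move: (partial ord0 x (y m)) (partial ord_max x (y m)) (partial ord0 y m) (partial ord_max y m) => s t r r'.
  rewrite !eqxx /= => J00 J01 J10 J11.
  rewrite !scalerDr !scalerA addrACA -!scalerDl => /free[e0 e1].
  split.
    transitivity (a * (r ord0 ord0 * s ord0 ord0 + r ord0 ord_max * t ord0 ord0) +
      b * (r' ord0 ord0 * s ord0 ord0 + r' ord0 ord_max * t ord0 ord0)).
      by rewrite J00 J10 mulr1 mulr0 addr0.
    transitivity ((a * r ord0 ord0 + b * r' ord0 ord0) * s ord0 ord0 +
      (a * r ord0 ord_max + b * r' ord0 ord_max) * t ord0 ord0); first by ring.
    by rewrite e0 e1 !mul0r addr0.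
  transitivity (a * (r ord0 ord0 * s ord0 ord_max + r ord0 ord_max * t ord0 ord_max) +
    b * (r' ord0 ord0 * s ord0 ord_max + r' ord0 ord_max * t ord0 ord_max)).
    by rewrite J01 J11 mulr1 mulr0 add0r.
  transitivity ((a * r ord0 ord0 + b * r' ord0 ord0) * s ord0 ord_max +
    (a * r ord0 ord_max + b * r' ord0 ord_max) * t ord0 ord_max); first by ring.
  by rewrite e0 e1 !mul0r addr0.
split=> //; split=> // [m|m]; first exact: GF.
exact: (integrates_gauss m smooth_id fid int surf).
Qed.

End Main.

Theorem proposition7p2 (R : realType) :
  (* surface -> family *)
  (forall phi : plane R -> 'cV[R]_7,
     surface phi -> abelian_surface phi -> nondegenerate_surface phi ->
     exists (x : plane R -> plane R) (F : plane R -> 'M[R]_7)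
            (v : plane R -> 'M[R]_(4 + 3 + 1)),
       [/\ local_diffeo x, flat_family x v, adapted_frame phi F,
           integrates x v F phi &
           forall y : plane R -> plane R, smooth y -> cancel y x ->
             [/\ flat_family id (v \o y), adapted_frame (phi \o y) (F \o y) &
                 integrates id (v \o y) (F \o y) (phi \o y)]])
  /\
  (* family -> surface *)
  (forall (x : plane R -> plane R) (v : plane R -> 'M[R]_(4 + 3 + 1)),
     local_diffeo x -> flat_family x v ->
     [/\ exists F phi, integrates x v F phi,
         forall F phi F' phi', integrates x v F phi -> integrates x v F' phi' ->
           exists g c, G2 g /\ forall m,
             F' m = (g *m F m)%R /\ phi' m = (g *m phi m + c)%R
       & forall F phi, integrates x v F phi -> surface phi ->
           [/\ abelian_surface phi, nondegenerate_surface phi & adapted_frame phi F]]).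
Proof.
split=> [phi sphi ab nd|x v dx fv].
  have [x [F [v [dx fv adF int]]]] := surface_to_family sphi ab nd.
  exists x, F, v; split; [exact: dx|exact: fv|exact: adF|exact: int|move=> y sy yK].
  have [sx _] := dx.
  exact: reparametrize sx sy yK sphi fv int.
have [sx _] := dx; split.
- exact: surface_exists.
- by move=> F phi F' phi' int int'; exact: surface_unique sx fv int int'.
- by move=> F phi int sphi; exact: integrates_surface dx fv int sphi.
Qed.
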